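(* Let $F$ be a function field of characteristic $p>0$, let $E/F$ be a non-isotrivial elliptic curve having good or split multiplicative reduction at every place of $F$, let $l\neq p$ be a prime, and let $\mathcal{F}/F$ be a $\mathbb{Z}_l^d$-extension. Let $F\subset F_1\subset\dots\subset F_n\subset\dots\subset\bigcup_n F_n=\mathcal{F}$ be a sequence of finite extensions of $F$ and put $\Gamma_n=\mathrm{Gal}(\mathcal{F}/F_n)$. Then the natural maps $$Sel_E(F_n)_p\longrightarrow Sel_E(\mathcal{F})_p^{\Gamma_n}$$ are isomorphisms.
   Context: A function field $F$ of characteristic $p$ is a finitely generated field of transcendence degree 1 over its constant field $\mathbb{F}$ (algebraically closed in $F$), where $\mathbb{F}_p\subseteq\mathbb{F}\subseteq\overline{\mathbb{F}}_p$. Non-isotrivial means $j(E)\notin\mathbb{F}$. A $\mathbb{Z}_l^d$-extension is a Galois extension with Galois group isomorphic to $\mathbb{Z}_l^d$. Selmer groups: for an algebraic extension $L/F$ let $\mathcal{M}_L$ be the set of places of $L$ and $L_v$ the completion of $L$ at $v$. Let $E[p^n]$ be the group scheme of $p^n$-torsion and put $H^1_{fl}(\mathrm{Spec}\,L,E[p^\infty]):=\varinjlim_n H^1_{fl}(\mathrm{Spec}\,L,E[p^n])$ (flat cohomology), and likewise for $L_v$. Let $\kappa_v:E(L_v)\otimes\mathbb{Q}_p/\mathbb{Z}_p\hookrightarrow H^1_{fl}(\mathrm{Spec}\,L_v,E[p^\infty])$ be the local Kummer map, coming from the exact sequences of sheaves $0\to E[p^n]\to E\xrightarrow{p^n}E\to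 0$. Then $$Sel_E(L)_p:=\mathrm{Ker}\Big\{H^1_{fl}(\mathrm{Spec}\,L,E[p^\infty])\to\prod_{v\in\mathcal{M}_L}H^1_{fl}(\mathrm{Spec}\,L_v,E[p^\infty])/\mathrm{Im}\,\kappa_v\Big\}.$$ The natural maps between Selmer groups are induced by restriction in cohomology. *)

(* Defs.v *)
From HB Require Import structures.
From mathcomp Require Import all_boot all_algebra.
From mathcomp Require Import boolp classical_sets functions.
From mathcomp Require Import ring.

Set Implicit Arguments.
Unset Strict Implicit.
Unset Printing Implicit Defensive.

Import GRing.Theory.
Local Open Scope ring_scope.

#[short(type="fieldAlgType")]
HB.structure Definition FieldAlgebra (F : fieldType) :=
  {L of GRing.Field L & GRing.ComAlgebra F L}.

Section FunctionFields.
Variable F : fieldType.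
Implicit Types (k : {pred F}) (s : seq F).

Definition algebraic_over k (x : F) : Prop :=
  exists q : {poly F}, [/\ q \is a polyOver k, q != 0 & root q x].

Definition adjoin k s : {pred F} :=
  [pred x | `[< forall K : {pred F}, divring_closed K ->
      {subset k <= K} -> {subset s <= K} -> x \in K >]].

(* F is a function field of characteristic p with constant field k; here F_p
   is the prime subfield of F, the set of the n%:R. *)
Definition function_field (p : nat) k : Prop :=
  [/\ p \in [pchar F],
      divring_closed k,
      (forall x, x \in k ->
         algebraic_over [pred y | `[< exists n : nat, y = n%:R >]] x),
      (forall x, algebraic_over k x -> x \in k) &
      (exists s, adjoin k s =i predT) /\
      (exists t, ~ algebraic_over k t /\
         forall x, algebraic_over (adjoin k [:: t]) x)].

End FunctionFields.

Section Places.
Variable L : fieldType.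

(* A place is given by its valuation ring.  When L is algebraic over a function
   field with constants algebraic over F_p, the constants of L are 0 and roots
   of unity, so they lie in every valuation ring. *)
Record place := Place {
  vring :> {pred L};
  vring_closed : subring_closed vring;
  vring_total : forall x, x \in vring \/ x^-1 \in vring;
  vring_proper : exists x, x \notin vring }.

Definition vmax (v : place) : {pred L} :=
  [pred x | (x \in v) && ((x == 0) || (x^-1 \notin v))].

(* c *: v, for c != 0, is a basis of neighbourhoods of 0. *)
Definition v_cvg (v : place) (u : nat -> L) (x : L) : Prop :=
  forall c, c != 0 -> exists N, forall n, (N <= n)%N -> (u n - x) / c \in v.

Definition v_cauchy (v : place) (u : nat -> L) : Prop :=
  forall c, c != 0 -> exists N, forall m n, (N <= m)%N -> (N <= n)%N ->
    (u m - u n) / c \in v.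

End Places.

(* i : L -> K is the completion of L at v, w being the place of K extending v.
   Sequences suffice: the fields considered here are algebraic over a function
   field, so the value group of v embeds in the rationals.  The completion
   exists and is unique up to a unique isomorphism. *)
Definition is_completion (L K : fieldType) (v : place L) (i : L -> K)
    (w : place K) : Prop :=
  [/\ (forall x, (i x \in w) = (x \in v)),
      (forall (x c : K), c != 0 -> exists y, (x - i y) / c \in w) &
      (forall u, v_cauchy w u -> exists x, v_cvg w u x)].

Record weierstrass (F : Type) :=
  Weierstrass { wa1 : F; wa2 : F; wa3 : F; wa4 : F; wa6 : F }.

Section WeierstrassInvariants.
Variables (F : fieldType) (W : weierstrass F).
Local Notation a1 := (wa1 W).
Local Notation a2 := (wa2 W).
Local Notation a3 := (wa3 W).
Local Notation a4 := (wa4 W).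
Local Notation a6 := (wa6 W).

Definition wb2 : F := a1 ^+ 2 + 4%:R * a2.
Definition wb4 : F := 2%:R * a4 + a1 * a3.
Definition wb6 : F := a3 ^+ 2 + 4%:R * a6.
Definition wb8 : F :=
  a1 ^+ 2 * a6 + 4%:R * a2 * a6 - a1 * a3 * a4 + a2 * a3 ^+ 2 - a4 ^+ 2.
Definition wc4 : F := wb2 ^+ 2 - 24%:R * wb4.
Definition wdisc : F :=
  - wb2 ^+ 2 * wb8 - 8%:R * wb4 ^+ 3 - 27%:R * wb6 ^+ 2
  + 9%:R * wb2 * wb4 * wb6.
Definition wj : F := wc4 ^+ 3 / wdisc.

(* W' is obtained from W by x = u^2 x' + r, y = u^3 y' + s u^2 x' + t. *)
Definition change_of_variables (W' : weierstrass F) (u r s t : F) : Prop :=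
  [/\ u * wa1 W' = a1 + 2%:R * s,
      u ^+ 2 * wa2 W' = a2 - s * a1 + 3%:R * r - s ^+ 2,
      u ^+ 3 * wa3 W' = a3 + r * a1 + 2%:R * t,
      u ^+ 4 * wa4 W' = a4 - s * a3 + 2%:R * r * a2 - (t + r * s) * a1
                        + 3%:R * r ^+ 2 - 2%:R * s * t &
      u ^+ 6 * wa6 W' = a6 + r * a4 + r ^+ 2 * a2 + r ^+ 3 - t * a3
                        - t ^+ 2 - r * t * a1].

End WeierstrassInvariants.

Section Reduction.
Variables (F : fieldType) (v : place F).
Implicit Types W : weierstrass F.

Definition integral_model W W' : Prop :=
  [/\ exists u r s t, u != 0 /\ change_of_variables W W' u r s t,
      wa1 W' \in v, wa2 W' \in v, wa3 W' \in v &
      wa4 W' \in v /\ wa6 W' \in v].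

Definition minimal_model W W' : Prop :=
  integral_model W W' /\
  forall W'', integral_model W W'' -> wdisc W'' / wdisc W' \in v.

Definition good_reduction W : Prop :=
  exists W', minimal_model W W' /\ wdisc W' \notin vmax v.

(* The reduction of W' has a singular point, the class of (x, y), which is a
   node whose tangents have slopes the classes of al and be, both in the residue
   field: the quadratic part of the equation at (x, y) is
   Y^2 + a1 X Y - (a2 + 3 x) X^2 = (Y - al X) (Y - be X). *)
Definition split_multiplicative_reduction W : Prop :=
  exists W', minimal_model W W' /\
  exists x y al be : F,
    let m := vmax v in
    [/\ [/\ x \in v, y \in v, al \in v & be \in v],
        y ^+ 2 + wa1 W' * x * y + wa3 W' * y
          - (x ^+ 3 + wa2 W' * x ^+ 2 + wa4 W' * x + wa6 W') \in m,
        wa1 W' * y - (3%:R * x ^+ 2 + 2%:R * wa2 W' * x + wa4 W') \in m,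
        2%:R * y + wa1 W' * x + wa3 W' \in m &
        [/\ al - be \notin m, al + be + wa1 W' \in m &
            al * be + wa2 W' + 3%:R * x \in m]].

End Reduction.

(* A point of the projective plane over R is a line subbundle of the trivial
   bundle R^3, i.e. a direct summand of rank 1.  These are exactly the
   submodules of R^3 all of whose 2x2 minors vanish and whose coordinates
   generate the unit ideal. *)
Section ProjectivePlane.
Variable R : comNzRingType.

Definition is_line (P : set 'rV[R]_3) : Prop :=
  [/\ (forall a u v, P u -> P v -> P (a *: u + v)),
      (forall u v, P u -> P v ->
         forall i j, u ord0 i * v ord0 j = u ord0 j * v ord0 i) &
      (exists n (u r : 'I_n -> 'rV[R]_3), (forall k, P (u k)) /\
         \sum_k \sum_i r k ord0 i * u k ord0 i = 1)].

Definition mspan (P : set 'rV[R]_3) : set 'rV[R]_3 :=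
  [set v | exists n (a : 'I_n -> R) (u : 'I_n -> 'rV[R]_3),
     (forall k, P (u k)) /\ v = \sum_k a k *: u k].

End ProjectivePlane.

Section Points.
Variables (F : fieldType) (W : weierstrass F).

(* Homogeneous Weierstrass equation, coordinates (X : Y : Z). *)
Definition weqn (R : comAlgType F) (u : 'rV[R]_3) : R :=
  let X := u ord0 0 in let Y := u ord0 1 in let Z := u ord0 2 in
  Y ^+ 2 * Z + (wa1 W)%:A * X * Y * Z + (wa3 W)%:A * Y * Z ^+ 2
  - (X ^+ 3 + (wa2 W)%:A * X ^+ 2 * Z + (wa4 W)%:A * X * Z ^+ 2
     + (wa6 W)%:A * Z ^+ 3).

Record wpoint (R : comAlgType F) := WPoint {
  wline : set 'rV[R]_3;
  wlineP : is_line wline;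
  wlineE : forall u, wline u -> weqn u = 0 }.

Lemma wpoint_eq (R : comAlgType F) (P Q : wpoint R) :
  wline P = wline Q -> P = Q.
Proof.
case: P Q => [P P1 P2] [Q Q1 Q2] /= e; case: Q / e Q1 Q2 => Q1 Q2.
by congr WPoint; apply: Prop_irrelevance.
Qed.

End Points.

Section Functoriality.
Variables (F : fieldType) (W : weierstrass F).

Let torsion_sum (R : comNzRingType) (x : R) (I : finType) (P : pred I)
    (t : I -> R) :
  (forall i, P i -> exists N, x * t i ^+ N = 0) ->
  exists N, x * (\sum_(i | P i) t i) ^+ N = 0.
Proof.
move=> h; apply: (big_ind (fun y => exists N, x * y ^+ N = 0)) => //; first by exists 1%N; rewrite expr1 mulr0.
move=> y z [N hN] [M hM]; exists (N + M)%N; rewrite exprDn mulr_sumr.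
apply: big1 => i _; rewrite mulrnAr.
suff -> : x * (y ^+ (N + M - i) * z ^+ i) = 0 by rewrite mul0rn.
have [le|lt] := leqP M i.
  by rewrite mulrCA -(subnKC le) exprD (mulrA x) hM mul0r mulr0.
have le : (N <= N + M - i)%N by rewrite -addnBA ?leq_addr // ltnW.
by rewrite -(subnKC le) exprD !mulrA hN !mul0r.
Qed.

Let weqnZ (R : comAlgType F) (a : R) (u : 'rV[R]_3) :
  weqn W (a *: u) = a ^+ 3 * weqn W u.
Proof. by rewrite /weqn /= !mxE; ring. Qed.

Lemma mspan_line (R S : comNzRingType) (phi : {rmorphism R -> S})
    (P : set 'rV[R]_3) : is_line P -> is_line (mspan (map_mx phi @` P)%classic).
Proof.
case=> Pl Pm [n [u [r [Pu sum1]]]]; split.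
- move=> a _ _ [n1 [a1 [u1 [h1 ->]]]] [n2 [a2 [u2 [h2 ->]]]].
  exists (n1 + n2)%N.
  exists (fun k : 'I_(n1 + n2) => match fintype.split k with inl i => a * a1 i | inr j => a2 j end).
  exists (fun k : 'I_(n1 + n2) => match fintype.split k with inl i => u1 i | inr j => u2 j end).
  split; first by move=> k; case: (fintype.split k).
  rewrite big_split_ord /= scaler_sumr; congr (_ + _); apply: eq_bigr => i _.
    by rewrite (unsplitK (inl i)) scalerA.
  by rewrite (unsplitK (inr i)).
- move=> _ _ [n1 [a1 [u1 [h1 ->]]]] [n2 [a2 [u2 [h2 ->]]]] i j.
  rewrite !summxE !mulr_suml; apply: eq_bigr => k _.
  rewrite !mulr_sumr; apply: eq_bigr => m _; rewrite !mxE.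
  have [x Px <-] := h1 k; have [y Py <-] := h2 m; rewrite !mxE.
  rewrite !mulrA !(mulrAC _ _ (a2 m)) -!mulrA; congr (_ * (_ * _)).
  by rewrite -!rmorphM (Pm x y Px Py i j).
- exists n, (fun k => map_mx phi (u k)), (fun k => map_mx phi (r k)); split.
    move=> k; exists 1%N, (fun=> 1), (fun=> map_mx phi (u k)).
    by split=> [_|]; [exists (u k) | rewrite big_ord1 scale1r].
  rewrite -(rmorph1 phi) -sum1 rmorph_sum; apply: eq_bigr => k _.
  by rewrite rmorph_sum; apply: eq_bigr => i _; rewrite !mxE rmorphM.
Qed.

Lemma mspan_weqn (R S : comAlgType F) (phi : {lrmorphism R -> S})
    (P : wpoint W R) u :
  mspan (map_mx phi @` wline P)%classic u -> weqn W u = 0.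
Proof.
move=> Qu; have Pl := wlineP P.
have [_ Qm _] := mspan_line phi Pl.
have [_ _ [n [w [r [Pw sum1]]]]] := Pl.
have weq0 k : weqn W (map_mx phi (w k)) = 0.
  rewrite -(rmorph0 phi) -(wlineE (Pw k)) /weqn !mxE.
  have phiA c : (phi : {rmorphism R -> S}) c%:A = c%:A by exact: rmorph_alg.
  by rewrite rmorphB !rmorphD !rmorphM !phiA.
have [N] : exists N, weqn W u * (\sum_k phi (\sum_i r k ord0 i * w k ord0 i)) ^+ N = 0.
  apply: torsion_sum => k _; rewrite rmorph_sum; apply: torsion_sum => i _.
  exists 3%N; rewrite rmorphM exprMn mulrCA.
  suff -> : weqn W u * phi (w k ord0 i) ^+ 3 = 0 by rewrite mulr0.
  rewrite mulrC -weqnZ.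
  have -> : phi (w k ord0 i) *: u = u ord0 i *: map_mx phi (w k).
    apply/rowP => j; rewrite !mxE.
    have Qw : mspan (map_mx phi @` wline P)%classic (map_mx phi (w k)).
      exists 1%N, (fun=> 1), (fun=> map_mx phi (w k)).
      by split=> [_|]; [exists (w k) | rewrite big_ord1 scale1r].
    by have := Qm _ _ Qu Qw i j; rewrite !mxE mulrC => ->; rewrite mulrC.
  by rewrite weqnZ weq0 mulr0.
by rewrite -rmorph_sum sum1 rmorph1 expr1n mulr1.
Qed.

Definition wmap (R S : comAlgType F) (phi : {lrmorphism R -> S})
    (P : wpoint W R) : wpoint W S :=
  WPoint (mspan_line phi (wlineP P)) (@mspan_weqn _ _ phi P).

Definition winf_line (R : comAlgType F) : set 'rV[R]_3 :=
  [set u | u ord0 0 = 0 /\ u ord0 2 = 0].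

Let ord3 (i : 'I_3) : [\/ i = 0, i = 1 | i = 2].
Proof.
case: i => [[|[|[|//]]] ?]; [constructor 1|constructor 2|constructor 3];
exact: val_inj.
Qed.

Lemma winf_is_line (R : comAlgType F) : is_line (@winf_line R).
Proof.
split.
- by move=> a u v [u0 u2] [v0 v2]; split; rewrite !mxE ?u0 ?u2 ?v0 ?v2 mulr0 addr0.
- move=> u v [u0 u2] [v0 v2] i j.
  by case: (ord3 i) => ->; case: (ord3 j) => ->;
     rewrite ?u0 ?u2 ?v0 ?v2 ?mulr0 ?mul0r.
- pose e : 'rV[R]_3 := delta_mx ord0 1.
  exists 1%N, (fun=> e), (fun=> e); split; first by move=> _; split; rewrite mxE.
  rewrite big_ord1 (bigD1 1) //= big1 ?addr0; last first.
    by move=> i /negPf ne; rewrite mxE ne andbF mulr0.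
  by rewrite mxE !eqxx mulr1.
Qed.

Lemma winf_weqn (R : comAlgType F) (u : 'rV[R]_3) :
  winf_line u -> weqn W u = 0.
Proof. by case=> u0 u2; rewrite /weqn u0 u2; ring. Qed.

Definition winf (R : comAlgType F) : wpoint W R :=
  WPoint (@winf_is_line R) (@winf_weqn R).

End Functoriality.

(* An elliptic curve over F is a smooth Weierstrass cubic with a structure of
   group scheme (given, by Yoneda, on the functor of points) whose identity is
   (0 : 1 : 0).  By rigidity of abelian varieties this structure exists and is
   unique, so it is the usual group law. *)
Record ellipticCurve (F : fieldType) := EllipticCurve {
  ecW :> weierstrass F;
  ec_smooth : wdisc ecW != 0;
  ec_add : forall R : comAlgType F, wpoint ecW R -> wpoint ecW R -> wpoint ecW R;
  ec_opp : forall R : comAlgType F, wpoint ecW R -> wpoint ecW R;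
  ec_addA : forall R, associative (@ec_add R);
  ec_addC : forall R, commutative (@ec_add R);
  ec_add0 : forall R, left_id (winf ecW R) (@ec_add R);
  ec_addN : forall R, left_inverse (winf ecW R) (@ec_opp R) (@ec_add R);
  ec_add_natural : forall (R S : comAlgType F) (phi : {lrmorphism R -> S}),
    {morph wmap phi : P Q / ec_add P Q} }.

Definition ecpoint (F : fieldType) (E : ellipticCurve F) (R : comAlgType F) :=
  wpoint E R.

HB.instance Definition _ (F : fieldType) (E : ellipticCurve F)
  (R : comAlgType F) := gen_eqMixin (ecpoint E R).
HB.instance Definition _ (F : fieldType) (E : ellipticCurve F)
  (R : comAlgType F) := gen_choiceMixin (ecpoint E R).
HB.instance Definition _ (F : fieldType) (E : ellipticCurve F)
  (R : comAlgType F) := GRing.isZmodule.Build (ecpoint E R)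
    (@ec_addA F E R) (@ec_addC F E R) (@ec_add0 F E R) (@ec_addN F E R).

Definition ecmap (F : fieldType) (E : ellipticCurve F) (R S : comAlgType F)
  (phi : {lrmorphism R -> S}) (P : ecpoint E R) : ecpoint E S := wmap phi P.

Section Extensions.
Variable F : fieldType.

Definition finite_extension (L : fieldAlgType F) : Prop :=
  exists s : seq L, forall x, exists c : nat -> F,
    x = \sum_(i < size s) c i *: s`_i.

(* Normal and separable: every element has a minimal polynomial which splits
   with simple roots. *)
Definition galois_extension (L : fieldAlgType F) : Prop :=
  forall x : L, exists (q : {poly F}) (s : seq L),
    [/\ irreducible_poly q, map_poly (in_alg L) q = \prod_(z <- s) ('X - z%:P),
        uniq s & x \in s].

Definition Gal (K L : fieldAlgType F) (e : {lrmorphism K -> L}) :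
    set {lrmorphism L -> L} :=
  [set s : {lrmorphism L -> L} | bijective s /\ forall x, s (e x) = e x]%classic.

Definition GalF (L : fieldAlgType F) : set {lrmorphism L -> L} :=
  [set s : {lrmorphism L -> L} | bijective s]%classic.

End Extensions.
Arguments GalF {F} L _.

(* The l-adic integers, as the inverse limit of the Z/l^(n+1). *)
Record ladic (l : nat) := Ladic {
  lproj :> forall n, 'Z_(l ^ n.+1);
  lproj_compat : forall n, lproj n.+1 = lproj n %[mod l ^ n.+1] }.

(* L/F is Galois and its Galois group, with the Krull topology, is isomorphic as
   a topological group to Z_l^d. *)
Definition Zl_extension (l d : nat) (F : fieldType) (L : fieldAlgType F) : Prop :=
  galois_extension L /\
  exists chi : {lrmorphism L -> L} -> ('I_d -> ladic l),
  [/\ set_bij (GalF L) setT chi,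
      (forall s t : {lrmorphism L -> L}, GalF L s -> GalF L t ->
         forall i n, chi (s \o t : {lrmorphism L -> L}) i n = chi s i n + chi t i n),
      (forall n, exists S : seq L, forall s, GalF L s ->
         {in S, forall x, s x = x} -> forall i, chi s i n = 0) &
      (forall x : L, exists n, forall s, GalF L s ->
         (forall i, chi s i n = 0) -> s x = x)].

(* Fix E over F.  For an extension L of F, an L-algebra is an F-algebra A with
   an F-algebra morphism L -> A.  H^1_fl(Spec L, -) is Cech cohomology for the
   fppf topology: the direct limit over the coverings of Spec L of the Cech H^1.
   Since a nonzero L-algebra is faithfully flat, the coverings Spec A -> Spec L
   with A of finite type and nonzero are cofinal. *)

Section FlatCohomology.
Variables (F : fieldType) (E : ellipticCurve F) (p : nat).

Record cover (L : fieldAlgType F) := Cover {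
  cov_alg :> comAlgType F;
  cov_str : {lrmorphism L -> cov_alg};
  cov_ft : exists s : seq cov_alg, forall B : {pred cov_alg},
    subring_closed B -> (forall x, cov_str x \in B) -> {subset s <= B} ->
    forall x, x \in B }.

(* By Yoneda, an element of E(A (x)_L A) is a natural family of elements of E(R)
   indexed by the pairs of L-algebra morphisms f, g : A -> R.  An element of
   the direct limit H^1_fl(Spec L, E[p^oo]) is represented by a Cech cocycle
   with values in some E[p^n]. *)
Record cocycle (L : fieldAlgType F) := Cocycle {
  coc_cov : cover L;
  coc_fun : forall (R : comAlgType F) (f g : {lrmorphism coc_cov -> R}),
    f \o cov_str coc_cov =1 g \o cov_str coc_cov -> ecpoint E R;
  coc_natural : forall (R S : comAlgType F) (phi : {lrmorphism R -> S})
    (f g : {lrmorphism coc_cov -> R}) (f' g' : {lrmorphism coc_cov -> S}) h h',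
    f' =1 phi \o f -> g' =1 phi \o g ->
    coc_fun (f := f') (g := g') h' = ecmap phi (coc_fun (f := f) (g := g) h);
  coc_cocycle : forall (R : comAlgType F) (f g k : {lrmorphism coc_cov -> R})
    hfg hgk hfk,
    coc_fun (f := f) (g := g) hfg + coc_fun (f := g) (g := k) hgk =
    coc_fun (f := f) (g := k) hfk;
  coc_torsion : exists n, forall (R : comAlgType F)
    (f g : {lrmorphism coc_cov -> R}) h, coc_fun (f := f) (g := g) h *+ p ^ n = 0 }.

(* The class of y in H^1(L', E[p^oo]) is the image of the class of x in
   H^1(L, E[p^oo]) under restriction along e : L -> L': on a common refinement C
   over e of their coverings, x and y differ by the coboundary of an element b
   of some E[p^n](C). *)
Definition restricts_to (L L' : fieldAlgType F) (e : {lrmorphism L -> L'})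
    (x : cocycle L) (y : cocycle L') : Prop :=
  exists (C : cover L') (h : {lrmorphism coc_cov x -> C})
    (k : {lrmorphism coc_cov y -> C}) (b : ecpoint E C) (n : nat),
  [/\ h \o cov_str (coc_cov x) =1 cov_str C \o e,
      k \o cov_str (coc_cov y) =1 cov_str C,
      b *+ p ^ n = 0 &
      forall (R : comAlgType F) (f g : {lrmorphism C -> R})
        (fg : f \o cov_str C =1 g \o cov_str C) hx hy,
        coc_fun (c := x) (f := f \o h) (g := g \o h) hx =
        coc_fun (c := y) (f := f \o k) (g := g \o k) hy + (ecmap g b - ecmap f b)].

Definition cohomologous (L : fieldAlgType F) : cocycle L -> cocycle L -> Prop :=
  restricts_to (idfun : {lrmorphism L -> L}).

(* The elements of H^1_fl(Spec L, E[p^oo]) are the cohomology classes.  Sets of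
   cocycles are plain predicates, as cocycles do not fit in the universe of the
   sets of classical_sets. *)
Definition cochains (L : fieldAlgType F) := cocycle L -> Prop.

Definition is_class (L : fieldAlgType F) (X : cochains L) : Prop :=
  exists x, X = cohomologous x.

Definition H1add (L : fieldAlgType F) (X Y : cochains L) : cochains L :=
  fun z => exists (x y w : cocycle L)
    (h : {lrmorphism coc_cov x -> coc_cov w})
    (k : {lrmorphism coc_cov y -> coc_cov w}),
  [/\ X x, Y y, cohomologous w z,
      h \o cov_str (coc_cov x) =1 cov_str (coc_cov w) /\
      k \o cov_str (coc_cov y) =1 cov_str (coc_cov w) &
      forall (R : comAlgType F) (f g : {lrmorphism coc_cov w -> R}) hw hx hy,
        coc_fun (c := w) (f := f) (g := g) hw =
        coc_fun (c := x) (f := f \o h) (g := g \o h) hx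
        + coc_fun (c := y) (f := f \o k) (g := g \o k) hy].

Definition res (L L' : fieldAlgType F) (e : {lrmorphism L -> L'})
    (X : cochains L) : cochains L' :=
  fun y => exists x, X x /\ restricts_to e x y.

(* kappa (P (x) p^-n): the image of P under the connecting morphism of
   0 -> E[p^n] -> E -> E -> 0.  On a covering A where P = p^n Q, it is the class
   of the coboundary of Q. *)
Definition kummer (K : fieldAlgType F) (P : ecpoint E K) (n : nat) : cochains K :=
  fun y => exists (x : cocycle K) (Q : ecpoint E (coc_cov x)),
  [/\ Q *+ p ^ n = ecmap (cov_str (coc_cov x)) P,
      forall (R : comAlgType F) (f g : {lrmorphism coc_cov x -> R}) h,
        coc_fun (c := x) (f := f) (g := g) h = ecmap g Q - ecmap f Q &
      cohomologous x y].

Definition selmer (L : fieldAlgType F) (X : cochains L) : Prop :=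
  is_class X /\
  forall (v : place L) (K : fieldAlgType F) (i : {lrmorphism L -> K})
    (w : place K), is_completion v i w ->
  exists (P : ecpoint E K) (n : nat), res i X = kummer P n.

(* Elements of the Selmer group fixed by the automorphisms of L over K; E being
   defined over F, the action of an automorphism s is restriction along s. *)
Definition selmer_inv (K L : fieldAlgType F) (e : {lrmorphism K -> L})
    (X : cochains L) : Prop :=
  selmer X /\ forall s : {lrmorphism L -> L}, Gal e s -> res s X = X.

(* res e is an isomorphism of groups from Sel(K) onto Sel(L)^Gal(L/K). *)
Definition selmer_res_iso (K L : fieldAlgType F) (e : {lrmorphism K -> L}) : Prop :=
  [/\ (forall X, selmer X -> selmer_inv e (res e X)),
      (forall X Y, selmer X -> selmer Y ->
         res e (H1add X Y) = H1add (res e X) (res e Y)),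
      (forall X Y, selmer X -> selmer Y -> res e X = res e Y -> X = Y) &
      (forall Z, selmer_inv e Z -> exists2 X, selmer X & res e X = Z)].

End FlatCohomology.

(* Main.v *)
From HB Require Import structures.
Require Import Defs.
From mathcomp Require Import all_boot all_fingroup all_solvable all_algebra.
From mathcomp Require Import boolp classical_sets functions.
From mathcomp Require Import ring mpoly.

Set Implicit Arguments.
Unset Strict Implicit.
Unset Printing Implicit Defensive.

Import GRing.Theory.
Local Open Scope ring_scope.
Local Notation cover := Defs.cover.

(* Write K = F_n and L for the Z_l^d-extension; finite subextensions of L/K have degree
   prime to p, so p-power torsion transfers through them.

   Cohomology.  A p-power torsion class over K which dies over L dies over a finite Galois
   extension N of K inside L, hence, by summing over Gal(N/K), is killed by [N : K],
   which is prime to p.  Conversely a class over L invariant under Gal(L/K) lives over a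
   finite level N; its corestriction to K restricts to [N : K] times the class.  So
   H^1(K, E[p^oo]) is H^1(L, E[p^oo])^Gal(L/K).

   Local conditions.  They go up because K_v maps to L_w.  For the converse, let x be a
   class over K which becomes a coboundary of a point over A (x)_K L_w, A being the
   covering of x.  This point has coordinates over a finitely generated K-subalgebra B of
   L_w.  Since L_w is separable over K, with v discrete on K and [K : K^p] = p, and since
   L is dense in L_w, Newton's method gives K-morphisms from B to the completion M of some
   finite N in L.  So x is a coboundary over M, and M is Galois over K_v with group a
   decomposition group in Gal(N/K), by weak approximation; the same transfer as above
   brings the coboundary down to K_v, which is the Kummer condition there. *)

(** * Algebras, quotients and subfields *)

(** A class satisfies the Kummer condition exactly when, over some cover, it becomes the coboundary
    of a point which need not be torsion: p^n times that point is then invariant and descends. All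
    descent statements are therefore about trivializations by arbitrary points, with a side clause
    that torsion is kept, and serve both the cohomology and the local conditions. The obstacle is
    that L_w may be larger than the union of the completions M, so a trivializing point over it may
    belong to no finite level and cannot be averaged; hence the specialization of B. Separability of
    L_w comes from MacLane's criterion: L_w must contain no p-th root of an element t with K =
    K^p(t). Such a t is taken with a value at v that is not p times a value of K; a p-th root in L_w
    would be close to an element of some N, and averaging over the decomposition group, of order
    prime to p, would give an element of K whose p-th power has the value of t. The group law is
    given only through the functor of points, so points over rings are handled as lines, whose
    equality is the vanishing of 2x2 minors. *)

Section AlgebraOfMorphism.
Variable F : fieldType.

(** A type alias, so that the scalar action through [phi] can be attached to a ring without clashing
    with a structure it already carries. *)
Definition alg_of (R : comNzRingType) (phi : {rmorphism F -> R}) : Type := R.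

Section Ring.
Variables (R : comNzRingType) (phi : {rmorphism F -> R}).
Local Notation A := (alg_of phi).
HB.instance Definition _ := GRing.ComNzRing.on A.
Let scale (a : F) (x : A) : A := (phi a : A) * x.
Let scaleA a b v : scale a (scale b v) = scale (a * b) v.
Proof. by rewrite /scale mulrA -rmorphM. Qed.
Let scale1 : left_id 1 scale.
Proof. by move=> v; rewrite /scale rmorph1 mul1r. Qed.
Let scaleDr : right_distributive scale +%R.
Proof. by move=> a u v; rewrite /scale mulrDr. Qed.
Let scaleDl v : {morph scale^~ v : a b / a + b}.
Proof. by move=> a b; rewrite /scale rmorphD mulrDl. Qed.
HB.instance Definition _ := @GRing.Zmodule_isLmodule.Build F A scale scaleA scale1 scaleDr scaleDl.
Let scaleAl (a : F) (u v : A) : a *: (u * v) = (a *: u) * v.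
Proof. exact: mulrA. Qed.
HB.instance Definition _ := @GRing.Lmodule_isLalgebra.Build F A scaleAl.
HB.instance Definition _ := @GRing.Lalgebra_isComAlgebra.Build F A.
End Ring.

(** The alias is hidden behind a pair of inverse morphisms: rings can be built first and made into
    F-algebras afterwards. *)
Lemma ring_algebra (R : comNzRingType) (phi : {rmorphism F -> R}) :
  exists (A : comAlgType F) (i : {rmorphism R -> A}) (j : {rmorphism A -> R}),
    [/\ cancel i j, cancel j i & forall c, i (phi c) = c%:A].
Proof.
exists (alg_of phi), (idfun : {rmorphism R -> R}), (idfun : {rmorphism R -> R}).
by split=> // c; symmetry; apply: mulr1.
Qed.

HB.instance Definition _ (R : fieldType) (phi : {rmorphism F -> R}) :=
  GRing.Field.on (alg_of phi).

Lemma field_algebra (R : fieldType) (phi : {rmorphism F -> R}) :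
  exists (A : fieldAlgType F) (i : {rmorphism R -> A}) (j : {rmorphism A -> R}),
    [/\ cancel i j, cancel j i & forall c, i (phi c) = c%:A].
Proof.
exists (alg_of phi), (idfun : {rmorphism R -> R}), (idfun : {rmorphism R -> R}).
by split=> // c; symmetry; apply: mulr1.
Qed.
End AlgebraOfMorphism.

Lemma rmorph_lr (F : fieldType) (A B : comAlgType F) (f : {rmorphism A -> B}) :
  (forall c : F, f c%:A = c%:A) -> exists g : {lrmorphism A -> B}, g =1 f.
Proof.
move=> fA.
have fZ : scalable f by move=> c x; rewrite -mulr_algl rmorphM fA mulr_algl.
pose M := GRing.isScalable.Build F A B *:%R (f : A -> B) fZ.
pose g : {lrmorphism A -> B} := HB.pack (f : A -> B) f M.
by exists g.
Qed.

Lemma lrmorph_cA (F : fieldType) (A B : comAlgType F) (f : {lrmorphism A -> B}) (c : F) :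
  f c%:A = c%:A.
Proof. exact: rmorph_alg. Qed.

Lemma build_rmorph (A B : nzRingType) (f : A -> B) :
  f 1 = 1 -> {morph f : x y / x + y} -> {morph f : x y / x * y} ->
  exists g : {rmorphism A -> B}, g =1 f.
Proof.
move=> f1 fD fM.
have f0 : f 0 = 0 by apply: (addrI (f 0)); rewrite -fD !addr0.
have fB : zmod_morphism f.
  move=> x y; rewrite fD; congr (_ + _); apply: (addrI (f y)).
  by rewrite -fD !subrr.
pose M := GRing.isZmodMorphism.Build A B f fB.
pose M' := GRing.isMonoidMorphism.Build A B f (conj f1 fM).
pose g : {rmorphism A -> B} := HB.pack f M M'.
by exists g.
Qed.

Lemma build_lrmorph (F : fieldType) (A B : comAlgType F) (f : A -> B) :
  (forall c : F, f c%:A = c%:A) -> {morph f : x y / x + y} ->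
  {morph f : x y / x * y} -> exists g : {lrmorphism A -> B}, g =1 f.
Proof.
move=> fA fD fM; have f1 : f 1 = 1 by have := fA 1; rewrite !scale1r.
have [g gE] := build_rmorph f1 fD fM.
have [h hE] := @rmorph_lr F A B g (fun c => etrans (gE _) (fA c)).
by exists h => x; rewrite hE gE.
Qed.

Section SubRing.
Variables (R : comNzRingType) (P : {pred R}) (cP : subring_closed P).
Definition subr_type (_ : subring_closed P) := {x : R | x \in P}.
Local Notation S := (subr_type cP).
HB.instance Definition _ := [isSub of S for @sval _ _].
HB.instance Definition _ := [Choice of S by <:].
HB.instance Definition _ := GRing.SubChoice_isSubComNzRing.Build R P S cP.

Lemma subring_type : exists (A : comNzRingType) (i : {rmorphism A -> R}),
  injective i /\ forall x, (x \in P) <-> exists y, i y = x.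
Proof.
exists S, (\val : {rmorphism S -> R}); split; first exact: val_inj.
move=> x; split=> [Px|[y <-]]; last exact: (valP y).
by exists (Sub x Px); exact: SubK.
Qed.
End SubRing.

Lemma field_of_inverses (A : comNzRingType) :
  (forall x : A, x != 0 -> exists y, y * x = 1) ->
  exists (K : fieldType) (i : {rmorphism A -> K}) (j : {rmorphism K -> A}),
    cancel i j /\ cancel j i.
Proof.
move=> h.
have /choice[inv invP] : forall x : A, exists y, (x != 0 -> y * x = 1) /\ (x = 0 -> y = 0).
  move=> x; have [->|nz] := eqVneq x 0; first by exists 0.
  by have [y yE] := h x nz; exists y; split=> // e; rewrite e eqxx in nz.
pose M := GRing.ComNzRing_isField.Build A (fun x nz => (invP x).1 nz) ((invP 0).2 erefl).
pose K : fieldType := HB.pack (A : Type) A M.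
exists K, (idfun : {rmorphism A -> A}), (idfun : {rmorphism A -> A}).
by split.
Qed.

Lemma subfield_type (R : fieldType) (P : {pred R}) : divring_closed P ->
  exists (A : fieldType) (i : {rmorphism A -> R}),
    forall x, (x \in P) <-> exists y, i y = x.
Proof.
move=> cP; have [A [i [inji iP]]] := subring_type (GRing.divring_closedBM cP).
have [] := @field_of_inverses A.
  move=> x nzx; have [y yE] : exists y, i y = (i x)^-1.
    apply/iP; rewrite -[_^-1]mul1r; case: cP => P1 _; apply=> //.
    by apply/iP; exists x.
  exists y; apply: (inji); rewrite rmorphM rmorph1 yE mulVf //.
  by apply: contra_neq nzx => ix0; apply: inji; rewrite ix0 rmorph0.
move=> K [f [g [fg gf]]]; exists K, (i \o g : {rmorphism K -> R}) => x.
rewrite iP; split=> -[y <-]; last by exists (g y).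
by exists (f y); rewrite /= fg.
Qed.

Lemma subalgebra (F : fieldType) (R : comAlgType F) (P : {pred R}) :
  subring_closed P -> (forall c : F, c%:A \in P) ->
  exists (A : comAlgType F) (i : {lrmorphism A -> R}),
    injective i /\ forall x, (x \in P) <-> exists y, i y = x.
Proof.
move=> cP FP; have [A0 [i0 [inji i0P]]] := subring_type cP.
have /choice[phi phiE] : forall c : F, exists y, i0 y = c%:A.
  by move=> c; apply/i0P.
have phi1 : phi 1 = 1 by apply: inji; rewrite phiE rmorph1 scale1r.
have phiD : {morph phi : x y / x + y}.
  by move=> x y; apply: inji; rewrite rmorphD !phiE scalerDl.
have phiM : {morph phi : x y / x * y}.
  by move=> x y; apply: inji; rewrite rmorphM !phiE -!in_algE -rmorphM.
have [psi psiE] := build_rmorph phi1 phiD phiM.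
have [A [i [j [ij ji iE]]]] := ring_algebra psi.
have ijA c : i0 (j c%:A) = c%:A by rewrite -iE ij psiE phiE.
have [k kE] := @rmorph_lr F A R (i0 \o j : {rmorphism A -> R}) ijA.
exists A, k; split=> [x y|x]; first by rewrite !kE /= => /inji /(can_inj ji).
rewrite i0P; split=> -[y <-]; last by exists (j y); rewrite kE.
by exists (i y); rewrite kE /= ij.
Qed.

Lemma subfield (F : fieldType) (R : fieldAlgType F) (P : {pred R}) :
  divring_closed P -> (forall c : F, c%:A \in P) ->
  exists (A : fieldAlgType F) (i : {lrmorphism A -> R}),
    forall x, (x \in P) <-> exists y, i y = x.
Proof.
move=> cP FP; have [A0 [i0 i0P]] := subfield_type cP.
have inji : injective i0 by exact: fmorph_inj.
have /choice[phi phiE] : forall c : F, exists y, i0 y = c%:A.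
  by move=> c; apply/i0P.
have phi1 : phi 1 = 1 by apply: inji; rewrite phiE rmorph1 scale1r.
have phiD : {morph phi : x y / x + y}.
  by move=> x y; apply: inji; rewrite rmorphD !phiE scalerDl.
have phiM : {morph phi : x y / x * y}.
  by move=> x y; apply: inji; rewrite rmorphM !phiE -!in_algE -rmorphM.
have [psi psiE] := build_rmorph phi1 phiD phiM.
have [A [i [j [ij ji iE]]]] := field_algebra psi.
have ijA c : i0 (j c%:A) = c%:A by rewrite -iE ij psiE phiE.
have [k kE] := @rmorph_lr F A R (i0 \o j : {rmorphism A -> R}) ijA.
exists A, k => x.
rewrite i0P; split=> -[y <-]; last by exists (j y); rewrite kE.
by exists (i y); rewrite kE /= ij.
Qed.

(* Quotients are realized as the set of classes of the congruence. *)
Section QuotientField.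
Variables (R : comNzRingType) (I : {pred R}).
Hypothesis I0 : 0 \in I.
Hypothesis IB : forall x y, x \in I -> y \in I -> x - y \in I.
Hypothesis IM : forall x y, y \in I -> x * y \in I.
Hypothesis I1 : 1 \notin I.

Let cls (x : R) : set R := [set y | y - x \in I]%classic.
Let IN x : x \in I -> - x \in I. Proof. by move=> h; rewrite -sub0r IB. Qed.
Let ID x y : x \in I -> y \in I -> x + y \in I.
Proof. by move=> hx hy; rewrite -[y]opprK IB // IN. Qed.
Let clsP x y : cls x = cls y <-> x - y \in I.
Proof.
split=> [e|h].
  have E := congr1 (fun c : set R => c x) e.
  by have h : (cls x : set R) x; [rewrite /cls /= subrr | move: h; rewrite E].
apply/seteqP; split=> z /= hz.
  by have := ID hz h; rewrite addrA subrK.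
by have := IB hz h; rewrite opprB addrA subrK.
Qed.

Definition quot_type : Type := {c : set R | exists x, c = cls x}.
Local Notation Q := quot_type.
HB.instance Definition _ := gen_eqMixin Q.
HB.instance Definition _ := gen_choiceMixin Q.
Let pr (x : R) : Q := exist _ (cls x) (ex_intro _ x erefl).
Let prP x y : pr x = pr y <-> x - y \in I.
Proof.
rewrite -clsP; split=> [e|e]; first by case: e.
exact/eq_exist.
Qed.
Let rep (q : Q) : R := sval (cid (svalP q)).
Let repK q : pr (rep q) = q.
Proof. by rewrite /rep; case: cid => x; case: q => c h /= e; apply/eq_exist. Qed.
Let prK x : rep (pr x) - x \in I.
Proof. by apply/prP; rewrite repK. Qed.
Let add (a b : Q) := pr (rep a + rep b).
Let opp (a : Q) := pr (- rep a).
Let mul (a b : Q) := pr (rep a * rep b).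
Let addE x y : add (pr x) (pr y) = pr (x + y).
Proof.
by apply/prP; rewrite opprD addrACA ID.
Qed.
Let oppE x : opp (pr x) = pr (- x).
Proof. by apply/prP; rewrite -opprD IN. Qed.
Let mulE x y : mul (pr x) (pr y) = pr (x * y).
Proof.
apply/prP.
have -> : rep (pr x) * rep (pr y) - x * y =
  rep (pr x) * (rep (pr y) - y) + y * (rep (pr x) - x) by ring.
by rewrite ID // IM.
Qed.
Let elim (P : Q -> Prop) : (forall x, P (pr x)) -> forall q, P q.
Proof. by move=> h q; rewrite -[q]repK. Qed.
Let addA : associative add.
Proof. by do 3!elim/elim=> ?; rewrite !addE addrA. Qed.
Let addC : commutative add.
Proof. by do 2!elim/elim=> ?; rewrite !addE addrC. Qed.
Let add0 : left_id (pr 0) add.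
Proof. by elim/elim=> ?; rewrite !addE add0r. Qed.
Let addN : left_inverse (pr 0) opp add.
Proof. by elim/elim=> ?; rewrite oppE !addE addNr. Qed.
HB.instance Definition _ := GRing.isZmodule.Build Q addA addC add0 addN.
Let mulA : associative mul.
Proof. by do 3!elim/elim=> ?; rewrite !mulE mulrA. Qed.
Let mulC : commutative mul.
Proof. by do 2!elim/elim=> ?; rewrite !mulE mulrC. Qed.
Let mul1 : left_id (pr 1) mul.
Proof. by elim/elim=> ?; rewrite !mulE mul1r. Qed.
Let mulD : left_distributive mul +%R.
Proof.
have D u v : pr u + pr v = pr (u + v) := addE u v.
by move=> a b c; rewrite -[a]repK -[b]repK -[c]repK !(mulE, D) mulrDl.
Qed.
Let oneN0 : pr 1 != 0.
Proof. by apply/eqP => /prP; rewrite subr0 (negPf I1). Qed.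
HB.instance Definition _ := GRing.Zmodule_isComNzRing.Build Q mulA mulC mul1 mulD oneN0.

Lemma quotient_ring : exists (A : comNzRingType) (p : {rmorphism R -> A}),
  (forall y, exists x, p x = y) /\ (forall x, (p x == 0) = (x \in I)).
Proof.
have prD : {morph pr : x y / x + y} by move=> x y; rewrite -addE.
have prM : {morph pr : x y / x * y} by move=> x y; rewrite -mulE.
have [p pE] := @build_rmorph R Q pr erefl prD prM.
exists Q, p; split=> [y|x].
  by exists (rep y); rewrite pE repK.
rewrite pE; apply/eqP/idP => h.
  by have /prP := h; rewrite subr0.
by apply/prP; rewrite subr0.
Qed.
End QuotientField.

Lemma quotient_field (R : comNzRingType) (I : {pred R}) :
  0 \in I -> (forall x y, x \in I -> y \in I -> x - y \in I) ->
  (forall x y, y \in I -> x * y \in I) -> 1 \notin I ->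
  (forall x, x \notin I -> exists y, y * x - 1 \in I) ->
  exists (K : fieldType) (p : {rmorphism R -> K}),
  (forall y, exists x, p x = y) /\ (forall x, (p x == 0) = (x \in I)).
Proof.
move=> I0 IB IM I1 Iinv; have [A [p [psurj pI]]] := quotient_ring I0 IB IM I1.
have [] := @field_of_inverses A.
  move=> a; have [x <-] := psurj a; rewrite pI => /Iinv[y].
  by rewrite -pI rmorphB rmorph1 subr_eq0 rmorphM => /eqP yE; exists (p y).
move=> K [i [j [ij ji]]]; exists K, (i \o p : {rmorphism R -> K}); split=> [y|x].
  by have [x xE] := psurj (j y); exists x; rewrite /= xE ji.
by rewrite /= -[0](rmorph0 i) (inj_eq (can_inj ij)) pI.
Qed.

(** * Points of an elliptic curve *)

Section Lines.
Variable R : comNzRingType.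
Implicit Types (P Q : set 'rV[R]_3) (u v : 'rV[R]_3).

Lemma line0 P : is_line P -> P 0.
Proof.
case=> Pl _ [[|n] [u [r [Pu]]]]; first by rewrite big_ord0 => /esym/eqP; rewrite oner_eq0.
by have := Pl (-1) _ _ (Pu ord0) (Pu ord0); rewrite scaleN1r addNr.
Qed.

Lemma lineD P u v : is_line P -> P u -> P v -> P (u + v).
Proof. by case=> Pl _ _ hu hv; have := Pl 1 _ _ hu hv; rewrite scale1r. Qed.

Lemma lineZ P a u : is_line P -> P u -> P (a *: u).
Proof. by move=> lP hu; have [Pl _ _] := lP; have := Pl a _ _ hu (line0 lP); rewrite addr0. Qed.

Lemma line_sum P (I : Type) (r : seq I) (f : I -> 'rV[R]_3) :
  is_line P -> (forall i, P (f i)) -> P (\sum_(i <- r) f i).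
Proof.
move=> lP hf; elim/big_rec: _ => [|i x _ hx]; first exact: line0.
exact: lineD.
Qed.

(** A partition of unity of Q, with vectors [v k] in Q, expands u as a combination of the [v k]: the
    vanishing mixed minors allow the coordinates of u and of [v k] to be exchanged. *)
Lemma line_sub P Q : is_line P -> is_line Q ->
  (forall u v, P u -> Q v -> forall i j, u ord0 i * v ord0 j = u ord0 j * v ord0 i) ->
  (P `<=` Q)%classic.
Proof.
move=> lP lQ h u Pu; have [_ _ [n [v [r [Qv sum1]]]]] := lQ.
have -> : u = \sum_k (\sum_i r k ord0 i * u ord0 i) *: v k.
  apply/rowP => j; rewrite summxE -[LHS]mul1r -sum1 mulr_suml; apply: eq_bigr => k _.
  rewrite mxE !mulr_suml; apply: eq_bigr => i _.
  by rewrite -!mulrA; congr (_ * _); rewrite mulrC (h u (v k)) // mulrC.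
by apply: line_sum => // k; apply: lineZ.
Qed.

(** Equality of points thus becomes a family of equations between coordinates, which can be tested
    after an injection or locally on the ring. *)
Lemma line_eq P Q : is_line P -> is_line Q ->
  (forall u v, P u -> Q v -> forall i j, u ord0 i * v ord0 j = u ord0 j * v ord0 i) ->
  P = Q.
Proof.
move=> lP lQ h; apply/seteqP; split; apply: line_sub => // u v hu hv i j.
by rewrite mulrC (h v u) // mulrC.
Qed.

End Lines.

Lemma mspan_in (R S : comNzRingType) (phi : {rmorphism R -> S}) (P : set 'rV[R]_3) u :
  P u -> mspan (map_mx phi @` P)%classic (map_mx phi u).
Proof.
move=> Pu; exists 1%N, (fun=> 1), (fun=> map_mx phi u).
by split=> [_|]; [exists u | rewrite big_ord1 scale1r].
Qed.

Section Points.
Variables (F : fieldType) (E : ellipticCurve F).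
Implicit Types R S T : comAlgType F.

Lemma ecmap_in R S (phi : {lrmorphism R -> S}) (P : ecpoint E R) u :
  wline P u -> wline (ecmap phi P) (map_mx phi u).
Proof. exact: mspan_in. Qed.

Lemma ecpoint_minor R (P : ecpoint E R) u v i j :
  wline P u -> wline P v -> u ord0 i * v ord0 j = u ord0 j * v ord0 i.
Proof. by case: (wlineP P) => _ h _ hu hv; apply: h. Qed.

(** The lines over T are spanned by the images of the two given lines, so bilinearity of the minors
    leaves only vectors coming from R and from S. *)
Lemma ecmap_eqP R S T (f : {lrmorphism R -> T}) (g : {lrmorphism S -> T})
    (P : ecpoint E R) (Q : ecpoint E S) :
  (forall u v, wline P u -> wline Q v -> forall i j,
     f (u ord0 i) * g (v ord0 j) = f (u ord0 j) * g (v ord0 i)) <->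
  ecmap f P = ecmap g Q.
Proof.
split=> [h|e u v Pu Qv i j]; last first.
  have hu := ecmap_in f Pu; have hv := ecmap_in g Qv; rewrite e in hu.
  by have := ecpoint_minor i j hu hv; rewrite !mxE.
apply: wpoint_eq; apply: line_eq; [exact: wlineP|exact: wlineP|].
move=> _ _ [n1 [a1 [u1 [h1 ->]]]] [n2 [a2 [u2 [h2 ->]]]] i j.
rewrite !summxE !mulr_suml; apply: eq_bigr => k _.
rewrite !mulr_sumr; apply: eq_bigr => m _; rewrite !mxE.
have [x Px <-] := h1 k; have [y Py <-] := h2 m; rewrite !mxE.
by rewrite mulrACA (h x y) // mulrACA.
Qed.

Lemma ecmap_ext R S (f g : {lrmorphism R -> S}) (P : ecpoint E R) :
  f =1 g -> ecmap f P = ecmap g P.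
Proof.
by move=> e; apply/ecmap_eqP => u v Pu Pv i j; rewrite !e -!rmorphM (ecpoint_minor i j Pu Pv).
Qed.

Lemma ecmap_comp R S T (f : {lrmorphism R -> S}) (g : {lrmorphism S -> T})
    (h : {lrmorphism R -> T}) (P : ecpoint E R) :
  h =1 g \o f -> ecmap h P = ecmap g (ecmap f P).
Proof.
move=> e; apply/ecmap_eqP => u _ Pu [n [a [v [hv ->]]]] i j.
rewrite !summxE !rmorph_sum !mulr_sumr; apply: eq_bigr => k _.
have [w Pw <-] := hv k; rewrite !mxE !rmorphM !e /= mulrCA [RHS]mulrCA; congr (_ * _).
by rewrite -!rmorphM (ecpoint_minor i j Pu Pw).
Qed.

Lemma ecmap_ecmap R S T (f : {lrmorphism R -> S}) (g : {lrmorphism S -> T}) (P : ecpoint E R) :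
  ecmap g (ecmap f P) = ecmap (g \o f : {lrmorphism R -> T}) P.
Proof. by symmetry; apply: ecmap_comp. Qed.

Lemma ecmap_id R (f : {lrmorphism R -> R}) (P : ecpoint E R) : f =1 id -> ecmap f P = P.
Proof.
move=> e; apply: wpoint_eq; apply: line_eq; [exact: wlineP|exact: wlineP|].
move=> _ v [n [a [u [hu ->]]]] Pv i j.
rewrite !summxE !mulr_suml; apply: eq_bigr => k _.
have fE x : (f : {rmorphism R -> R}) x = x by exact: e.
have [w Pw <-] := hu k; rewrite !mxE !fE -!mulrA; congr (_ * _).
exact: (ecpoint_minor i j Pw Pv).
Qed.

Lemma ecmap_inj R S (f : {lrmorphism R -> S}) :
  injective f -> injective (ecmap f : ecpoint E R -> ecpoint E S).
Proof.
move=> inj P Q /ecmap_eqP h; apply: wpoint_eq; apply: line_eq; [exact: wlineP|exact: wlineP|].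
by move=> u v Pu Qv i j; apply: inj; rewrite !rmorphM h.
Qed.

Lemma ecmap_is_additive R S (f : {lrmorphism R -> S}) :
  zmod_morphism (ecmap f : ecpoint E R -> ecpoint E S).
Proof.
have D : {morph (ecmap f : ecpoint E R -> ecpoint E S) : x y / x + y}.
  by move=> x y; exact: (ec_add_natural f x y).
move=> x y; apply: (addIr (ecmap f y)); rewrite subrK -D; congr (ecmap f _).
exact: subrK.
Qed.
HB.instance Definition _ R S (f : {lrmorphism R -> S}) :=
  GRing.isZmodMorphism.Build (ecpoint E R) (ecpoint E S) (ecmap f)
    (ecmap_is_additive f).

(* Points glue along a partition of unity: F agrees with G k where e k lives. *)
Lemma ecmap_local R S (I : finType) (e : I -> S) (f : {lrmorphism R -> S})
    (g : I -> {lrmorphism R -> S}) (P : ecpoint E R) (Q : ecpoint E S) :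
  \sum_k e k = 1 -> (forall k a, e k * f a = e k * g k a) ->
  (forall k, ecmap (g k) P = Q) -> ecmap f P = Q.
Proof.
move=> e1 eg gP; rewrite -[RHS](@ecmap_id S idfun) //.
apply/ecmap_eqP => u v Pu Qv i j /=.
rewrite -[LHS]mul1r -[RHS]mul1r -e1 !mulr_suml; apply: eq_bigr => k _.
rewrite !mulrA !eg -!mulrA; congr (_ * _).
have hu := ecmap_in (g k) Pu; rewrite gP in hu.
by have := ecpoint_minor i j hu Qv; rewrite !mxE.
Qed.

(** The vectors over R whose image lies in the line of P form a line as soon as they admit a
    partition of unity; the minors and the equation vanish over R since f is injective. *)
Lemma ecpoint_descent R S (f : {lrmorphism R -> S}) (P : ecpoint E S) n
    (u r : 'I_n -> 'rV[R]_3) :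
  injective f -> (forall k, wline P (map_mx f (u k))) ->
  \sum_k \sum_i r k ord0 i * u k ord0 i = 1 -> exists P0, ecmap f P0 = P.
Proof.
move=> inj Pu sum1.
pose l : set 'rV[R]_3 := [set v | wline P (map_mx f v)]%classic.
have ll : is_line l.
  split.
  - move=> a v w hv hw; rewrite /l /= map_mxD map_mxZ.
    by apply: lineD; [exact: wlineP | apply: lineZ => //; exact: wlineP | ].
  - move=> v w hv hw i j; apply: inj; rewrite !rmorphM.
    by have := ecpoint_minor i j hv hw; rewrite !mxE.
  - by exists n, u, r.
have lE v : l v -> weqn E v = 0.
  move=> /wlineE h; apply: inj; rewrite rmorph0 -h /weqn !mxE.
  by rewrite !(rmorphB, rmorphD, rmorphM, rmorphXn) /= !lrmorph_cA.
exists (WPoint ll lE : ecpoint E R).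
rewrite -[RHS](@ecmap_id S idfun) //; apply/ecmap_eqP => v w hv hw i j /=.
have {}hv : wline P (map_mx f v) by [].
by have := ecpoint_minor i j hv hw; rewrite !mxE.
Qed.

(** The list consists of the entries of a partition of unity of P. It is the source of every claim
    that a point over a large ring involves only finitely many elements. *)
Lemma ecpoint_coords R (P : ecpoint E R) : exists s : seq R,
  forall S (f : {lrmorphism S -> R}), injective f ->
    (forall x, x \in s -> exists y, f y = x) -> exists P0, ecmap f P0 = P.
Proof.
have [_ _ [n [u [r [Pu sum1]]]]] := wlineP P.
exists ([seq u x.1 ord0 x.2 | x : 'I_n * 'I_3] ++ [seq r x.1 ord0 x.2 | x : 'I_n * 'I_3]).
move=> S f inj h.
have /choice[u0 u0E] : forall k, exists v, map_mx f v = u k.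
  move=> k; have /choice[v vE] : forall i, exists y, f y = u k ord0 i.
    move=> i; apply: h; rewrite mem_cat; apply/orP; left.
    by apply/mapP; exists (k, i); rewrite ?mem_enum.
  by exists (\row_i v i); apply/rowP => i; rewrite !mxE.
have /choice[r0 r0E] : forall k, exists v, map_mx f v = r k.
  move=> k; have /choice[v vE] : forall i, exists y, f y = r k ord0 i.
    move=> i; apply: h; rewrite mem_cat; apply/orP; right.
    by apply/mapP; exists (k, i); rewrite ?mem_enum.
  by exists (\row_i v i); apply/rowP => i; rewrite !mxE.
apply: (@ecpoint_descent _ _ f P n u0 r0) => // [k|]; first by rewrite u0E.
apply: inj; rewrite rmorph1 -sum1 rmorph_sum; apply: eq_bigr => k _.
rewrite rmorph_sum; apply: eq_bigr => i _.
by rewrite rmorphM -u0E -r0E !mxE.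
Qed.

End Points.

(** * Tensor products over a field *)

Lemma zorn_above (T : Type) (good : set T -> Prop) (W : set T) (w : T) :
  W w -> good W ->
  (forall C : set (set T), (exists X, C X) -> (forall X, C X -> good X) ->
     total_on C subset -> good (\bigcup_(X in C) X)%classic) ->
  exists M, [/\ good M, (W `<=` M)%classic &
    forall X, good X -> (M `<=` X)%classic -> (X `<=` M)%classic].
Proof.
move=> Ww gW gU.
pose P (X : set T) := X = set0 \/ (good X /\ (W `<=` X)%classic).
have PW : P W by right; split=> // x.
have [C CP tot|M [PM maxM]] := @Zorn_bigcup T P.
  have [[X CX nX]|no] := pselect (exists2 X, C X & X <> set0); last first.
    left; apply/seteqP; split=> x //= [X CX Xx].
    by case: no; exists X => // X0; rewrite X0 in Xx.
  right; split; last first.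
    by case: (CP _ CX) => // -[_ sub] x /sub Xx; exists X.
  have -> : (\bigcup_(X in C) X = \bigcup_(X in [set X | C X /\ X <> set0]) X)%classic.
    apply/seteqP; split=> x [Y CY Yx]; last by case: CY => CY _; exists Y.
    by exists Y => //; split=> // Y0; rewrite Y0 in Yx.
  apply: gU; first by exists X.
    by move=> Y [CY nY]; case: (CP _ CY) => // -[].
  by move=> Y Z [CY _] [CZ _]; exact: tot.
case: PM => [M0|[gM WM]].
  case: (maxM W) => //; rewrite M0; split=> // /(_ w Ww) //.
exists M; split=> // X gX MX.
apply: contrapT => nXM; apply: (maxM X) => //.
by right; split=> // x /WM /MX.
Qed.

Section Functionals.
Variables (F : fieldType) (K : fieldAlgType F) (A : comAlgType F) (s : {lrmorphism K -> A}).

Definition functional (phi : A -> K) :=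
  (forall x y, phi (x + y) = phi x + phi y) /\ (forall c x, phi (s c * x) = c * phi x).

Lemma functional0 phi : functional phi -> phi 0 = 0.
Proof. by move=> [D _]; apply: (addrI (phi 0)); rewrite -D !addr0. Qed.

Lemma functionalN phi x : functional phi -> phi (- x) = - phi x.
Proof.
move=> h; apply: (addrI (phi x)); rewrite -h.1 !subrr; exact: functional0.
Qed.

Lemma functional_sum phi (I : Type) (r : seq I) (f : I -> A) : functional phi ->
  phi (\sum_(i <- r) f i) = \sum_(i <- r) phi (f i).
Proof. by move=> h; elim: r => [|i r IH]; rewrite ?big_nil ?functional0 // !big_cons h.1 IH. Qed.

Lemma functionalM phi a : functional phi -> functional (fun x => phi (a * x)).
Proof.
by move=> [D Z]; split=> [x y|c x]; rewrite ?mulrDr ?D // mulrCA Z.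
Qed.

Definition subspace (W : set A) :=
  [/\ W 0, (forall x y, W x -> W y -> W (x + y)) & (forall c x, W x -> W (s c * x))].

(** In a maximal subspace M among those that contain W and avoid a, every x is congruent to a unique
    multiple of a, and its coefficient is the functional. Zorn's lemma enters because A may be
    infinite dimensional. *)
Lemma functional_sep (W : set A) a : subspace W -> ~ W a ->
  exists phi, [/\ functional phi, forall x, W x -> phi x = 0 & phi a = 1].
Proof.
move=> sW nWa; pose good X := subspace X /\ ~ X a.
have [] := @zorn_above A good W 0; [by case: sW|by []| |].
  move=> C [X0 CX0] gC tot; split; last by move=> [X /gC[_ nX]] /nX.
  split; first by exists X0 => //; case: (gC _ CX0) => -[].
    move=> x y [X CX Xx] [Y CY Yy]; case: (tot _ _ CX CY) => sub.
      by exists Y => //; case: (gC _ CY) => -[_ D _] _; apply: D => //; apply: sub.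
    by exists X => //; case: (gC _ CX) => -[_ D _] _; apply: D => //; apply: sub.
  by move=> c x [X CX Xx]; exists X => //; case: (gC _ CX) => -[_ _ Z] _; apply: Z.
move=> M [[[M0 MD MZ] nMa] WM maxM].
have MN x : M x -> M (- x).
  by move=> Mx; have := MZ (- 1) _ Mx; rewrite rmorphN rmorph1 mulN1r.
have uniq_c x c d : M (x - s c * a) -> M (x - s d * a) -> c = d.
  move=> hc hd; apply: contrapT => /eqP; rewrite -subr_eq0 => nz.
  apply: nMa; have := MZ (c - d)^-1 _ (MD _ _ hd (MN _ hc)).
  have -> : x - s d * a - (x - s c * a) = s (c - d) * a by rewrite rmorphB; ring.
  by rewrite mulrA -rmorphM mulVf // rmorph1 mul1r.
have ex_c x : exists c, M (x - s c * a).
  apply: contrapT => no.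
  pose X := [set y | exists c, M (y - s c * x)]%classic.
  have sX : subspace X.
    split; first by exists 0; rewrite rmorph0 mul0r subr0.
      move=> y z [c hc] [d hd]; exists (c + d).
      have -> : y + z - s (c + d) * x = (y - s c * x) + (z - s d * x).
        by rewrite rmorphD; ring.
      exact: MD.
    move=> c y [d hd]; exists (c * d).
    have -> : s c * y - s (c * d) * x = s c * (y - s d * x) by rewrite rmorphM; ring.
    exact: MZ.
  have MX : (M `<=` X)%classic.
    by move=> y My; exists 0; rewrite rmorph0 mul0r subr0.
  have Xx : X x by exists 1; rewrite rmorph1 mul1r subrr.
  have nXa : ~ X a.
    move=> [c hc]; have [c0|nz] := eqVneq c 0.
      by move: hc; rewrite c0 rmorph0 mul0r subr0.
    apply: no; exists c^-1.
    have := MZ (- c^-1) _ hc.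
    have -> : s (- c^-1) * (a - s c * x) = s (c^-1 * c) * x - s c^-1 * a.
      by rewrite rmorphN rmorphM; ring.
    by rewrite mulVf // rmorph1 mul1r.
  apply: no; exists 0; rewrite rmorph0 mul0r subr0.
  exact: (maxM X).
have /choice[phi phiP] := ex_c.
exists phi; split.
- split=> [x y|c x].
    apply: (uniq_c (x + y)) => //.
    have -> : x + y - s (phi x + phi y) * a = (x - s (phi x) * a) + (y - s (phi y) * a).
      by rewrite rmorphD; ring.
    exact: MD.
  apply: (uniq_c (s c * x)) => //.
  have -> : s c * x - s (c * phi x) * a = s c * (x - s (phi x) * a) by rewrite rmorphM; ring.
  exact: MZ.
- by move=> x /WM Mx; apply: (uniq_c x) => //; rewrite rmorph0 mul0r subr0.
- by apply: (uniq_c a) => //; rewrite rmorph1 mul1r subrr.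
Qed.

Lemma functional_neq0 a : a != 0 -> exists2 phi, functional phi & phi a = 1.
Proof.
move=> /eqP nz; have [||phi [h _ e]] := @functional_sep [set 0]%classic a => //; last by exists phi.
by split=> // [x y -> ->|c x ->]; rewrite ?addr0 ?mulr0.
Qed.

End Functionals.

Section Tensor.
Variables (F : fieldType) (K : fieldAlgType F) (A B : comAlgType F).
Variables (s : {lrmorphism K -> A}) (t : {lrmorphism K -> B}).

Definition balanced (V : zmodType) (beta : A -> B -> V) :=
  [/\ forall x y b, beta (x + y) b = beta x b + beta y b,
      forall a x y, beta a (x + y) = beta a x + beta a y &
      forall c a b, beta (s c * a) b = beta a (t c * b)].

(** While some left entry is a combination of the others, its coefficients are moved into the right
    entries and the term is dropped. All balanced maps are treated at once, so that the new
    expression may be used before any tensor product is available; [phi] is the dual family. *)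
Lemma indep_rep n (a : 'I_n -> A) (b : 'I_n -> B) :
  exists m (a' : 'I_m -> A) (b' : 'I_m -> B) (phi : 'I_m -> A -> K),
  [/\ forall i, functional s (phi i), forall i j, phi i (a' j) = (i == j)%:R &
      forall (V : zmodType) (beta : A -> B -> V), balanced beta ->
        \sum_i beta (a i) (b i) = \sum_i beta (a' i) (b' i)].
Proof.
elim: n a b => [|n IH] a b.
  exists 0%N, a, b, (fun _ _ => 0); split=> [[]|[]|//] //.
have [h|/existsNP[i0 h]] := pselect (forall i, exists phi, [/\ functional s phi,
    phi (a i) = 1 & forall j, j != i -> phi (a j) = 0]).
  have /choice[phi phiP] := h.
  exists n.+1, a, b, phi; split=> [i|i j|//]; first by case: (phiP i).
  case: (phiP i) => _ e1 e0; have [<-|ne] := eqVneq i j; first by rewrite e1.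
  by rewrite e0 // eq_sym.
pose W : set A := [set x | exists c : 'I_n -> K, x = \sum_j s (c j) * a (lift i0 j)]%classic.
have [c ac] : W (a i0).
  apply: contrapT => nW; apply: h.
  have sW : subspace s W.
    split.
    - by exists (fun=> 0); rewrite big1 // => j _; rewrite rmorph0 mul0r.
    - move=> x y [c ->] [d ->]; exists (fun j => c j + d j).
      by rewrite -big_split; apply: eq_bigr => j _; rewrite rmorphD mulrDl.
    - move=> d x [c ->]; exists (fun j => d * c j).
      by rewrite mulr_sumr; apply: eq_bigr => j _; rewrite rmorphM mulrA.
  have [phi [fphi phi0 phi1]] := functional_sep sW nW.
  exists phi; split=> // j ne; apply: phi0.
  have [k ->] : exists k, j = lift i0 k by case: (unliftP i0 j) ne => [k ->|->]; [exists k | rewrite eqxx].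
  exists (fun m => (m == k)%:R); rewrite (bigD1 k) //= eqxx rmorph1 mul1r big1 ?addr0 //.
  by move=> m /negPf ->; rewrite rmorph0 mul0r.
have [m [a' [b' [phi [h1 h2 h3]]]]] :=
  IH (fun j => a (lift i0 j)) (fun j => b (lift i0 j) + t (c j) * b i0).
exists m, a', b', phi; split=> // V beta bal; rewrite -h3 //.
case: (bal) => bD1 bD2 bZ.
have b0 x : beta 0 x = 0 by apply: (addrI (beta 0 x)); rewrite -bD1 !addr0.
rewrite (bigD1_ord i0) //= ac.
have -> : forall x, beta (\sum_j s (c j) * a (lift i0 j)) x =
   \sum_j beta (a (lift i0 j)) (t (c j) * x).
  move=> x; rewrite (big_morph (fun z => beta z x) (fun u v => bD1 u v x) (b0 x)).
  by apply: eq_bigr => j _; rewrite bZ.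
by rewrite addrC -big_split; apply: eq_bigr => j _; rewrite bD2.
Qed.

(** The tensor product over the field K is realized inside the functions from the dual of A to B: a
    list of pairs (a, b) acts by sending phi to the sum of the t (phi a) b. Functionals separate the
    vectors of A, so two lists give the same function exactly when they represent the same
    tensor. *)
Definition dual_type := {phi : A -> K | functional s phi}.
Let ev (l : seq (A * B)) (phi : dual_type) : B := \sum_(x <- l) t (sval phi x.1) * x.2.
Definition tensor_type : Type := {T : dual_type -> B | exists l, T = ev l}.
Local Notation D := tensor_type.
HB.instance Definition _ := gen_eqMixin D.
HB.instance Definition _ := gen_choiceMixin D.
Let pr l : D := exist _ (ev l) (ex_intro _ l erefl).
Let prP l m : pr l = pr m <-> ev l =1 ev m.
Proof.
split=> [|e]; first by case=> e phi; rewrite e.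
by apply/eq_exist/funext.
Qed.
Let rep (x : D) := sval (cid (svalP x)).
Let repK x : pr (rep x) = x.
Proof. by rewrite /rep; case: cid => l; case: x => T h /= e; apply/eq_exist. Qed.
Let elim (P : D -> Prop) : (forall l, P (pr l)) -> forall x, P x.
Proof. by move=> h x; rewrite -[x]repK. Qed.
Let evr l : ev (rep (pr l)) =1 ev l.
Proof. by apply/prP; rewrite repK. Qed.

Let lopp (l : seq (A * B)) := [seq (- x.1, x.2) | x <- l].
Let lmul (l m : seq (A * B)) := [seq (x.1 * y.1, x.2 * y.2) | x <- l, y <- m].
Let evD l m phi : ev (l ++ m) phi = ev l phi + ev m phi.
Proof. exact: big_cat. Qed.
Let evN l phi : ev (lopp l) phi = - ev l phi.
Proof.
rewrite /ev big_map -sumrN; apply: eq_bigr => x _ /=.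
by rewrite (functionalN _ (svalP phi)) rmorphN mulNr.
Qed.
Let evM l m phi : ev (lmul l m) phi =
  \sum_(x <- l) \sum_(y <- m) t (sval phi (x.1 * y.1)) * (x.2 * y.2).
Proof. by rewrite /ev /lmul big_allpairs_dep. Qed.
Let shift (phi : dual_type) (a : A) : dual_type :=
  exist _ _ (functionalM a (svalP phi)).
Let evMr l m phi : ev (lmul l m) phi = \sum_(x <- l) x.2 * ev m (shift phi x.1).
Proof.
rewrite evM; apply: eq_bigr => x _; rewrite mulr_sumr; apply: eq_bigr => y _ /=.
by rewrite mulrCA.
Qed.
Let evMC l m : ev (lmul l m) =1 ev (lmul m l).
Proof.
move=> phi; rewrite !evM exchange_big /=; apply: eq_bigr => x _; apply: eq_bigr => y _.
by rewrite mulrC [y.2 * _]mulrC [y.1 * _]mulrC mulrC.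
Qed.
(** With the left list fixed, a product depends on the right list only through its values on shifted
    functionals; commutativity handles the other side. *)
Let lmul_congr l l' m m' : ev l =1 ev l' -> ev m =1 ev m' -> ev (lmul l m) =1 ev (lmul l' m').
Proof.
move=> e e' phi.
have -> : ev (lmul l m) phi = ev (lmul l m') phi.
  by rewrite !evMr; apply: eq_bigr => x _; rewrite e'.
rewrite evMC [RHS]evMC !evMr.
by apply: eq_bigr => x _; rewrite e.
Qed.

Let add (x y : D) := pr (rep x ++ rep y).
Let opp (x : D) := pr (lopp (rep x)).
Let mul (x y : D) := pr (lmul (rep x) (rep y)).
Let addE l m : add (pr l) (pr m) = pr (l ++ m).
Proof. by apply/prP => phi; rewrite !evD !evr. Qed.
Let oppE l : opp (pr l) = pr (lopp l).
Proof. by apply/prP => phi; rewrite !evN evr. Qed.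
Let mulE l m : mul (pr l) (pr m) = pr (lmul l m).
Proof. by apply/prP; apply: lmul_congr => phi; rewrite evr. Qed.
Let addA : associative add.
Proof. by do 3!elim/elim=> ?; rewrite !addE catA. Qed.
Let addC : commutative add.
Proof. by do 2!elim/elim=> ?; rewrite !addE; apply/prP => phi; rewrite !evD addrC. Qed.
Let add0 : left_id (pr [::]) add.
Proof. by elim/elim=> ?; rewrite addE. Qed.
Let addN : left_inverse (pr [::]) opp add.
Proof.
elim/elim=> l; rewrite oppE addE; apply/prP => phi; rewrite evD evN addNr.
by rewrite /ev big_nil.
Qed.
HB.instance Definition _ := GRing.isZmodule.Build D addA addC add0 addN.
Let mulA : associative mul.
Proof.
elim/elim=> l; elim/elim=> m; elim/elim=> n; rewrite !mulE; apply/prP => phi.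
rewrite evMr !evM big_allpairs_dep; apply: eq_bigr => x _.
rewrite evM mulr_sumr; apply: eq_bigr => y _; rewrite mulr_sumr; apply: eq_bigr => z _ /=.
by rewrite mulrCA !mulrA.
Qed.
Let mulC : commutative mul.
Proof. by elim/elim=> l; elim/elim=> m; rewrite !mulE; apply/prP/evMC. Qed.
Let one := pr [:: (1, 1)].
Let mul1 : left_id one mul.
Proof.
elim/elim=> l; rewrite !mulE; apply/prP => phi; rewrite evMr big_seq1 mul1r /=.
by apply: eq_bigr => x _ /=; rewrite mul1r.
Qed.
Let mulD : left_distributive mul +%R.
Proof.
have D1 u v : pr u + pr v = pr (u ++ v) := addE u v.
move=> a b c; rewrite -[a]repK -[b]repK -[c]repK !(mulE, D1); apply/prP => phi.
by rewrite evD !evMr big_cat.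
Qed.
Let oneN0 : one != 0.
Proof.
apply/eqP => /prP h.
have [phi hphi phi1] := @functional_neq0 F K A s 1 (oner_neq0 _).
have := h (exist _ phi hphi); rewrite /ev big_nil big_seq1 /= phi1 rmorph1 mul1r.
by move/eqP; rewrite oner_eq0.
Qed.
HB.instance Definition _ := GRing.Zmodule_isComNzRing.Build D mulA mulC mul1 mulD oneN0.

Let prD u v : pr u + pr v = pr (u ++ v). Proof. exact: addE. Qed.
Let prM u v : pr u * pr v = pr (lmul u v). Proof. exact: mulE. Qed.
Let pr0 : pr [::] = 0. Proof. by []. Qed.

Let ev1 a b phi : ev [:: (a, b)] phi = t (sval phi a) * b.
Proof. by rewrite /ev big_seq1. Qed.

Lemma tensor_ring : exists (D : comNzRingType) (i : {rmorphism A -> D}) (j : {rmorphism B -> D})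
  (sl : (A -> K) -> D -> B),
  [/\ i \o s =1 j \o t,
      forall x, exists n (a : 'I_n -> A) (b : 'I_n -> B), x = \sum_k i (a k) * j (b k) &
      forall phi, functional s phi ->
        (forall x y, sl phi (x + y) = sl phi x + sl phi y) /\
        (forall a b, sl phi (i a * j b) = t (phi a) * b)].
Proof.
have i1 : pr [:: (1, 1)] = 1 by [].
have iD : {morph (fun a => pr [:: (a, 1)]) : x y / x + y}.
  move=> x y; rewrite prD; apply/prP => phi; rewrite -cat1s evD !ev1 /= .
  by rewrite (svalP phi).1 rmorphD mulrDl.
have iM : {morph (fun a => pr [:: (a, 1)]) : x y / x * y}.
  by move=> x y; rewrite prM; apply/prP => phi; rewrite /lmul /= mulr1.
have jD : {morph (fun b => pr [:: (1, b)]) : x y / x + y}.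
  by move=> x y; rewrite prD; apply/prP => phi; rewrite -cat1s evD !ev1 /= mulrDr.
have jM : {morph (fun b => pr [:: (1, b)]) : x y / x * y}.
  by move=> x y; rewrite prM; apply/prP => phi; rewrite /lmul /= mulr1.
have [i iE] := build_rmorph i1 iD iM.
have [j jE] := build_rmorph i1 jD jM.
have ijE a b : i a * j b = pr [:: (a, b)].
  by rewrite iE jE prM; apply/prP => phi; rewrite /lmul /= mulr1 mul1r.
exists D, i, j, (fun phi x => if pselect (functional s phi) is left h then sval x (exist _ phi h) else 0).
split.
- move=> c; rewrite /= iE jE; apply/prP => phi; rewrite !ev1.
  by rewrite -[s c]mulr1 (svalP phi).2 rmorphM mulr1 mulrC.
- elim/elim=> l; exists (size l), (fun k => (tnth (in_tuple l) k).1), (fun k => (tnth (in_tuple l) k).2).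
  rewrite -(big_tnth _ _ _ xpredT (fun x => i x.1 * j x.2)) /=.
  elim: l => [|x l IH]; first by rewrite big_nil pr0.
  by rewrite big_cons -IH ijE prD; congr pr; case: x.
- move=> phi h; split=> [x y|a b]; case: pselect => // h'; last by rewrite ijE /= ev1.
  by rewrite -[x]repK -[y]repK prD /= evD.
Qed.

End Tensor.

(** Slices stand in place of the universal property: every functional of A extends to an additive
    map from D to B. They are what the computations use, and [tensor_univ] recovers the universal
    property from them. *)
Definition is_tensor (F : fieldType) (K : fieldAlgType F) (A B D : comAlgType F)
    (s : {lrmorphism K -> A}) (t : {lrmorphism K -> B})
    (i : {lrmorphism A -> D}) (j : {lrmorphism B -> D}) :=
  [/\ i \o s =1 j \o t,
      forall x, exists n (a : 'I_n -> A) (b : 'I_n -> B), x = \sum_k i (a k) * j (b k) &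
      forall phi, functional s phi -> exists sl : D -> B,
        (forall x y, sl (x + y) = sl x + sl y) /\
        (forall a b, sl (i a * j b) = t (phi a) * b)].

Lemma tensor_exists (F : fieldType) (K : fieldAlgType F) (A B : comAlgType F)
    (s : {lrmorphism K -> A}) (t : {lrmorphism K -> B}) :
  exists (D : comAlgType F) (i : {lrmorphism A -> D}) (j : {lrmorphism B -> D}),
    is_tensor s t i j.
Proof.
have [D0 [i0 [j0 [sl [ij gen slP]]]]] := tensor_ring s t.
have [D [f [g [fg gf fE]]]] := ring_algebra (i0 \o in_alg A : {rmorphism F -> D0}).
have [i iE] := @rmorph_lr F A D (f \o i0 : {rmorphism A -> D}) fE.
have [|j jE] := @rmorph_lr F B D (f \o j0 : {rmorphism B -> D}).
  move=> c; rewrite -fE /=; congr (f _).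
  by have := ij c%:A; rewrite /= !lrmorph_cA => ->.
exists D, i, j; split=> [c|x|phi h].
- by have := ij c; rewrite /= iE jE /= => ->.
- have [n [a [b e]]] := gen (g x); exists n, a, b.
  rewrite -[x]gf e rmorph_sum; apply: eq_bigr => k _.
  by rewrite iE jE rmorphM.
- exists (sl phi \o g); have [slD slE] := slP phi h; split=> [x y|a b] /=.
    by rewrite rmorphD slD.
  by rewrite iE jE /= -rmorphM fg slE.
Qed.

Lemma additive_sum (U V : zmodType) (f : U -> V) (I : Type) (r : seq I) (g : I -> U) :
  (forall x y, f (x + y) = f x + f y) -> f (\sum_(k <- r) g k) = \sum_(k <- r) f (g k).
Proof.
move=> D; apply: (big_morph f D); apply: (addrI (f 0)).
by rewrite -D !addr0.
Qed.

Section TensorTheory.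
Variables (F : fieldType) (K : fieldAlgType F) (A B D : comAlgType F).
Variables (s : {lrmorphism K -> A}) (t : {lrmorphism K -> B}).
Variables (i : {lrmorphism A -> D}) (j : {lrmorphism B -> D}).
Hypothesis tD : is_tensor s t i j.

Lemma tensor_slice phi : functional s phi -> exists sl : D -> B,
  [/\ forall x y, sl (x + y) = sl x + sl y,
      forall a b, sl (i a * j b) = t (phi a) * b &
      forall x b, sl (x * j b) = sl x * b].
Proof.
move=> h; have [ij gen slP] := tD; have [sl [slD slE]] := slP phi h.
exists sl; split=> // x b; have [n [a [c ->]]] := gen x.
rewrite mulr_suml !(additive_sum _ _ slD) mulr_suml; apply: eq_bigr => k _.
by rewrite -mulrA -rmorphM !slE mulrA.
Qed.

Lemma tensor_indep x : exists n (a : 'I_n -> A) (b : 'I_n -> B) (phi : 'I_n -> A -> K),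
  [/\ x = \sum_k i (a k) * j (b k), forall k, functional s (phi k) &
      forall k m, phi k (a m) = (k == m)%:R].
Proof.
have [ij gen _] := tD; have [n [a [b ->]]] := gen x.
have [m [a' [b' [phi [h1 h2 h3]]]]] := indep_rep s t a b.
exists m, a', b', phi; split=> //; apply: (h3 D (fun a b => i a * j b)).
split=> [u v w|u v w|c u v]; rewrite ?rmorphD ?mulrDl ?mulrDr //.
by rewrite !rmorphM; have /= -> := ij c; rewrite -mulrA mulrCA.
Qed.

Lemma tensor_injr : injective j.
Proof.
have [phi h e] := functional_neq0 s (oner_neq0 A).
have [sl [_ slE _]] := tensor_slice h.
move=> x y jxy; have E b : sl (j b) = b.
  by rewrite -[j b]mul1r -(rmorph1 i) slE e rmorph1 mul1r.
by rewrite -[x]E jxy E.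
Qed.

Lemma tensor_injl : injective i.
Proof.
apply: raddf_inj => a ia0; apply: contrapT => /eqP nz.
have [phi h e] := functional_neq0 s nz.
have [sl [slD slE slM]] := tensor_slice h.
have := slE a 1; rewrite ia0 mul0r e rmorph1 mulr1 => sl0.
have : sl 0 = 0 by apply: (addrI (sl 0)); rewrite -slD !addr0.
by rewrite sl0 => /eqP; rewrite oner_eq0.
Qed.

(** The issue is well-definedness: a vanishing sum is rewritten with independent left entries, and
    the dual slices then kill each right entry. *)
Lemma tensor_univ (R : comAlgType F) (f : {lrmorphism A -> R}) (g : {lrmorphism B -> R}) :
  f \o s =1 g \o t -> exists h : {lrmorphism D -> R}, h \o i =1 f /\ h \o j =1 g.
Proof.
move=> fg; have [ij gen _] := tD.
have key n (a : 'I_n -> A) (b : 'I_n -> B) :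
    \sum_k i (a k) * j (b k) = 0 -> \sum_k f (a k) * g (b k) = 0.
  have [m [a' [b' [phi [h1 h2 h3]]]]] := indep_rep s t a b.
  rewrite (h3 D (fun a b => i a * j b)); last first.
    split=> [u v w|u v w|c u v]; rewrite ?rmorphD ?mulrDl ?mulrDr //.
    by rewrite !rmorphM; have /= -> := ij c; rewrite -mulrA mulrCA.
  move=> e; rewrite (h3 R (fun a b => f a * g b)); last first.
    split=> [u v w|u v w|c u v]; rewrite ?rmorphD ?mulrDl ?mulrDr //.
    by rewrite !rmorphM; have /= -> := fg c; rewrite -mulrA mulrCA.
  apply: big1 => k _; suff -> : b' k = 0 by rewrite rmorph0 mulr0.
  have [sl [slD slE slM]] := tensor_slice (h1 k).
  have sl0 : sl 0 = 0 by apply: (addrI (sl 0)); rewrite -slD !addr0.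
  move: sl0; rewrite -e (additive_sum _ _ slD) (bigD1 k) //= slE h2 eqxx rmorph1 mul1r.
  rewrite big1 ?addr0 // => m' ne; rewrite slE h2 eq_sym (negPf ne) rmorph0 mul0r //.
have /choice[h hP] : forall x, exists y, forall n (a : 'I_n -> A) (b : 'I_n -> B),
    x = \sum_k i (a k) * j (b k) -> y = \sum_k f (a k) * g (b k).
  move=> x; have [n [a [b xE]]] := gen x.
  exists (\sum_k f (a k) * g (b k)) => m a' b' xE'.
  apply/eqP; rewrite -subr_eq0 -sumrN; apply/eqP.
  (* The difference of two expressions of x, as a single expression of 0, the sign being carried by
     the left entries. *)
  pose a2 (k : 'I_(n + m)) := match fintype.split k with inl k => a k | inr k => - a' k end.
  pose b2 (k : 'I_(n + m)) := match fintype.split k with inl k => b k | inr k => b' k end.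
  have S (V : zmodType) (beta : A -> B -> V) : (forall a b, beta (- a) b = - beta a b) ->
    \sum_k beta (a2 k) (b2 k) = (\sum_k beta (a k) (b k) - \sum_k beta (a' k) (b' k)).
    move=> bN; rewrite big_split_ord -sumrN /=; congr (_ + _); apply: eq_bigr => k _; rewrite /a2 /b2.
      by rewrite (unsplitK (inl k)).
    by rewrite (unsplitK (inr k)) bN.
  rewrite sumrN -(S R (fun a b => f a * g b)) => [|u v]; last by rewrite rmorphN mulNr.
  apply: key; rewrite (S D (fun a b => i a * j b)) => [|u v]; last by rewrite rmorphN mulNr.
  by rewrite -xE -xE' subrr.
have hE a b : h (i a * j b) = f a * g b.
  by rewrite (hP _ 1%N (fun=> a) (fun=> b)) ?big_ord1.
have hD : {morph h : x y / x + y}.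
  move=> x y; have [n [a [b xE]]] := gen x; have [m [a' [b' yE]]] := gen y.
  rewrite (hP (x + y) (n + m)%N
    (fun k => match fintype.split k with inl k => a k | inr k => a' k end)
    (fun k => match fintype.split k with inl k => b k | inr k => b' k end)).
    rewrite (hP _ _ _ _ xE) (hP _ _ _ _ yE) big_split_ord; congr (_ + _);
    apply: eq_bigr => k _; [by rewrite (unsplitK (inl k))|by rewrite (unsplitK (inr k))].
  rewrite {1}xE {1}yE big_split_ord; congr (_ + _);
  apply: eq_bigr => k _; [by rewrite (unsplitK (inl k))|by rewrite (unsplitK (inr k))].
have hM : {morph h : x y / x * y}.
  move=> x y; have [n [a [b ->]]] := gen x; have [m [a' [b' ->]]] := gen y.
  rewrite mulr_suml !(additive_sum _ _ hD) mulr_suml; apply: eq_bigr => k _.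
  rewrite mulr_sumr (additive_sum _ _ hD) mulr_sumr; apply: eq_bigr => k' _.
  by rewrite mulrACA -!rmorphM !hE !rmorphM mulrACA.
have hA (c : F) : h c%:A = c%:A.
  by rewrite -(lrmorph_cA i) -[i _]mulr1 -(rmorph1 j) hE rmorph1 mulr1 lrmorph_cA.
have [k kE] := build_lrmorph hA hD hM.
exists k; split=> [a|b] /=; rewrite kE.
  by rewrite -[i a]mulr1 -(rmorph1 j) hE rmorph1 mulr1.
by rewrite -[j b]mul1r -(rmorph1 i) hE rmorph1 mul1r.
Qed.

Lemma tensor_uniq (R : comAlgType F) (h h' : {lrmorphism D -> R}) :
  h \o i =1 h' \o i -> h \o j =1 h' \o j -> h =1 h'.
Proof.
move=> hi hj x; have [_ gen _] := tD; have [n [a [b ->]]] := gen x.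
rewrite !rmorph_sum; apply: eq_bigr => k _; rewrite !rmorphM.
by have /= -> := hi (a k); have /= -> := hj (b k).
Qed.

Lemma tensor_gen (P : {pred D}) : subring_closed P ->
  (forall a, i a \in P) -> (forall b, j b \in P) -> forall x, x \in P.
Proof.
move=> cP hi hj x; have [_ gen _] := tD; have [n [a [b ->]]] := gen x.
have [P1 PB PM] := cP.
have P0 : 0 \in P by rewrite -(subrr (1 : D)) PB.
have PD u v : u \in P -> v \in P -> u + v \in P.
  by move=> hx' hy'; rewrite -[v]opprK -[- v]sub0r PB // PB.
by apply: (big_ind (fun z => z \in P)) => // k _; apply: PM.
Qed.

End TensorTheory.

(** Flatness over a field: with independent left entries a tensor vanishes only if all its right
    entries do, and u detects this. *)
Lemma tensor_map_inj (F : fieldType) (K : fieldAlgType F) (A B D B' D' : comAlgType F)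
    (s : {lrmorphism K -> A}) (t : {lrmorphism K -> B}) (t' : {lrmorphism K -> B'})
    (i : {lrmorphism A -> D}) (j : {lrmorphism B -> D})
    (i' : {lrmorphism A -> D'}) (j' : {lrmorphism B' -> D'})
    (u : {lrmorphism B -> B'}) (h : {lrmorphism D -> D'}) :
  is_tensor s t i j -> is_tensor s t' i' j' -> injective u ->
  h \o i =1 i' -> h \o j =1 j' \o u -> injective h.
Proof.
move=> tD tD' inju hi hj.
suff inj0 x : h x = 0 -> x = 0.
  by move=> x y e; apply/eqP; rewrite -subr_eq0; apply/eqP/inj0/eqP; rewrite rmorphB subr_eq0; apply/eqP.
have [n [a [b [phi [-> h1 h2]]]]] := tensor_indep tD x.
rewrite rmorph_sum => e; apply: big1 => k _.
have [sl [slD slE slM]] := tensor_slice tD' (h1 k).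
have sl0 : sl 0 = 0 by apply: (addrI (sl 0)); rewrite -slD !addr0.
have E m : h (i (a m) * j (b m)) = i' (a m) * j' (u (b m)).
  by rewrite rmorphM; have /= -> := hi (a m); have /= -> := hj (b m).
move: sl0; rewrite -e (additive_sum _ _ slD) (bigD1 k) //= E slE h2 eqxx rmorph1 mul1r.
rewrite big1 ?addr0 => [ub|m ne]; last by rewrite E slE h2 eq_sym (negPf ne) rmorph0 mul0r.
have -> : b k = 0 by apply: inju; rewrite ub rmorph0.
by rewrite rmorph0 mulr0.
Qed.

(** * Descent of points *)

Section Descent.
Variables (F : fieldType) (E : ellipticCurve F).

(** The hypothesis is applied to the ideal generated by the coordinates; it spares the caller an
    explicit partition of unity. *)
Lemma ecpoint_descent_ideal (R S : comAlgType F) (f : {lrmorphism R -> S}) (P : ecpoint E S) :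
  injective f ->
  (forall J : R -> Prop, J 0 -> (forall x y, J x -> J y -> J (x + y)) ->
     (forall r u i, wline P (map_mx f u) -> J (r * u ord0 i)) -> J 1) ->
  exists P0, ecmap f P0 = P.
Proof.
move=> inj h.
pose J x := exists n (u r : 'I_n -> 'rV[R]_3), (forall k, wline P (map_mx f (u k))) /\
         \sum_k \sum_i r k ord0 i * u k ord0 i = x.
have [||r u i Pu|n [u [r [Pu sum1]]]] := h J.
- by exists 0%N, (fun=> 0), (fun=> 0); split=> [[]|] //; rewrite big_ord0.
- move=> x y [n [u [r [Pu <-]]]] [m [v [q [Pv <-]]]].
  exists (n + m)%N.
  exists (fun k : 'I_(n + m) => match fintype.split k with inl i => u i | inr j => v j end).
  exists (fun k : 'I_(n + m) => match fintype.split k with inl i => r i | inr j => q j end).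
  split; first by move=> k; case: (fintype.split k).
  rewrite big_split_ord; congr (_ + _); apply: eq_bigr => k _; apply: eq_bigr => i _.
    by rewrite (unsplitK (inl k)).
  by rewrite (unsplitK (inr k)).
- exists 1%N, (fun=> u), (fun=> r *: delta_mx ord0 i); split=> [_|] //.
  rewrite big_ord1 (bigD1 i) //= big1 ?addr0 => [|j /negPf ne].
    by rewrite !mxE !eqxx mulr1.
  by rewrite !mxE ne andbF mulr0 mul0r.
- exact: (@ecpoint_descent _ _ _ _ f P n u r).
Qed.

(** Faithfully flat descent of a line. The two pull-backs of P to W, the tensor product of C and V,
    agree; slicing this equality shows that the slices of vectors of P, which have coordinates in U,
    lie again in the line of P. They generate the unit ideal because a tensor is recovered from its
    slices. *)
Lemma tensor_descent (K : fieldAlgType F) (C U V : comAlgType F)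
    (s : {lrmorphism K -> C}) (t : {lrmorphism K -> U})
    (i : {lrmorphism C -> V}) (j : {lrmorphism U -> V}) (P : ecpoint E V) :
  is_tensor s t i j ->
  (forall (R : comAlgType F) (f g : {lrmorphism V -> R}),
     f \o j =1 g \o j -> ecmap f P = ecmap g P) ->
  exists Q, ecmap j Q = P.
Proof.
move=> tV inv.
have [W [i1 [j1 tW]]] := tensor_exists s (j \o t : {lrmorphism K -> V}).
have [ij1 _ _] := tW.
have [d1 [d1i d1j]] := @tensor_univ _ _ _ _ _ _ _ _ _ tV W i1 (j1 \o j : {lrmorphism U -> W}) ij1.
have eP : ecmap d1 P = ecmap j1 P by apply: inv => x; have /= -> := d1j x.
have slice phi : functional s phi -> exists sl : V -> U,
   [/\ forall x y, sl (x + y) = sl x + sl y, forall x b, sl (x * j b) = sl x * b,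
       forall a b, sl (i a * j b) = t (phi a) * b &
       forall u, wline P u -> wline P (map_mx j (map_mx sl u))].
  move=> h; have [sl [slD slE slM]] := tensor_slice tV h.
  have [sl1 [sl1D sl1E sl1M]] := tensor_slice tW h.
  exists sl; split=> // u Pu.
  have slE1 x : sl1 (d1 x) = j (sl x).
    have [_ gen _] := tV; have [n [a [b ->]]] := gen x.
    rewrite rmorph_sum !(additive_sum _ _ slD) !(additive_sum _ _ sl1D) rmorph_sum.
    apply: eq_bigr => k _; rewrite rmorphM slE rmorphM.
    have /= -> := d1i (a k); have /= -> := d1j (b k).
    by rewrite sl1E.
  have := ecmap_in d1 Pu; rewrite eP => -[n [a [v [Pv uE]]]].
  have /choice[w wP] : forall k, exists w, wline P w /\ map_mx j1 w = v k.
    by move=> k; have [w Pw <-] := Pv k; exists w.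
  have -> : map_mx j (map_mx sl u) = \sum_k sl1 (a k) *: w k.
    apply/rowP => m; rewrite !mxE -slE1.
    have /(congr1 (fun z : 'rV[W]_3 => sl1 (z ord0 m))) := uE; rewrite !mxE => ->.
    rewrite !summxE (additive_sum _ _ sl1D); apply: eq_bigr => k _.
    by have [_ <-] := wP k; rewrite !mxE sl1M.
  apply: line_sum => [|k]; first exact: wlineP.
  by apply: lineZ; [exact: wlineP | case: (wP k)].
apply: ecpoint_descent_ideal; first exact: (tensor_injr tV).
move=> J J0 JD JM.
have [_ _ [n [u [r [Pu sum1]]]]] := wlineP P.
have [phi0 h0 e0] := functional_neq0 s (oner_neq0 C).
have [sl0 [sl0D sl0M sl0E _]] := slice _ h0.
(* This slice fixes 1. Applied to the partition of unity of P it leaves a combination of right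
   entries [b q], each of which is a coordinate of a slice of a vector of P. *)
have -> : 1 = sl0 1 by rewrite -[X in sl0 X]mulr1 -{1}(rmorph1 i) -(rmorph1 j) sl0E e0 rmorph1 mulr1.
rewrite -sum1 (additive_sum _ _ sl0D); apply: big_ind => // k _.
rewrite (additive_sum _ _ sl0D); apply: big_ind => // m _.
have [N [a [b [phi [uE hphi phiE]]]]] := tensor_indep tV (u k ord0 m).
rewrite uE mulr_sumr (additive_sum _ _ sl0D); apply: big_ind => // q _.
rewrite mulrA sl0M.
have [sl [slD slM slE Psl]] := slice _ (hphi q).
suff -> : b q = map_mx sl (u k) ord0 m by apply: JM; apply: Psl.
rewrite mxE uE (additive_sum _ _ slD) (bigD1 q) //= slE phiE eqxx rmorph1 mul1r.
by rewrite big1 ?addr0 // => q' ne; rewrite slE phiE eq_sym (negPf ne) rmorph0 mul0r.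
Qed.

(** The previous descent with U = K, since C is its own tensor product with K. *)
Lemma point_descent (K : fieldAlgType F) (C : comAlgType F)
    (s : {lrmorphism K -> C}) (P : ecpoint E C) :
  (forall (R : comAlgType F) (f g : {lrmorphism C -> R}),
     f \o s =1 g \o s -> ecmap f P = ecmap g P) ->
  exists Q, ecmap s Q = P.
Proof.
move=> inv; pose id1 : {lrmorphism K -> K} := idfun; pose id2 : {lrmorphism C -> C} := idfun.
apply: (@tensor_descent K C K C s id1 id2 s) => //.
split=> // [x|phi h].
  by exists 1%N, (fun=> x), (fun=> 1); rewrite big_ord1 rmorph1 mulr1.
exists phi; split=> [x y|a b]; first by rewrite h.1.
by rewrite mulrC h.2 mulrC.
Qed.

End Descent.

(** * Cech cocycles *)

Lemma subring_closedD (R : pzRingType) (P : {pred R}) : subring_closed P ->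
  [/\ 0 \in P, 1 \in P & forall x, x \in P -> - x \in P] /\
  (forall x y, x \in P -> y \in P -> x + y \in P) /\
  (forall x y, x \in P -> y \in P -> x * y \in P).
Proof.
move=> [P1 PB PM].
have P0 : 0 \in P by rewrite -(subrr (1 : R)) PB.
have PN x : x \in P -> - x \in P by move=> h; rewrite -sub0r PB.
by split=> //; split=> // x y hx hy; rewrite -[y]opprK PB // PN.
Qed.

Section Covers.
Variable F : fieldType.
Implicit Types K L : fieldAlgType F.

Definition finite_type (R A : comAlgType F) (s : {lrmorphism R -> A}) :=
  exists l : seq A, forall B : {pred A},
    subring_closed B -> (forall x, s x \in B) -> {subset l <= B} -> forall x, x \in B.

Lemma finite_type_comp (R A B : comAlgType F) (s : {lrmorphism R -> A})
    (t : {lrmorphism A -> B}) (u : {lrmorphism R -> B}) :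
  finite_type s -> finite_type t -> u =1 t \o s -> finite_type u.
Proof.
move=> [l hl] [m hm] e; exists ([seq t x | x <- l] ++ m) => P cP sP lP.
apply: hm => // [x|x mx]; last by apply: lP; rewrite mem_cat mx orbT.
apply: (hl [pred x | t x \in P]) => [|y|y ly]; rewrite ?inE.
- by case: cP => P1 PB PM; split=> [|a b|a b]; rewrite ?inE ?rmorph1 ?rmorphB ?rmorphM //; [apply: PB|apply: PM].
- by have /= <- := e y.
- by apply: lP; rewrite mem_cat map_f.
Qed.

Lemma finite_type_tensor K (A B D : comAlgType F)
    (s : {lrmorphism K -> A}) (t : {lrmorphism K -> B})
    (i : {lrmorphism A -> D}) (j : {lrmorphism B -> D}) :
  is_tensor s t i j -> finite_type s -> finite_type j.
Proof.
move=> tD [l hl]; exists [seq i x | x <- l] => P cP jP lP.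
apply: (tensor_gen tD) => // a.
apply: (hl [pred x | i x \in P]) => [|y|y ly]; rewrite ?inE.
- by case: cP => P1 PB PM; split=> [|x b|x b]; rewrite ?inE ?rmorph1 ?rmorphB ?rmorphM //; [apply: PB|apply: PM].
- by have [ij _ _] := tD; have /= -> := ij y.
- by apply: lP; rewrite map_f.
Qed.

Lemma cover_push L (C C' : cover L) : exists (D : cover L)
  (v : {lrmorphism C -> D}) (v' : {lrmorphism C' -> D}),
  v \o cov_str C =1 cov_str D /\ v' \o cov_str C' =1 cov_str D.
Proof.
have [D [i [j tD]]] := tensor_exists (cov_str C) (cov_str C').
have ft : finite_type (j \o cov_str C' : {lrmorphism L -> D}).
  exact: finite_type_comp (cov_ft C') (finite_type_tensor tD (cov_ft C)) _.
by exists (Cover ft), i, j; split=> // x; have [ij _ _] := tD; exact: ij.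
Qed.

Lemma cover_base K L (e : {lrmorphism K -> L}) (C : cover K) : exists (D : cover L)
  (v : {lrmorphism C -> D}), v \o cov_str C =1 cov_str D \o e.
Proof.
have [D [i [j tD]]] := tensor_exists (cov_str C) e.
have ft : finite_type j by apply: finite_type_tensor tD (cov_ft C).
by exists (Cover ft), i; case: tD.
Qed.

End Covers.

Lemma compat_comp (A0 A B C D : Type) (s : A0 -> A) (h : A -> B) (e : A0 -> D)
    (t : D -> B) (v : B -> C) (t' : D -> C) :
  h \o s =1 t \o e -> v \o t =1 t' -> (v \o h) \o s =1 t' \o e.
Proof. by move=> hs vt z; rewrite /= -[h _]/((h \o s) z) hs /= -vt. Qed.

Section Cech.
Variables (F : fieldType) (E : ellipticCurve F) (p : nat).
Implicit Types K L : fieldAlgType F.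

Definition agree L (A R : comAlgType F) (s : {lrmorphism L -> A}) (f g : {lrmorphism A -> R}) :=
  f \o s =1 g \o s.

(** Unlike [coc_fun], no proof of agreement is taken as an argument, so that pull-backs and sums
    compose freely; values at pairs that do not agree on the base carry no meaning. *)
Definition family (A : comAlgType F) :=
  forall R : comAlgType F, {lrmorphism A -> R} -> {lrmorphism A -> R} -> ecpoint E R.

Definition is_cocycle L (A : comAlgType F) (s : {lrmorphism L -> A}) (w : family A) :=
  (forall (R S : comAlgType F) (phi : {lrmorphism R -> S}) (f g : {lrmorphism A -> R})
     (f' g' : {lrmorphism A -> S}), agree s f g -> f' =1 phi \o f -> g' =1 phi \o g ->
     w S f' g' = ecmap phi (w R f g)) /\
  (forall (R : comAlgType F) (f g k : {lrmorphism A -> R}),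
     agree s f g -> agree s g k -> w R f g + w R g k = w R f k).

Definition torsion_family L (A : comAlgType F) (s : {lrmorphism L -> A}) (w : family A) :=
  exists n, forall (R : comAlgType F) (f g : {lrmorphism A -> R}),
    agree s f g -> w R f g *+ p ^ n = 0.

Definition pull (A B : comAlgType F) (h : {lrmorphism A -> B}) (w : family A) : family B :=
  fun R f g => w R (f \o h : {lrmorphism A -> R}) (g \o h : {lrmorphism A -> R}).

Definition coboundary (A : comAlgType F) (b : ecpoint E A) : family A :=
  fun R f g => ecmap g b - ecmap f b.

Section Families.
Variables (L : fieldAlgType F) (A : comAlgType F) (s : {lrmorphism L -> A}) (w : family A).
Hypothesis cw : is_cocycle s w.

Lemma fam_ext (R : comAlgType F) (f g f' g' : {lrmorphism A -> R}) :
  agree s f g -> f =1 f' -> g =1 g' -> w f g = w f' g'.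
Proof.
move=> fg e e'; rewrite -[LHS](@ecmap_id _ _ _ (idfun : {lrmorphism R -> R})) //.
by symmetry; apply: cw.1 => // x; rewrite ?e ?e'.
Qed.

Lemma pull_cocycle (L' : fieldAlgType F) (e : {lrmorphism L -> L'}) (B : comAlgType F)
    (h : {lrmorphism A -> B}) (t : {lrmorphism L' -> B}) :
  h \o s =1 t \o e -> is_cocycle t (pull h w).
Proof.
move=> hs.
have ag (R : comAlgType F) (f g : {lrmorphism B -> R}) : agree t f g ->
    agree s (f \o h : {lrmorphism A -> R}) (g \o h : {lrmorphism A -> R}).
  by move=> fg x; have /= -> := hs x; exact: fg.
split=> [R S phi f g f' g' fg ff' gg'|R f g k fg gk]; last by apply: cw.2; apply: ag.
by apply: cw.1; [apply: ag|move=> x; exact: ff'|move=> x; exact: gg'].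
Qed.

(* Two choices of the map h only change the pulled back family by a coboundary. *)
Lemma pull_indep (L' : fieldAlgType F) (e : {lrmorphism L -> L'}) (B : comAlgType F)
    (h h' : {lrmorphism A -> B}) (t : {lrmorphism L' -> B}) :
  h \o s =1 t \o e -> h' \o s =1 t \o e ->
  forall (R : comAlgType F) (f g : {lrmorphism B -> R}), agree t f g ->
    pull h w f g = pull h' w f g + coboundary (w h' h) f g.
Proof.
move=> hs hs' R f g fg.
have ag : agree s h' h by move=> x; rewrite hs hs'.
rewrite /coboundary -(cw.1 _ _ g h' h (g \o h' : {lrmorphism A -> R}) (g \o h : {lrmorphism A -> R})) //.
rewrite -(cw.1 _ _ f h' h (f \o h' : {lrmorphism A -> R}) (f \o h : {lrmorphism A -> R})) //.
have a1 : agree s (f \o h' : {lrmorphism A -> R}) (f \o h : {lrmorphism A -> R}).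
  by move=> x; rewrite /= -[h' (s x)]/((h' \o s) x) -[h (s x)]/((h \o s) x) hs hs'.
have a2 : agree s (f \o h : {lrmorphism A -> R}) (g \o h : {lrmorphism A -> R}).
  by move=> x; rewrite /= -[h (s x)]/((h \o s) x) hs /=; exact: fg.
have a3 : agree s (f \o h' : {lrmorphism A -> R}) (g \o h' : {lrmorphism A -> R}).
  by move=> x; rewrite /= -[h' (s x)]/((h' \o s) x) hs' /=; exact: fg.
have a4 : agree s (g \o h' : {lrmorphism A -> R}) (g \o h : {lrmorphism A -> R}).
  by move=> x; rewrite /= -[h' (s x)]/((h' \o s) x) -[h (s x)]/((h \o s) x) hs hs'.
have E1 := cw.2 _ _ _ _ a1 a2; have E2 := cw.2 _ _ _ _ a3 a4.
rewrite -/(pull h w f g) -/(pull h' w f g) /pull in E1 E2 *.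
by rewrite addrA E2 -E1 addrAC subrr add0r.
Qed.

End Families.

(** Cohomology on one fixed algebra; comparisons between different covers are reduced to it by
    [pull]. *)
Definition coh L (A : comAlgType F) (s : {lrmorphism L -> A}) (w w' : family A) :=
  exists b : ecpoint E A, (exists n, b *+ p ^ n = 0) /\
    forall (R : comAlgType F) (f g : {lrmorphism A -> R}), agree s f g ->
      w R f g = w' R f g + coboundary b f g.

Lemma coboundary0 (A R : comAlgType F) (f g : {lrmorphism A -> R}) :
  coboundary (0 : ecpoint E A) f g = 0.
Proof. by rewrite /coboundary !raddf0 ?subrr ?addr0. Qed.
Lemma coboundaryN (A R : comAlgType F) (f g : {lrmorphism A -> R}) (b : ecpoint E A) :
  coboundary (- b) f g = - coboundary b f g.
Proof. by rewrite /coboundary !raddfN opprD. Qed.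
Lemma coboundaryD (A R : comAlgType F) (f g : {lrmorphism A -> R}) (b b' : ecpoint E A) :
  coboundary (b + b') f g = coboundary b f g + coboundary b' f g.
Proof. by rewrite /coboundary !raddfD ?opprD addrACA. Qed.
Lemma coboundaryMn (A R : comAlgType F) (f g : {lrmorphism A -> R}) (b : ecpoint E A) n :
  coboundary (b *+ n) f g = coboundary b f g *+ n.
Proof. by rewrite /coboundary !raddfMn -?mulrnDl. Qed.

Lemma ptorsion_max (V : zmodType) (x y : V) : (exists n, x *+ p ^ n = 0) ->
  (exists n, y *+ p ^ n = 0) -> exists n, x *+ p ^ n = 0 /\ y *+ p ^ n = 0.
Proof.
move=> [n hn] [m hm]; exists (n + m)%N; rewrite expnD mulrnA hn mul0rn.
by rewrite mulnC mulrnA hm mul0rn.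
Qed.

Lemma ptorsionD (V : zmodType) (x y : V) : (exists n, x *+ p ^ n = 0) ->
  (exists n, y *+ p ^ n = 0) -> exists n, (x + y) *+ p ^ n = 0.
Proof.
by move=> hx hy; have [n [h h']] := ptorsion_max hx hy; exists n; rewrite mulrnDl h h' addr0.
Qed.

Lemma ptorsionN (V : zmodType) (x : V) : (exists n, x *+ p ^ n = 0) -> exists n, - x *+ p ^ n = 0.
Proof. by move=> [n h]; exists n; rewrite mulNrn h oppr0. Qed.

Lemma coh_sym L (A : comAlgType F) (s : {lrmorphism L -> A}) (w w' : family A) :
  coh s w w' -> coh s w' w.
Proof.
move=> [b [tb h]]; exists (- b); split; first exact: ptorsionN.
by move=> R f g fg; rewrite h // coboundaryN addrK.
Qed.

Lemma coh_trans L (A : comAlgType F) (s : {lrmorphism L -> A}) (w1 w2 w3 : family A) :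
  coh s w1 w2 -> coh s w2 w3 -> coh s w1 w3.
Proof.
move=> [b [tb h]] [b' [tb' h']]; exists (b' + b); split; first exact: ptorsionD.
by move=> R f g fg; rewrite h // h' // coboundaryD -addrA.
Qed.

Lemma coh_ext L (A : comAlgType F) (s : {lrmorphism L -> A}) (w w' : family A) :
  (forall (R : comAlgType F) (f g : {lrmorphism A -> R}), agree s f g -> w R f g = w' R f g) ->
  coh s w w'.
Proof.
move=> h; exists 0; split; first by exists 0%N; rewrite mul0rn.
by move=> R f g fg; rewrite coboundary0 addr0 h.
Qed.

Lemma coh_pull L L' (e : {lrmorphism L -> L'}) (A B : comAlgType F) (s : {lrmorphism L -> A})
    (t : {lrmorphism L' -> B}) (v : {lrmorphism A -> B}) (w w' : family A) :
  v \o s =1 t \o e -> coh s w w' -> coh t (pull v w) (pull v w').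
Proof.
move=> vs [b [[n tb] h]]; exists (ecmap v b); split.
  by exists n; rewrite -raddfMn tb raddf0.
move=> R f g fg; rewrite /pull h; last first.
  by move=> x; rewrite /= -[v (s x)]/((v \o s) x) vs; exact: fg.
rewrite /coboundary (@ecmap_comp _ _ _ _ _ v g) // (@ecmap_comp _ _ _ _ _ v f) //.
Qed.

Lemma coh_pullM L L' (e : {lrmorphism L -> L'}) (A B C : comAlgType F) (s : {lrmorphism L -> A})
    (t : {lrmorphism L' -> C}) (v : {lrmorphism A -> B}) (v' : {lrmorphism B -> C}) (w : family A) :
  is_cocycle s w -> v' \o v \o s =1 t \o e ->
  coh t (pull v' (pull v w)) (pull (v' \o v : {lrmorphism A -> C}) w).
Proof.
move=> cw vs; apply: coh_ext => R f g fg; apply: (fam_ext cw) => // z.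
by have /= -> := vs z; exact: fg.
Qed.

Lemma coh_add L (A : comAlgType F) (s : {lrmorphism L -> A}) (w1 w2 w1' w2' : family A) :
  coh s w1 w1' -> coh s w2 w2' ->
  coh s (fun R f g => w1 R f g + w2 R f g) (fun R f g => w1' R f g + w2' R f g).
Proof.
move=> [b [tb h]] [b' [tb' h']]; exists (b + b'); split; first exact: ptorsionD.
by move=> R f g fg; rewrite h // h' // coboundaryD addrACA.
Qed.

Lemma coh_indep L L' (e : {lrmorphism L -> L'}) (A B : comAlgType F) (s : {lrmorphism L -> A})
    (w : family A) (h h' : {lrmorphism A -> B}) (t : {lrmorphism L' -> B}) :
  is_cocycle s w -> torsion_family s w -> h \o s =1 t \o e -> h' \o s =1 t \o e ->
  coh t (pull h w) (pull h' w).
Proof.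
move=> cw [n tw] hs hs'; exists (w _ h' h); split.
  by exists n; apply: tw => x; rewrite hs hs'.
exact: (pull_indep cw hs hs').
Qed.

Definition cval L (x : cocycle E p L) : family (coc_cov x) := fun R f g =>
  if pselect (f \o cov_str (coc_cov x) =1 g \o cov_str (coc_cov x)) is left h
  then coc_fun h else 0.

Lemma cvalE L (x : cocycle E p L) (R : comAlgType F) (f g : {lrmorphism coc_cov x -> R}) h :
  @coc_fun _ _ _ _ x R f g h = cval f g.
Proof. by rewrite /cval; case: pselect => // h'; congr coc_fun; exact: Prop_irrelevance. Qed.

Lemma cval_cocycle L (x : cocycle E p L) : is_cocycle (cov_str (coc_cov x)) (@cval L x).
Proof.
split=> [R S phi f g f' g' fg ff' gg'|R f g k fg gk].
  have fg' : f' \o cov_str (coc_cov x) =1 g' \o cov_str (coc_cov x).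
    by move=> y; rewrite /= ff' gg' /=; congr (phi _); exact: fg.
  by rewrite -(cvalE fg) -(cvalE fg'); exact: coc_natural.
have fk : f \o cov_str (coc_cov x) =1 k \o cov_str (coc_cov x).
  by move=> y; rewrite fg gk.
by rewrite -(cvalE fg) -(cvalE gk) -(cvalE fk); exact: coc_cocycle.
Qed.

Lemma cval_torsion L (x : cocycle E p L) : torsion_family (cov_str (coc_cov x)) (@cval L x).
Proof.
by have [n h] := coc_torsion x; exists n => R f g fg; rewrite -(cvalE fg) h.
Qed.

Section Make.
Variables (L : fieldAlgType F) (C : cover L) (w : family C).
Hypotheses (cw : is_cocycle (cov_str C) w) (tw : torsion_family (cov_str C) w).

Let wn (R S : comAlgType F) (phi : {lrmorphism R -> S})
    (f g : {lrmorphism C -> R}) (f' g' : {lrmorphism C -> S})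
    (h : f \o cov_str C =1 g \o cov_str C) (h' : f' \o cov_str C =1 g' \o cov_str C) :
  f' =1 phi \o f -> g' =1 phi \o g -> w f' g' = ecmap phi (w f g).
Proof. exact: cw.1. Qed.

Definition mk_cocycle : cocycle E p L :=
  @Cocycle F E p L C (fun R f g _ => w f g) wn
   (fun R f g k hfg hgk _ => cw.2 R f g k hfg hgk) tw.

Lemma mk_cocycleE (R : comAlgType F) (f g : {lrmorphism C -> R}) :
  agree (cov_str C) f g -> @cval L mk_cocycle R f g = w f g.
Proof. by move=> h; rewrite -(@cvalE L mk_cocycle R f g h). Qed.
End Make.

Lemma restricts_toP L L' (e : {lrmorphism L -> L'}) (x : cocycle E p L) (y : cocycle E p L') :
  restricts_to e x y <-> exists (C : cover L') (h : {lrmorphism coc_cov x -> C})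
    (k : {lrmorphism coc_cov y -> C}),
  [/\ h \o cov_str (coc_cov x) =1 cov_str C \o e,
      k \o cov_str (coc_cov y) =1 cov_str C &
      coh (cov_str C) (pull h (@cval _ x)) (pull k (@cval _ y))].
Proof.
split=> [[C [h [k [b [n [hs ks tb cb]]]]]]|[C [h [k [hs ks [b [[n tb] cb]]]]]]].
  exists C, h, k; split=> //; exists b; split; first by exists n.
  move=> R f g fg.
  have hx : (f \o h : {lrmorphism coc_cov x -> R}) \o cov_str (coc_cov x) =1 (g \o h : {lrmorphism coc_cov x -> R}) \o cov_str (coc_cov x).
    by move=> z; rewrite /= -[h _]/((h \o cov_str (coc_cov x)) z) hs; exact: fg.
  have hy : (f \o k : {lrmorphism coc_cov y -> R}) \o cov_str (coc_cov y) =1 (g \o k : {lrmorphism coc_cov y -> R}) \o cov_str (coc_cov y).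
    by move=> z; rewrite /= -[k _]/((k \o cov_str (coc_cov y)) z) ks; exact: fg.
  by rewrite /pull -(cvalE hx) -(cvalE hy); exact: cb.
exists C, h, k, b, n; split=> // R f g fg hx hy; rewrite !cvalE.
exact: cb.
Qed.

(** [restricts_to] provides one cover and one pair of maps. Any other pair h, k can be used after a
    refinement, since a change of maps alters the pull-backs by a torsion coboundary. *)
Lemma rt_refine L L' (e : {lrmorphism L -> L'}) (x : cocycle E p L) (y : cocycle E p L')
    (D : cover L') (h : {lrmorphism coc_cov x -> D}) (k : {lrmorphism coc_cov y -> D}) :
  restricts_to e x y -> h \o cov_str (coc_cov x) =1 cov_str D \o e ->
  k \o cov_str (coc_cov y) =1 cov_str D ->
  exists (D' : cover L') (v : {lrmorphism D -> D'}), v \o cov_str D =1 cov_str D' /\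
    coh (cov_str D') (pull (v \o h : {lrmorphism coc_cov x -> D'}) (@cval _ x))
     (pull (v \o k : {lrmorphism coc_cov y -> D'}) (@cval _ y)).
Proof.
move=> /restricts_toP[C [h0 [k0 [hs0 ks0 c0]]]] hs ks.
have [D' [v0 [v [v0s vs]]]] := cover_push C D.
exists D', v; split=> //.
have vse : v0 \o cov_str C =1 cov_str D' \o idfun by exact: v0s.
have c1 := coh_pull vse c0.
have c2 : coh (cov_str D') (pull (v \o h : {lrmorphism coc_cov x -> D'}) (@cval _ x))
    (pull (v0 \o h0 : {lrmorphism coc_cov x -> D'}) (@cval _ x)).
  by apply: (coh_indep (e := e) (cval_cocycle x) (cval_torsion x)); exact: compat_comp.
have c3 : coh (cov_str D') (pull (v0 \o k0 : {lrmorphism coc_cov y -> D'}) (@cval _ y))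
    (pull (v \o k : {lrmorphism coc_cov y -> D'}) (@cval _ y)).
  apply: (coh_indep (e := idfun) (cval_cocycle y) (cval_torsion y)).
    exact: (compat_comp (e := idfun) ks0).
  exact: (compat_comp (e := idfun) ks).
apply: coh_trans c2 _; apply: coh_trans _ c3; apply: coh_trans (coh_trans _ c1) _.
  by apply: coh_sym; apply: (coh_pullM (e := e) (cval_cocycle x)); exact: compat_comp hs0 v0s.
by apply: (coh_pullM (e := idfun) (cval_cocycle y)); exact: (compat_comp (e := idfun) ks0).
Qed.

End Cech.

(** * Functoriality and addition of cohomology classes *)

Section Classes.
Variables (F : fieldType) (E : ellipticCurve F) (p : nat).
Implicit Types K L : fieldAlgType F.
Local Notation cocycle := (cocycle E p).

Lemma agree_compat K L (e : {lrmorphism K -> L}) (A B R : comAlgType F) (s : {lrmorphism K -> A})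
    (t : {lrmorphism L -> B}) (h : {lrmorphism A -> B}) (f g : {lrmorphism B -> R}) :
  h \o s =1 t \o e -> agree t f g ->
  agree s (f \o h : {lrmorphism A -> R}) (g \o h : {lrmorphism A -> R}).
Proof. by move=> hs fg z; have /= -> := hs z; exact: fg. Qed.

Lemma coh_push L L' (e : {lrmorphism L -> L'}) (A B C D : comAlgType F)
    (s : {lrmorphism L -> C}) (s' : {lrmorphism L' -> D})
    K K' (a : {lrmorphism K -> L}) (b : {lrmorphism K' -> L})
    (sA : {lrmorphism K -> A}) (sB : {lrmorphism K' -> B})
    (h : {lrmorphism A -> C}) (k : {lrmorphism B -> C})
    (v : {lrmorphism C -> D}) (w : family E A) (w' : family E B) :
  is_cocycle sA w -> is_cocycle sB w' -> h \o sA =1 s \o a -> k \o sB =1 s \o b ->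
  v \o s =1 s' \o e -> coh p s (pull h w) (pull k w') ->
  coh p s' (pull (v \o h : {lrmorphism A -> D}) w) (pull (v \o k : {lrmorphism B -> D}) w').
Proof.
move=> cw cw' hs ks vs c; apply: coh_trans (coh_trans _ (coh_pull vs c)) _.
  apply: coh_sym; apply: (@coh_pullM F E p K L' (e \o a : {lrmorphism K -> L'}) A C D sA s' h v w cw) => z /=.
  by have /= -> := hs z; exact: vs.
apply: (@coh_pullM F E p K' L' (e \o b : {lrmorphism K' -> L'}) B C D sB s' k v w' cw') => z /=.
by have /= -> := ks z; exact: vs.
Qed.

Lemma rt_trans K L L' (e : {lrmorphism K -> L}) (e' : {lrmorphism L -> L'})
    (x : cocycle K) (y : cocycle L) (z : cocycle L') :
  restricts_to e x y -> restricts_to e' y z ->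
  restricts_to (e' \o e : {lrmorphism K -> L'}) x z.
Proof.
move=> /restricts_toP[C [h [k [hs ks c]]]] /restricts_toP[C' [h' [k' [hs' ks' c']]]].
have [D0 [v0 v0s]] := cover_base e' C.
have [D [v1 [v' [v1s v's]]]] := cover_push D0 C'.
pose v : {lrmorphism C -> D} := v1 \o v0.
have vs : v \o cov_str C =1 cov_str D \o e' by exact: (compat_comp (e := e') v0s v1s).
apply/restricts_toP; exists D, (v \o h : {lrmorphism _ -> _}), (v' \o k' : {lrmorphism _ -> _}); split.
- by move=> u; rewrite /= -[h _]/((h \o cov_str (coc_cov x)) u) hs /= -[LHS]/((v \o cov_str C) (e u)) vs.
- by exact: (compat_comp (e := idfun) ks').
- have c1 := coh_push (a := e) (b := idfun) (cval_cocycle x) (cval_cocycle y) hs ks vs c.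
  have c2 := coh_push (e := idfun) (a := e') (b := idfun) (cval_cocycle y) (cval_cocycle z) hs' ks' v's c'.
  apply: coh_trans c1 (coh_trans _ c2).
  apply: (coh_indep (e := e') (cval_cocycle y) (cval_torsion y)) => u.
    by rewrite /= -[k _]/((k \o cov_str (coc_cov y)) u) ks -[LHS]/((v \o cov_str C) u) vs.
  by rewrite /= -[h' _]/((h' \o cov_str (coc_cov y)) u) hs' /= -v's.
Qed.

Lemma rt_ext K L (e e' : {lrmorphism K -> L}) (x : cocycle K) (y : cocycle L) :
  e =1 e' -> restricts_to e x y -> restricts_to e' x y.
Proof.
move=> ee /restricts_toP[C [h [k [hs ks c]]]]; apply/restricts_toP; exists C, h, k; split=> //.
by move=> z; rewrite hs /= ee.
Qed.

Lemma rt_unique K L (e : {lrmorphism K -> L}) (x : cocycle K) (y y' : cocycle L) :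
  restricts_to e x y -> restricts_to e x y' -> cohomologous y y'.
Proof.
move=> /restricts_toP[C [h [k [hs ks c]]]] /restricts_toP[C' [h' [k' [hs' ks' c']]]].
have [D [v [v' [vs v's]]]] := cover_push C C'.
apply/restricts_toP; exists D, (v \o k : {lrmorphism _ -> _}), (v' \o k' : {lrmorphism _ -> _}); split.
- exact: (compat_comp (e := idfun) ks).
- exact: (compat_comp (e := idfun) ks').
- have c1 := coh_push (e := idfun) (a := e) (b := idfun) (cval_cocycle x) (cval_cocycle y) hs ks vs c.
  have c2 := coh_push (e := idfun) (a := e) (b := idfun) (cval_cocycle x) (cval_cocycle y') hs' ks' v's c'.
  apply: coh_trans (coh_sym c1) (coh_trans _ c2).
  by apply: (coh_indep (e := e) (cval_cocycle x) (cval_torsion x)); exact: compat_comp.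
Qed.

Lemma rt_id L (x : cocycle L) : cohomologous x x.
Proof.
apply/restricts_toP; exists (coc_cov x), idfun, idfun; split=> //.
exact: coh_ext.
Qed.

Lemma cohom_sym L (x y : cocycle L) : cohomologous x y -> cohomologous y x.
Proof. by move=> h; apply: rt_unique h (rt_id x). Qed.

Lemma cohom_trans L (x y z : cocycle L) : cohomologous x y -> cohomologous y z -> cohomologous x z.
Proof. by move=> h h'; apply: rt_ext (rt_trans h h'). Qed.

Lemma rt_cohomr K L (e : {lrmorphism K -> L}) (x : cocycle K) (y y' : cocycle L) :
  restricts_to e x y -> cohomologous y y' -> restricts_to e x y'.
Proof. by move=> h h'; apply: rt_ext (rt_trans h h'). Qed.

Lemma rt_cohoml K L (e : {lrmorphism K -> L}) (x x' : cocycle K) (y : cocycle L) :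
  cohomologous x' x -> restricts_to e x y -> restricts_to e x' y.
Proof. by move=> h h'; apply: rt_ext (rt_trans h h'). Qed.

Lemma mk_cocycle_rt K L (e : {lrmorphism K -> L}) (x : cocycle K) (D : cover L)
    (v : {lrmorphism coc_cov x -> D}) (w : family E D)
    (cw : is_cocycle (cov_str D) w) (tw : torsion_family p (cov_str D) w) :
  v \o cov_str (coc_cov x) =1 cov_str D \o e -> w = pull v (@cval _ _ _ _ x) ->
  restricts_to e x (mk_cocycle cw tw).
Proof.
move=> vs wE; apply/restricts_toP; exists D, v, idfun; split=> //.
apply: coh_ext => R f g fg; rewrite /(pull idfun) /=.
rewrite mk_cocycleE // wE.
by apply: (fam_ext (cval_cocycle x)) => // z; rewrite /= -[v _]/((v \o cov_str (coc_cov x)) z) vs; exact: fg.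
Qed.

Lemma pull_torsion K L (e : {lrmorphism K -> L}) (A B : comAlgType F) (s : {lrmorphism K -> A})
   (t : {lrmorphism L -> B}) (v : {lrmorphism A -> B}) (w : family E A) :
  v \o s =1 t \o e -> torsion_family p s w -> torsion_family p t (pull v w).
Proof.
move=> vs [n tw]; exists n => R f g fg; apply: tw => z.
by rewrite /= -[v _]/((v \o s) z) vs; exact: fg.
Qed.

Lemma rt_exists K L (e : {lrmorphism K -> L}) (x : cocycle K) : exists y, restricts_to e x y.
Proof.
have [D [v vs]] := cover_base e (coc_cov x).
have cw := pull_cocycle (cval_cocycle x) vs.
have tw := pull_torsion vs (cval_torsion x).
by exists (mk_cocycle cw tw); apply: mk_cocycle_rt vs _.
Qed.

Lemma cochain_eq L (X Y : cochains E p L) : (forall z, X z <-> Y z) -> X = Y.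
Proof. by move=> h; apply/funext => z; apply/propext. Qed.

Lemma class_eqP L (x y : cocycle L) : @cohomologous _ _ _ _ x = cohomologous y <-> cohomologous x y.
Proof.
split=> [->|h]; first exact: rt_id.
apply: cochain_eq => z; split=> h'; first exact: cohom_trans (cohom_sym h) h'.
exact: cohom_trans h h'.
Qed.

Lemma res_class K L (e : {lrmorphism K -> L}) (x : cocycle K) (y : cocycle L) :
  restricts_to e x y -> res e (cohomologous x) = cohomologous y.
Proof.
move=> h; apply: cochain_eq => z; split=> [[x' [xx' h']]|yz].
  exact: rt_unique h (rt_cohoml xx' h').
by exists x; split; [exact: rt_id | exact: rt_cohomr h yz].
Qed.

Lemma res_classP K L (e : {lrmorphism K -> L}) (x : cocycle K) (y : cocycle L) :
  res e (cohomologous x) = cohomologous y -> restricts_to e x y.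
Proof.
move=> h; have [y' hy'] := rt_exists e x.
have : res e (cohomologous x) y by rewrite h; exact: rt_id.
by move=> [x' [xx' h']]; exact: rt_cohoml xx' h'.
Qed.

Lemma res_is_class K L (e : {lrmorphism K -> L}) (X : cochains E p K) : is_class X -> is_class (res e X).
Proof.
by move=> [x ->]; have [y hy] := rt_exists e x; exists y; exact: res_class.
Qed.

Lemma res_comp K L L' (e : {lrmorphism K -> L}) (e' : {lrmorphism L -> L'})
    (f : {lrmorphism K -> L'}) (X : cochains E p K) :
  is_class X -> f =1 e' \o e -> res e' (res e X) = res f X.
Proof.
move=> [x ->] fe; have [y hy] := rt_exists e x; have [z hz] := rt_exists e' y.
rewrite (res_class hy) (res_class hz); symmetry; apply: res_class.
by apply: rt_ext (rt_trans hy hz) => u; rewrite fe.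
Qed.

Definition is_sum L (w x y : cocycle L) :=
  exists (h : {lrmorphism coc_cov x -> coc_cov w}) (k : {lrmorphism coc_cov y -> coc_cov w}),
  [/\ h \o cov_str (coc_cov x) =1 cov_str (coc_cov w),
      k \o cov_str (coc_cov y) =1 cov_str (coc_cov w) &
      forall (R : comAlgType F) (f g : {lrmorphism coc_cov w -> R}),
        agree (cov_str (coc_cov w)) f g ->
        cval (x := w) f g = pull h (@cval _ _ _ _ x) f g + pull k (@cval _ _ _ _ y) f g].

(** One cover must carry both comparisons: it is refined for x and then for y, and the comparison
    for x is pulled back to the second refinement. *)
Lemma sum_rt K L (e : {lrmorphism K -> L}) (w x y : cocycle K) (w' x' y' : cocycle L) :
  is_sum w x y -> is_sum w' x' y' -> restricts_to e x x' -> restricts_to e y y' ->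
  restricts_to e w w'.
Proof.
move=> [h [k [hs ks wE]]] [h' [k' [hs' ks' wE']]] rx ry.
have [D0 [v0 v0s]] := cover_base e (coc_cov w).
have [D1 [v1 [v' [v1s v's]]]] := cover_push D0 (coc_cov w').
pose v : {lrmorphism coc_cov w -> D1} := v1 \o v0.
have vs : v \o cov_str (coc_cov w) =1 cov_str D1 \o e by exact: (compat_comp (e := e) v0s v1s).
have vhs : (v \o h : {lrmorphism _ -> _}) \o cov_str (coc_cov x) =1 cov_str D1 \o e.
  by move=> z; rewrite /= -[h _]/((h \o cov_str _) z) hs; exact: vs.
have vks : (v \o k : {lrmorphism _ -> _}) \o cov_str (coc_cov y) =1 cov_str D1 \o e.
  by move=> z; rewrite /= -[k _]/((k \o cov_str _) z) ks; exact: vs.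
have vhs' : (v' \o h' : {lrmorphism _ -> _}) \o cov_str (coc_cov x') =1 cov_str D1.
  by move=> z; rewrite /= -[h' _]/((h' \o cov_str _) z) hs'; exact: v's.
have vks' : (v' \o k' : {lrmorphism _ -> _}) \o cov_str (coc_cov y') =1 cov_str D1.
  by move=> z; rewrite /= -[k' _]/((k' \o cov_str _) z) ks'; exact: v's.
have [D2 [v2 [v2s c2]]] := rt_refine rx vhs vhs'.
have vks2 : (v2 \o (v \o k) : {lrmorphism _ -> _}) \o cov_str (coc_cov y) =1 cov_str D2 \o e.
  exact: (compat_comp vks v2s).
have vks2' : (v2 \o (v' \o k') : {lrmorphism _ -> _}) \o cov_str (coc_cov y') =1 cov_str D2.
  exact: (compat_comp (e := idfun) vks' v2s).
have [D [v3 [v3s c3]]] := rt_refine ry vks2 vks2'.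
have vhs2 : (v2 \o (v \o h) : {lrmorphism _ -> _}) \o cov_str (coc_cov x) =1 cov_str D2 \o e.
  exact: (compat_comp vhs v2s).
have vhs2' : (v2 \o (v' \o h') : {lrmorphism _ -> _}) \o cov_str (coc_cov x') =1 cov_str D2.
  exact: (compat_comp (e := idfun) vhs' v2s).
have c4 := coh_push (e := idfun) (a := e) (b := idfun) (cval_cocycle x) (cval_cocycle x') vhs2 vhs2' v3s c2.
pose V : {lrmorphism coc_cov w -> D} := v3 \o (v2 \o v).
pose V' : {lrmorphism coc_cov w' -> D} := v3 \o (v2 \o v').
have Vs : V \o cov_str (coc_cov w) =1 cov_str D \o e.
  exact: (compat_comp (compat_comp vs v2s) v3s).
have V's : V' \o cov_str (coc_cov w') =1 cov_str D.
  exact: (compat_comp (e := idfun) (compat_comp (e := idfun) v's v2s) v3s).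
apply/restricts_toP; exists D, V, V'; split=> //.
apply: coh_trans (coh_trans _ (coh_add c4 c3)) _; apply: coh_ext => R f g fg.
  rewrite /(pull V) wE; last exact: (agree_compat Vs fg).
  congr (_ + _); [apply: (fam_ext (cval_cocycle x))|apply: (fam_ext (cval_cocycle y))] => // z.
    by have /= -> := compat_comp vhs2 v3s z; exact: fg.
  by have /= -> := compat_comp vks2 v3s z; exact: fg.
rewrite /(pull V') wE'; last exact: (agree_compat (e := idfun) V's fg).
symmetry; congr (_ + _); [apply: (fam_ext (cval_cocycle x'))|apply: (fam_ext (cval_cocycle y'))] => // z.
  by have /= -> := compat_comp (e := idfun) vhs2' v3s z; exact: fg.
by have /= -> := compat_comp (e := idfun) vks2' v3s z; exact: fg.
Qed.

Lemma add_cocycle L (A : comAlgType F) (s : {lrmorphism L -> A}) (w w' : family E A) :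
  is_cocycle s w -> is_cocycle s w' -> is_cocycle s (fun R f g => w R f g + w' R f g).
Proof.
move=> cw cw'; split=> [R S phi f g f' g' fg ff' gg'|R f g k fg gk].
  by rewrite raddfD; congr (_ + _); [exact: cw.1|exact: cw'.1].
by rewrite addrACA cw.2 // cw'.2.
Qed.

Lemma add_torsion L (A : comAlgType F) (s : {lrmorphism L -> A}) (w w' : family E A) :
  torsion_family p s w -> torsion_family p s w' ->
  torsion_family p s (fun R f g => w R f g + w' R f g).
Proof.
move=> [n tw] [m tw']; exists (n + m)%N => R f g fg.
by rewrite mulrnDl {1}expnD mulrnA tw // mul0rn add0r addnC expnD mulrnA tw' // mul0rn.
Qed.

Lemma sum_exists L (x y : cocycle L) : exists w, is_sum w x y.
Proof.
have [D [v [v' [vs v's]]]] := cover_push (coc_cov x) (coc_cov y).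
have cw := add_cocycle (pull_cocycle (e := idfun) (cval_cocycle x) vs)
  (pull_cocycle (e := idfun) (cval_cocycle y) v's).
have tw := add_torsion (pull_torsion (e := idfun) vs (cval_torsion x))
  (pull_torsion (e := idfun) v's (cval_torsion y)).
exists (mk_cocycle cw tw), v, v'; split=> // R f g fg; exact: mk_cocycleE.
Qed.

Lemma class_add L (x y w : cocycle L) : is_sum w x y ->
  H1add (cohomologous x) (cohomologous y) = cohomologous w.
Proof.
move=> sw; apply: cochain_eq => z; split=> [[x' [y' [w' [h [k [xx' yy' wz [hs ks] E']]]]]]|wz].
  apply: cohom_trans wz; apply: sum_rt sw _ xx' yy'.
  exists h, k; split=> // R f g fg.
  have fgx : (f \o h : {lrmorphism coc_cov x' -> R}) \o cov_str (coc_cov x') =1 (g \o h : {lrmorphism coc_cov x' -> R}) \o cov_str (coc_cov x').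
    by move=> u; rewrite /= -[h _]/((h \o cov_str _) u) hs; exact: fg.
  have fgy : (f \o k : {lrmorphism coc_cov y' -> R}) \o cov_str (coc_cov y') =1 (g \o k : {lrmorphism coc_cov y' -> R}) \o cov_str (coc_cov y').
    by move=> u; rewrite /= -[k _]/((k \o cov_str _) u) ks; exact: fg.
  by have := E' R f g fg fgx fgy; rewrite !cvalE.
have [h [k [hs ks wE]]] := sw.
exists x, y, w, h, k; split=> //; [exact: rt_id|exact: rt_id|].
by move=> R f g hw hx hy; rewrite !cvalE wE.
Qed.

Lemma res_add K L (e : {lrmorphism K -> L}) (X Y : cochains E p K) :
  is_class X -> is_class Y -> res e (H1add X Y) = H1add (res e X) (res e Y).
Proof.
move=> [x ->] [y ->]; have [w sw] := sum_exists x y.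
have [x' rx] := rt_exists e x; have [y' ry] := rt_exists e y; have [w' sw'] := sum_exists x' y'.
rewrite (class_add sw) (res_class rx) (res_class ry) (class_add sw').
exact: res_class (sum_rt sw sw' rx ry).
Qed.

End Classes.

(** * Kummer classes as coboundaries of points *)

Section Kummer.
Variables (F : fieldType) (E : ellipticCurve F) (p : nat).
Implicit Types K L : fieldAlgType F.
Local Notation cocycle := (cocycle E p).

(** Two quotients of P by p^n differ, on a common cover, by a p^n-torsion point, and its coboundary
    is the difference of the cocycles. So one representative determines the whole Kummer class. *)
Lemma kummer_class K (P : ecpoint E K) n (y : cocycle K) (Q : ecpoint E (coc_cov y)) :
  Q *+ p ^ n = ecmap (cov_str (coc_cov y)) P ->
  (forall (R : comAlgType F) (f g : {lrmorphism coc_cov y -> R}),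
     agree (cov_str (coc_cov y)) f g -> cval (x := y) f g = coboundary Q f g) ->
  kummer (p := p) P n = cohomologous y.
Proof.
move=> QP yQ; apply: cochain_eq => z; split=> [[x [Q' [QP' xQ' xz]]]|yz]; last first.
  by exists y, Q; split=> // R f g h; rewrite cvalE yQ.
apply: cohom_trans xz.
have [D [v [v' [vs v's]]]] := cover_push (coc_cov y) (coc_cov x).
apply/restricts_toP; exists D, v, v'; split=> //.
exists (ecmap v Q - ecmap v' Q'); split.
  exists n; rewrite mulrnBl -!raddfMn QP QP' /=.
  rewrite -(@ecmap_comp _ _ _ _ _ _ _ (cov_str D)); last by move=> u; rewrite -vs.
  by rewrite -(@ecmap_comp _ _ _ _ _ _ _ (cov_str D)) ?subrr // => u; rewrite -v's.
move=> R f g fg; rewrite /pull yQ; last exact: (agree_compat (e := idfun) vs fg).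
have fg' := agree_compat (e := idfun) v's fg.
by rewrite -(cvalE fg') xQ' coboundaryD coboundaryN /coboundary !ecmap_ecmap [RHS]addrC subrK.
Qed.

(** A member x is supplied because [kummer P n] is empty until P is known to be divisible by p^n on
    some cover; the surjectivity of multiplication by p^n for the flat topology is thereby
    avoided. *)
Lemma kummer_res K L (e : {lrmorphism K -> L}) (P : ecpoint E K) n x :
  kummer (p := p) P n x -> res e (kummer (p := p) P n) = kummer (p := p) (ecmap e P) n.
Proof.
move=> [y [Q [QP yQ _]]].
have yQ' (R : comAlgType F) (f g : {lrmorphism coc_cov y -> R}) :
    agree (cov_str (coc_cov y)) f g -> cval (x := y) f g = coboundary Q f g.
  by move=> fg; rewrite -(cvalE fg) yQ.
rewrite (kummer_class QP yQ').
have [D [v vs]] := cover_base e (coc_cov y).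
have cw := pull_cocycle (cval_cocycle y) vs.
have tw := pull_torsion vs (cval_torsion y).
rewrite (res_class (mk_cocycle_rt cw tw vs erefl)); symmetry.
apply: (@kummer_class _ _ _ (mk_cocycle cw tw) (ecmap v Q)).
  rewrite -raddfMn QP /= -(@ecmap_comp _ _ _ _ _ _ _ (v \o cov_str (coc_cov y) : {lrmorphism _ -> _})) //.
  exact: ecmap_comp.
move=> R f g fg; rewrite mk_cocycleE // /pull yQ'; last exact: (agree_compat vs fg).
by rewrite /coboundary !ecmap_ecmap.
Qed.

(** One half of the equivalence between the Kummer condition and triviality in the cohomology of E:
    the torsion point provided by [restricts_to] is absorbed in Q. *)
Lemma kummer_trivializes K L (e : {lrmorphism K -> L}) (x : cocycle K) (P : ecpoint E L) n :
  res e (cohomologous x) = kummer (p := p) P n ->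
  exists (C : cover L) (h : {lrmorphism coc_cov x -> C}) (Q : ecpoint E C),
    h \o cov_str (coc_cov x) =1 cov_str C \o e /\
    forall (R : comAlgType F) (f g : {lrmorphism C -> R}), agree (cov_str C) f g ->
      pull h (@cval _ _ _ _ x) f g = coboundary Q f g.
Proof.
move=> xP; have [y0 hy0] := rt_exists e x.
have : kummer (p := p) P n y0 by rewrite -xP (res_class hy0); exact: rt_id.
move=> [y [Q [QP yQ yy0]]].
have /restricts_toP[C [h [k [hs ks [b [_ cb]]]]]] := rt_cohomr hy0 (cohom_sym yy0).
exists C, h, (ecmap k Q + b); split=> // R f g fg.
have fg' := agree_compat (e := idfun) ks fg.
rewrite cb // coboundaryD; congr (_ + _); rewrite /pull -(cvalE fg') yQ.
by rewrite /coboundary !ecmap_ecmap.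
Qed.

(** Since p^n kills the cocycle, p^n Q has trivial coboundary and descends to a point P over L, of
    which Q is then a division by p^n. *)
Lemma trivial_kummer K L (e : {lrmorphism K -> L}) (x : cocycle K) (C : cover L)
    (h : {lrmorphism coc_cov x -> C}) (Q : ecpoint E C) :
  h \o cov_str (coc_cov x) =1 cov_str C \o e ->
  (forall (R : comAlgType F) (f g : {lrmorphism C -> R}), agree (cov_str C) f g ->
      pull h (@cval _ _ _ _ x) f g = coboundary Q f g) ->
  exists (P : ecpoint E L) n, res e (cohomologous x) = kummer (p := p) P n.
Proof.
move=> hs xQ; have cw := pull_cocycle (cval_cocycle x) hs.
have tw := pull_torsion hs (cval_torsion x).
have [n tn] := tw.
have [|P PE] := @point_descent _ E _ _ (cov_str C) (Q *+ p ^ n).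
  move=> R f g fg; have := tn R f g fg; rewrite xQ // => /eqP.
  by rewrite /coboundary mulrnBl -!raddfMn subr_eq0 => /eqP ->.
exists P, n; rewrite (res_class (mk_cocycle_rt cw tw hs erefl)); symmetry.
apply: (@kummer_class _ _ _ (mk_cocycle cw tw) Q); first by rewrite PE.
by move=> R f g fg; rewrite mk_cocycleE // xQ.
Qed.

End Kummer.

(** * Transfer along a finite Galois extension *)

Lemma quotient_algebra (F : fieldType) (R : comAlgType F) (I : {pred R}) :
  0 \in I -> (forall x y, x \in I -> y \in I -> x - y \in I) ->
  (forall x y, y \in I -> x * y \in I) -> 1 \notin I ->
  exists (A : comAlgType F) (p : {lrmorphism R -> A}),
  (forall y, exists x, p x = y) /\ (forall x, (p x == 0) = (x \in I)).
Proof.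
move=> I0 IB IM I1; have [A0 [p0 [p0s p0I]]] := quotient_ring I0 IB IM I1.
have [A [i [j [ij ji iE]]]] := ring_algebra (p0 \o in_alg R : {rmorphism F -> A0}).
have [p pE] := @rmorph_lr F R A (i \o p0 : {rmorphism R -> A}) iE.
exists A, p; split=> [y|x].
  by have [x xE] := p0s (j y); exists x; rewrite pE /= xE ji.
by rewrite pE /= -[0](rmorph0 i) (inj_eq (can_inj ij)) p0I.
Qed.

(** The component cut out by [eps k] is the quotient of R by the annihilator of [eps k], where this
    idempotent becomes 1; a minor that vanishes there is killed by [eps k]. *)
Lemma ecpoint_local (F : fieldType) (E : ellipticCurve F) (R : comAlgType F) (I : finType)
    (eps : I -> R) (P Q : ecpoint E R) :
  \sum_k eps k = 1 -> (forall k, eps k * eps k = eps k) ->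
  (forall k (S : comAlgType F) (j : {lrmorphism R -> S}), j (eps k) = 1 -> ecmap j P = ecmap j Q) ->
  P = Q.
Proof.
move=> e1 idem h; apply: wpoint_eq; apply: line_eq; [exact: wlineP|exact: wlineP|].
move=> u v Pu Qv i j; apply/eqP; rewrite -subr_eq0; apply/eqP.
set m := _ - _; rewrite -[m]mul1r -e1 mulr_suml; apply: big1 => k _.
have [->|nz] := eqVneq (eps k) 0; first by rewrite mul0r.
pose J : {pred R} := [pred x | eps k * x == 0].
have [|x y|x y||S [q [_ qJ]]] := @quotient_algebra F R J.
- by rewrite inE mulr0.
- by rewrite !inE mulrBr => /eqP -> /eqP ->; rewrite subrr.
- by rewrite !inE mulrCA => /eqP ->; rewrite mulr0.
- by rewrite inE mulr1.
have q1 : q (eps k) = 1.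
  by apply/eqP; rewrite -subr_eq0 -(rmorph1 q) -rmorphB qJ inE mulrBr idem mulr1 subrr.
have /ecmap_eqP H := h k S q q1.
apply/eqP; have -> : (eps k * m == 0) = (m \in J) by rewrite inE.
by rewrite -qJ /m rmorphB !rmorphM (H u v Pu Qv i j) subrr.
Qed.

Section Galois.
Variables (F : fieldType) (K N : fieldAlgType F) (e : {lrmorphism K -> N}).
Variables (gT : finGroupType) (act : gT -> {lrmorphism N -> N}).

(** Artin's description of a finite Galois extension; separability and finiteness are derived from
    it. *)
Definition galois_datum :=
  [/\ forall s c, act s (e c) = e c,
      forall s t, act (s * t)%g =1 act s \o act t,
      forall s, s != 1%g -> exists x, act s x != x &
      forall x, (forall s, act s x = x) -> exists c, e c = x].

Hypothesis gal : galois_datum.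

Lemma act1 : act 1%g =1 id.
Proof.
move=> x; case: gal => _ aM _ _.
by apply: (fmorph_inj (act 1%g)); rewrite -[LHS]/((act 1%g \o act 1%g) x) -aM mulg1.
Qed.

Definition tr (y : N) : N := \sum_s act s y.

Lemma tr_base y : exists c, e c = tr y.
Proof.
case: gal => _ aM _; apply=> s; rewrite /tr rmorph_sum.
rewrite [RHS](reindex_inj (mulgI s)) /=; apply: eq_bigr => t _.
by rewrite aM.
Qed.

(** The list is the separability idempotent of N over K, viewed as a function on the group.
    Functions of this form are closed under products, and for s other than 1 the function t -> (act
    t x - act s x) / (x - act s x) is 1 at 1 and 0 at s. *)
Lemma galois_sep : exists l : seq (N * N),
  forall s, \sum_(x <- l) x.1 * act s x.2 = (s == 1%g)%:R.
Proof.
pose rep (phi : gT -> N) := exists l : seq (N * N), forall s, \sum_(x <- l) x.1 * act s x.2 = phi s.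
have repM phi psi : rep phi -> rep psi -> rep (fun s => phi s * psi s).
  move=> [l hl] [m hm]; exists [seq (x.1 * y.1, x.2 * y.2) | x <- l, y <- m] => s.
  rewrite big_allpairs_dep -hl -hm mulr_suml; apply: eq_bigr => x _.
  by rewrite mulr_sumr; apply: eq_bigr => y _; rewrite /= rmorphM mulrACA.
have rep1 : rep (fun=> 1).
  by exists [:: (1, 1)] => s; rewrite big_seq1 /= rmorph1 mulr1.
have sep1 s : s != 1%g -> exists phi, [/\ rep phi, phi 1%g = 1 & phi s = 0].
  case: gal => _ _ faith _ /faith[x xs].
  have nz : x - act s x != 0 by rewrite subr_eq0 eq_sym.
  exists (fun t => (x - act s x)^-1 * act t x - act s x / (x - act s x)); split.
  - exists [:: ((x - act s x)^-1, x); (- act s x / (x - act s x), 1)] => t.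
    by rewrite big_cons big_seq1 /= rmorph1 mulr1 mulNr.
  - by rewrite act1 [_^-1 * _]mulrC -mulrBl divff.
  - by rewrite mulrC subrr.
have H (r : seq gT) : exists phi, [/\ rep phi, phi 1%g = 1 & forall s, s \in r -> s != 1%g -> phi s = 0].
  elim: r => [|s r [phi [h1 h2 h3]]]; first by exists (fun=> 1).
  have [s1|/sep1[psi [k1 k2 k3]]] := eqVneq s 1%g.
    by exists phi; split=> // t; rewrite inE s1 => /orP[/eqP->|/h3//]; rewrite eqxx.
  exists (fun t => phi t * psi t); split; first exact: repM.
    by rewrite h2 k2 mulr1.
  move=> t; rewrite inE => /orP[/eqP-> _|tr t1]; first by rewrite k3 mulr0.
  by rewrite h3 // mul0r.
have [phi [[l hl] p1 p0]] := H (enum gT); exists l => s; rewrite hl.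
by have [->//|s1] := eqVneq s 1%g; rewrite p0 // mem_enum.
Qed.

Variable l : seq (N * N).
Hypothesis hl : forall s, \sum_(x <- l) x.1 * act s x.2 = (s == 1%g)%:R.

(** The two columns of the list are dual generating families for the trace form. *)
Lemma sep_expand y : y = \sum_(x <- l) x.1 * tr (x.2 * y).
Proof.
rewrite /tr; under eq_bigr => x _ do rewrite mulr_sumr.
rewrite exchange_big (bigD1 1%g) //= [X in _ + X]big1 => [|s s1].
  rewrite addr0 -[LHS]mul1r -[in LHS](act1 y).
  have <- : \sum_(x <- l) x.1 * act 1%g x.2 = 1 by rewrite hl eqxx.
  rewrite mulr_suml; apply: eq_bigr => x _.
  by rewrite rmorphM mulrA.
under eq_bigr => x _ do rewrite rmorphM mulrA.
by rewrite -mulr_suml hl (negPf s1) mul0r.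
Qed.

Lemma sep_dual s : \sum_(x <- l) act s x.1 * x.2 = (s == 1%g)%:R.
Proof.
case: gal => _ aM _ _.
have -> : \sum_(x <- l) act s x.1 * x.2 = act s (\sum_(x <- l) x.1 * act s^-1%g x.2).
  rewrite rmorph_sum; apply: eq_bigr => x _; rewrite rmorphM; congr (_ * _).
  by rewrite -[RHS]/((act s \o act s^-1%g) x.2) -aM mulgV act1.
by rewrite hl rmorph_nat -eq_invg1 invgK.
Qed.

Lemma sep_expand' y : y = \sum_(x <- l) x.2 * tr (x.1 * y).
Proof.
rewrite /tr; under eq_bigr => x _ do rewrite mulr_sumr.
rewrite exchange_big (bigD1 1%g) //= [X in _ + X]big1 => [|s s1].
  rewrite addr0 -[LHS]mul1r -[in LHS](act1 y).
  have <- : \sum_(x <- l) act 1%g x.1 * x.2 = 1 by rewrite sep_dual eqxx.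
  rewrite mulr_suml; apply: eq_bigr => x _.
  by rewrite rmorphM mulrA [x.2 * _]mulrC.
under eq_bigr => x _ do rewrite rmorphM mulrA [x.2 * _]mulrC.
by rewrite -mulr_suml sep_dual (negPf s1) mul0r.
Qed.

Section Idempotents.
Variables (R : comAlgType F) (f g : {lrmorphism N -> R}).
Hypothesis fg : f \o e =1 g \o e.

(** The pair (f, g) is an R-point of the spectrum of the tensor square of N over K, which is a
    disjoint union of copies of Spec N indexed by the group. [eps s] is the idempotent of R that
    cuts out the locus where g is f composed with [act s]. *)
Definition eps (s : gT) : R := \sum_(x <- l) g x.1 * f (act s x.2).

Let tr_fg y : (f : {rmorphism N -> R}) (tr y) = (g : {rmorphism N -> R}) (tr y).
Proof. by have [c <-] := tr_base y; exact: fg. Qed.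

Lemma eps_sum : \sum_s eps s = 1.
Proof.
have -> : 1 = g (\sum_(x <- l) x.1 * tr (x.2 * 1)) by rewrite -sep_expand rmorph1.
rewrite /eps exchange_big rmorph_sum /=.
apply: eq_bigr => x _; rewrite -mulr_sumr rmorphM. rewrite -tr_fg mulr1 /tr rmorph_sum //.
Qed.

(** Expanding x.1 * y in the dual families leaves traces, which come from K and may pass from g to
    f; contracting them on the side of f rebuilds [act s y]. *)
Lemma eps_swap s y : eps s * g y = eps s * f (act s y).
Proof.
have -> : eps s * g y = \sum_(x <- l) \sum_(z <- l) g z.1 * f (act s x.2) * f (tr (z.2 * (x.1 * y))).
  rewrite /eps mulr_suml; apply: eq_bigr => x _.
  rewrite mulrAC -rmorphM [in LHS](sep_expand (x.1 * y)) rmorph_sum mulr_suml; apply: eq_bigr => z _.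
  by rewrite rmorphM -tr_fg mulrAC.
rewrite exchange_big /eps mulr_suml /=; apply: eq_bigr => z _.
under eq_bigr => x _ do rewrite -mulrA.
rewrite -mulr_sumr -mulrA; congr (_ * _).
rewrite -rmorphM -rmorphM (sep_expand' (z.2 * y)) !rmorph_sum; apply: eq_bigr => x _.
rewrite !rmorphM; congr (_ * f _); rewrite mulrCA.
by have [c hc] := tr_base (x.1 * (z.2 * y)); rewrite -hc; case: gal => h _ _ _; symmetry; exact: h.
Qed.

Lemma eps_orth s t : eps s * eps t = if s == t then eps s else 0.
Proof.
case: gal => _ aM _ _.
rewrite {2}/eps mulr_sumr.
have -> : \sum_(x <- l) eps s * (g x.1 * f (act t x.2)) =
   eps s * f (act s (\sum_(x <- l) x.1 * act (s^-1 * t)%g x.2)).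
  rewrite !rmorph_sum mulr_sumr; apply: eq_bigr => x _.
  rewrite mulrA eps_swap -mulrA !rmorphM; congr (_ * (_ * f _)).
  by rewrite -[RHS]/((act s \o act (s^-1 * t)%g) x.2) -aM mulKVg.
rewrite hl rmorph_nat rmorph_nat -eq_mulVg1; case: eqP => _; by rewrite ?mulr1 ?mulr0.
Qed.

(** The swap relation determines the idempotents. The shift by a serves when g is another morphism
    composed with [act a], whose idempotents are [del]. *)
Lemma eps_unique (del : gT -> R) (a : gT) :
  \sum_s del s = 1 -> (forall s y, del s * g y = del s * f (act (s * a)%g y)) ->
  forall s, eps (s * a)%g = del s.
Proof.
case: gal => _ aM _ _ d1 dsw.
have dE s t : del t * eps (s * a)%g = if s == t then del t else 0.
  rewrite /eps mulr_sumr.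
  have -> : \sum_(x <- l) del t * (g x.1 * f (act (s * a)%g x.2)) =
   del t * f (act (t * a)%g (\sum_(x <- l) x.1 * act ((t * a)^-1 * (s * a))%g x.2)).
    rewrite !rmorph_sum mulr_sumr; apply: eq_bigr => x _.
    rewrite mulrA dsw -mulrA !rmorphM; congr (_ * (_ * f _)).
    by rewrite -[RHS]/((act (t * a)%g \o act ((t * a)^-1 * (s * a))%g) x.2) -aM mulKVg.
  rewrite hl rmorph_nat rmorph_nat -eq_mulVg1 (inj_eq (mulIg a)) eq_sym; case: eqP => _; by rewrite ?mulr1 ?mulr0.
move=> s; rewrite -[LHS]mul1r -d1 mulr_suml (bigD1 s) //= dE eqxx big1 ?addr0 // => t ts.
by rewrite dE eq_sym (negPf ts).
Qed.

Lemma patch_hom (A : comAlgType F) (h : gT -> {lrmorphism A -> R}) :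
  exists k : {lrmorphism A -> R}, forall x, k x = \sum_s eps s * h s x.
Proof.
have [|||k kE] := @build_lrmorph F A R (fun x => \sum_s eps s * h s x).
- by move=> c; under eq_bigr => s _ do rewrite lrmorph_cA; rewrite -mulr_suml eps_sum mul1r.
- by move=> x y; rewrite -big_split; apply: eq_bigr => s _; rewrite rmorphD mulrDr.
- move=> x y; rewrite mulr_suml; apply: eq_bigr => s _.
  rewrite mulr_sumr (bigD1 s) //= big1 ?addr0 => [|t ts].
    by rewrite mulrACA eps_orth eqxx rmorphM.
  by rewrite mulrACA eps_orth eq_sym (negPf ts) mul0r.
by exists k.
Qed.

Lemma patch_mul (A : comAlgType F) (h : gT -> {lrmorphism A -> R}) (x : A) (s : gT) :
  eps s * \sum_t eps t * h t x = eps s * h s x.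
Proof.
rewrite mulr_sumr (bigD1 s) //= mulrA eps_orth eqxx big1 ?addr0 // => t ts.
by rewrite mulrA eps_orth eq_sym (negPf ts) mul0r.
Qed.

End Idempotents.

Lemma eps_nat (R S : comAlgType F) (f g : {lrmorphism N -> R}) (f' g' : {lrmorphism N -> S})
    (phi : {lrmorphism R -> S}) s :
  f' =1 phi \o f -> g' =1 phi \o g -> eps f' g' s = phi (eps f g s).
Proof.
move=> ff gg; rewrite /eps rmorph_sum; apply: eq_bigr => x _.
by rewrite rmorphM ff gg.
Qed.

Lemma eps_id (R : comAlgType F) (f g : {lrmorphism N -> R}) s : f =1 g ->
  eps f g s = (s == 1%g)%:R.
Proof.
by move=> fg; rewrite -(rmorph_nat g) -hl /eps rmorph_sum; apply: eq_bigr => x _; rewrite rmorphM fg.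
Qed.

End Galois.

(** * Averaging and corestriction of cocycles *)

Section Transfer.
Variables (F : fieldType) (E : ellipticCurve F) (p : nat).
Variables (K N : fieldAlgType F) (e : {lrmorphism K -> N}).
Variables (gT : finGroupType) (act : gT -> {lrmorphism N -> N}).
Hypothesis gal : galois_datum e act.

Lemma galois_span : exists l : seq (N * N), forall y, exists c : N -> K,
  y = \sum_(x <- l) x.1 * e (c x.2).
Proof.
have [l hl] := galois_sep gal; exists l => y.
have /choice[c cE] : forall z, exists c, e c = tr act (z * y) by move=> z; exact: tr_base.
exists c; rewrite [LHS](sep_expand gal hl); apply: eq_bigr => x _.
by rewrite cE.
Qed.

Lemma galois_finite_type : finite_type e.
Proof.
have [l hl] := galois_span; exists [seq x.1 | x <- l] => P cP eP lP y.
have [c ->] := hl y; have [[P0 _ _] [PD PM]] := subring_closedD cP.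
rewrite big_seq; apply: (big_ind (fun z => z \in P)) => // x xl.
by apply: PM => //; apply: lP; rewrite map_f.
Qed.

Section Norm.
Variables (K0 : fieldAlgType F) (c : {lrmorphism K0 -> K}).
Variables (A B : comAlgType F) (sA : {lrmorphism K0 -> A}).
Variables (i : {lrmorphism A -> B}) (s : {lrmorphism N -> B}).
Variables (iota : gT -> {lrmorphism B -> B}).
Hypotheses (iotai : forall a, iota a \o i =1 i) (iotas : forall a, iota a \o s =1 s \o act a).
Hypothesis iotaM : forall a b, iota (a * b)%g =1 iota a \o iota b.
Hypothesis compat : i \o sA =1 s \o (e \o c).

(** f and g agree only over K. The patched morphism k agrees with f on A and with g on N, so every
    twist of b computes the same value of w, and the sum over the group gives #|gT| times it. This
    sum T is invariant under the twists, and on each component k is f composed with some [iota a],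
    so k and f take T to the same point. *)
Lemma norm_coboundary (w : family E A) (b : ecpoint E B) :
  is_cocycle sA w ->
  (forall (R : comAlgType F) (f g : {lrmorphism B -> R}), agree s f g ->
     pull i w f g = coboundary b f g) ->
  forall (R : comAlgType F) (f g : {lrmorphism B -> R}),
    agree (s \o e : {lrmorphism K -> B}) f g ->
    pull i w f g *+ #|gT| = coboundary (\sum_a ecmap (iota a) b) f g.
Proof.
move=> cw wb R f g fg.
have [l hl] := galois_sep gal.
pose fs : {lrmorphism N -> R} := f \o s; pose gs : {lrmorphism N -> R} := g \o s.
have fgs : fs \o e =1 gs \o e by exact: fg.
have e1 := eps_sum gal hl fgs.
have [k kE] := patch_hom gal hl fgs (fun a => f \o iota a : {lrmorphism B -> R}).
have ki x : k (i x) = f (i x).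
  rewrite kE; under eq_bigr => a _ do rewrite /= -[iota a _]/((iota a \o i) x) iotai.
  by rewrite -mulr_suml e1 mul1r.
have ks x : k (s x) = g (s x).
  rewrite kE; under eq_bigr => a _ do
    rewrite /= -[iota a _]/((iota a \o s) x) iotas -[f _]/(fs (act a x)) -(eps_swap gal hl fgs).
  by rewrite -mulr_suml e1 mul1r.
have agi : agree sA (f \o i : {lrmorphism A -> R}) (g \o i : {lrmorphism A -> R}).
  by move=> x; have /= -> := compat x; exact: fg.
have wE a : pull i w f g = coboundary b (k \o iota a : {lrmorphism B -> R}) (g \o iota a : {lrmorphism B -> R}).
  rewrite -wb; last by move=> x; have /= -> := iotas a x; exact: ks.
  apply: (fam_ext cw) => // x /=; last by have /= -> := iotai a x.
  by have /= -> := iotai a x; rewrite ki.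
set T := \sum_a _.
have -> : pull i w f g *+ #|gT| = ecmap g T - ecmap k T.
  rewrite -sumr_const /T !raddf_sum -big_split; apply: eq_bigr => a _.
  by rewrite /= (wE a) /coboundary !ecmap_ecmap.
rewrite /coboundary; congr (_ - _).
apply: (@ecmap_local _ _ _ _ gT (eps act l fs gs) k (fun a => f \o iota a : {lrmorphism B -> R})) => //.
  by move=> a x; rewrite kE (patch_mul gal hl fgs).
move=> a; rewrite -ecmap_ecmap; congr (ecmap f _).
rewrite /T raddf_sum [RHS](reindex_inj (mulgI a)) /=; apply: eq_bigr => d _.
by rewrite ecmap_ecmap; apply: ecmap_ext => x /=; rewrite iotaM.
Qed.
End Norm.

Lemma actK a x : act a^-1%g (act a x) = x.
Proof.
by case: (gal) => _ aM _ _; rewrite -[LHS]/((act a^-1%g \o act a) x) -aM mulVg (act1 gal).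
Qed.

(** B is the tensor product over N of the conjugates of A, one for each element of the group, so
    that it is of finite type over N and receives all of them. *)
Lemma twists (A : comAlgType F) (s : {lrmorphism N -> A}) : finite_type s ->
  exists (B : comAlgType F) (tau : {lrmorphism N -> B}) (iota : gT -> {lrmorphism A -> B}),
    finite_type tau /\ forall a, iota a \o s =1 tau \o act a.
Proof.
move=> fts; case: (gal) => _ aM _ _.
suff [B [tau [ft h]]] : exists (B : comAlgType F) (tau : {lrmorphism N -> B}),
    finite_type tau /\ forall a, a \in enum gT -> exists iota : {lrmorphism A -> B}, iota \o s =1 tau \o act a.
  have h' a : {iota : {lrmorphism A -> B} | iota \o s =1 tau \o act a}.
    by apply: cid; apply: h; rewrite mem_enum.
  by exists B, tau, (fun a => sval (h' a)); split=> // a; case: (h' a).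
elim: (enum gT) => [|a r [B [tau [ft h]]]].
  exists N, idfun; split=> //; exists [::] => P cP sP _ x; exact: sP.
have [D [i [j tD]]] := tensor_exists (s \o act a^-1%g : {lrmorphism N -> A}) tau.
have ij : i \o (s \o act a^-1%g) =1 j \o tau by case: tD.
exists D, (j \o tau : {lrmorphism N -> D}); split.
  apply: (finite_type_comp ft _ (fun _ => erefl)).
  apply: (finite_type_tensor tD).
  have [m hm] := fts; exists m => P cP sP mP; apply: hm => // x.
  by have := sP (act a x); rewrite /= actK.
move=> d; rewrite inE => /orP[/eqP->|/h[io ioE]].
  exists i => x; have := ij (act a x).
  by rewrite /= actK.
by exists (j \o io : {lrmorphism A -> D}) => x; rewrite /= -[io _]/((io \o s) x) ioE.
Qed.

Section Corestriction.
Variable w : cocycle E p N.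
Local Notation A := (coc_cov w).
Local Notation s := (cov_str (coc_cov w)).
Variables (B : comAlgType F) (tau : {lrmorphism N -> B}) (iota : gT -> {lrmorphism A -> B}).
Hypothesis iotaE : forall a, iota a \o s =1 tau \o act a.
Variables (l : seq (N * N)).
Hypothesis hl : forall s, \sum_(x <- l) x.1 * act s x.2 = (s == 1%g)%:R.

Local Notation agK := (agree (tau \o e : {lrmorphism K -> B})).

(* The twist of the first argument which agrees with the second one over N. *)
Let shifted (R : comAlgType F) (f g : {lrmorphism B -> R}) (h : agK f g) (a : gT) :
  exists k : {lrmorphism A -> R}, forall x, k x =
    \sum_d eps act l (f \o tau : {lrmorphism N -> R}) (g \o tau : {lrmorphism N -> R}) d * f (iota (d * a)%g x).
Proof.
exact: (@patch_hom _ _ _ _ _ _ gal _ hl R (f \o tau : {lrmorphism N -> R}) (g \o tau : {lrmorphism N -> R}) h A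
  (fun d => f \o iota (d * a)%g : {lrmorphism A -> R})).
Qed.
Let shift (R : comAlgType F) (f g : {lrmorphism B -> R}) (h : agK f g) (a : gT) : {lrmorphism A -> R} :=
  sval (cid (@shifted R f g h a)).
Let shiftE (R : comAlgType F) (f g : {lrmorphism B -> R}) (h : agK f g) a x :
  shift h a x = \sum_d eps act l (f \o tau : {lrmorphism N -> R}) (g \o tau : {lrmorphism N -> R}) d * f (iota (d * a)%g x).
Proof. by rewrite /shift; case: cid. Qed.

Let shift_agree (R : comAlgType F) (f g : {lrmorphism B -> R}) (h : agK f g) a :
  agree s (shift h a) (g \o iota a : {lrmorphism A -> R}).
Proof.
case: (gal) => _ aM _ _ x.
rewrite /= shiftE -[iota a _]/((iota a \o s) x) iotaE /=.
under eq_bigr => d _ do rewrite -[iota _ _]/((iota (d * a)%g \o s) x) iotaE /= aM /=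
  -[f _]/((f \o tau : {lrmorphism N -> R}) (act d (act a x))) -(eps_swap gal hl (f := f \o tau : {lrmorphism N -> R}) (g := g \o tau : {lrmorphism N -> R}) h).
by rewrite -mulr_suml (eps_sum gal hl (f := f \o tau : {lrmorphism N -> R}) (g := g \o tau : {lrmorphism N -> R}) h) mul1r.
Qed.

(** The corestriction on the level of cocycles, a sum over the conjugates of w; the shift repairs
    the first argument when f and g agree only over K. Pairs that do not even agree over K get the
    default value 0. *)
Definition cores : family E B := fun R f g =>
  if pselect (agK f g) is left h then
    \sum_a cval (x := w) (shift h a) (g \o iota a : {lrmorphism A -> R}) else 0.

Let coresE (R : comAlgType F) (f g : {lrmorphism B -> R}) (h : agK f g) :
  cores f g = \sum_a cval (x := w) (shift h a) (g \o iota a : {lrmorphism A -> R}).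
Proof.
rewrite /cores; case: pselect => // h'; apply: eq_bigr => a _.
apply: (fam_ext (cval_cocycle w)) => [|x|//]; first exact: shift_agree.
by rewrite !shiftE.
Qed.

(** When f and g agree over N all idempotents except the one at 1 vanish, so the shift does nothing.
    This is the cocycle form of restriction after corestriction. *)
Lemma cores_over (R : comAlgType F) (f g : {lrmorphism B -> R}) : agree tau f g ->
  cores f g = \sum_a cval (x := w) (f \o iota a : {lrmorphism A -> R}) (g \o iota a : {lrmorphism A -> R}).
Proof.
move=> fg; have h : agK f g by move=> x; exact: fg.
rewrite (coresE h); apply: eq_bigr => a _.
apply: (fam_ext (cval_cocycle w)) => [|x|//]; first exact: shift_agree.
rewrite shiftE (bigD1 1%g) //= (eps_id hl) // eqxx mul1r mul1g big1 ?addr0 // => d d1.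
by rewrite (eps_id hl) // (negPf d1) mul0r.
Qed.

Lemma cores_cocycle : is_cocycle (tau \o e : {lrmorphism K -> B}) cores.
Proof.
split=> [R S phi f g f' g' fg ff' gg'|R f g k fg gk].
  have fg' : agK f' g' by move=> x; rewrite /= ff' gg' /=; congr (phi _); exact: fg.
  rewrite (coresE fg) (coresE fg') raddf_sum; apply: eq_bigr => a _.
  apply: (cval_cocycle w).1 => [|x|x]; first exact: shift_agree.
    rewrite /= !shiftE rmorph_sum; apply: eq_bigr => d _.
    rewrite rmorphM ff' /=; congr (_ * _); apply: eps_nat => y; exact: ff' || exact: gg'.
  exact: gg'.
have fk : agK f k by move=> x; rewrite fg gk.
rewrite (coresE fg) (coresE gk) (coresE fk).
pose ft : {lrmorphism N -> R} := f \o tau; pose gt : {lrmorphism N -> R} := g \o tau.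
pose kt : {lrmorphism N -> R} := k \o tau.
(* It is enough to argue on the component where k restricted to N is g composed with [act a]; there
   the summand d of the pair (g, k) matches the summand a d of the pair (f, g). *)
apply: (@ecpoint_local _ _ _ gT (eps act l gt kt)).
- exact: (eps_sum gal hl (f := gt) (g := kt) gk).
- by move=> a; rewrite (eps_orth gal hl (f := gt) (g := kt) gk) eqxx.
move=> a S j ja; rewrite raddfD !raddf_sum /=.
have ja' d : d != a -> j (eps act l gt kt d) = 0.
  move=> da; rewrite -[LHS]mulr1 -ja -rmorphM (eps_orth gal hl (f := gt) (g := kt) gk) (negPf da) rmorph0 //.
have jaR : (j : {rmorphism R -> S}) (eps act l gt kt a) = 1 := ja.
have ja'R d : d != a -> (j : {rmorphism R -> S}) (eps act l gt kt d) = 0 := ja' d.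
have cnat (f1 g1 : {lrmorphism A -> R}) : agree s f1 g1 ->
   ecmap j (cval (x := w) f1 g1) = cval (x := w) (j \o f1 : {lrmorphism A -> S}) (j \o g1 : {lrmorphism A -> S}).
  by move=> h; symmetry; apply: (cval_cocycle w).1.
have E1 : \sum_d ecmap j (cval (x := w) (shift fg d) (g \o iota d : {lrmorphism A -> R})) =
   \sum_d cval (x := w) (j \o shift fg (a * d)%g : {lrmorphism A -> S}) (j \o (g \o iota (a * d)%g) : {lrmorphism A -> S}).
  rewrite [LHS](reindex_inj (mulgI a)) /=; apply: eq_bigr => d _.
  by rewrite cnat //; exact: shift_agree.
rewrite E1 -big_split /=; apply: eq_bigr => d _.
rewrite !cnat; [|exact: shift_agree|exact: shift_agree].
have j2 x : j (shift gk d x) = j (g (iota (a * d)%g x)).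
  rewrite shiftE -/gt -/kt rmorph_sum (bigD1 a) //= rmorphM jaR mul1r big1 ?addr0 // => d' d'a.
  by rewrite rmorphM ja'R // mul0r.
have j3 x : j (shift fk d x) = j (shift fg (a * d)%g x).
  rewrite !shiftE !rmorph_sum [LHS](reindex_inj (mulIg a)) /=; apply: eq_bigr => d' _.
  rewrite !rmorphM mulgA; congr (_ * _).
  pose jf : {lrmorphism N -> S} := j \o ft; pose jg : {lrmorphism N -> S} := j \o gt.
  pose jk : {lrmorphism N -> S} := j \o kt.
  transitivity (eps act l jf jk (d' * a)%g); first by symmetry; exact: eps_nat.
  transitivity (eps act l jf jg d'); last exact: eps_nat.
  have jfg : jf \o e =1 jg \o e by move=> x'; congr (j _); exact: fg.
  have jfk : jf \o e =1 jk \o e by move=> x'; congr (j _); exact: fk.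
  (* On this component the idempotents of (f, k) are those of (f, g) translated by a. *)
  apply: (eps_unique gal hl); first exact: (eps_sum gal hl jfg).
  move=> t y; case: (gal) => _ aM _ _.
  have -> : jk y = jg (act a y).
    have := congr1 j (eps_swap gal hl (f := gt) (g := kt) gk a y).
    by rewrite !rmorphM jaR !mul1r.
  by rewrite (eps_swap gal hl jfg) aM.
have ag1 : agree s (j \o shift gk d : {lrmorphism A -> S}) (j \o (k \o iota d) : {lrmorphism A -> S}).
  by move=> x; congr (j _); exact: shift_agree.
have ag2 : agree s (j \o shift fk d : {lrmorphism A -> S}) (j \o (k \o iota d) : {lrmorphism A -> S}).
  by move=> x; congr (j _); exact: shift_agree.
have ag3 : agree s (j \o shift fg (a * d)%g : {lrmorphism A -> S}) (j \o (g \o iota (a * d)%g) : {lrmorphism A -> S}).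
  by move=> x; congr (j _); exact: shift_agree.
rewrite (fam_ext (cval_cocycle w) (f' := j \o (g \o iota (a * d)%g) : {lrmorphism A -> S}) ag1 j2 (fun _ => erefl)).
rewrite (fam_ext (cval_cocycle w) (f' := j \o shift fg (a * d)%g : {lrmorphism A -> S}) ag2 j3 (fun _ => erefl)).
apply: (cval_cocycle w).2 => // x.
by rewrite /= -j2; exact: ag1.
Qed.

End Corestriction.
End Transfer.

(** * Descent of trivializations *)

Section Trivializations.
Variables (F : fieldType) (E : ellipticCurve F) (p : nat).
Implicit Types K L N : fieldAlgType F.

Definition trivialized L (A : comAlgType F) (s : {lrmorphism L -> A}) (w : family E A)
    (Q : ecpoint E A) :=
  forall (R : comAlgType F) (f g : {lrmorphism A -> R}), agree s f g -> w R f g = coboundary Q f g.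

(** The auxiliary cover C is removed: the covering algebra A of the cocycle, base changed to L, is
    already large enough to carry a trivialization. *)
Lemma trivialization_descent K L (e : {lrmorphism K -> L}) (A C U : comAlgType F)
    (sA : {lrmorphism K -> A}) (sC : {lrmorphism L -> C}) (h : {lrmorphism A -> C})
    (i : {lrmorphism A -> U}) (j : {lrmorphism L -> U}) (w : family E A) (Q : ecpoint E C) :
  is_cocycle sA w -> torsion_family p sA w -> h \o sA =1 sC \o e -> is_tensor sA e i j ->
  trivialized sC (pull h w) Q -> exists Q0 : ecpoint E U, trivialized j (pull i w) Q0 /\
    ((exists n, Q *+ p ^ n = 0) -> exists n, Q0 *+ p ^ n = 0).
Proof.
move=> cw tw hs tU wQ.
have [V [i1 [j1 tV]]] := tensor_exists sC j.
have ij1 : i1 \o sC =1 j1 \o j by case: tV.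
have ij : i \o sA =1 j \o e by case: tU.
pose a1 : {lrmorphism A -> V} := i1 \o h; pose a2 : {lrmorphism A -> V} := j1 \o i.
have a12 : agree sA a1 a2.
  move=> x; rewrite /= -[h _]/((h \o sA) x) hs -[i _]/((i \o sA) x) ij /=.
  exact: ij1.
(* Q corrected by the value of w between the two maps out of A; by the cocycle relation the
   dependence on C cancels, so this point comes from U. *)
pose Q' := ecmap i1 Q + w V a1 a2.
have compQ (R : comAlgType F) (f : {lrmorphism V -> R}) :
    ecmap f Q' = ecmap (f \o i1 : {lrmorphism C -> R}) Q +
      w R (f \o a1 : {lrmorphism A -> R}) (f \o a2 : {lrmorphism A -> R}).
  by rewrite raddfD /= ecmap_ecmap; congr (_ + _); symmetry; apply: cw.1.
have [|Q0 Q0E] := @tensor_descent F E L C U V sC j i1 j1 Q' tV.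
  move=> R f g fg.
  have fgC : agree sC (f \o i1 : {lrmorphism C -> R}) (g \o i1 : {lrmorphism C -> R}).
    by move=> x; rewrite /= -[i1 _]/((i1 \o sC) x) ij1; exact: fg.
  have := wQ R _ _ fgC; rewrite /coboundary => e1.
  pose fa1 : {lrmorphism A -> R} := f \o a1; pose ga1 : {lrmorphism A -> R} := g \o a1.
  pose fa2 : {lrmorphism A -> R} := f \o a2; pose ga2 : {lrmorphism A -> R} := g \o a2.
  have ag1 : agree sA fa1 ga1 by move=> x; have := fgC (e x); have /= -> := hs x.
  have ag2 : agree sA ga1 ga2 by move=> x; congr (g _); exact: a12.
  have ag3 : agree sA fa1 fa2 by move=> x; congr (f _); exact: a12.
  have E1 : w R fa1 fa2 = ecmap (g \o i1 : {lrmorphism C -> R}) Q -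
      ecmap (f \o i1 : {lrmorphism C -> R}) Q + w R ga1 ga2.
    rewrite -e1 (fam_ext cw (f' := fa1) (g' := ga2) ag3) => [|//|x]; last exact: fg.
    rewrite -(cw.2 _ _ _ _ ag1 ag2); congr (_ + _); apply: (fam_ext cw) => //.
  by rewrite !compQ -/fa1 -/fa2 E1 addrA [_ + (_ - _)]addrC subrK.
exists Q0; split; last first.
  move=> tQ; have [n Qn] : exists n, Q' *+ p ^ n = 0.
    apply: ptorsionD; first by case: tQ => n Qn; exists n; rewrite -raddfMn Qn raddf0.
    by case: tw => n tn; exists n; apply: tn.
  exists n; apply: (ecmap_inj (tensor_injr tV)).
  by rewrite raddfMn raddf0 /= Q0E Qn.
move=> R f g fg.
(* C need not map to R, but it maps to the base change R', into which R embeds and where the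
   identity can be checked. *)
have [R' [c [r tR]]] := tensor_exists sC (f \o j : {lrmorphism L -> R}).
have cr : c \o sC =1 r \o (f \o j) by case: tR.
have cr' : c \o sC =1 (r \o g : {lrmorphism U -> R'}) \o j.
  by move=> x; rewrite cr /=; congr (r _); exact: fg.
have [f' [f'i f'j]] := tensor_univ tV (f := c) (g := r \o f : {lrmorphism U -> R'}) cr.
have [g' [g'i g'j]] := tensor_univ tV (f := c) (g := r \o g : {lrmorphism U -> R'}) cr'.
apply: (ecmap_inj (tensor_injr tR)).
have agi : agree sA (f \o i : {lrmorphism A -> R}) (g \o i : {lrmorphism A -> R}).
  by move=> x; rewrite /= -[i _]/((i \o sA) x) ij; exact: fg.
rewrite -(cw.1 _ _ r _ _ (r \o (f \o i) : {lrmorphism A -> R'}) (r \o (g \o i) : {lrmorphism A -> R'}) agi) //.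
rewrite /coboundary raddfB /= !ecmap_ecmap.
rewrite -(ecmap_ext Q0 f'j) -(ecmap_ext Q0 g'j) -!ecmap_ecmap Q0E !compQ.
rewrite (ecmap_ext Q f'i) (ecmap_ext Q g'i).
pose fa1 : {lrmorphism A -> R'} := f' \o a1; pose ga1 : {lrmorphism A -> R'} := g' \o a1.
pose fa2 : {lrmorphism A -> R'} := f' \o a2; pose ga2 : {lrmorphism A -> R'} := g' \o a2.
pose rf : {lrmorphism A -> R'} := r \o (f \o i); pose rg : {lrmorphism A -> R'} := r \o (g \o i).
have e1 x : fa1 x = c (h x) by exact: f'i.
have e2 x : ga1 x = c (h x) by exact: g'i.
have e3 x : fa2 x = rf x by exact: f'j.
have e4 x : ga2 x = rg x by exact: g'j.
have ag0 : agree sA fa1 fa2 by move=> x; congr (f' _); exact: a12.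
have ag1 : agree sA ga1 ga2 by move=> x; congr (g' _); exact: a12.
have ag2 : agree sA rf rg by move=> x; congr (r _); exact: agi.
rewrite opprD addrACA subrr add0r -/fa1 -/ga1 -/fa2 -/ga2 -/rf -/rg.
rewrite (fam_ext cw (f' := fa1) (g' := rg) ag1) => [|x|//]; last by rewrite e1 e2.
rewrite (fam_ext cw (f' := fa1) (g' := rf) ag0) => [|//|//].
have ag3 : agree sA fa1 rf by move=> x; rewrite (ag0 x); exact: e3.
by rewrite -(cw.2 _ _ _ _ ag3 ag2) addrC addKr.
Qed.

(* A trivialization over L only involves finitely many elements of L; it descends
   to a ring B of coefficients containing them, and then pushes forward to N. *)
Lemma trivialization_specialize K L (t : {lrmorphism K -> L}) (A U : comAlgType F)
    (sA : {lrmorphism K -> A}) (i : {lrmorphism A -> U}) (j : {lrmorphism L -> U})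
    (w : family E A) (Q : ecpoint E U) :
  is_cocycle sA w -> is_tensor sA t i j -> trivialized j (pull i w) Q ->
  exists S : seq L, forall (B : comAlgType F) (tB : {lrmorphism K -> B}) (io : {lrmorphism B -> L})
      N (phi : {lrmorphism B -> N}) (t' : {lrmorphism K -> N}) (U' : comAlgType F)
      (i' : {lrmorphism A -> U'}) (j' : {lrmorphism N -> U'}),
    injective io -> io \o tB =1 t -> (forall x, x \in S -> exists y, io y = x) ->
    phi \o tB =1 t' -> is_tensor sA t' i' j' ->
    exists Q' : ecpoint E U', trivialized j' (pull i' w) Q' /\
      ((exists n, Q *+ p ^ n = 0) -> exists n, Q' *+ p ^ n = 0).
Proof.
move=> cw tU wQ; have ij : i \o sA =1 j \o t by case: tU.
have [co hco] := ecpoint_coords Q.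
have /choice[ex exP] : forall x : U, exists l : seq (A * L), x = \sum_(z <- l) i z.1 * j z.2.
  move=> x; have [_ gen _] := tU; have [n [a [b ->]]] := gen x.
  by exists [seq (a k, b k) | k <- enum 'I_n]; rewrite big_map big_enum.
exists (flatten [seq [seq z.2 | z <- ex x] | x <- co]) => B tB io N phi t' U' i' j' injio iot SN phit tU'.
have ij' : i' \o sA =1 j' \o t' by case: tU'.
have [UB [iB [jB tUB]]] := tensor_exists sA tB.
have ijB : iB \o sA =1 jB \o tB by case: tUB.
have compU : i \o sA =1 (j \o io : {lrmorphism B -> U}) \o tB.
  by move=> x; rewrite ij /= -iot.
have [u [ui uj]] := tensor_univ tUB compU.
have inju : injective u by apply: (tensor_map_inj tUB tU injio ui uj).
have [|QB QBE] := hco UB u inju.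
  move=> x xco; rewrite (exP x).
  have {}SN z : z \in ex x -> exists y, io y = z.2.
    move=> zx; apply: SN; apply/flattenP; exists [seq z.2 | z <- ex x]; last exact: map_f.
    by apply/mapP; exists x.
  elim: (ex x) SN => [|z l IH] SN; first by exists 0; rewrite big_nil rmorph0.
  have [y yE] := IH (fun z' h => SN z' (mem_behead (s := z :: l) h)).
  have [b bE] := SN z (mem_head _ _).
  exists (iB z.1 * jB b + y); rewrite big_cons -yE -bE rmorphD rmorphM.
  by congr (_ * _ + _); [exact: ui|exact: uj].
(* the universal pair of B-morphisms out of A (x) B *)
have [V [i1 [i2 tV]]] := tensor_exists sA sA.
have i12 : i1 \o sA =1 i2 \o sA by case: tV.
pose sV : {lrmorphism K -> V} := i1 \o sA.
have [VB [iVB [jVB tVB]]] := tensor_exists sV tB.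
have [VH [iVH [jVH tVH]]] := tensor_exists sV t.
have ijVB : iVB \o sV =1 jVB \o tB by case: tVB.
have ijVH : iVH \o sV =1 jVH \o t by case: tVH.
have cV : iVH \o sV =1 (jVH \o io : {lrmorphism B -> VH}) \o tB by move=> x; rewrite ijVH /= -iot.
have [z [zi zj]] := tensor_univ tVB cV.
have injz : injective z by apply: (tensor_map_inj tVB tVH injio zi zj).
have c1 : (iVB \o i1 : {lrmorphism A -> VB}) \o sA =1 jVB \o tB by exact: ijVB.
have c2 : (iVB \o i2 : {lrmorphism A -> VB}) \o sA =1 jVB \o tB.
  by move=> x; rewrite -ijVB /= -[i2 _]/((i2 \o sA) x) -i12.
have [f0 [f0i f0j]] := tensor_univ tUB c1.
have [g0 [g0i g0j]] := tensor_univ tUB c2.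
have d1 : (iVH \o i1 : {lrmorphism A -> VH}) \o sA =1 jVH \o t by exact: ijVH.
have d2 : (iVH \o i2 : {lrmorphism A -> VH}) \o sA =1 jVH \o t.
  by move=> x; rewrite -ijVH /= -[i2 _]/((i2 \o sA) x) -i12.
have [f1 [f1i f1j]] := tensor_univ tU d1.
have [g1 [g1i g1j]] := tensor_univ tU d2.
have f1u : f1 \o u =1 z \o f0.
  apply: (tensor_uniq tUB (h := f1 \o u : {lrmorphism UB -> VH}) (h' := z \o f0 : {lrmorphism UB -> VH})) => x /=.
    rewrite -[u _]/((u \o iB) x) ui -[f1 _]/((f1 \o i) x) f1i -[f0 _]/((f0 \o iB) x) f0i /=.
    by rewrite -[z _]/((z \o iVB) (i1 x)) zi.
  rewrite -[u _]/((u \o jB) x) uj /= -[f1 _]/((f1 \o j) (io x)) f1j -[f0 _]/((f0 \o jB) x) f0j /=.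
  by rewrite -[z _]/((z \o jVB) x) zj.
have g1u : g1 \o u =1 z \o g0.
  apply: (tensor_uniq tUB (h := g1 \o u : {lrmorphism UB -> VH}) (h' := z \o g0 : {lrmorphism UB -> VH})) => x /=.
    rewrite -[u _]/((u \o iB) x) ui -[g1 _]/((g1 \o i) x) g1i -[g0 _]/((g0 \o iB) x) g0i /=.
    by rewrite -[z _]/((z \o iVB) (i2 x)) zi.
  rewrite -[u _]/((u \o jB) x) uj /= -[g1 _]/((g1 \o j) (io x)) g1j -[g0 _]/((g0 \o jB) x) g0j /=.
  by rewrite -[z _]/((z \o jVB) x) zj.
have agV : agree sA (iVB \o i1 : {lrmorphism A -> VB}) (iVB \o i2 : {lrmorphism A -> VB}).
  by move=> x; rewrite c1 c2.
(* The coboundary relation is a single identity between points over the universal pair of morphisms.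
   It holds after extension to L, and VB embeds in VH, so it holds over B; every other instance is a
   specialization of this one. *)
have univ : w VB (iVB \o i1 : {lrmorphism A -> VB}) (iVB \o i2 : {lrmorphism A -> VB}) = ecmap g0 QB - ecmap f0 QB.
  apply: (ecmap_inj injz); rewrite raddfB /= !ecmap_ecmap.
  rewrite -(ecmap_ext QB f1u) -(ecmap_ext QB g1u) -!ecmap_ecmap QBE.
  have agj : agree j f1 g1 by move=> x; rewrite f1j g1j.
  have := wQ VH f1 g1 agj; rewrite /coboundary => <-; symmetry.
  apply: cw.1 agV _ _ => x /=.
    by rewrite -[f1 _]/((f1 \o i) x) f1i -[z _]/((z \o iVB) (i1 x)) zi.
  by rewrite -[g1 _]/((g1 \o i) x) g1i -[z _]/((z \o iVB) (i2 x)) zi.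
have compU' : i' \o sA =1 (j' \o phi : {lrmorphism B -> U'}) \o tB by move=> x; rewrite ij' /= -phit.
have [rho [rhoi rhoj]] := tensor_univ tUB compU'.
exists (ecmap rho QB); split; last first.
  move=> [n Qn]; exists n; rewrite -raddfMn /=.
  suff -> : QB *+ p ^ n = 0 by rewrite raddf0.
  by apply: (ecmap_inj inju); rewrite raddfMn raddf0 /= QBE.
move=> R f g fg.
have agi : (f \o i' : {lrmorphism A -> R}) \o sA =1 (g \o i' : {lrmorphism A -> R}) \o sA.
  by move=> x; rewrite /= -[i' _]/((i' \o sA) x) ij'; exact: fg.
have [y [y1 y2]] := tensor_univ tV agi.
have cy : y \o sV =1 (f \o j' \o phi : {lrmorphism B -> R}) \o tB.
  move=> x; rewrite /= -[y _]/((y \o i1) (sA x)) y1 /= -[i' _]/((i' \o sA) x) ij' /=.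
  by rewrite -[phi _]/((phi \o tB) x) phit.
have [th [thi thj]] := tensor_univ tVB cy.
have fth : f \o rho =1 th \o f0.
  apply: (tensor_uniq tUB (h := f \o rho : {lrmorphism UB -> R}) (h' := th \o f0 : {lrmorphism UB -> R})) => x /=.
    rewrite -[rho _]/((rho \o iB) x) rhoi -[f0 _]/((f0 \o iB) x) f0i /=.
    by rewrite -[th _]/((th \o iVB) (i1 x)) thi -[y _]/((y \o i1) x) y1.
  rewrite -[rho _]/((rho \o jB) x) rhoj -[f0 _]/((f0 \o jB) x) f0j /=.
  by rewrite -[th _]/((th \o jVB) x) thj.
have gth : g \o rho =1 th \o g0.
  apply: (tensor_uniq tUB (h := g \o rho : {lrmorphism UB -> R}) (h' := th \o g0 : {lrmorphism UB -> R})) => x /=.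
    rewrite -[rho _]/((rho \o iB) x) rhoi -[g0 _]/((g0 \o iB) x) g0i /=.
    by rewrite -[th _]/((th \o iVB) (i2 x)) thi -[y _]/((y \o i2) x) y2.
  rewrite -[rho _]/((rho \o jB) x) rhoj -[g0 _]/((g0 \o jB) x) g0j /=.
  by rewrite -[th _]/((th \o jVB) x) thj /=; symmetry; exact: fg.
rewrite /coboundary !ecmap_ecmap (ecmap_ext QB fth) (ecmap_ext QB gth) -!ecmap_ecmap -raddfB /= -univ.
apply: cw.1 agV _ _ => x /=.
  by rewrite -[th _]/((th \o iVB) (i1 x)) thi -[y _]/((y \o i1) x) y1.
by rewrite -[th _]/((th \o iVB) (i2 x)) thi -[y _]/((y \o i2) x) y2.
Qed.

End Trivializations.

(** u inverts m modulo p^n. It does not depend on the group, so it can be fixed before a cocycle is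
    evaluated on any ring. *)
Lemma coprime_mulr (p n m : nat) : coprime p m -> exists u, forall (V : zmodType) (x : V),
  x *+ p ^ n = 0 -> x *+ (m * u) = x.
Proof.
move=> cpm; have [->|n0] := posnP n.
  by exists 0%N => V x; rewrite expn0 mulr1n => ->; rewrite mul0rn.
have [m0|m0] := posnP m.
  move: cpm; rewrite m0 /coprime gcdn0 => /eqP ->.
  by exists 0%N => V x; rewrite exp1n mulr1n => ->; rewrite mul0rn.
have : coprime m (p ^ n) by rewrite coprime_sym coprimeXl.
case: (egcdnP (p ^ n) m0) => km kn eq _ c.
exists km => V x tx; move: c; rewrite /coprime => /eqP g1.
by rewrite mulnC eq g1 mulrnDr mulnC mulrnA tx mul0rn add0r mulr1n.
Qed.

(** * Descent through a tower of finite levels *)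

Section Tower.
Variables (F : fieldType) (E : ellipticCurve F) (p : nat).
Implicit Types K L N : fieldAlgType F.

(** The group acts on U through the factor N; the sum of the conjugates of Q trivializes #|gT| times
    w, and u divides by #|gT|. The base K0 of the cocycle is kept apart from K because K will also
    be a completion of K0. *)
Lemma galois_trivial K0 K N (c : {lrmorphism K0 -> K}) (e : {lrmorphism K -> N})
    (gT : finGroupType) (act : gT -> {lrmorphism N -> N}) (A U : comAlgType F)
    (sA : {lrmorphism K0 -> A}) (i : {lrmorphism A -> U}) (j : {lrmorphism N -> U})
    (w : family E A) (Q : ecpoint E U) :
  galois_datum e act -> coprime p #|gT| -> is_cocycle sA w -> torsion_family p sA w ->
  is_tensor sA (e \o c : {lrmorphism K0 -> N}) i j -> trivialized j (pull i w) Q ->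
  exists Q' : ecpoint E U, trivialized (j \o e : {lrmorphism K -> U}) (pull i w) Q' /\
    ((exists n, Q *+ p ^ n = 0) -> exists n, Q' *+ p ^ n = 0).
Proof.
move=> gal cop cw [n tw] tU tQ; have ij : i \o sA =1 j \o (e \o c) by case: tU.
case: (gal) => actE aM _ _.
have /(_ _)/cid-/all_sig[iota iotaE] : forall a, exists iota : {lrmorphism U -> U},
    iota \o i =1 i /\ iota \o j =1 j \o act a.
  move=> a; apply: (tensor_univ tU (f := i) (g := j \o act a : {lrmorphism N -> U})) => x.
  by rewrite ij /= actE.
have iotaM a b : iota (a * b)%g =1 iota a \o iota b.
  apply: (tensor_uniq tU (h' := iota a \o iota b : {lrmorphism U -> U})) => x /=.
    have /= -> := (iotaE (a * b)%g).1 x; have /= -> := (iotaE b).1 x.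
    by symmetry; exact: (iotaE a).1.
  have /= -> := (iotaE (a * b)%g).2 x; have /= -> := (iotaE b).2 x.
  by have /= -> := (iotaE a).2 (act b x); rewrite aM.
have H := norm_coboundary gal (fun a => (iotaE a).1) (fun a => (iotaE a).2) iotaM ij cw tQ.
have [u uP] := coprime_mulr n cop.
exists ((\sum_a ecmap (iota a) Q) *+ u); split.
  move=> R f g fg; rewrite coboundaryMn -H // -mulrnA uP //.
  by apply: tw => x; rewrite /= -[i _]/((i \o sA) x) ij; exact: fg.
move=> [m Qm]; exists m; rewrite -mulrnA mulnC mulrnA -sumrMnl.
by rewrite big1 ?mul0rn // => a _; rewrite -raddfMn Qm raddf0.
Qed.

(** What the cohomological part uses of the extension. The lifts to L allow the invariance of a
    class over L to be exploited at a finite level. *)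
Definition galois_tower K L (e : {lrmorphism K -> L}) :=
  forall S : seq L, exists N (j : {lrmorphism N -> L}) (e' : {lrmorphism K -> N})
    (gT : finGroupType) (act : gT -> {lrmorphism N -> N}),
  [/\ galois_datum e' act, j \o e' =1 e, forall x, x \in S -> exists y, j y = x,
      coprime p #|gT| & forall a, exists s, Gal e s /\ s \o j =1 j \o act a].

(** The trivialization passes from C to the base change of A to L, from there to a finite level N,
    and is then averaged down to K; D is the base change of A to N, viewed over K. *)
Lemma tower_trivial K L (e : {lrmorphism K -> L}) (A C : comAlgType F)
    (sA : {lrmorphism K -> A}) (sC : {lrmorphism L -> C}) (h : {lrmorphism A -> C})
    (w : family E A) (Q : ecpoint E C) :
  galois_tower e -> finite_type sA -> is_cocycle sA w -> torsion_family p sA w ->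
  h \o sA =1 sC \o e -> trivialized sC (pull h w) Q ->
  exists (D : cover K) (v : {lrmorphism A -> D}) (Q' : ecpoint E D),
  [/\ v \o sA =1 cov_str D, trivialized (cov_str D) (pull v w) Q' &
    (exists n, Q *+ p ^ n = 0) -> exists n, Q' *+ p ^ n = 0].
Proof.
move=> tow fA cw tw hs tQ.
have [U [i [j tU]]] := tensor_exists sA e.
have [Q0 [tQ0 toQ0]] := trivialization_descent cw tw hs tU tQ.
have [S SP] := trivialization_specialize p cw tU tQ0.
have [N [jN [e' [gT [act [gal je SN cop _]]]]]] := tow S.
have [U' [i' [j' tU']]] := tensor_exists sA e'.
have [Q1 [tQ1 toQ1]] := SP N e' jN N idfun e' U' i' j' (fmorph_inj jN) je SN (fun=> erefl) tU'.
have [Q' [tQ' toQ']] := galois_trivial (c := idfun) gal cop cw tw tU' tQ1.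
have ft : finite_type (j' \o e' : {lrmorphism K -> U'}).
  exact: finite_type_comp (galois_finite_type gal) (finite_type_tensor tU' fA) (fun _ => erefl).
exists (Cover ft), i', Q'; split=> //; first by case: tU'.
by move=> h1; apply/toQ'/toQ1/toQ0.
Qed.

Lemma opp_cocycle L (A : comAlgType F) (s : {lrmorphism L -> A}) (w : family E A) :
  is_cocycle s w -> is_cocycle s (fun R f g => - w R f g).
Proof.
move=> cw; split=> [R S phi f g f' g' fg ff' gg'|R f g k fg gk].
  by rewrite (cw.1 _ _ _ _ _ _ _ fg ff' gg') raddfN.
by rewrite -opprD cw.2.
Qed.

Lemma opp_torsion L (A : comAlgType F) (s : {lrmorphism L -> A}) (w : family E A) :
  torsion_family p s w -> torsion_family p s (fun R f g => - w R f g).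
Proof. by move=> [n tw]; exists n => R f g fg; rewrite mulNrn tw // oppr0. Qed.

(** The difference of x and y on a common cover becomes a torsion coboundary over L; [tower_trivial]
    brings the trivializing point down to K and keeps it torsion. *)
Lemma tower_injective K L (e : {lrmorphism K -> L}) (x y : cocycle E p K) (z : cocycle E p L) :
  galois_tower e -> restricts_to e x z -> restricts_to e y z -> cohomologous x y.
Proof.
move=> tow rx ry.
have [A [vx [vy [vxs vys]]]] := cover_push (coc_cov x) (coc_cov y).
pose w : family E A := fun R f g => pull vx (@cval _ _ _ _ x) f g + (- pull vy (@cval _ _ _ _ y) f g).
have cx := pull_cocycle (e := idfun) (cval_cocycle x) vxs.
have cy := pull_cocycle (e := idfun) (cval_cocycle y) vys.
have cw : is_cocycle (cov_str A) w by apply: add_cocycle => //; exact: opp_cocycle.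
have tw : torsion_family p (cov_str A) w.
  apply: add_torsion; first exact: (pull_torsion (e := idfun) vxs (cval_torsion x)).
  exact/opp_torsion/(pull_torsion (e := idfun) vys (cval_torsion y)).
have [D0 [v0 v0s]] := cover_base e A.
have [D1 [v1 [vz [v1s vzs]]]] := cover_push D0 (coc_cov z).
pose h1 : {lrmorphism A -> D1} := v1 \o v0.
have h1s : h1 \o cov_str A =1 cov_str D1 \o e by exact: (compat_comp (e := e) v0s v1s).
have hx : (h1 \o vx : {lrmorphism _ -> _}) \o cov_str (coc_cov x) =1 cov_str D1 \o e.
  by move=> u; rewrite /= -[vx _]/((vx \o cov_str _) u) vxs; exact: h1s.
have hy : (h1 \o vy : {lrmorphism _ -> _}) \o cov_str (coc_cov y) =1 cov_str D1 \o e.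
  by move=> u; rewrite /= -[vy _]/((vy \o cov_str _) u) vys; exact: h1s.
have [D2 [v2 [v2s c2]]] := rt_refine rx hx vzs.
have hy2 : (v2 \o (h1 \o vy) : {lrmorphism _ -> _}) \o cov_str (coc_cov y) =1 cov_str D2 \o e.
  exact: (compat_comp hy v2s).
have hx2 : (v2 \o (h1 \o vx) : {lrmorphism _ -> _}) \o cov_str (coc_cov x) =1 cov_str D2 \o e.
  exact: (compat_comp hx v2s).
have vz2 : (v2 \o vz : {lrmorphism _ -> _}) \o cov_str (coc_cov z) =1 cov_str D2.
  exact: (compat_comp (e := idfun) vzs v2s).
have [C [v3 [v3s c3]]] := rt_refine ry hy2 vz2.
have c4 := coh_push (e := idfun) (a := e) (b := idfun) (cval_cocycle x) (cval_cocycle z) hx2 vz2 v3s c2.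
have [b [tb hb]] := coh_trans c4 (coh_sym c3).
pose h : {lrmorphism A -> C} := v3 \o (v2 \o h1).
have hs : h \o cov_str A =1 cov_str C \o e.
  exact: (compat_comp (compat_comp h1s v2s) v3s).
have hw : trivialized (cov_str C) (pull h w) b.
  move=> R f g fg; have := hb R f g fg => /(canLR (addKr _)) <-.
  rewrite addrC /w /pull; congr (_ - _).
    apply: (fam_ext (cval_cocycle x)) => // u.
    by have /= -> := compat_comp hx2 v3s u; exact: fg.
  apply: (fam_ext (cval_cocycle y)) => // u.
  by have /= -> := compat_comp hy2 v3s u; exact: fg.
have [D [v [b' [vs tb' tob]]]] := tower_trivial tow (cov_ft A) cw tw hs hw.
apply/restricts_toP; exists D, (v \o vx : {lrmorphism _ -> _}), (v \o vy : {lrmorphism _ -> _}).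
have vvx := compat_comp (e := idfun) vxs vs; have vvy := compat_comp (e := idfun) vys vs.
split=> //; exists b'; split; first exact: tob.
move=> R f g fg; rewrite -tb' // /w /(pull v) [RHS]addrC.
rewrite -[LHS]addr0; rewrite -addrA; congr (_ + _).
  apply: (fam_ext (cval_cocycle x)) => // u.
  by have /= -> := vvx u; exact: fg.
apply/esym/eqP; rewrite addrC subr_eq0; apply/eqP.
apply: (fam_ext (cval_cocycle y)) => // u.
by have /= -> := vvy u; exact: fg.
Qed.

End Tower.

(** * Descent of invariant classes *)

Lemma factor_inj (F : fieldType) (A B C : comAlgType F) (f : {lrmorphism B -> C})
    (i : {lrmorphism A -> C}) :
  injective i -> (forall b, exists a, i a = f b) ->
  exists g : {lrmorphism B -> A}, i \o g =1 f.
Proof.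
move=> inj /choice[h hE].
have hER x : (i : {rmorphism A -> C}) (h x) = (f : {rmorphism B -> C}) x by exact: hE.
have [|||g gE] := @build_lrmorph F B A h.
- by move=> c; apply: (inj); rewrite hE !lrmorph_cA.
- by move=> x y; apply: (inj); rewrite rmorphD !hER rmorphD.
- by move=> x y; apply: (inj); rewrite rmorphM !hER rmorphM.
by exists g => b; rewrite /= gE hE.
Qed.

(** A finite basis reduces the descent of an algebra to that of its finitely many structure
    constants. *)
Definition free_basis (F : fieldType) (L : fieldAlgType F) (A : comAlgType F)
    (s : {lrmorphism L -> A}) n (beta : 'I_n -> A) :=
  (forall x, exists c : 'I_n -> L, x = \sum_k s (c k) * beta k) /\
  (forall c : 'I_n -> L, \sum_k s (c k) * beta k = 0 -> forall k, c k = 0).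

Section CocycleLimit.
Variables (F : fieldType) (E : ellipticCurve F) (p : nat) (L : fieldAlgType F).
Variables (A : comAlgType F) (s : {lrmorphism L -> A}) (n : nat) (beta : 'I_n -> A).
Hypothesis bas : free_basis s beta.

Let co (x : A) : 'I_n -> L := sval (cid (bas.1 x)).
Let coE x : x = \sum_k s (co x k) * beta k.
Proof. by rewrite /co; case: cid. Qed.
Let co_uniq x c : x = \sum_k s (c k) * beta k -> forall k, co x k = c k.
Proof.
move=> e k; apply/eqP; rewrite -subr_eq0; apply/eqP; move: k; apply: bas.2.
under eq_bigr => k _ do rewrite rmorphB mulrBl.
by rewrite sumrB -coE -e subrr.
Qed.
Let coD x y k : co (x + y) k = co x k + co y k.
Proof.
apply: (co_uniq (c := fun k => co x k + co y k)); rewrite {1}(coE x) {1}(coE y) -big_split.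
by apply: eq_bigr => m _; rewrite rmorphD mulrDl.
Qed.
Let coN x k : co (- x) k = - co x k.
Proof.
apply: (co_uniq (c := fun k => - co x k)); rewrite {1}(coE x) -sumrN.
by apply: eq_bigr => m _; rewrite rmorphN mulNr.
Qed.
Let coZ c x k : co (s c * x) k = c * co x k.
Proof.
apply: (co_uniq (c := fun k => c * co x k)); rewrite {1}(coE x) mulr_sumr.
by apply: eq_bigr => m _; rewrite rmorphM mulrA.
Qed.
Let co0 k : co 0 k = 0.
Proof. by have := coD 0 0 k; rewrite addr0 => /eqP; rewrite -[X in X == _]addr0 (inj_eq (addrI _)) eq_sym => /eqP. Qed.
Let co_sum (I : Type) (r : seq I) (f : I -> A) k : co (\sum_(i <- r) f i) k = \sum_(i <- r) co (f i) k.
Proof. exact: (big_morph (fun x => co x k) (fun x y => coD x y k) (co0 k)). Qed.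
Let co_beta m k : co (beta m) k = (m == k)%:R.
Proof.
apply: (co_uniq (c := fun k => (m == k)%:R)); rewrite (bigD1 m) //= eqxx rmorph1 mul1r big1 ?addr0 //.
by move=> k' /negPf; rewrite eq_sym => ->; rewrite rmorph0 mul0r.
Qed.

Section Sub.
Variables (N : fieldAlgType F) (j : {lrmorphism N -> L}).
Hypothesis j1 : forall k, exists y, j y = co 1 k.
Hypothesis jM : forall k m r, exists y, j y = co (beta k * beta m) r.

Let inN (x : L) := exists y, j y = x.
Let inN_D x y : inN x -> inN y -> inN (x + y).
Proof. by move=> [a <-] [b <-]; exists (a + b); rewrite rmorphD. Qed.
Let inN_M x y : inN x -> inN y -> inN (x * y).
Proof. by move=> [a <-] [b <-]; exists (a * b); rewrite rmorphM. Qed.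
Let inN_N x : inN x -> inN (- x).
Proof. by move=> [a <-]; exists (- a); rewrite rmorphN. Qed.
Let inN_sum (I : Type) (r : seq I) (f : I -> L) : (forall i, inN (f i)) -> inN (\sum_(i <- r) f i).
Proof. by move=> h; apply: big_ind => //; exists 0; rewrite rmorph0. Qed.

(** A0 is the span of the basis over N, a ring once the structure constants lie in N. The last
    clause extends functionals from A0 to A, which is what makes the tensor square of A0 embed in
    that of A. *)
Lemma basis_descends : exists (A0 : comAlgType F) (i : {lrmorphism A0 -> A}) (s0 : {lrmorphism N -> A0}),
  [/\ injective i, is_tensor s0 j i s, finite_type s0,
      forall x, (forall k, exists y, j y = co x k) -> exists a, i a = x &
      forall phi, functional s0 phi -> exists Phi, functional s Phi /\ forall a, Phi (i a) = j (phi a)].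
Proof.
pose P : {pred A} := [pred x | `[< forall k, inN (co x k) >]].
have PP x : reflect (forall k, inN (co x k)) (x \in P) by exact: asboolP.
have PZ y x : x \in P -> s (j y) * x \in P.
  by move=> /PP h; apply/PP => k; rewrite coZ; apply: inN_M => //; exists y.
have P1 : 1 \in P by apply/PP; exact: j1.
have cP : subring_closed P.
  split=> // [x y /PP hx /PP hy|x y /PP hx /PP hy]; apply/PP => k.
    by rewrite coD coN; apply: inN_D => //; exact: inN_N.
  rewrite {1}(coE x) {1}(coE y) mulr_suml co_sum; apply: inN_sum => m.
  rewrite mulr_sumr co_sum; apply: inN_sum => r.
  rewrite mulrACA -rmorphM coZ; apply: inN_M; [exact: inN_M|exact: jM].
have FP (c : F) : c%:A \in P.
  by rewrite -(lrmorph_cA s) -(lrmorph_cA j) -[s _]mulr1 PZ.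
have [A0 [i [inji iP]]] := subalgebra cP FP.
have [s0 s0E] : exists s0 : {lrmorphism N -> A0}, i \o s0 =1 s \o j.
  apply: (@factor_inj _ _ _ _ (s \o j : {lrmorphism N -> A})) => // y.
  by apply/iP; rewrite /= -[s _]mulr1 PZ.
have /choice[b bE] : forall k, exists a, i a = beta k.
  move=> k; apply/iP/PP => m; rewrite co_beta.
  by exists (k == m)%:R; rewrite rmorph_nat.
have expand a : exists y : 'I_n -> N, (forall k, j (y k) = co (i a) k) /\ a = \sum_k s0 (y k) * b k.
  have /choice[y yE] : forall k, exists y, j y = co (i a) k.
    by apply/PP/iP; exists a.
  exists y; split=> //; apply: (inji); rewrite rmorph_sum {1}(coE (i a)); apply: eq_bigr => k _.
  by rewrite rmorphM -yE -bE; congr (_ * _); symmetry; exact: s0E.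
have Phi phi : functional s0 phi -> exists Phi, functional s Phi /\ forall a, Phi (i a) = j (phi a).
  move=> h; exists (fun x => \sum_k co x k * j (phi (b k))); split; first split.
  - by move=> x y; rewrite -big_split; apply: eq_bigr => k _; rewrite coD mulrDl.
  - by move=> c x; rewrite mulr_sumr; apply: eq_bigr => k _; rewrite coZ mulrA.
  - move=> a; have [y [yE aE]] := expand a.
    rewrite {2}aE (functional_sum _ _ h) rmorph_sum; apply: eq_bigr => k _.
    by rewrite h.2 rmorphM -yE.
exists A0, i, s0; split=> //.
- split=> // [x|phi h].
    exists n, b, (co x); rewrite {1}(coE x); apply: eq_bigr => k _.
    by rewrite bE mulrC.
  have [Phi' [h' Phi'E]] := Phi phi h; exists Phi'; split=> [x y|a l]; first by rewrite h'.1.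
  by rewrite mulrC h'.2 Phi'E mulrC.
- exists [seq b k | k <- enum 'I_n] => B cB sB bB a.
  have [y [_ ->]] := expand a; have [[B0 _ _] [BD BM]] := subring_closedD cB.
  apply: (big_ind (fun z => z \in B)) => // k _.
  by apply: BM => //; apply: bB; apply: map_f; rewrite mem_enum.
- by move=> x h; apply/iP/PP.
Qed.
End Sub.

(** A cocycle is one point P over the tensor square of A. The list S collects the coordinates of 1,
    the structure constants, and the coordinates of the tensors that occur in P. *)
Lemma cocycle_descends (z : cocycle E p L) (q : {lrmorphism coc_cov z -> A}) :
  q \o cov_str (coc_cov z) =1 s ->
  exists S : seq L, forall (N : fieldAlgType F) (j : {lrmorphism N -> L}),
    (forall x, x \in S -> exists y, j y = x) ->
    exists w : cocycle E p N, restricts_to j w z.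
Proof.
move=> qs.
have [W [i1 [i2 tW]]] := tensor_exists s s.
have i12 : i1 \o s =1 i2 \o s by case: tW.
pose w0 := pull q (@cval _ _ _ _ z).
have cw0 : is_cocycle s w0 by apply: (pull_cocycle (e := idfun) (cval_cocycle z)).
have tw0 : torsion_family p s w0 by apply: (pull_torsion (e := idfun) qs (cval_torsion z)).
pose P := w0 W i1 i2.
have [cs hcs] := ecpoint_coords P.
have /choice[ex exP] : forall x : W, exists l : seq (A * A), x = \sum_(z <- l) i1 z.1 * i2 z.2.
  move=> x; have [_ gen _] := tW; have [m [a [b ->]]] := gen x.
  by exists [seq (a k, b k) | k <- enum 'I_m]; rewrite big_map big_enum.
pose coords (x : A) : seq L := [seq co x k | k <- enum 'I_n].
pose S := coords 1 ++ flatten [seq coords (beta k * beta m) | k <- enum 'I_n, m <- enum 'I_n]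
  ++ flatten [seq flatten [seq coords u.1 ++ coords u.2 | u <- ex x] | x <- cs].
exists S => N j SN.
have coordsN x : {subset coords x <= S} -> forall k, exists y, j y = co x k.
  by move=> sub k; apply: SN; apply: sub; apply: map_f; rewrite mem_enum.
have [|k m r|A0 [i [s0 [inji tA ft iP PhiP]]]] := @basis_descends N j.
- by apply: coordsN => x h; rewrite /S mem_cat h.
- move: r; apply: coordsN => x h; rewrite /S !mem_cat; apply/orP; right; apply/orP; left.
  apply/flattenP; exists (coords (beta k * beta m)) => //.
  by apply: allpairs_f; rewrite mem_enum.
have exN x u : x \in cs -> u \in ex x -> (exists a, i a = u.1) /\ (exists a, i a = u.2).
  move=> xc ux.
  have sub : {subset coords u.1 ++ coords u.2 <= S}.
    move=> y hy; rewrite /S !mem_cat; apply/orP; right; apply/orP; right.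
    apply/flattenP; exists (flatten [seq coords u.1 ++ coords u.2 | u <- ex x]).
      by apply/mapP; exists x.
    by apply/flattenP; exists (coords u.1 ++ coords u.2) => //; apply/mapP; exists u.
  by split; apply: iP; apply: coordsN => y hy; apply: sub; rewrite mem_cat hy ?orbT.
have is0 : i \o s0 =1 s \o j by case: tA.
have [W0 [k1 [k2 tW0]]] := tensor_exists s0 s0.
have k12 : k1 \o s0 =1 k2 \o s0 by case: tW0.
have [psi [psi1 psi2]] : exists psi : {lrmorphism W0 -> W}, psi \o k1 =1 i1 \o i /\ psi \o k2 =1 i2 \o i.
  apply: (tensor_univ tW0 (f := i1 \o i : {lrmorphism A0 -> W}) (g := i2 \o i : {lrmorphism A0 -> W})) => x.
  by rewrite /= -[i _]/((i \o s0) x) is0; exact: i12.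
have injpsi : injective psi.
  suff inj0 x : psi x = 0 -> x = 0.
    by move=> x y e; apply/eqP; rewrite -subr_eq0; apply/eqP/inj0/eqP; rewrite rmorphB subr_eq0; apply/eqP.
  have [m [a [b [phi [-> h1 h2]]]]] := tensor_indep tW0 x.
  rewrite rmorph_sum => e; apply: big1 => k _.
  have [Phi [hPhi PhiE]] := PhiP _ (h1 k).
  have [sl [slD slE _]] := tensor_slice tW hPhi.
  have sl0 : sl 0 = 0 by apply: (addrI (sl 0)); rewrite -slD !addr0.
  have PE r : psi (k1 (a r) * k2 (b r)) = i1 (i (a r)) * i2 (i (b r)).
    by rewrite rmorphM; congr (_ * _); [exact: psi1|exact: psi2].
  move: sl0; rewrite -e (additive_sum _ _ slD) (bigD1 k) //= PE slE PhiE h2 eqxx !rmorph1 mul1r.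
  rewrite big1 ?addr0 => [ib|r ne]; last by rewrite PE slE PhiE h2 eq_sym (negPf ne) !rmorph0 mul0r.
  have -> : b k = 0 by apply: (inji); rewrite ib rmorph0.
  by rewrite rmorph0 mulr0.
have [|P0 P0E] := hcs W0 psi injpsi.
  move=> x xc; rewrite (exP x).
  have h u : u \in ex x -> exists v, psi v = i1 u.1 * i2 u.2.
    move=> ux; have [[a <-] [b <-]] := exN x u xc ux.
    by exists (k1 a * k2 b); rewrite rmorphM; congr (_ * _); [exact: psi1|exact: psi2].
  elim: (ex x) h => [|u l IH] h; first by exists 0; rewrite big_nil rmorph0.
  have [y yE] := IH (fun z' hz => h z' (mem_behead (s := u :: l) hz)).
  have [v vE] := h u (mem_head _ _).
  by exists (v + y); rewrite big_cons -yE -vE rmorphD.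
have mapP (R : comAlgType F) (f g : {lrmorphism A0 -> R}) : agree s0 f g ->
    exists h : {lrmorphism W0 -> R}, h \o k1 =1 f /\ h \o k2 =1 g.
  by move=> fg; exact: (tensor_univ tW0).
pose w : family E A0 := fun R f g =>
  if pselect (agree s0 f g) is left h then ecmap (sval (cid (mapP R f g h))) P0 else 0.
have wE (R : comAlgType F) (f g : {lrmorphism A0 -> R}) (h : {lrmorphism W0 -> R}) :
    agree s0 f g -> h \o k1 =1 f -> h \o k2 =1 g -> w R f g = ecmap h P0.
  move=> fg h1 h2; rewrite /w; case: pselect => // fg'; case: cid => h' /= [h'1 h'2].
  apply: ecmap_ext; apply: (tensor_uniq tW0) => x; first by rewrite h'1 h1.
  by rewrite h'2 h2.
(* Identities between values of w over R are checked in R', the base change of R from N to L: R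
   embeds in it, and the morphisms from A0 extend to A there. *)
have w_lift (R : comAlgType F) (f : {lrmorphism A0 -> R}) :
    exists (R' : comAlgType F) (r : {lrmorphism R -> R'}), injective r /\
    exists lift : {lrmorphism A0 -> R} -> {lrmorphism A -> R'},
    forall g h, agree s0 f g -> agree s0 f h ->
    agree s (lift g) (lift h) /\ ecmap r (w R g h) = w0 R' (lift g) (lift h).
  have [R' [r [lam tR]]] := tensor_exists (f \o s0 : {lrmorphism N -> R}) j.
  have rl : r \o (f \o s0) =1 lam \o j by case: tR.
  exists R', r; split; first exact: tensor_injl tR.
  have /choice[lift liftP] : forall g : {lrmorphism A0 -> R}, exists g' : {lrmorphism A -> R'},
      agree s0 f g -> g' \o i =1 r \o g /\ g' \o s =1 lam.
    move=> g; have [fg|nfg] := pselect (agree s0 f g).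
      have [|g' [g'1 g'2]] := tensor_univ tA (f := r \o g : {lrmorphism A0 -> R'}) (g := lam).
        by move=> x; rewrite /= -[lam _]/((lam \o j) x) -rl /=; congr (r _); symmetry; exact: fg.
      by exists g'.
    have [|g' _] := tensor_univ tA (f := r \o f : {lrmorphism A0 -> R'}) (g := lam).
      by move=> x; exact: rl.
    by exists g'.
  exists lift => g h fg fh.
  have [g1 g2] := liftP g fg; have [h1 h2] := liftP h fh.
  have gh' : agree s (lift g) (lift h) by move=> x; rewrite g2 h2.
  split=> //.
  have gh : agree s0 g h by move=> x; rewrite -fg fh.
  have [k [kk1 kk2]] := mapP R g h gh.
  have [K [K1 K2]] := tensor_univ tW gh'.
  rewrite (wE _ _ _ _ gh kk1 kk2) ecmap_ecmap.
  transitivity (ecmap K P); last by symmetry; apply: cw0.1 => // x; rewrite ?K1 ?K2.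
  rewrite -P0E ecmap_ecmap; apply: ecmap_ext; apply: (tensor_uniq tW0) => x.
    by rewrite /= -[k _]/((k \o k1) x) kk1 -[psi _]/((psi \o k1) x) psi1 /= -[K _]/((K \o i1) (i x)) K1; symmetry; exact: g1.
  by rewrite /= -[k _]/((k \o k2) x) kk2 -[psi _]/((psi \o k2) x) psi2 /= -[K _]/((K \o i2) (i x)) K2; symmetry; exact: h1.
have cw : is_cocycle s0 w.
  split=> [R R1 phi f g f' g' fg ff' gg'|R f g k fg gk].
    have [k [kk1 kk2]] := mapP R f g fg.
    rewrite (wE _ _ _ _ fg kk1 kk2) ecmap_ecmap; apply: wE => x.
    - by rewrite /= ff' gg' /=; congr (phi _); exact: fg.
    - by rewrite /= ff' /=; congr (phi _); exact: kk1.
    - by rewrite /= gg' /=; congr (phi _); exact: kk2.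
  have fk : agree s0 f k by move=> x; rewrite fg gk.
  have [R' [r [injr [lift liftP]]]] := w_lift R f.
  apply: (ecmap_inj injr); rewrite raddfD /=.
  have [a1 ->] := liftP f g (fun _ => erefl) fg.
  have [a2 ->] := liftP g k fg fk.
  have [a3 ->] := liftP f k (fun _ => erefl) fk.
  exact: cw0.2.
have tw : torsion_family p s0 w.
  case: tw0 => m tm; exists m => R f g fg.
  have [R' [r [injr [lift liftP]]]] := w_lift R f.
  apply: (ecmap_inj injr); rewrite raddfMn raddf0 /=.
  by have [a1 ->] := liftP f g (fun _ => erefl) fg; exact: tm.
exists (@mk_cocycle F E p N (Cover ft) w cw tw).
have fts : finite_type s.
  exists [seq beta k | k <- enum 'I_n] => B cB sB bB a.
  rewrite (coE a); have [[B0 _ _] [BD BM]] := subring_closedD cB.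
  apply: (big_ind (fun z => z \in B)) => // k _.
  by apply: BM => //; apply: bB; apply: map_f; rewrite mem_enum.
apply/restricts_toP; exists (Cover fts), i, q; split=> //.
apply: coh_ext => R f g fg; rewrite /(pull i).
have fgi : agree s0 (f \o i : {lrmorphism A0 -> R}) (g \o i : {lrmorphism A0 -> R}).
  by move=> x; rewrite /= -[i _]/((i \o s0) x) is0; exact: fg.
rewrite mk_cocycleE //.
have [K [K1 K2]] := tensor_univ tW fg.
rewrite (wE _ _ _ (K \o psi : {lrmorphism W0 -> R}) fgi) => [|x|x].
- rewrite -ecmap_ecmap P0E; symmetry; apply: cw0.1 => // x; by rewrite ?K1 ?K2.
- by rewrite /= -[psi _]/((psi \o k1) x) psi1; exact: K1.
- by rewrite /= -[psi _]/((psi \o k2) x) psi2; exact: K2.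
Qed.

End CocycleLimit.

Section Surjectivity.
Variables (F : fieldType) (E : ellipticCurve F) (p : nat).
Implicit Types K L N : fieldAlgType F.

Lemma scale_cocycle L (A : comAlgType F) (s : {lrmorphism L -> A}) (w : family E A) m :
  is_cocycle s w -> is_cocycle s (fun R f g => w R f g *+ m).
Proof.
move=> cw; split=> [R S phi f g f' g' fg ff' gg'|R f g k fg gk].
  by rewrite (cw.1 _ _ _ _ _ _ _ fg ff' gg') raddfMn.
by rewrite -mulrnDl cw.2.
Qed.

Lemma scale_torsion L (A : comAlgType F) (s : {lrmorphism L -> A}) (w : family E A) m :
  torsion_family p s w -> torsion_family p s (fun R f g => w R f g *+ m).
Proof. by move=> [n tw]; exists n => R f g fg; rewrite -mulrnA mulnC mulrnA tw // mul0rn. Qed.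

Lemma coh_scale L (A : comAlgType F) (s : {lrmorphism L -> A}) (w w' : family E A) m :
  coh p s w w' -> coh p s (fun R f g => w R f g *+ m) (fun R f g => w' R f g *+ m).
Proof.
move=> [b [[n tb] h]]; exists (b *+ m); split.
  by exists n; rewrite -mulrnA mulnC mulrnA tb mul0rn.
by move=> R f g fg; rewrite h // mulrnDl coboundaryMn.
Qed.

Lemma tower_surjective K L (e : {lrmorphism K -> L}) (z : cocycle E p L)
    (A : comAlgType F) (q : {lrmorphism coc_cov z -> A}) n (beta : 'I_n -> A) :
  galois_tower p e ->
  free_basis (q \o cov_str (coc_cov z) : {lrmorphism L -> A}) beta ->
  (forall s, Gal e s -> restricts_to s z z) ->
  exists x : cocycle E p K, restricts_to e x z.
Proof.
move=> tow bas inv.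
have [S SP] := cocycle_descends bas (fun _ => erefl).
have [N [j [e' [gT [act [gal je SN cop lifts]]]]]] := tow S.
have [w rw] := SP N j SN.
have [B [tau [iota [ftau iotaE]]]] := twists gal (cov_ft (coc_cov w)).
have [l hl] := galois_sep gal.
pose x0 := cores gal tau iota hl.
have cx0 : is_cocycle (tau \o e' : {lrmorphism K -> B}) x0 := cores_cocycle gal iotaE hl.
have tx0 : torsion_family p (tau \o e' : {lrmorphism K -> B}) x0.
  have [m tm] := cval_torsion w; exists m => R f g fg; rewrite /x0 /cores.
  case: pselect => h; last by rewrite mul0rn.
  rewrite -sumrMnl; apply: big1 => a _; rewrite /cval; case: pselect => // h'.
    by rewrite cvalE tm.
  by rewrite mul0rn.
have ftB : finite_type (tau \o e' : {lrmorphism K -> B}).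
  exact: finite_type_comp (galois_finite_type gal) ftau (fun _ => erefl).
have [D0 [v0 v0s]] := cover_base j (Cover ftau).
have [D1 [v1 [vz [v1s vzs]]]] := cover_push D0 (coc_cov z).
pose v : {lrmorphism B -> D1} := v1 \o v0.
have vs : v \o tau =1 cov_str D1 \o j by exact: (compat_comp (e := j) v0s v1s).
have ws a s' : Gal e s' -> s' \o j =1 j \o act a ->
    (v \o iota a : {lrmorphism _ -> _}) \o cov_str (coc_cov w) =1 cov_str D1 \o (s' \o j).
  move=> _ sj x; rewrite /= -[iota a _]/((iota a \o cov_str (coc_cov w)) x) iotaE.
  by rewrite -[LHS]/((v \o tau) (act a x)) vs /= -[s' _]/((s' \o j) x) sj.
(* By invariance of z every conjugate of w restricts to z. Each comparison needs its own refinement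
   of the cover, hence the induction over the group elements. *)
have main (r : seq gT) : exists (D : cover L) (V : {lrmorphism D1 -> D}),
    V \o cov_str D1 =1 cov_str D /\
    coh p (cov_str D) (fun R f g => \sum_(a <- r) pull (V \o (v \o iota a) : {lrmorphism _ -> _}) (@cval _ _ _ _ w) f g)
      (fun R f g => pull (V \o vz : {lrmorphism _ -> _}) (@cval _ _ _ _ z) f g *+ size r).
  elim: r => [|a r [D [V [Vs c1]]]].
    exists D1, idfun; split=> //; apply: coh_ext => R f g fg.
    by rewrite big_nil mulr0n.
  have [s' [gs' sj]] := lifts a.
  have wsa := ws a s' gs' sj.
  have rz : restricts_to (s' \o j : {lrmorphism N -> L}) w z by exact: rt_trans rw (inv _ gs').
  have h1 : (V \o (v \o iota a) : {lrmorphism _ -> _}) \o cov_str (coc_cov w) =1 cov_str D \o (s' \o j).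
    exact: (compat_comp wsa Vs).
  have h2 : (V \o vz : {lrmorphism _ -> _}) \o cov_str (coc_cov z) =1 cov_str D.
    exact: (compat_comp (e := idfun) vzs Vs).
  have [D' [V' [V's c2]]] := rt_refine rz h1 h2.
  exists D', (V' \o V : {lrmorphism _ -> _}); split; first exact: (compat_comp (e := idfun) Vs V's).
  have c3 := coh_add c2 (coh_pull (e := idfun) V's c1).
  apply: coh_trans (coh_trans _ c3) _; apply: coh_ext => R f g fg.
    rewrite big_cons; congr (_ + _); first by apply: (fam_ext (cval_cocycle w)) => // x;
      have /= -> := compat_comp h1 V's x; exact: fg.
    rewrite /(pull V'); apply: eq_bigr => d _; apply: (fam_ext (cval_cocycle w)) => // x.
    have [s2 [gs2 sj2]] := lifts d.
    by have /= -> := compat_comp (compat_comp (ws d s2 gs2 sj2) Vs) V's x; exact: fg.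
  rewrite /= mulrS; congr (_ + _ *+ _).
    by apply: (fam_ext (cval_cocycle z)) => // x; have /= -> := compat_comp (e := idfun) h2 V's x; exact: fg.
  by apply: (fam_ext (cval_cocycle z)) => // x; have /= -> := compat_comp (e := idfun) h2 V's x; exact: fg.
have [D [V [Vs c]]] := main (enum gT).
have [m tz] := cval_torsion z.
have [u uP] := coprime_mulr m cop.
have cx := scale_cocycle u cx0; have tx := scale_torsion u tx0.
have Vvs : (V \o v : {lrmorphism B -> D}) \o tau =1 cov_str D \o j by exact: (compat_comp vs Vs).
exists (@mk_cocycle F E p K (Cover ftB) _ cx tx).
apply/restricts_toP; exists D, (V \o v : {lrmorphism B -> D}), (V \o vz : {lrmorphism _ -> D}); split.
- by move=> x; have /= -> := Vvs (e' x); have /= -> := je x.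
- exact: (compat_comp (e := idfun) vzs Vs).
apply: coh_trans (coh_trans _ (coh_scale u c)) _; apply: coh_ext => R f g fg.
  have fgt : agree tau (f \o (V \o v) : {lrmorphism B -> R}) (g \o (V \o v) : {lrmorphism B -> R}).
    by move=> x; have /= -> := Vvs x; exact: fg.
  rewrite /(pull (V \o v)) mk_cocycleE; last by move=> x; exact: fgt.
  rewrite /x0 /= cores_over // big_enum; congr (_ *+ _); apply: eq_bigr => a _.
  apply: (fam_ext (cval_cocycle w)) => // x.
  have [s2 [gs2 sj2]] := lifts a.
  by have /= -> := compat_comp (ws a s2 gs2 sj2) Vs x; exact: fg.
rewrite -cardE -mulrnA uP //; apply: tz => x.
by have /= -> := compat_comp (e := idfun) vzs Vs x; exact: fg.
Qed.

End Surjectivity.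

(** * Zariski's lemma *)

Section Span.
Variables (k : fieldType) (A : comNzRingType) (i : {rmorphism k -> A}).

Definition in_span n (b : 'I_n -> A) (x : A) := exists c : 'I_n -> k, x = \sum_j i (c j) * b j.
Definition indep n (b : 'I_n -> A) := forall c : 'I_n -> k,
  \sum_j i (c j) * b j = 0 -> forall j, c j = 0.

Lemma in_spanD n (b : 'I_n -> A) x y : in_span b x -> in_span b y -> in_span b (x + y).
Proof.
move=> [c ->] [d ->]; exists (fun j => c j + d j); rewrite -big_split.
by apply: eq_bigr => j _; rewrite rmorphD mulrDl.
Qed.

Lemma in_spanZ n (b : 'I_n -> A) c x : in_span b x -> in_span b (i c * x).
Proof.
move=> [d ->]; exists (fun j => c * d j); rewrite mulr_sumr.
by apply: eq_bigr => j _; rewrite rmorphM mulrA.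
Qed.

Lemma in_span0 n (b : 'I_n -> A) : in_span b 0.
Proof. by exists (fun=> 0); rewrite big1 // => j _; rewrite rmorph0 mul0r. Qed.

Lemma in_span_sum n (b : 'I_n -> A) (I : Type) (r : seq I) (f : I -> A) :
  (forall j, in_span b (f j)) -> in_span b (\sum_(j <- r) f j).
Proof. by move=> h; apply: big_ind => //; [exact: in_span0|exact: in_spanD]. Qed.

Lemma in_span_mem n (b : 'I_n -> A) j : in_span b (b j).
Proof.
exists (fun l => (l == j)%:R); rewrite (bigD1 j) //= eqxx rmorph1 mul1r big1 ?addr0 // => l /negPf ->.
by rewrite rmorph0 mul0r.
Qed.

Lemma span_dependent n m (b : 'I_n -> A) (v : 'I_m -> A) : (n < m)%N ->
  (forall j, in_span b (v j)) ->
  exists c : 'I_m -> k, (exists j, c j != 0) /\ \sum_j i (c j) * v j = 0.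
Proof.
move=> nm /choice[c cE].
pose M : 'M[k]_(m, n) := \matrix_(j, l) c j l.
have /matrix0Pn[r [l rl]] : kermx M != 0.
  by rewrite -mxrank_eq0 mxrank_ker subn_eq0 -ltnNge (leq_ltn_trans (rank_leq_col M)).
exists (fun j => kermx M r j); split; first by exists l.
have : row r (kermx M) *m M = 0 by rewrite -row_mul mulmx_ker row0.
move=> /rowP h.
transitivity (\sum_j \sum_l i (kermx M r j * c j l) * b l).
  apply: eq_bigr => j _; rewrite cE mulr_sumr; apply: eq_bigr => q _.
  by rewrite rmorphM mulrA.
rewrite exchange_big; apply: big1 => q _ /=.
rewrite -mulr_suml -rmorph_sum; have := h q; rewrite !mxE => e.
have -> : \sum_j kermx M r j * c j q = 0.
  by rewrite -[RHS]e; apply: eq_bigr => j _; rewrite !mxE.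
by rewrite rmorph0 mul0r.
Qed.

Lemma span_basis n (b : 'I_n -> A) (V : A -> Prop) :
  (forall x, V x -> in_span b x) -> (forall j, V (b j)) ->
  exists m (c : 'I_m -> A), [/\ forall x, V x -> in_span c x, forall j, V (c j) & indep c].
Proof.
pose P m := `[< exists c : 'I_m -> A, (forall x, V x -> in_span c x) /\ (forall j, V (c j)) >].
move=> hb Vb; have exP : exists m, P m by exists n; apply/asboolP; exists b.
case: (ex_minnP exP) => m /asboolP[c [hc Vc]] minm; exists m, c; split=> // d d0 j0.
apply: contrapT => /eqP nz.
case: m c hc Vc minm d d0 j0 nz => [|m] c hc Vc minm d d0 j0 nz; first by case: j0 {nz}.
suff : P m by move=> /minm; rewrite ltnn.
have cj0 : c j0 = \sum_j i (- (d j0)^-1 * d (lift j0 j)) * c (lift j0 j).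
  move: d0; rewrite (bigD1_ord j0) //= => /eqP; rewrite addr_eq0 => /eqP e.
  rewrite -[LHS]mul1r -(rmorph1 i) -(mulVf nz) rmorphM -mulrA e mulrN mulr_sumr -sumrN.
  by apply: eq_bigr => j _; rewrite mulNr rmorphN mulNr rmorphM mulrA.
apply/asboolP; exists (fun j => c (lift j0 j)); split=> // x /hc[a ->].
apply: in_span_sum => j; apply: in_spanZ.
case: (unliftP j0 j) => [l ->|->]; first exact: in_span_mem.
rewrite cj0; apply: in_span_sum => l; apply: in_spanZ; exact: in_span_mem.
Qed.

End Span.

Lemma algebraic_of_span (k A : fieldType) (i : {rmorphism k -> A}) n (b : 'I_n -> A) x :
  (forall m, in_span i b (x ^+ m)) -> exists2 q : {poly k}, q != 0 & root (map_poly i q) x.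
Proof.
move=> hV; have [c [[j0 cj0] c0]] := span_dependent (ltnSn n) (fun j : 'I_n.+1 => hV j).
exists (\poly_(j < n.+1) c (inord j)).
  apply/eqP => /polyP/(_ j0); rewrite coef_poly ltn_ord inord_val coef0 => e.
  by rewrite e eqxx in cj0.
apply/rootP; rewrite -[RHS]c0 (horner_coef_wide (n := n.+1)).
  by apply: eq_bigr => j _; rewrite coef_map coef_poly ltn_ord inord_val.
exact: leq_trans (size_poly _ _) (size_poly _ _).
Qed.

Lemma algebraic_inverse (k A : fieldType) (i : {rmorphism k -> A}) (x : A) (q : {poly k}) :
  x != 0 -> q != 0 -> root (map_poly i q) x ->
  exists r : {poly k}, x^-1 = (map_poly i r).[x].
Proof.
(* Removing the power of 'X from q leaves a nonzero constant term c, by which the relation is solved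
   for the inverse of x. *)
move=> x0 q0; have [m [q' nr ->]] := multiplicity_XsubC q 0.
rewrite q0 /= in nr; rewrite rmorphM rootM rmorphXn /= subr0 map_polyX.
case/orP => [rq|]; last by rewrite rootE hornerXn expf_eq0 (negPf x0) andbF.
pose c := q'`_0; have c0 : c != 0 by rewrite /c -horner_coef0.
exists (- c^-1 *: \poly_(j < (size q').-1) q'`_j.+1).
have sq : (size q' = (size q').-1.+1)%N.
  by rewrite prednK // size_poly_gt0; apply: contraNneq c0 => e; rewrite /c e coef0.
apply: (mulfI x0); rewrite divff //.
move/rootP: rq; rewrite (horner_coef_wide (n := size q')) ?size_poly //.
rewrite sq big_ord_recl coef_map expr0 mulr1 -/c => /eqP; rewrite addr_eq0 => /eqP e.
rewrite -[LHS](rmorph1 i) -(mulVf c0) rmorphM e map_polyZ hornerZ rmorphN mulNr !mulrN.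
congr (- _); rewrite [RHS]mulrCA; congr (_ * _).
rewrite (horner_coef_wide (n := (size q').-1)); last first.
  exact: leq_trans (size_poly _ _) (size_poly _ _).
rewrite mulr_sumr; apply: eq_bigr => j _.
by rewrite !coef_map coef_poly ltn_ord /= mulrCA exprS.
Qed.

Lemma horner_in (k : fieldType) (A : comNzRingType) (i : {rmorphism k -> A}) (V : {pred A}) (q : {poly k}) x :
  subring_closed V -> (forall c, i c \in V) -> x \in V -> (map_poly i q).[x] \in V.
Proof.
move=> cV kV Vx; have [[V0 V1 VN] [VD VM]] := subring_closedD cV.
elim/poly_ind: q => [|q c IH]; first by rewrite rmorph0 horner0.
rewrite rmorphD rmorphM /= map_polyX map_polyC hornerMXaddC.
by apply: VD; [apply: VM | apply: kV].
Qed.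

Lemma span_inverse (k A : fieldType) (i : {rmorphism k -> A}) n (b : 'I_n -> A) (V : {pred A}) :
  subring_closed V -> (forall c, i c \in V) -> (forall x, x \in V -> in_span i b x) ->
  divring_closed V.
Proof.
move=> cV kV hV; have [[V0 V1 VN] [VD VM]] := subring_closedD cV.
have VX x m : x \in V -> x ^+ m \in V.
  by move=> h; elim: m => [|m IH]; rewrite ?expr0 // exprS VM.
case: (cV) => _ VB _; split=> // x y Vx Vy; apply: VM => //.
have [->|nz] := eqVneq y 0; first by rewrite invr0.
have [q q0 qy] := algebraic_of_span (fun m => hV _ (VX _ m Vy)).
have [r ->] := algebraic_inverse nz q0 qy; exact: horner_in.
Qed.

Lemma horner_divring (k A : fieldType) (i : {rmorphism k -> A}) (x : A) (q : {poly k}) :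
  q != 0 -> root (map_poly i q) x ->
  divring_closed [pred z | `[< exists a, z = (map_poly i a).[x] >]] /\
  forall z, z \in [pred z | `[< exists a, z = (map_poly i a).[x] >]] ->
    in_span i (fun j : 'I_(size q) => x ^+ j) z.
Proof.
move=> q0 qx; set V := [pred z | _].
have VP z : reflect (exists a, z = (map_poly i a).[x]) (z \in V) by exact: asboolP.
have cV : subring_closed V.
  split=> [|u v /VP[a ->] /VP[d ->]|u v /VP[a ->] /VP[d ->]]; apply/VP.
  - by exists 1; rewrite rmorph1 hornerC.
  - by exists (a - d); rewrite rmorphB hornerD hornerN.
  - by exists (a * d); rewrite rmorphM hornerM.
have Vspan z : z \in V -> in_span i (fun j : 'I_(size q) => x ^+ j) z.
  move=> /VP[a ->]; exists (fun j : 'I_(size q) => (a %% q)`_j).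
  rewrite {1}(divp_eq a q) rmorphD rmorphM hornerD hornerM (rootP qx) mulr0 add0r.
  rewrite (horner_coef_wide (n := size q)); last first.
    by rewrite size_map_poly ltnW // ltn_modp.
  by apply: eq_bigr => j _; rewrite coef_map.
split=> //; apply: (span_inverse cV _ Vspan) => y; apply/VP; exists y%:P.
by rewrite map_polyC hornerC.
Qed.

Lemma in_span_trans (k k' A : fieldType) (i : {rmorphism k -> k'}) (i' : {rmorphism k' -> A})
    n (b : 'I_n -> k') m (c : 'I_m -> A) :
  (forall y, in_span i b y) -> (forall x, in_span i' c x) ->
  exists N (d : 'I_N -> A), forall x, in_span (i' \o i : {rmorphism k -> A}) d x.
Proof.
move=> hb hc; exists (n * m)%N.
pose f (l : 'I_(n * m)) : 'I_n * 'I_m := enum_val (cast_ord (esym (etrans (card_prod _ _) (congr2 muln (card_ord n) (card_ord m)))) l).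
pose g (u : 'I_n * 'I_m) : 'I_(n * m) := cast_ord (etrans (card_prod _ _) (congr2 muln (card_ord n) (card_ord m))) (enum_rank u).
have gK : cancel g f by move=> u; rewrite /f /g cast_ordK enum_rankK.
exists (fun l => i' (b (f l).1) * c (f l).2) => x.
have [e ->] := hc x; apply: in_span_sum => l.
have [a ->] := hb (e l); rewrite rmorph_sum mulr_suml; apply: in_span_sum => j.
rewrite rmorphM -mulrA; apply: (in_spanZ (i := i' \o i)).
by have := in_span_mem (i' \o i : {rmorphism k -> A}) (fun l => i' (b (f l).1) * c (f l).2) (g (j, l)); rewrite gK.
Qed.

(** Induction on the number of generators, for all base fields at once since k(x) replaces k. If the
    first generator x were transcendental, the finitely many coordinates and structure constants
    over k(x) would have a common denominator s, and every element of A, in particular of k(x),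
    would have its coordinates in k[x, 1/s]. *)
Lemma zariski (r : nat) (A : fieldType) : forall (c : seq A) (k : fieldType) (i : {rmorphism k -> A}),
  (size c = r)%N ->
  (forall P : {pred A}, subring_closed P -> (forall y, i y \in P) -> {subset c <= P} -> forall x, x \in P) ->
  exists n (b : 'I_n -> A), forall x, in_span i b x.
Proof.
elim: r => [|r IH] [|x c] k i //= sc gen.
  exists 1%N, (fun=> 1) => y.
  have : y \in [pred z | `[< exists u, i u = z >]].
    apply: gen => //; last by move=> z; apply/asboolP; exists z.
    split=> [|u v /asboolP[a <-] /asboolP[b <-]|u v /asboolP[a <-] /asboolP[b <-]]; apply/asboolP.
    - by exists 1; rewrite rmorph1.
    - by exists (a - b); rewrite rmorphB.
    - by exists (a * b); rewrite rmorphM.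
  by move=> /asboolP[u <-]; exists (fun=> u); rewrite big_ord1 mulr1.
pose ev (q : {poly k}) : A := (map_poly i q).[x].
have evD q q' : ev (q + q') = ev q + ev q' by rewrite /ev rmorphD hornerD.
have evN q : ev (- q) = - ev q by rewrite /ev rmorphN hornerN.
have evM q q' : ev (q * q') = ev q * ev q' by rewrite /ev rmorphM hornerM.
have ev1 : ev 1 = 1 by rewrite /ev rmorph1 hornerC.
have evC a : ev a%:P = i a by rewrite /ev map_polyC hornerC.
have evX : ev 'X = x by rewrite /ev map_polyX hornerX.
pose kx : {pred A} := [pred z | `[< exists q q', ev q' != 0 /\ z = ev q / ev q' >]].
have kxP z : reflect (exists q q', ev q' != 0 /\ z = ev q / ev q') (z \in kx) by exact: asboolP.
have ckx : divring_closed kx.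
  split=> [|u v /kxP[q [q' [h ->]]] /kxP[d [d' [h' ->]]]|u v /kxP[q [q' [h ->]]] /kxP[d [d' [h' ->]]]]; apply/kxP.
  - by exists 1, 1; rewrite ev1 oner_eq0 divr1.
  - exists (q * d' - d * q'), (q' * d'); rewrite evD evN !evM mulf_neq0 //; split=> //.
    by rewrite -mulNr addf_div // mulNr.
  - have [e|ne] := eqVneq (ev d) 0.
      by exists 0, 1; rewrite ev1 oner_eq0 e mul0r invr0 mulr0 divr1 /ev rmorph0 horner0.
    exists (q * d'), (q' * d); rewrite !evM mulf_neq0 //; split=> //.
    by rewrite invf_div mulf_div.
have [k' [i' i'P]] := subfield_type ckx.
have kin a : exists y, i' y = i a.
  by apply/i'P/kxP; exists a%:P, 1; rewrite ev1 oner_eq0 divr1 evC.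
have xin : exists y, i' y = x.
  by apply/i'P/kxP; exists 'X, 1; rewrite ev1 oner_eq0 divr1 evX.
have [||n [b hb]] := IH c k' i'; first by case: sc.
  move=> P cP kP cinP; apply: gen => // [y|y]; first by have [z <-] := kin y.
  by rewrite inE => /orP[/eqP->|/cinP//]; have [z <-] := xin.
have /choice[io ioE] := kin.
have [iota iotaE] : exists io' : {rmorphism k -> k'}, io' =1 io.
  apply: build_rmorph => [|u v|u v]; apply: (fmorph_inj i').
  - by rewrite ioE !rmorph1.
  - by rewrite rmorphD !ioE rmorphD.
  - by rewrite rmorphM !ioE rmorphM.
have i'iota a : i' (iota a) = i a by rewrite iotaE ioE.
have [x' x'E] := xin.
have [[q q0 qx]|trans] := pselect (exists2 q : {poly k}, q != 0 & root (map_poly i q) x).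
  have [dV Vspan] := horner_divring q0 qx.
  have VP z : reflect (exists a, z = ev a) (z \in [pred z | `[< exists a, z = ev a >]]) by exact: asboolP.
  have k'span y : in_span iota (fun j : 'I_(size q) => x' ^+ j) y.
    have [|e eE] := Vspan (i' y).
      have /kxP[u [v [v0 ->]]] : i' y \in kx by apply/i'P; exists y.
      by case: dV => _ _; apply; apply/VP; [exists u | exists v].
    exists e; apply: (fmorph_inj i'); rewrite eE rmorph_sum; apply: eq_bigr => j _.
    by rewrite rmorphM rmorphXn x'E -i'iota.
  have [N [d hd]] := in_span_trans k'span hb.
  exists N, d => z; have [e ->] := hd z; exists e.
  by apply: eq_bigr => j _; rewrite /= i'iota.
have ev_inj q : ev q = 0 -> q = 0.
  by move=> e; apply: contrapT => /eqP q0; apply: trans; exists q => //; apply/rootP.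
have [m [be [hbe _ ibe]]] := span_basis (V := fun=> True) (fun z _ => hb z) (fun _ => Logic.I).
have /choice[co coE] := fun z => hbe z Logic.I.
have fracs (l : seq k') : exists2 s : {poly k}, s != 0 & forall y, y \in l -> exists q, i' y * ev s = ev q.
  elim: l => [|y l [s s0 hs]]; first by exists 1; rewrite ?oner_neq0.
  have /kxP[u [v [v0 yE]]] : i' y \in kx by apply/i'P; exists y.
  have vn0 : v != 0 by apply: contraNneq v0 => ->; rewrite /ev rmorph0 horner0.
  exists (v * s) => [|z]; first by rewrite mulf_neq0.
  rewrite inE => /orP[/eqP->|/hs[w wE]].
    by exists (u * s); rewrite yE !evM mulrA divfK.
  by exists (v * w); rewrite !evM mulrCA wE.
pose L := [seq co 1 j | j <- enum 'I_m] ++ flatten [seq [seq co z j | j <- enum 'I_m] | z <- c]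
  ++ flatten [seq [seq co (be j1 * be j2) j | j <- enum 'I_m] | j1 <- enum 'I_m, j2 <- enum 'I_m].
have [s s0 sP] := fracs L.
pose good (y : k') := exists N q, i' y * ev s ^+ N = ev q.
have goodL y : y \in L -> good y by move=> /sP[w wE]; exists 1%N, w; rewrite expr1.
have evXn q N : ev (q ^+ N) = ev q ^+ N.
  by elim: N => [|N IHN]; rewrite ?expr0 ?ev1 // !exprS evM IHN.
have goodD y z : good y -> good z -> good (y + z).
  move=> [N [u uE]] [M [v vE]]; exists (N + M)%N, (u * s ^+ M + v * s ^+ N).
  by rewrite evD !evM !evXn -uE -vE rmorphD exprD; ring.
have goodM y z : good y -> good z -> good (y * z).
  move=> [N [u uE]] [M [v vE]]; exists (N + M)%N, (u * v).
  by rewrite evM -uE -vE rmorphM exprD; ring.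
have goodN y : good y -> good (- y).
  by move=> [N [u uE]]; exists N, (- u); rewrite evN -uE rmorphN mulNr.
have good_sum (I : Type) (l : seq I) (f : I -> k') : (forall j, good (f j)) -> good (\sum_(j <- l) f j).
  move=> h; apply: big_ind => //; exists 0%N, 0; rewrite rmorph0 mul0r /ev rmorph0 horner0 //.
have good_ev q y : i' y = ev q -> good y by move=> e; exists 0%N, q; rewrite expr0 mulr1.
have co_uniq z a : z = \sum_j i' (a j) * be j -> forall j, co z j = a j.
  move=> e j; apply/eqP; rewrite -subr_eq0; apply/eqP; move: j; apply: ibe.
  under eq_bigr => j _ do rewrite rmorphB mulrBl.
  by rewrite sumrB -coE -e subrr.
have co1 j : good (co 1 j) by apply: goodL; rewrite /L mem_cat map_f ?mem_enum.
pose V : {pred A} := [pred z | `[< forall j, good (co z j) >]].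
have VP z : reflect (forall j, good (co z j)) (z \in V) by exact: asboolP.
have coZ y z j : co (i' y * z) j = y * co z j.
  apply: (co_uniq _ (fun j => y * co z j)); rewrite [in LHS](coE z) mulr_sumr; apply: eq_bigr => j' _.
  by rewrite rmorphM mulrA.
have coB y z j : co (y - z) j = co y j - co z j.
  apply: (co_uniq _ (fun j => co y j - co z j)); rewrite [in LHS](coE y) [in LHS](coE z) -sumrB.
  by apply: eq_bigr => j' _; rewrite rmorphB mulrBl.
have coD y z j : co (y + z) j = co y j + co z j.
  apply: (co_uniq _ (fun j => co y j + co z j)); rewrite [in LHS](coE y) [in LHS](coE z) -big_split.
  by apply: eq_bigr => j' _; rewrite rmorphD mulrDl.
have VZ y z : good y -> z \in V -> i' y * z \in V.
  by move=> gy /VP hz; apply/VP => j; rewrite coZ; apply: goodM.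
have V1 : 1 \in V by apply/VP.
have V0 : 0 \in V by apply/VP => j; rewrite -(subrr (1 : A)) coB subrr; apply: (good_ev 0); rewrite rmorph0 /ev rmorph0 horner0.
have VD y z : y \in V -> z \in V -> y + z \in V.
  by move=> /VP hy /VP hz; apply/VP => j; rewrite coD; apply: goodD.
have Vall z : z \in V.
  apply: gen => [|y|y].
  - split=> // [u v /VP hu /VP hv|u v /VP hu /VP hv].
      by apply/VP => j; rewrite coB; apply: goodD => //; apply: goodN.
    rewrite (coE u) (coE v) mulr_suml; apply: (big_ind (fun z => z \in V)) => // j1 _.
    rewrite mulr_sumr; apply: (big_ind (fun z => z \in V)) => // j2 _.
    rewrite mulrACA -rmorphM; apply: VZ; first exact: goodM.
    apply/VP => j; apply: goodL; rewrite /L !mem_cat; apply/orP; right; apply/orP; right.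
    apply/flattenP; exists [seq co (be j1 * be j2) j | j <- enum 'I_m]; last by rewrite map_f ?mem_enum.
    by apply: allpairs_f; rewrite mem_enum.
  - by rewrite -i'iota -[i' _]mulr1; apply: VZ => //; apply: (good_ev y%:P); rewrite evC i'iota.
  - rewrite inE => /orP[/eqP->|yc].
      by rewrite -x'E -[i' _]mulr1; apply: VZ => //; apply: (good_ev 'X); rewrite evX.
    apply/VP => j; apply: goodL; rewrite /L !mem_cat; apply/orP; right; apply/orP; left.
    apply/flattenP; exists [seq co y j | j <- enum 'I_m]; last by rewrite map_f ?mem_enum.
    by apply/mapP; exists y.
have [j0 d0] : exists j, co 1 j != 0.
  apply: contrapT => no; have := oner_neq0 A; rewrite (coE 1) big1 ?eqxx // => j _.
  have [->|h] := eqVneq (co 1 j) 0; first by rewrite rmorph0 mul0r.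
  by case: no; exists j.
(* A non-constant polynomial prime to s, whose inverse therefore does not lie in k[x, 1/s]. *)
pose t : {poly k} := s * 'X + 1.
have st : (1 < size t)%N by rewrite /t -polyC1 size_MXaddC (negPf s0) ltnS lt0n size_poly_eq0.
have t0 : t != 0 by rewrite -size_poly_gt0 (leq_trans _ st).
have [t' t'E] : exists y, i' y = ev t.
  by apply/i'P/kxP; exists t, 1; rewrite ev1 oner_eq0 divr1.
have t'0 : t' != 0.
  by apply: contra_neq t0 => e; apply: ev_inj; rewrite -t'E e rmorph0.
(* The factor is scaled by the coordinate of 1 at j0, so that the coordinate of this element at j0
   is exactly the inverse of t'. *)
have /VP/(_ j0) := Vall (i' ((co 1 j0)^-1 / t') * 1).
rewrite coZ mulrAC mulVf // mul1r => -[N [q]].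
have evt0 : ev t != 0 by apply: contra_neq t0; exact: ev_inj.
rewrite fmorphV t'E => e.
have h : s ^+ N = t * q.
  by apply/eqP; rewrite -subr_eq0; apply/eqP/ev_inj; rewrite evD evN evM evXn -e mulVKf // subrr.
have cop : coprimep t (s ^+ N).
  rewrite coprimep_expr //; apply/Bezout_eq1_coprimepP; exists (1, - 'X).
  by rewrite /t /=; ring.
have : coprimep t t by apply: coprimep_dvdl cop; rewrite h dvdp_mulr.
by rewrite coprimepp => /eqP e1; rewrite e1 in st.
Qed.

Lemma maximal_quotient (F : fieldType) (A : comAlgType F) :
  exists (K : fieldAlgType F) (q : {lrmorphism A -> K}), forall y, exists x, q x = y.
Proof.
pose good (I : set A) := [/\ I 0, forall x y, I x -> I y -> I (x - y), forall x y, I y -> I (x * y) & ~ I 1].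
have [] := @zorn_above A good [set 0]%classic 0; [by []| | |].
- split=> // [x y -> ->|x y ->|e]; rewrite ?subrr ?mulr0 //.
  by have := oner_neq0 A; rewrite e eqxx.
- move=> C [I0 CI0] gC tot; split.
  + by exists I0 => //; case: (gC _ CI0).
  + move=> x y [I CI Ix] [J CJ Jy]; case: (tot _ _ CI CJ) => sub.
      by exists J => //; case: (gC _ CJ) => _ B _ _; apply: B => //; apply: sub.
    by exists I => //; case: (gC _ CI) => _ B _ _; apply: B => //; apply: sub.
  + by move=> x y [I CI Iy]; exists I => //; case: (gC _ CI) => _ _ M _; apply: M.
  + by move=> [I /gC[_ _ _ n1]] /n1.
move=> I [[I0 IB IM I1] _ maxI].
have [|x y|x y||x|K0 [p [ps pI]]] := @quotient_field A [pred x | `[< I x >]].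
- exact/asboolP.
- by move=> /asboolP hx /asboolP hy; apply/asboolP/IB.
- by move=> /asboolP hy; apply/asboolP/IM.
- by apply/asboolP.
- move=> /asboolP nIx; apply: contrapT => no.
  pose J := [set z | exists y, I (z - y * x)]%classic.
  have gJ : good J.
    split.
    + by exists 0; rewrite mul0r subr0.
    + move=> u v [a ha] [b hb]; exists (a - b).
      have -> : u - v - (a - b) * x = (u - a * x) - (v - b * x) by ring.
      exact: IB.
    + move=> u v [a ha]; exists (u * a).
      have -> : u * v - u * a * x = u * (v - a * x) by ring.
      exact: IM.
    + move=> [a ha]; apply: no; exists a; apply/asboolP.
      by have := IB _ _ I0 ha; rewrite sub0r opprB.
  have IJ : (I `<=` J)%classic by move=> z hz; exists 0; rewrite mul0r subr0.
  by apply: nIx; apply: (maxI J gJ IJ); exists 1; rewrite mul1r subrr.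
have [K [i [j [ij ji iE]]]] := field_algebra (p \o in_alg A : {rmorphism F -> K0}).
have [q qE] := @rmorph_lr F A K (i \o p : {rmorphism A -> K}) iE.
exists K, q => y; have [x xE] := ps (j y); exists x.
by rewrite qE /= xE ji.
Qed.

(** A residue field of the cover refines it, and is finite over L by Zariski's lemma. *)
Lemma cover_free (F : fieldType) (L : fieldAlgType F) (C : cover L) :
  exists (A : comAlgType F) (q : {lrmorphism C -> A}) n (beta : 'I_n -> A),
    free_basis (q \o cov_str C : {lrmorphism L -> A}) beta.
Proof.
have [K [q qs]] := maximal_quotient C.
have [l hl] := cov_ft C.
have [|n [b hb]] := @zariski (size l) K [seq q x | x <- l] L (q \o cov_str C : {rmorphism L -> K}) (size_map _ _).
  move=> P cP kP lP y; have [x <-] := qs y.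
  apply: (hl [pred x | q x \in P]) => [|z|z zl]; rewrite ?inE.
  - by case: cP => P1 PB PM; split=> [|u v|u v]; rewrite ?inE ?rmorph1 ?rmorphB ?rmorphM //; [apply: PB|apply: PM].
  - exact: kP.
  - by apply: lP; rewrite map_f.
have [m [be [hbe _ ibe]]] := span_basis (V := fun=> True) (fun z _ => hb z) (fun _ => Logic.I).
exists K, q, m, be; split=> [x|]; first exact: hbe.
exact: ibe.
Qed.

(** * Automorphisms *)

Lemma min_poly_exists (k A : fieldType) (i : {rmorphism k -> A}) x :
  (exists2 q : {poly k}, q != 0 & root (map_poly i q) x) ->
  exists m : {poly k}, [/\ m != 0, root (map_poly i m) x &
    forall q : {poly k}, root (map_poly i q) x = (m %| q)].
Proof.
move=> [q0 q0n q0x].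
pose P n := `[< exists q : {poly k}, [/\ q != 0, root (map_poly i q) x & size q = n] >].
have exP : exists n, P n by exists (size q0); apply/asboolP; exists q0.
case: (ex_minnP exP) => n /asboolP[m [m0 mx sm]] minn.
exists m; split=> // q; apply/idP/idP => [qx|]; last first.
  by move=> /dvdpP[r ->]; rewrite rmorphM rootM mx orbT.
rewrite /dvdp; apply: contraT => r0.
have : P (size (q %% m)).
  apply/asboolP; exists (q %% m); split=> //.
  move: qx; rewrite {1}(divp_eq q m) rmorphD rmorphM !rootE hornerD hornerM.
  by move/rootP: mx => ->; rewrite mulr0 add0r.
by move=> /minn; rewrite leqNgt -sm ltn_modp m0.
Qed.

Section Extend.
Variables (F : fieldType) (L : fieldAlgType F).
Hypothesis galL : galois_extension L.

(** The graph of an F-morphism from a subfield of L to L; with graphs, the supremum of a chain is a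
    plain union. *)
Definition partial_hom (G : set (L * L)) :=
  [/\ forall c : F, G (c%:A, c%:A),
      forall a b a' b', G (a, b) -> G (a', b') -> G (a - a', b - b'),
      forall a b a' b', G (a, b) -> G (a', b') -> G (a * a', b * b'),
      forall a b, G (a, b) -> G (a^-1, b^-1) &
      forall b, G (0, b) -> b = 0].

(** The minimal polynomial of z over the domain has degree at least 2, and its transport by the
    morphism splits in L with simple roots, so a root z' other than z is available. The condition z'
    != z is what later produces automorphisms that move a given element. *)
Lemma partial_hom_step (G : set (L * L)) (z : L) : partial_hom G ->
  ~ (exists b, G (z, b)) ->
  exists H, [/\ partial_hom H, (G `<=` H)%classic & exists2 z', z' != z & H (z, z')].
Proof.
move=> [GF GB GM GV G0] nz.
have Guniq a b b' : G (a, b) -> G (a, b') -> b = b'.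
  move=> h h'; apply/eqP; rewrite -subr_eq0; apply/eqP/G0.
  by have := GB _ _ _ _ h h'; rewrite subrr.
pose dom : {pred L} := [pred a | `[< exists b, G (a, b) >]].
have domP a : reflect (exists b, G (a, b)) (a \in dom) by exact: asboolP.
have G1 : G (1, 1) by have := GF 1; rewrite scale1r.
have cdom : divring_closed dom.
  split=> [|a a' /domP[b h] /domP[b' h']|a a' /domP[b h] /domP[b' h']]; apply/domP.
  - by exists 1.
  - by exists (b - b'); apply: GB.
  - by exists (b / b'); apply: GM => //; apply: GV.
have [k [i iP]] := subfield_type cdom.
have /choice[ph phE] : forall a, exists b, G (i a, b) by move=> a; apply/domP/iP; exists a.
have [phi phiE] : exists phi : {rmorphism k -> L}, phi =1 ph.
  apply: build_rmorph => [|a b|a b].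
  - by apply: (Guniq 1); [rewrite -(rmorph1 i); exact: phE|].
  - apply: (Guniq (i (a + b))); first exact: phE.
    have := GB _ _ _ _ (phE a) (GB _ _ _ _ (GF 0) (phE b)).
    by rewrite scale0r !sub0r !opprK rmorphD.
  - by apply: (Guniq (i (a * b))); [exact: phE | rewrite rmorphM; apply: GM].
have phG a : G (i a, phi a) by rewrite phiE; exact: phE.
have [q [s [_ qs us zs]]] := galL z.
have q0 : q != 0.
  by rewrite -(map_poly_eq0 (in_alg L)) qs monic_neq0 // monic_prod_XsubC.
have /choice[ka kaE] : forall c : F, exists y, i y = c%:A.
  by move=> c; apply/iP/domP; exists c%:A.
have [kap kapE] : exists f : {rmorphism F -> k}, f =1 ka.
  apply: build_rmorph => [|u v|u v]; apply: (fmorph_inj i).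
  - by rewrite kaE rmorph1 scale1r.
  - by rewrite rmorphD !kaE scalerDl.
  - by rewrite rmorphM !kaE -!in_algE rmorphM.
have ik c : i (kap c) = c%:A by rewrite kapE kaE.
have pk c : phi (kap c) = c%:A by apply: (Guniq c%:A); [rewrite -ik; exact: phG|exact: GF].
have mapk (f : {rmorphism k -> L}) : (forall c, f (kap c) = c%:A) ->
    map_poly f (map_poly kap q) = \prod_(r <- s) ('X - r%:P).
  by move=> h; rewrite -qs -map_poly_comp; apply: eq_map_poly => c /=; rewrite h.
have qz : root (map_poly i (map_poly kap q)) z by rewrite (mapk i ik) root_prod_XsubC.
have [|m [m0 mz mP]] := @min_poly_exists k L i z.
  by exists (map_poly kap q) => //; rewrite map_poly_eq0.
have sm : (2 < size m)%N.
  rewrite ltnNge; apply/negP => sm; case: nz; apply/domP/iP.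
  have sm1 : (1 < size m)%N.
    by rewrite -(size_map_poly i) (root_size_gt1 _ mz) // map_poly_eq0.
  exists (- m`_0 / m`_1).
  have sm2 : size m = 2%N by apply/eqP; rewrite eqn_leq sm sm1.
  have m1 : i m`_1 != 0.
    rewrite fmorph_eq0; have : lead_coef m != 0 by rewrite lead_coef_eq0.
    by rewrite /lead_coef sm2.
  move/rootP: mz; rewrite (horner_coef_wide (n := 2)) ?size_map_poly ?sm2 //.
  rewrite !big_ord_recl big_ord0 addr0 !coef_map expr0 mulr1 expr1 /= => /eqP.
  rewrite addrC addr_eq0 => /eqP e; rewrite rmorphM rmorphN fmorphV -e mulrC mulKf //.
have mphi : map_poly phi m %| \prod_(r <- s) ('X - r%:P).
  by rewrite -(mapk phi pk) dvdp_map -mP.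
have [z' z'z rz'] : exists2 z', z' != z & root (map_poly phi m) z'.
  have [msk] := dvdp_prod_XsubC mphi; set t := mask _ _ => mt.
  have st : (1 < size t)%N.
    by have := eqp_size mt; rewrite size_map_poly size_prod_XsubC => e; rewrite -ltnS -e.
  have ut : uniq t by exact: mask_uniq.
  have rt y : y \in t -> root (map_poly phi m) y by rewrite (eqp_root mt) root_prod_XsubC.
  case: t st ut rt {mt} => [|a [|b t]] //= _ /andP[ab _] rt.
  have [az|na] := eqVneq a z; last by exists a => //; apply: rt; rewrite mem_head.
  exists b; last by apply: rt; rewrite !inE eqxx orbT.
  by apply: contraNneq ab => bz; rewrite az -bz mem_head.
pose ev (a : {poly k}) := (map_poly i a).[z]; pose ev' (a : {poly k}) := (map_poly phi a).[z'].
have ev0 a : ev a = 0 -> ev' a = 0.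
  move=> /rootP; rewrite mP => /dvdpP[r ->].
  by rewrite /ev' rmorphM hornerM (rootP rz') mulr0.
exists [set u | exists a, u = (ev a, ev' a)]%classic; split; last first.
- exists z' => //; exists 'X; rewrite /ev /ev' !map_polyX !hornerX //.
- move=> [a b] hab.
  have [y yE] : exists y, i y = a by apply/iP/domP; exists b.
  exists y%:P; rewrite /ev /ev' !map_polyC !hornerC; congr (_, _); first exact: esym yE.
  by apply: (Guniq a) => //; rewrite -yE; exact: phG.
- split.
  + by move=> c; exists (kap c)%:P; rewrite /ev /ev' !map_polyC !hornerC; congr (_, _); [exact: esym (ik c)|exact: esym (pk c)].
  + by move=> _ _ _ _ [a [-> ->]] [b [-> ->]]; exists (a - b); rewrite /ev /ev' !rmorphB !hornerD !hornerN.
  + by move=> _ _ _ _ [a [-> ->]] [b [-> ->]]; exists (a * b); rewrite /ev /ev' !rmorphM !hornerM.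
  + move=> _ _ [a [-> ->]].
    have [e|ne] := eqVneq (ev a) 0.
      by rewrite e (ev0 _ e) invr0; exists 0; rewrite /ev /ev' !rmorph0 !horner0.
    have [[V1 _ VV] _] := horner_divring m0 mz.
    have /asboolP[r rE] : (ev a)^-1 \in [pred y | `[< exists b, y = (map_poly i b).[z] >]].
      by rewrite -[_^-1]mul1r; apply: VV => //; apply/asboolP; exists a.
    exists r; rewrite rE; congr (_, _).
    have : ev' (r * a - 1) = 0.
      by apply: ev0; rewrite /ev rmorphB rmorphM rmorph1 hornerD hornerN hornerM hornerC -rE mulVf // subrr.
    rewrite /ev' rmorphB rmorphM rmorph1 hornerD hornerN hornerM hornerC => /eqP.
    by rewrite subr_eq0 => /eqP/mulr1_eq <-; rewrite invrK.
  + by move=> _ [a [e ->]]; rewrite (ev0 a).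
Qed.
End Extend.

Section Automorphisms.
Variables (F : fieldType) (L : fieldAlgType F).
Hypothesis galL : galois_extension L.

Lemma roots_stable (s : {lrmorphism L -> L}) (q : {poly F}) (r : seq L) :
  map_poly (in_alg L) q = \prod_(z <- r) ('X - z%:P) -> {in r, forall z, s z \in r}.
Proof.
move=> qr z zr; rewrite -root_prod_XsubC -qr.
have -> : map_poly (in_alg L) q = map_poly s (map_poly (in_alg L) q).
  by rewrite -map_poly_comp; apply: eq_map_poly => c /=; rewrite lrmorph_cA.
by rewrite (fmorph_root s) qr root_prod_XsubC.
Qed.

(** An F-endomorphism is injective and preserves the finite set of roots of a polynomial over F,
    hence permutes it. *)
Lemma endo_surj (s : {lrmorphism L -> L}) y : exists x, s x = y.
Proof.
have [q [r [_ qr ur yr]]] := galL y.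
have sub : {subset map s r <= r} by move=> _ /mapP[z zr ->]; exact: (@roots_stable s q r qr z zr).
have us : uniq (map s r) by rewrite map_inj_uniq //; exact: fmorph_inj.
have [_ e] := uniq_min_size us sub (eq_leq (esym (size_map s r))).
by move: yr; rewrite -e => /mapP[x _ ->]; exists x.
Qed.

Lemma endo_bij (s : {lrmorphism L -> L}) : bijective s.
Proof.
have /choice[t tE] := endo_surj s.
by exists t => // x; apply: (fmorph_inj s); exact: tE.
Qed.

Lemma aut_inverse (s : {lrmorphism L -> L}) :
  exists t : {lrmorphism L -> L}, cancel s t /\ cancel t s.
Proof.
have [t tE] : exists t : {lrmorphism L -> L}, s \o t =1 idfun.
  apply: (@factor_inj F L L L (idfun : {lrmorphism L -> L}) s (fmorph_inj s)) => y.
  exact: endo_surj.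
by exists t; split=> x; [apply: (fmorph_inj s); exact: tE|exact: tE].
Qed.

(** The inclusion of K is extended so as to move x, and the result is then extended to all of L by
    Zorn's lemma. *)
Lemma aut_extend (K : fieldAlgType F) (e : {lrmorphism K -> L}) x :
  (forall c, e c <> x) -> exists s, Gal e s /\ s x != x.
Proof.
move=> nx; pose G0 : set (L * L) := [set u | exists c, u = (e c, e c)]%classic.
have pG0 : partial_hom G0.
  split.
  - by move=> c; exists c%:A; rewrite lrmorph_cA.
  - by move=> _ _ _ _ [a [-> ->]] [b [-> ->]]; exists (a - b); rewrite rmorphB.
  - by move=> _ _ _ _ [a [-> ->]] [b [-> ->]]; exists (a * b); rewrite rmorphM.
  - by move=> _ _ [a [-> ->]]; exists a^-1; rewrite fmorphV.
  - by move=> _ [a [<- ->]].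
have [|G1 [pG1 G01 [x' x'x G1x]]] := partial_hom_step (z := x) galL pG0.
  by move=> [b [c [e1 _]]]; apply: (nx c).
have [] := @zorn_above _ (@partial_hom F L) G1 (x, x') G1x pG1.
  move=> C [X0 CX0] gC tot.
  have two u v : (\bigcup_(X in C) X)%classic u -> (\bigcup_(X in C) X)%classic v ->
    exists X, [/\ C X, X u & X v].
    move=> [X CX Xu] [Y CY Yv]; case: (tot _ _ CX CY) => sub.
      by exists Y; split=> //; exact: sub.
    by exists X; split=> //; exact: sub.
  split.
  - by move=> c; exists X0 => //; case: (gC _ CX0) => h _ _ _ _; exact: h.
  - move=> a b a' b' h h'; have [X [CX hu hv]] := two _ _ h h'; exists X => //.
    by case: (gC _ CX) => _ B _ _ _; exact: B.
  - move=> a b a' b' h h'; have [X [CX hu hv]] := two _ _ h h'; exists X => //.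
    by case: (gC _ CX) => _ _ M _ _; exact: M.
  - by move=> a b [X CX h]; exists X => //; case: (gC _ CX) => _ _ _ V _; exact: V.
  - by move=> b [X CX h]; case: (gC _ CX) => _ _ _ _; apply.
move=> M [pM G1M maxM].
have tot z : exists b, M (z, b).
  apply: contrapT => nz; have [H [pH MH [z' _ Hz]]] := partial_hom_step galL pM nz.
  by apply: nz; exists z'; exact: maxM pH MH _ Hz.
have /choice[f fM] := tot.
have [MF MB MM MV M0] := pM.
have uniqM a b b' : M (a, b) -> M (a, b') -> b = b'.
  move=> h h'; apply/eqP; rewrite -subr_eq0; apply/eqP/M0.
  by have := MB _ _ _ _ h h'; rewrite subrr.
have [|||s sE] := @build_lrmorph F L L f.
- by move=> c; apply: (uniqM c%:A).
- move=> a b; apply: (uniqM (a + b)) => //.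
  have := MB _ _ _ _ (fM a) (MB _ _ _ _ (MF 0) (fM b)).
  by rewrite scale0r !sub0r !opprK.
- by move=> a b; apply: (uniqM (a * b)) => //; apply: MM.
exists s; split; last by rewrite sE (uniqM x (f x) x') //; exact: G1M.
split=> [|c]; first exact: endo_bij.
by rewrite sE; apply: (uniqM (e c)) => //; apply/G1M/G01; exists c.
Qed.

(** The conjugates Z of S are finite in number and are permuted by Gal(L/K). N is the field fixed by
    the automorphisms that fix Z pointwise, and its group is the image of Gal(L/K) in the
    permutations of Z. *)
Lemma gal_tower (p l : nat) (K : fieldAlgType F) (e : {lrmorphism K -> L}) :
  prime p -> prime l -> l != p ->
  (forall (s : {lrmorphism L -> L}) x, exists m, iter (l ^ m) s x = x) ->
  galois_tower p e.
Proof.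
move=> pp pl lp tors S.
have /choice[roots rootsP] : forall x : L, exists r : seq L, x \in r /\
   exists q : {poly F}, map_poly (in_alg L) q = \prod_(z <- r) ('X - z%:P).
  by move=> x; have [q [r [_ qr _ xr]]] := galL x; exists r; split=> //; exists q.
pose Z := flatten (map roots S).
have SZ : {subset S <= Z}.
  move=> x xS; apply/flattenP; exists (roots x); first exact: map_f.
  by case: (rootsP x).
have Zst (s : {lrmorphism L -> L}) : {in Z, forall z, s z \in Z}.
  move=> z /flattenP[_ /mapP[x xS ->] zr]; apply/flattenP; exists (roots x); first exact: map_f.
  by case: (rootsP x) => _ [q qr]; exact: (@roots_stable s q _ qr z zr).
pose T := seq_sub Z.
pose gf (s : {lrmorphism L -> L}) (z : T) : T := SeqSub (Zst s _ (ssvalP z)).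
have gf_inj s : injective (gf s).
  by move=> u v /(congr1 val) /= /(fmorph_inj s) /val_inj.
pose gp s : {perm T} := perm (gf_inj s).
have gpE s (z : T) : val (gp s z) = s (val z) by rewrite permE.
have galM (s t : {lrmorphism L -> L}) : Gal e s -> Gal e t -> Gal e (s \o t : {lrmorphism L -> L}).
  by move=> [bs es] [bt et]; split; [exact: bij_comp|move=> c /=; rewrite et].
pose H : {set {perm T}} := [set g | `[< exists s, Gal e s /\ gp s = g >]].
have HP g : reflect (exists s, Gal e s /\ gp s = g) (g \in H).
  by rewrite inE; exact: asboolP.
have gpM (s t : {lrmorphism L -> L}) : gp (s \o t : {lrmorphism L -> L}) = (gp t * gp s)%g.
  by apply/permP => z; apply: val_inj; rewrite permM !gpE.
have id_gal : Gal e (idfun : {lrmorphism L -> L}) by split=> //; exists id.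
have gH : group_set H.
  apply/group_setP; split.
    by apply/HP; exists idfun; split=> //; apply/permP => z; apply: val_inj; rewrite gpE perm1.
  move=> g h /HP[s [gs <-]] /HP[t [gt <-]]; apply/HP; exists (t \o s : {lrmorphism L -> L}).
  by split; [exact: galM|exact: gpM].
pose HG := Group gH.
pose gT : finGroupType := subg_of HG.
(* The inverse compensates for the product of permutations, which composes from left to right. *)
have /choice[lift liftP] : forall g : gT, exists s, Gal e s /\ gp s = (sgval g)^-1%g.
  by move=> g; apply/HP; exact: (groupVr (subgP g)).
have fixN (s t : {lrmorphism L -> L}) x :
    (forall u, Gal e u -> {in Z, forall z, u z = z} -> u x = x) ->
    Gal e s -> Gal e t -> {in Z, s =1 t} -> s x = t x.
  move=> hx gs gt st; have [t' [tt' t't]] := aut_inverse t.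
  have gt' : Gal e t' by split=> [|c]; [exact: endo_bij|rewrite -{1}(gt.2 c) tt'].
  have := hx (t' \o s : {lrmorphism L -> L}) (galM _ _ gt' gs).
  by move=> /(_ _)/(congr1 t) /=; rewrite t't; apply=> z zZ; rewrite /= st // tt'.
pose PN : {pred L} := [pred x | `[< forall u, Gal e u -> {in Z, forall z, u z = z} -> u x = x >]].
have PNP x : reflect (forall u, Gal e u -> {in Z, forall z, u z = z} -> u x = x) (x \in PN) by exact: asboolP.
have [||N [j jP]] := @subfield F L PN.
- split=> [|x y /PNP hx /PNP hy|x y /PNP hx /PNP hy]; apply/PNP => u gu uZ.
  + exact: rmorph1.
  + by rewrite rmorphB; congr (_ - _); [exact: hx|exact: hy].
  + by rewrite rmorphM fmorphV; congr (_ / _); [exact: hx|exact: hy].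
- by move=> c; apply/PNP => u _ _; exact: lrmorph_cA.
have jN x : forall u, Gal e u -> {in Z, forall z, u z = z} -> u (j x) = j x.
  by apply/PNP/jP; exists x.
have [e' e'E] : exists e' : {lrmorphism K -> N}, j \o e' =1 e.
  apply: (@factor_inj _ _ _ _ e j (fmorph_inj j)) => c; apply/jP/PNP => u gu _.
  exact: gu.2.
have /(_ _)/cid-/all_sig[act actE] : forall g : gT, exists a : {lrmorphism N -> N}, j \o a =1 lift g \o j.
  move=> g; have [gg _] := liftP g.
  apply: (@factor_inj _ _ _ _ (lift g \o j : {lrmorphism N -> L}) j (fmorph_inj j)) => x.
  apply/jP/PNP => u gu uZ /=.
  apply: (fixN (u \o lift g : {lrmorphism L -> L}) (lift g)) => //.
  - exact: jN.
  - exact: galM.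
  - by move=> z zZ /=; apply: uZ; exact: (Zst _ _ zZ).
have lift_eq g s x : Gal e s -> gp s = (sgval g)^-1%g -> s (j x) = lift g (j x).
  move=> gs es; have [gg eg] := liftP g; apply: fixN => // [|z zZ]; first exact: jN.
  by rewrite -[z]/(val (SeqSub zZ : T)) -!gpE es eg.
exists N, j, e', gT, act; split=> //.
- split.
  + move=> g c; apply: (fmorph_inj j); rewrite -[LHS]/((j \o act g) (e' c)) actE /=.
    by rewrite -[j _]/((j \o e') c) e'E; have [[_ h] _] := liftP g; exact: h.
  + move=> g h x; apply: (fmorph_inj j); rewrite -[LHS]/((j \o act _) x) actE /=.
    rewrite -[RHS]/((j \o act g) (act h x)) actE /= -[j (act h x)]/((j \o act h) x) actE /=.
    symmetry; have [gg eg] := liftP g; have [gh eh] := liftP h.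
    apply: (lift_eq _ (lift g \o lift h : {lrmorphism L -> L})); first exact: galM.
    by rewrite gpM eg eh -invMg.
  + move=> g g1; have : (sgval g)^-1%g != 1%g.
      by rewrite eq_invg1; apply: contra_neq g1 => h; apply: val_inj.
    move=> h; have [z hz] : exists z : T, (sgval g)^-1%g z != z.
      apply: contrapT => no; case/eqP: h; apply/permP => z; rewrite perm1.
      by apply: contrapT => /eqP hz; apply: no; exists z.
    have [y yE] : exists y, j y = val z by apply/jP/PNP => u _; apply; exact: ssvalP.
    exists y; apply: contraNneq hz => ay; apply/eqP/val_inj.
    have [_ <-] := liftP g; rewrite gpE -yE -[lift g _]/((lift g \o j) y) -actE /=.
    by congr (j _).
  + move=> x fx; have [[c cE]|no] := pselect (exists c, e c = j x).
      by exists c; apply: (fmorph_inj j); exact: (etrans (e'E c) cE).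
    have [|s [gs]] := @aut_extend K e (j x); first by move=> c hc; apply: no; exists c.
    have gH' : ((gp s)^-1 \in HG)%g by rewrite groupV; apply/HP; exists s.
    rewrite (@lift_eq (subg HG (gp s)^-1%g)) ?subgK ?invgK //.
    by rewrite -[lift _ _]/((lift _ \o j) x) -actE /= fx eqxx.
- by move=> x xS; apply/jP/PNP => u gu uZ; apply: uZ; exact: SZ.
- rewrite prime_coprime //; apply/negP.
  have -> : #|gT| = #|HG| by rewrite card_sub; exact: eq_card.
  (* An element of order p would be induced by some s; but some iterate of s, with exponent a power
     of l, is trivial on the finite set Z. *)
  move=> /(Cauchy pp)[g gHG og].
  have /HP[s [gs sg]] := gHG.
  have /choice[m mP] : forall z : L, exists m, iter (l ^ m) s z = z by exact: tors.
  pose M := \sum_(z <- Z) m z.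
  have sM z : z \in Z -> iter (l ^ M) s z = z.
    move=> zZ; have -> : M = (m z + (M - m z))%N.
      by rewrite subnKC // /M (big_rem z) //= leq_addr.
    rewrite expnD mulnC; elim: (l ^ (M - m z))%N => [|k IH]; first by rewrite mul0n.
    by rewrite mulSn iterD IH mP.
  have gM : (g ^+ (l ^ M) = 1)%g.
    have it k z : val ((g ^+ k)%g z) = iter k s (val z).
      elim: k => [|k IH]; first by rewrite expg0 perm1.
      by rewrite expgSr permM -sg gpE sg IH.
    by apply/permP => z; apply: val_inj; rewrite it perm1 sM //; exact: ssvalP.
  have : (#[g]%g %| l ^ M)%N by rewrite order_dvdn gM.
  by rewrite og Euclid_dvdX // dvdn_prime2 // eq_sym (negPf lp).
- move=> g; exists (lift g); split; first by case: (liftP g).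
  by move=> x; symmetry; exact: actE.
Qed.
End Automorphisms.

(** Fixing x is an open condition on the Galois group: it follows from the vanishing of [chi] modulo
    l^(n+1) for some n, which the iterate of s of order l^(n+1) satisfies. *)
Lemma Zl_torsion (l d : nat) (F : fieldType) (L : fieldAlgType F) :
  prime l -> Zl_extension l d L ->
  forall (s : {lrmorphism L -> L}) x, exists m, iter (l ^ m) s x = x.
Proof.
move=> pl [galL [chi [_ chiM _ chi0]]] s x.
have [n hn] := chi0 x.
have powP k : exists t : {lrmorphism L -> L}, t =1 iter k.+1 s /\ forall i, chi t i n = chi s i n *+ k.+1.
  elim: k => [|k [t [tE tc]]]; first by exists s; split=> // i; rewrite mulr1n.
  exists (s \o t : {lrmorphism L -> L}); split=> [y|i]; first by rewrite /= tE.
  by rewrite chiM ?tc ?mulrS //; exact: endo_bij.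
have [t] := powP (l ^ n.+1).-1; rewrite prednK ?expn_gt0 ?prime_gt0 // => -[tE tc].
exists n.+1; rewrite -tE; apply: hn; first exact: endo_bij.
move=> i; rewrite tc -mulr_natl pchar_Zp ?mul0r //.
by rewrite -(expn0 l) ltn_exp2l // prime_gt1.
Qed.

(** * Function fields *)

Lemma lift_poly (k A : nzRingType) (i : {rmorphism k -> A}) (q : {poly A}) :
  (forall j, exists y, i y = q`_j) -> exists r : {poly k}, map_poly i r = q.
Proof.
elim/poly_ind: q => [|q c IH] h; first by exists 0; rewrite rmorph0.
have [j|r rE] := IH; first by have := h j.+1; rewrite coefD coefMX coefC /= addr0.
have [y] := h 0; rewrite coefD coefMX coefC /= add0r => yE.
by exists (r * 'X + y%:P); rewrite rmorphD rmorphM /= map_polyX map_polyC /= rE yE.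
Qed.

Lemma simple_subfield (k A : fieldType) (i : {rmorphism k -> A}) (x : A) :
  exists (k' : fieldType) (i' : {rmorphism k' -> A}) (iota : {rmorphism k -> k'}),
  [/\ i' \o iota =1 i, exists y, i' y = x &
      forall y, exists q q' : {poly k}, (map_poly i q').[x] != 0 /\
         i' y = (map_poly i q).[x] / (map_poly i q').[x]].
Proof.
pose ev (q : {poly k}) : A := (map_poly i q).[x].
have evD q q' : ev (q + q') = ev q + ev q' by rewrite /ev rmorphD hornerD.
have evN q : ev (- q) = - ev q by rewrite /ev rmorphN hornerN.
have evM q q' : ev (q * q') = ev q * ev q' by rewrite /ev rmorphM hornerM.
have ev1 : ev 1 = 1 by rewrite /ev rmorph1 hornerC.
have evC a : ev a%:P = i a by rewrite /ev map_polyC hornerC.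
have evX : ev 'X = x by rewrite /ev map_polyX hornerX.
pose kx : {pred A} := [pred z | `[< exists q q', ev q' != 0 /\ z = ev q / ev q' >]].
have kxP z : reflect (exists q q', ev q' != 0 /\ z = ev q / ev q') (z \in kx) by exact: asboolP.
have ckx : divring_closed kx.
  split=> [|u v /kxP[q [q' [h ->]]] /kxP[d [d' [h' ->]]]|u v /kxP[q [q' [h ->]]] /kxP[d [d' [h' ->]]]]; apply/kxP.
  - by exists 1, 1; rewrite ev1 oner_eq0 divr1.
  - exists (q * d' - d * q'), (q' * d'); rewrite evD evN !evM mulf_neq0 //; split=> //.
    by rewrite -mulNr addf_div // mulNr.
  - have [e|ne] := eqVneq (ev d) 0.
      by exists 0, 1; rewrite ev1 oner_eq0 e mul0r invr0 mulr0 divr1 /ev rmorph0 horner0.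
    exists (q * d'), (q' * d); rewrite !evM mulf_neq0 //; split=> //.
    by rewrite invf_div mulf_div.
have [k' [i' i'P]] := subfield_type ckx.
have /choice[io ioE] : forall a, exists y, i' y = i a.
  by move=> a; apply/i'P/kxP; exists a%:P, 1; rewrite ev1 oner_eq0 divr1 evC.
have [iota iotaE] : exists io' : {rmorphism k -> k'}, io' =1 io.
  apply: build_rmorph => [|u v|u v]; apply: (fmorph_inj i').
  - by rewrite ioE !rmorph1.
  - by rewrite rmorphD !ioE rmorphD.
  - by rewrite rmorphM !ioE rmorphM.
exists k', i', iota; split=> [y||y]; first by rewrite /= iotaE ioE.
  by apply/i'P/kxP; exists 'X, 1; rewrite ev1 oner_eq0 divr1 evX.
by apply/kxP/i'P; exists y.
Qed.

Definition finite_over (k A : fieldType) (i : {rmorphism k -> A}) :=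
  exists n (b : 'I_n -> A), forall x, in_span i b x.

Definition algebraic (k A : fieldType) (i : {rmorphism k -> A}) (x : A) :=
  exists2 q : {poly k}, q != 0 & root (map_poly i q) x.

Lemma finite_algebraic (k A : fieldType) (i : {rmorphism k -> A}) x :
  finite_over i -> algebraic i x.
Proof. by move=> [n [b hb]]; apply: algebraic_of_span (fun m => hb _). Qed.

Lemma algebraic_up (k k' A : fieldType) (i : {rmorphism k -> A}) (i' : {rmorphism k' -> A}) x :
  (forall y, exists z, i' z = i y) -> algebraic i x -> algebraic i' x.
Proof.
move=> h [q q0 qx].
have [j|r rE] := @lift_poly _ _ i' (map_poly i q); first by rewrite coef_map; exact: h.
exists r; last by rewrite rE.
by rewrite -(map_poly_eq0 i') rE map_poly_eq0.
Qed.

Lemma finite_adjoin (k A : fieldType) (i : {rmorphism k -> A}) (l : seq A) :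
  (forall x, x \in l -> algebraic i x) ->
  exists (M : fieldType) (j : {rmorphism M -> A}) (iota : {rmorphism k -> M}),
  [/\ j \o iota =1 i, finite_over iota & forall x, x \in l -> exists y, j y = x].
Proof.
elim: l => [|x l IH] h.
  exists k, i, idfun; split=> //; exists 1%N, (fun=> 1) => y; exists (fun=> y).
  by rewrite big_ord1 mulr1.
have [M [j [iota [ji [n [b hb]] lM]]]] := IH (fun y hy => h y (mem_behead (s := x :: l) hy)).
have [q q0 qx] : algebraic j x.
  apply: algebraic_up (h x (mem_head _ _)) => y; exists (iota y); exact: ji.
have [dV Vspan] := horner_divring q0 qx.
have [M' [j' j'P]] := subfield_type dV.
have /choice[io ioE] : forall a, exists y, j' y = j a.
  by move=> a; apply/j'P/asboolP; exists a%:P; rewrite map_polyC hornerC.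
have [iota' iotaE] : exists io' : {rmorphism M -> M'}, io' =1 io.
  apply: build_rmorph => [|u v|u v]; apply: (fmorph_inj j').
  - by rewrite ioE !rmorph1.
  - by rewrite rmorphD !ioE rmorphD.
  - by rewrite rmorphM !ioE rmorphM.
have [x' x'E] : exists y, j' y = x.
  by apply/j'P/asboolP; exists 'X; rewrite map_polyX hornerX.
exists M', j', (iota' \o iota : {rmorphism k -> M'}); split.
- by move=> y; rewrite /= iotaE ioE; exact: ji.
- apply: (in_span_trans hb (i' := iota') (c := fun u : 'I_(size q) => x' ^+ u)) => y.
  have [|c cE] := Vspan (j' y); first by apply/j'P; exists y.
  exists c; apply: (fmorph_inj j'); rewrite cE rmorph_sum; apply: eq_bigr => u _.
  by rewrite rmorphM rmorphXn x'E /= iotaE ioE.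
- move=> y; rewrite inE => /orP[/eqP->|/lM[z zE]]; first by exists x'.
  by exists (iota' z); rewrite iotaE ioE.
Qed.

(** Steinitz exchange. Clearing denominators turns an equation of t over k(u) into a polynomial
    relation between t and u; regrouped by powers of u it is an equation of u, nonzero because t is
    transcendental. *)
Lemma algebraic_exchange (k A k1 k2 : fieldType) (i : {rmorphism k -> A})
    (i1 : {rmorphism k1 -> A}) (i2 : {rmorphism k2 -> A}) (t u : A) :
  (forall y, exists q q' : {poly k}, (map_poly i q').[u] != 0 /\
         i1 y = (map_poly i q).[u] / (map_poly i q').[u]) ->
  (forall q : {poly k}, exists y, i2 y = (map_poly i q).[t]) ->
  algebraic i1 t -> ~ algebraic i t -> algebraic i2 u.
Proof.
move=> h1 h2 [q q0 qt] nt.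
pose ev (x : A) (r : {poly k}) : A := (map_poly i r).[x].
have evM x r r' : ev x (r * r') = ev x r * ev x r' by rewrite /ev rmorphM hornerM.
have [d d0 [P PE]] : exists2 d : {poly k}, ev u d != 0 & exists P : {poly {poly k}},
    forall j, ev u P`_j = ev u d * i1 q`_j.
  elim/poly_ind: q {q0 qt} => [|q c [d d0 [P PE]]].
    by exists 1; rewrite /ev ?rmorph1 ?hornerC ?oner_neq0 //; exists 0 => j; rewrite !coef0 !rmorph0 horner0 mulr0.
  have [r [r' [r'0 cE]]] := h1 c.
  exists (d * r'); first by rewrite evM mulf_neq0.
  exists (r' *: P * 'X + (r * d)%:P) => -[|j].
    rewrite !coefD !coefMX !coefC /= !add0r !evM cE /ev [LHS]mulrC -mulrA; congr (_ * _).
    by rewrite mulrCA divff // mulr1.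
  by rewrite !coefD !coefMX !coefC /= !addr0 coefZ !evM PE mulrCA mulrA.
have [j0 qj0] : exists j, q`_j != 0 by exists (size q).-1; rewrite -/(lead_coef q) lead_coef_eq0.
have Pj0 : P`_j0 != 0.
  apply/eqP => e; have := PE j0; rewrite e {1}/ev rmorph0 horner0 => /esym/eqP.
  by rewrite mulf_eq0 (negPf d0) fmorph_eq0 (negPf qj0).
pose N := \max_(j < size P) size (P`_j)%R.
have hN (j : 'I_(size P)) : (size (P`_j)%R <= N)%N by exact: (leq_bigmax (F := fun j : 'I_(size P) => size (P`_j)%R)).
(* The coefficient of u^m in the relation, a polynomial in t. *)
pose Q (m : nat) : {poly k} := \poly_(j < size P) P`_j`_m.
have [R RE] : exists R : {poly k2}, map_poly i2 R = \poly_(m < N) ev t (Q m).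
  apply: lift_poly => m; rewrite coef_poly; case: ifP => _; first exact: h2.
  by exists 0; rewrite rmorph0.
have sj0 : (j0 < size P)%N by rewrite ltnNge; apply: contra Pj0 => /leq_sizeP/(_ j0 (leqnn _)) ->.
exists R.
  rewrite -(map_poly_eq0 i2) RE; apply/eqP => /polyP e.
  have [m Pm] : exists m, P`_j0`_m != 0.
    by exists (size P`_j0).-1; rewrite -/(lead_coef _) lead_coef_eq0.
  have mN : (m < N)%N.
    apply: leq_trans (hN (Ordinal sj0)) => /=.
    by rewrite ltnNge; apply: contra Pm => /leq_sizeP/(_ m (leqnn _)) ->.
  have := e m; rewrite coef_poly mN coef0 => em; apply: nt; exists (Q m); last exact/rootP.
  by apply/eqP => /polyP/(_ j0); rewrite coef_poly sj0 coef0 => /eqP; rewrite (negPf Pm).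
rewrite RE; apply/rootP; rewrite (horner_coef_wide (n := N)) ?size_poly //.
transitivity (\sum_(j < size P) ev u P`_j * t ^+ j).
  transitivity (\sum_(m < N) \sum_(j < size P) i P`_j`_m * t ^+ j * u ^+ m).
    apply: eq_bigr => m _; rewrite coef_poly ltn_ord -mulr_suml; congr (_ * _).
    rewrite /ev (horner_coef_wide (n := size P)) ?size_map_poly ?size_poly //.
    by apply: eq_bigr => j _; rewrite coef_map coef_poly ltn_ord.
  rewrite exchange_big; apply: eq_bigr => j _ /=.
  rewrite /ev (horner_coef_wide (n := N)) ?size_map_poly ?hN // mulr_suml.
  by apply: eq_bigr => m _; rewrite coef_map mulrAC.
under eq_bigr => j _ do rewrite PE -mulrA.
rewrite -mulr_sumr.
have sq : (size q <= size P)%N.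
  apply/leq_sizeP => j sj; apply/eqP; have := PE j; rewrite nth_default // {1}/ev rmorph0 horner0 => /esym/eqP.
  by rewrite mulf_eq0 (negPf d0) fmorph_eq0.
move/rootP: qt; rewrite (horner_coef_wide (n := size P)) ?size_map_poly // => e.
under eq_bigr => j _ do rewrite -coef_map.
by rewrite e mulr0.
Qed.

Lemma pigeonhole (T : finType) (f : nat -> T) : exists i j, (i < j)%N /\ f i = f j.
Proof.
have [/injectiveP inj|/injectivePn[x [y xy e]]] := boolP (injectiveb (fun i : 'I_#|T|.+1 => f i)).
  by have := leq_card _ inj; rewrite card_ord ltnn.
have : (x != y :> nat) by [].
by rewrite neq_ltn => /orP[h|h]; [exists x, y|exists y, x].
Qed.

Lemma algebraic_trans (k k' A : fieldType) (i : {rmorphism k -> A}) (i' : {rmorphism k' -> A}) :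
  (forall y, algebraic i (i' y)) -> forall x, algebraic i' x -> algebraic i x.
Proof.
move=> h x [q q0 qx].
have [|M [j [io [ji fio lM]]]] := @finite_adjoin k A i (map_poly i' q).
  move=> y /(nthP 0)[m _ <-]; rewrite coef_map; exact: h.
have [m|r rE] := @lift_poly _ _ j (map_poly i' q).
  have [sm|sm] := ltnP m (size (map_poly i' q)); first by apply: lM; exact: mem_nth.
  by exists 0; rewrite rmorph0 nth_default.
have [|M' [j' [io' [ji' fio' lM']]]] := @finite_adjoin M A j [:: x].
  move=> y; rewrite inE => /eqP->; exists r; last by rewrite rE.
  by rewrite -(map_poly_eq0 j) rE map_poly_eq0.
have [n [b hb]] := fio; have [n' [b' hb']] := fio'.
have fM : finite_over (io' \o io : {rmorphism k -> M'}) by exact: in_span_trans hb hb'.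
have [x' <-] := lM' x (mem_head _ _).
have [s s0 sx] := finite_algebraic x' fM.
exists s => //.
have -> : map_poly i s = map_poly j' (map_poly (io' \o io) s).
  rewrite -map_poly_comp; apply: eq_map_poly => y /=.
  by rewrite -ji -[RHS]/((j' \o io') (io y)) ji'.
by rewrite fmorph_root.
Qed.

Lemma algebraic_eq (k A : fieldType) (i i' : {rmorphism k -> A}) x : i =1 i' -> algebraic i x -> algebraic i' x.
Proof. by move=> e [q q0 qx]; exists q => //; rewrite -(eq_map_poly e). Qed.

Lemma algebraic_map (k A B : fieldType) (i : {rmorphism k -> A}) (f : {rmorphism A -> B}) x :
  algebraic (f \o i : {rmorphism k -> B}) (f x) <-> algebraic i x.
Proof.
split=> -[q q0 qx]; exists q => //.
  by move: qx; rewrite map_poly_comp fmorph_root.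
by rewrite map_poly_comp fmorph_root.
Qed.

Lemma lift_polyOver (k A : nzRingType) (i : {rmorphism k -> A}) (K : {pred A}) (q : {poly A}) :
  (forall y, y \in K -> exists z, i z = y) -> q \is a polyOver K ->
  exists r : {poly k}, map_poly i r = q.
Proof.
move=> iK qK; apply: lift_poly => j.
have [sj|sj] := ltnP j (size q); last by exists 0; rewrite rmorph0 nth_default.
by apply: iK; apply: (allP qK); exact: mem_nth.
Qed.

Lemma algebraic_overP (A k : fieldType) (i : {rmorphism k -> A}) (K : {pred A}) x :
  (forall y, (y \in K) <-> exists z, i z = y) -> algebraic_over K x <-> algebraic i x.
Proof.
move=> iK; split.
  move=> [q [qK q0 qx]].
  have [r rE] := @lift_polyOver _ _ i K q (fun y => (iK y).1) qK.
  by exists r; rewrite ?rE // -(map_poly_eq0 i) rE.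
move=> [q q0 qx]; exists (map_poly i q); split=> //; last by rewrite map_poly_eq0.
by apply/allP => _ /(nthP 0)[j _ <-]; rewrite coef_map; apply/iK; exists q`_j.
Qed.

Section Constants.
Variables (p : nat) (F : fieldType) (k : {pred F}).
Hypothesis pF : p \in [pchar F].

Lemma prime_field : exists i : {rmorphism 'F_p -> F},
  forall y, (y \in [pred y | `[< exists n : nat, y = n%:R >]]) <-> exists z, i z = y.
Proof.
have modE n : (n %% (Zp_trunc (pdiv p)).+2)%:R = n%:R :> F.
  by rewrite Fp_cast ?(pcharf_prime pF) // GRing.natr_mod_pchar.
have [|a b|a b|i iE] := @build_rmorph 'F_p F (fun a : 'F_p => (a : nat)%:R).
- by [].
- by rewrite -natrD -[RHS]modE.
- by rewrite -natrM -[RHS]modE.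
exists i => y; split=> [/asboolP[n ->]|[z <-]]; last by apply/asboolP; exists z; rewrite iE.
by exists n%:R; rewrite rmorph_nat.
Qed.

(** The powers of x lie in a finite-dimensional space over the finite prime field, so two of them
    coincide. *)
Lemma prime_field_root (x : F) : x != 0 ->
  algebraic_over [pred y | `[< exists n : nat, y = n%:R >]] x ->
  exists n, (0 < n)%N /\ x ^+ n = 1.
Proof.
have [i iP] := prime_field; move=> x0 /(algebraic_overP _ iP)[q q0 qx].
have [dV Vspan] := horner_divring q0 qx.
have pw m : exists c : {ffun 'I_(size q) -> 'F_p}, x ^+ m = \sum_j i (c j) * x ^+ j.
  have [|c cE] := Vspan (x ^+ m).
    by apply/asboolP; exists 'X^m; rewrite map_polyXn hornerXn.
  by exists (finfun c); rewrite cE; apply: eq_bigr => j _; rewrite ffunE.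
have /choice[c cE] := pw.
have [m [n [mn e]]] := pigeonhole c.
exists (n - m)%N; rewrite subn_gt0; split=> //.
apply: (mulfI (expf_neq0 m x0)); rewrite -exprD subnKC ?(ltnW mn) // mulr1.
by rewrite cE [RHS]cE e.
Qed.

Lemma frobenius_inj (A : fieldType) : p \in [pchar A] -> injective (fun x : A => x ^+ p).
Proof.
move=> pA x y e; apply/eqP; rewrite -subr_eq0.
have : (x - y) ^+ p = 0.
  by have := pFrobenius_autB_comm pA (mulrC x y); rewrite !pFrobenius_autE e subrr.
by move/eqP; rewrite expf_eq0 => /andP[].
Qed.

(** The powers of p repeat modulo n, so x^(p^i) = x^(p^j) for some i < j; cancelling the injective
    Frobenius i times gives x = x^(p^(j-i)), a p-th power. *)
Lemma root_of_unity_pth (A : fieldType) (x : A) n : p \in [pchar A] -> (0 < n)%N ->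
  x ^+ n = 1 -> exists y, y ^+ p = x.
Proof.
move=> pA; case: n => // n _ xn.
have [i [j [ij e]]] := pigeonhole (fun i => inord (p ^ i %% n.+1) : 'I_n.+1).
have e' : (p ^ i %% n.+1 = p ^ j %% n.+1)%N.
  by move/(congr1 val): e; rewrite /= !inordK ?ltn_mod.
have xe m : x ^+ m = x ^+ (m %% n.+1).
  by rewrite {1}(divn_eq m n.+1) exprD mulnC exprM xn expr1n mul1r.
have : x ^+ (p ^ i) = x ^+ (p ^ j) by rewrite xe e' -xe.
rewrite -(subnK ij); move: (j - i.+1)%N => d; elim: {ij e e'} i => [|i IH].
  by rewrite addn1 expr1 expnS mulnC exprM => /esym h; exists (x ^+ (p ^ d)).
move=> h; apply: IH; apply: (frobenius_inj pA) => /=.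
by rewrite -!exprM -!expnSr h !addnS.
Qed.
End Constants.

(** The function field seen through the embedding of its constant field. The last clause speaks of
    any field k1 whose image contains the polynomials in t, so that no model of k(t) has to be
    fixed. *)
Record constants (p : nat) (k F : fieldType) (ka : {rmorphism k -> F}) : Prop := Constants {
  const_char : p \in [pchar F];
  const_root : forall a : k, a != 0 -> exists n, (0 < n)%N /\ a ^+ n = 1;
  const_gen : exists s : seq F, forall P : {pred F}, divring_closed P ->
     (forall a, ka a \in P) -> {subset s <= P} -> forall x, x \in P;
  const_transc : exists t, ~ algebraic ka t /\
     forall (k1 : fieldType) (i1 : {rmorphism k1 -> F}),
       (forall q : {poly k}, exists z, i1 z = (map_poly ka q).[t]) ->
       forall x, algebraic i1 x }.

Lemma function_field_constants p (F : fieldType) (K : {pred F}) :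
  function_field p K -> exists (k : fieldType) (ka : {rmorphism k -> F}), constants p ka.
Proof.
move=> [pF cK rK aK [[s sK] [t [nt tK]]]].
have [k [ka kaP]] := subfield_type cK.
exists k, ka; split=> //.
- move=> a a0; have Ka : ka a \in K by apply/kaP; exists a.
  have a0' : ka a != 0 by rewrite fmorph_eq0.
  have [n [n0 e]] := prime_field_root pF a0' (rK _ Ka).
  by exists n; split=> //; apply: (fmorph_inj ka); rewrite rmorphXn rmorph1.
- exists s => P cP Pk Ps x; have := sK x; rewrite !inE => /asboolP; apply=> //.
  by move=> y /kaP[z <-].
- exists t; split; first by move=> /(algebraic_overP t kaP).
  move=> k1 i1 h x.
  have sub (y : F) : y \in adjoin K [:: t] -> exists z, i1 z = y.
    pose P : {pred F} := [pred y | `[< exists z, i1 z = y >]].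
    move=> /asboolP/(_ P) hP; apply/asboolP; apply: hP.
    + split=> [|u v /asboolP[a <-] /asboolP[b <-]|u v /asboolP[a <-] /asboolP[b <-]]; apply/asboolP.
      * by exists 1; rewrite rmorph1.
      * by exists (a - b); rewrite rmorphB.
      * by exists (a / b); rewrite rmorphM fmorphV.
    + move=> y' /kaP[a <-]; apply/asboolP; have [z zE] := h a%:P.
      by exists z; rewrite zE map_polyC hornerC.
    + move=> y'; rewrite inE => /eqP->; apply/asboolP; have [z zE] := h 'X.
      by exists z; rewrite zE map_polyX hornerX.
  have [q [qK q0 qx]] := tK x.
  have [r rE] := @lift_polyOver _ _ i1 _ q sub qK.
  by exists r; rewrite ?rE // -(map_poly_eq0 i1) rE.
Qed.

Section TranscendenceDegreeOne.
Variables (p : nat) (k F A : fieldType) (ka : {rmorphism k -> F}) (io : {rmorphism F -> A}).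
Hypothesis cka : constants p ka.
Let kA : {rmorphism k -> A} := io \o ka.

(** By exchange, t may replace the given transcendence basis t0: t is algebraic over k(t0), hence t0
    over k(t), hence everything over k(t). *)
Lemma transc_algebraic (k2 : fieldType) (i2 : {rmorphism k2 -> A}) (t x : A) :
  (forall x, algebraic io x) -> ~ algebraic kA t ->
  (forall q : {poly k}, exists z, i2 z = (map_poly kA q).[t]) ->
  algebraic i2 x.
Proof.
move=> algA nt h2.
have [t0 [nt0 ht0]] := const_transc cka.
have [k1 [i1 [iota [i1k [y0 y0E] i1q]]]] := simple_subfield kA (io t0).
have [k1' [i1' [iota' [i1k' [y0' y0E'] i1q']]]] := simple_subfield ka t0.
have h1 (y : k1') : exists z, i1 z = io (i1' y).
  have [q [q' [_ ->]]] := i1q' y.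
  exists ((map_poly iota q).[y0] / (map_poly iota q').[y0]).
  have ev (r : {poly k}) : i1 (map_poly iota r).[y0] = io (map_poly ka r).[t0].
    rewrite -!horner_map /= y0E -!map_poly_comp; congr _.[_].
    by apply: eq_map_poly => c; rewrite -[LHS]/((i1 \o iota) c) i1k.
  by rewrite fmorph_div !ev fmorph_div.
have alg1 y : algebraic i1 y.
  apply: (@algebraic_trans _ _ _ i1 io) (algA y) => z.
  apply: (@algebraic_up _ _ _ (io \o i1' : {rmorphism k1' -> A}) i1); first exact: h1.
  apply/algebraic_map; apply: ht0 => q.
  exists (map_poly iota' q).[y0']; rewrite -horner_map /= y0E' -map_poly_comp.
  by congr _.[_]; apply: eq_map_poly => c; rewrite -[LHS]/((i1' \o iota') c) i1k'.
have algu : algebraic i2 (io t0).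
  exact: (@algebraic_exchange k A k1 k2 kA i1 i2 t (io t0) i1q h2 (alg1 t) nt).
apply: (@algebraic_trans _ _ _ i2 i1) (alg1 x) => y.
have [|M [j [m [jm fm lM]]]] := @finite_adjoin k2 A i2 [:: io t0].
  by move=> z; rewrite inE => /eqP ->.
have [u uE] := lM _ (mem_head _ _).
have kM (c : k) : exists z, j z = kA c.
  have [z zE] := h2 c%:P; exists (m z); rewrite -[LHS]/((j \o m) z) jm zE map_polyC hornerC.
  by [].
have evM (r : {poly k}) : exists z, j z = (map_poly kA r).[io t0].
  have [|r' r'E] := @lift_poly _ _ j (map_poly kA r); first by move=> n; rewrite coef_map; exact: kM.
  by exists r'.[u]; rewrite -r'E -uE horner_map.
have [q [q' [q'0 ->]]] := i1q y; have [z zE] := evM q; have [z' zE'] := evM q'.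
apply: (algebraic_eq jm); rewrite -zE -zE' -fmorph_div; apply/algebraic_map.
exact: finite_algebraic.
Qed.

(** Algebraicity over k(t) becomes finiteness because F is generated over its constants by finitely
    many elements. *)
Lemma transc_finite (k2 : fieldType) (i2 : {rmorphism k2 -> A}) (t : A) :
  finite_over io -> ~ algebraic kA t ->
  (forall q : {poly k}, exists z, i2 z = (map_poly kA q).[t]) ->
  finite_over i2.
Proof.
move=> fA nt h2; have [s hs] := const_gen cka.
have alg2 x : algebraic i2 x.
  by apply: (transc_algebraic (t := t)) => // y; exact: finite_algebraic.
have [M [j [m [jm [n [b hb]] lM]]]] := @finite_adjoin k2 A i2 (map io s) (fun x _ => alg2 x).
pose P : {pred F} := [pred x | `[< exists z, j z = io x >]].
have inP x : x \in P.
  apply: hs => [|a|y ys].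
  - split=> [|u v /asboolP[a aE] /asboolP[c cE]|u v /asboolP[a aE] /asboolP[c cE]]; apply/asboolP.
    + by exists 1; rewrite !rmorph1.
    + by exists (a - c); rewrite !rmorphB aE cE.
    + by exists (a / c); rewrite !rmorphM !fmorphV aE cE.
  - apply/asboolP; have [z zE] := h2 a%:P; exists (m z).
    by rewrite -[LHS]/((j \o m) z) jm zE map_polyC hornerC.
  - by apply/asboolP; apply: lM; apply: map_f.
have [n' [b' hb']] := fA.
have hj x : in_span j b' x.
  have [c ->] := hb' x; have /choice[d dE] : forall l, exists z, j z = io (c l).
    by move=> l; exact/asboolP/inP.
  by exists d; apply: eq_bigr => l _; rewrite dE.
have [N [d hd]] := in_span_trans hb hj.
by exists N, d => x; have [c ->] := hd x; exists c; apply: eq_bigr => l _; rewrite -jm.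
Qed.
End TranscendenceDegreeOne.

(** * Places *)

Section PlaceTheory.
Variables (L : fieldType) (v : place L).
Implicit Types x y c : L.

Let cv := subring_closedD (vring_closed v).

Lemma place0 : 0 \in v. Proof. by case: cv => -[]. Qed.
Lemma place1 : 1 \in v. Proof. by case: cv => -[]. Qed.
Lemma placeN x : (- x \in v) = (x \in v).
Proof.
by have [[_ _ vN] _] := cv; apply/idP/idP => /vN //; rewrite opprK.
Qed.
Lemma placeD x y : x \in v -> y \in v -> x + y \in v. Proof. by case: cv => _ [+ _]; apply. Qed.
Lemma placeM x y : x \in v -> y \in v -> x * y \in v. Proof. by case: cv => _ [_ +]; apply. Qed.
Lemma placeB x y : x \in v -> y \in v -> x - y \in v.
Proof. by move=> vx vy; rewrite placeD ?placeN. Qed.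
Lemma placeX x n : x \in v -> x ^+ n \in v.
Proof. by move=> vx; elim: n => [|n IH]; rewrite ?expr0 ?place1 // exprS placeM. Qed.
Lemma place_sum (I : Type) (r : seq I) (P : pred I) f :
  (forall i, P i -> f i \in v) -> \sum_(i <- r | P i) f i \in v.
Proof. by move=> h; apply: (big_ind (fun x => x \in v)) => //; [exact: place0|exact: placeD]. Qed.
Lemma place_nat n : n%:R \in v.
Proof. by elim: n => [|n IH]; rewrite ?place0 // -addn1 natrD placeD ?place1. Qed.

Lemma vmax_place x : x \in vmax v -> x \in v. Proof. by case/andP. Qed.
Lemma vmax_inv x : x \in vmax v -> x != 0 -> x^-1 \notin v.
Proof. by case/andP => _ /orP[/eqP->|//]; rewrite eqxx. Qed.
Lemma vmaxI x : x \in v -> x^-1 \notin v -> x \in vmax v.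
Proof. by move=> vx vx'; apply/andP; split=> //; rewrite vx' orbT. Qed.
Lemma vmax0 : 0 \in vmax v. Proof. by apply/andP; rewrite place0 eqxx. Qed.
Lemma vmax1 : 1 \notin vmax v.
Proof. by apply/negP => /vmax_inv; rewrite oner_eq0 invr1 place1 => /(_ isT). Qed.
Lemma place_inv x : x \notin v -> x^-1 \in vmax v.
Proof.
move=> vx; case: (vring_total v x) => [|h]; first by rewrite (negPf vx).
by apply: vmaxI; rewrite ?invrK.
Qed.
Lemma vmaxM x y : x \in v -> y \in vmax v -> x * y \in vmax v.
Proof.
move=> vx my; have [->|nz] := eqVneq (x * y) 0; first exact: vmax0.
have := nz; rewrite mulf_eq0 negb_or => /andP[x0 y0].
apply: vmaxI; first by apply: placeM => //; exact: vmax_place.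
apply: contra (vmax_inv my y0) => h.
by have := placeM vx h; rewrite invfM mulrA divff // mul1r.
Qed.
Lemma vmaxD x y : x \in vmax v -> y \in vmax v -> x + y \in vmax v.
Proof.
move=> mx my; have [->|x0] := eqVneq x 0; first by rewrite add0r.
have [->|y0] := eqVneq y 0; first by rewrite addr0.
case: (vring_total v (x / y)) => h.
  have -> : x + y = (x / y + 1) * y by rewrite mulrDl divfK // mul1r.
  by rewrite vmaxM ?placeD ?place1.
have -> : x + y = (1 + y / x) * x by rewrite mulrDl divfK // mul1r.
by rewrite vmaxM ?placeD ?place1 // -invf_div.
Qed.
Lemma vmaxN x : (- x \in vmax v) = (x \in vmax v).
Proof.
by apply/idP/idP => h; [rewrite -[x]opprK|]; rewrite -mulN1r vmaxM // placeN place1.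
Qed.
Lemma vmaxB x y : x \in vmax v -> y \in vmax v -> x - y \in vmax v.
Proof. by move=> mx my; rewrite vmaxD ?vmaxN. Qed.
Lemma vmaxX x n : x \in vmax v -> x ^+ n.+1 \in vmax v.
Proof. by move=> mx; rewrite exprSr vmaxM // placeX // vmax_place. Qed.
Lemma vmax_sum (I : Type) (r : seq I) (P : pred I) f :
  (forall i, P i -> f i \in vmax v) -> \sum_(i <- r | P i) f i \in vmax v.
Proof. by move=> h; apply: (big_ind (fun x => x \in vmax v)) => //; [exact: vmax0|exact: vmaxD]. Qed.

Lemma unit_neq0 x : x \notin vmax v -> x != 0.
Proof. by apply: contraNneq => ->; exact: vmax0. Qed.
Lemma unit_inv x : x \notin vmax v -> x^-1 \in v.
Proof. by move=> mx; apply: contraNT mx => /place_inv; rewrite invrK. Qed.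
Lemma unitD x y : x \notin vmax v -> y \in vmax v -> x + y \notin vmax v.
Proof. by move=> mx my; apply: contra mx => h; have := vmaxB h my; rewrite addrK. Qed.
Lemma unitM x y : x \notin vmax v -> y \notin vmax v -> x * y \notin vmax v.
Proof.
move=> mx my; apply: contra my => h.
by have := vmaxM (unit_inv mx) h; rewrite mulKf ?unit_neq0.
Qed.
Lemma unitV x : x \in v -> x \notin vmax v -> x^-1 \notin vmax v.
Proof.
move=> vx mx; apply: contra vmax1 => /(vmaxM vx).
by rewrite divff ?unit_neq0.
Qed.

Lemma uniformizer : exists y, y \in vmax v /\ y != 0.
Proof.
have [x vx] := vring_proper v; exists x^-1; split; first exact: place_inv.
by rewrite invr_eq0; apply: contraNneq vx => ->; exact: place0.
Qed.

Lemma place_trans x c d : c != 0 -> x / c \in v -> c / d \in v -> x / d \in v.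
Proof. by move=> c0 h h'; have := placeM h h'; rewrite mulrA divfK. Qed.

Lemma place_separated x : (forall c, c != 0 -> x / c \in v) -> x = 0.
Proof.
move=> h; apply/eqP; apply: contraT => x0.
have [y vy] := vring_proper v.
have y0 : y != 0 by apply: contraNneq vy => ->; exact: place0.
have := h (x / y); rewrite mulf_neq0 ?invr_eq0 // invf_div mulrCA divff // mulr1 => /(_ isT).
by rewrite (negPf vy).
Qed.

Lemma place_integral n (a : 'I_n -> L) x :
  (forall j, a j \in v) -> x ^+ n = \sum_j a j * x ^+ j -> x \in v.
Proof.
move=> va e; apply: contraT => vx; have mx := place_inv vx.
have x0 : x != 0 by apply: contraNneq vx => ->; exact: place0.
have : 1 \in vmax v.
  rewrite -(divff (expf_neq0 n x0)) {1}e mulr_suml; apply: vmax_sum => j _.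
  rewrite -mulrA; apply: vmaxM => //.
  have -> : x ^+ j / x ^+ n = x^-1 ^+ (n - j).
    by rewrite -{2}(subnKC (ltnW (ltn_ord j))) exprD invfM mulrA divff ?expf_neq0 // mul1r exprVn.
  by rewrite -(subnSK (ltn_ord j)) vmaxX.
by rewrite (negPf vmax1).
Qed.

(** The rank one property, stated as convergence of powers to 0 so that no value group has to be
    introduced. *)
Definition archimedean := forall y c, y \in vmax v -> c != 0 ->
  exists N, forall n, (N <= n)%N -> y ^+ n / c \in v.

Lemma place_list (s : seq L) : exists c, c != 0 /\ forall x, x \in s -> x * c \in v.
Proof.
elim: s => [|x s [c [c0 h]]]; first by exists 1; rewrite oner_neq0.
have [vx|vx] := boolP (x * c \in v).
  by exists c; split=> // y; rewrite inE => /orP[/eqP->|/h].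
have xc0 : x * c != 0 by apply: contraNneq vx => ->; exact: place0.
exists (c / (x * c)); split; first by rewrite mulf_neq0 // invr_eq0.
have m := place_inv vx.
move=> y; rewrite inE => /orP[/eqP->|/h vy]; rewrite mulrA; last by rewrite placeM // vmax_place.
by rewrite divff // place1.
Qed.
End PlaceTheory.

Section PlaceExtension.
Variables (K L : fieldType) (e : {rmorphism K -> L}).
Hypothesis alg : forall x, algebraic e x.

(** Otherwise c would be smaller than every nonzero element of K; in an equation of c over K with
    nonzero constant term, all other terms would then be smaller than the constant one, which is
    impossible. *)
Lemma place_cofinal (w : place L) c : c != 0 -> exists a, a != 0 /\ e a / c \in w.
Proof.
move=> c0; apply: contrapT => no.
have hc a : e a / c \notin w \/ a = 0.
  have [->|a0] := eqVneq a 0; first by right.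
  by left; apply/negP => h; apply: no; exists a.
have mc a : e a * c \in vmax w.
  have [->|a0] := eqVneq a 0; first by rewrite rmorph0 mul0r vmax0.
  case: (hc a^-1) => [/place_inv|/eqP]; last by rewrite invr_eq0 (negPf a0).
  by rewrite invf_div fmorphV invrK mulrC.
have [q q0 qc] := alg c.
have [m [r r0 qE]] := multiplicity_XsubC q 0; rewrite q0 /= in r0.
have rc : root (map_poly e r) c.
  move: qc; rewrite qE rmorphM rootM rmorphXn /= subr0 map_polyX => /orP[//|].
  by rewrite rootE hornerXn expf_eq0 (negPf c0) andbF.
have r00 : r`_0 != 0 by rewrite -horner_coef0.
have r0c j : e r`_0 != 0 by rewrite fmorph_eq0.
move/rootP: rc; rewrite horner_coef size_map_poly.
have sr : (0 < size r)%N by rewrite lt0n size_poly_eq0; apply: contraNneq r00 => ->; rewrite coef0.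
case: (size r) sr => // n _; rewrite big_ord_recl coef_map expr0 mulr1 => /eqP.
rewrite addr_eq0 => /eqP e1.
have : 1 \in vmax w.
  have -> : 1 = (- \sum_(i < n) (map_poly e r)`_(lift ord0 i) * c ^+ lift ord0 i) / e r`_0.
    by rewrite -e1 divff // fmorph_eq0.
  rewrite mulNr vmaxN mulr_suml; apply: vmax_sum => j _.
  rewrite coef_map /= /bump add1n exprS mulrAC -fmorph_div mulrA mulrC vmaxM ?mc //.
  by apply: placeX; apply: vmax_place; have := mc 1; rewrite rmorph1 mul1r.
by rewrite (negPf (vmax1 w)).
Qed.
End PlaceExtension.

Lemma place_restrict (K L : fieldType) (e : {rmorphism K -> L}) (w : place L) :
  (exists x, e x \notin w) -> exists v : place K, forall x, (e x \in w) = (x \in v).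
Proof.
move=> pr; pose R : {pred K} := [pred x | e x \in w].
have cR : subring_closed R.
  split=> [|x y|x y]; rewrite !inE ?rmorph1 ?place1 // => h h'.
    by rewrite rmorphB placeB.
  by rewrite rmorphM placeM.
have tR x : x \in R \/ x^-1 \in R by rewrite !inE fmorphV; exact: vring_total.
by exists (Place cR tR pr) => x.
Qed.

Lemma place_restrict_alg (K L : fieldType) (e : {rmorphism K -> L}) (w : place L) :
  (forall x, algebraic e x) -> exists v : place K, forall x, (e x \in w) = (x \in v).
Proof.
move=> alg; apply: place_restrict.
have [y [my y0]] := uniformizer w.
have [a [a0 h]] := place_cofinal alg w y0.
exists a^-1; rewrite fmorphV; apply: vmax_inv; last by rewrite fmorph_eq0.
by rewrite -(divfK y0 (e a)) vmaxM.
Qed.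

(** * Places of algebraic extensions of a function field have rank one *)

Section Archimedean.
Variables (p : nat) (k F A : fieldType) (ka : {rmorphism k -> F}) (io : {rmorphism F -> A}).
Hypothesis cka : constants p ka.
Hypothesis algA : forall x, algebraic io x.
Let kA : {rmorphism k -> A} := io \o ka.
Variable w : place A.

Lemma constant_unit a : a != 0 -> kA a \notin vmax w.
Proof.
move=> a0; have [n [n0 e]] := const_root cka a0; apply: contra (vmax1 w).
by case: n n0 e => // n _ e /(vmaxX n); rewrite -rmorphXn e rmorph1.
Qed.

Lemma constant_place a : kA a \in w.
Proof.
have [->|a0] := eqVneq a 0; first by rewrite rmorph0 place0.
by rewrite -[a]invrK fmorphV unit_inv // constant_unit // invr_eq0.
Qed.

Lemma poly_place (r : {poly k}) y : y \in w -> (map_poly kA r).[y] \in w.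
Proof.
move=> wy; elim/poly_ind: r => [|r c IH]; first by rewrite rmorph0 horner0 place0.
rewrite rmorphD rmorphM /= map_polyX map_polyC hornerMXaddC placeD ?placeM //.
exact: constant_place.
Qed.

(** Nonzero constants are units, so the lowest term of the polynomial dominates when y is in the
    maximal ideal. *)
Lemma poly_value (r : {poly k}) y : r != 0 -> y \in vmax w -> y != 0 ->
  exists a u, [/\ u \in w, u \notin vmax w & (map_poly kA r).[y] = y ^+ a * u].
Proof.
move=> + my y0; elim/poly_ind: r => [|r c IH]; first by rewrite eqxx.
rewrite rmorphD rmorphM /= map_polyX map_polyC hornerMXaddC /=.
have wr : (map_poly kA r).[y] * y \in vmax w by rewrite vmaxM // poly_place // vmax_place.
have [->|c0 _] := eqVneq c 0.
  rewrite rmorph0 !addr0 => r0; have {}r0 : r != 0 by apply: contraNneq r0 => ->; rewrite mul0r.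
  have [a [u [wu mu ->]]] := IH r0.
  by exists a.+1, u; split=> //; rewrite !rmorph0 addr0 exprSr [RHS]mulrAC.
exists 0, ((map_poly kA r).[y] * y + kA c); split; last by rewrite mul1r.
  by rewrite placeD ?constant_place ?vmax_place.
by rewrite addrC unitD ?constant_unit.
Qed.

Lemma vmax_transc y : y \in vmax w -> y != 0 -> ~ algebraic kA y.
Proof.
move=> my y0 [q q0 /rootP].
have [a [u [_ /unit_neq0 u0 ->]]] := poly_value q0 my y0.
by apply/eqP; rewrite mulf_neq0 // expf_neq0.
Qed.

(** By [poly_value] a large power of y makes any given element of k(y) integral. The inverse of c is
    algebraic over k(y), so its product with a large power of y satisfies a monic equation with
    integral coefficients. *)
Lemma place_archimedean : archimedean w.
Proof.
move=> y c my c0; have [->|y0] := eqVneq y 0.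
  by exists 1%N => -[|n] // _; rewrite expr0n mul0r place0.
have [k2 [i2 [iota [ik [y2 y2E] i2q]]]] := simple_subfield kA y.
have h2 (q : {poly k}) : exists z, i2 z = (map_poly kA q).[y].
  exists (map_poly iota q).[y2]; rewrite -horner_map /= y2E -map_poly_comp.
  by congr _.[_]; apply: eq_map_poly => z; rewrite -[LHS]/((i2 \o iota) z) ik.
have bnd z : exists N, forall n, (N <= n)%N -> y ^+ n * i2 z \in w.
  have [q [q' [q'0 ->]]] := i2q z.
  have nq' : q' != 0 by apply: contraNneq q'0 => ->; rewrite rmorph0 horner0.
  have [a [u [_ mu ->]]] := poly_value nq' my y0.
  exists a => n an; have u0 := unit_neq0 mu; have ya0 := expf_neq0 a y0.
  have -> : y ^+ n * ((map_poly kA q).[y] / (y ^+ a * u)) = y ^+ (n - a) * ((map_poly kA q).[y] * u^-1).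
    by rewrite -{1}(subnK an) exprD; move: (y ^+ a) ya0 => yy yy0; field; rewrite u0 yy0.
  by rewrite !placeM ?poly_place ?unit_inv ?placeX ?(vmax_place my).
have [q q0 qx] : algebraic i2 c^-1.
  have h := @transc_algebraic p k F A ka io cka k2 i2 y c^-1 algA.
  exact: (h (vmax_transc my y0) h2).
pose n := (size q).-1.
have lq : i2 (lead_coef q) != 0 by rewrite fmorph_eq0 lead_coef_eq0.
have sq : size q = n.+1 by rewrite prednK // lt0n size_poly_eq0.
pose a (j : 'I_n) := - (q`_j / lead_coef q).
have aE : c^-1 ^+ n = \sum_j i2 (a j) * c^-1 ^+ j.
  move/rootP: qx; rewrite horner_coef size_map_poly sq big_ord_recr /= coef_map.
  rewrite -[q`_n]/(lead_coef q) => /eqP; rewrite addrC addr_eq0 => /eqP e.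
  apply: (mulfI lq); rewrite e -sumrN mulr_sumr; apply: eq_bigr => j _.
  by rewrite coef_map mulrA -rmorphM /a mulrN mulrCA divff ?lead_coef_eq0 // mulr1 rmorphN mulNr.
have /choice[N hN] := fun j => bnd (a j).
pose M := (\max_j N j).+1.
exists M => m Mm.
have hM j : y ^+ m * i2 (a j) \in w.
  by apply: hN; apply: leq_trans (leq_trans (leqnSn _) Mm); exact: leq_bigmax.
apply: (@place_integral _ w n (fun j => y ^+ (m * (n - j.+1)) * (y ^+ m * i2 (a j)))).
  by move=> j; rewrite placeM // placeX // vmax_place.
rewrite exprMn aE mulr_sumr; apply: eq_bigr => j _; rewrite exprMn.
have -> : y ^+ m ^+ n = y ^+ (m * (n - j.+1)) * y ^+ m * y ^+ m ^+ j.
  by rewrite -!exprM -!exprD -{1}(subnK (ltn_ord j)) mulnDr mulnS addnA.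
by ring.
Qed.
End Archimedean.

(** * Chevalley's extension theorem for places *)

Section Chevalley.
Variables (L : fieldType) (I : L -> Prop).
Hypothesis I0 : I 0.
Hypothesis ID : forall x y, I x -> I y -> I (x + y).
Hypothesis IM : forall x y, I x -> I y -> I (x * y).
Hypothesis IN : forall x, I x -> I (- x).
Hypothesis I1 : ~ I 1.

Let one_at n x := exists u : nat -> L, (forall i, I (u i)) /\ \sum_(i < n.+1) u i * x ^+ i = 1.

(** The relation for the inverse of x expresses (1 - v 0) x^(n+1) through lower powers. Substituted
    into 1 - v 0 times the relation for x it lowers the degree, and adding v 0 restores the sum
    1. *)
Let one_at_step n x : x != 0 -> one_at n.+1 x -> one_at n.+1 x^-1 -> one_at n x.
Proof.
move=> x0 [u [Iu u1]] [v [Iv v1]].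
have vx : (1 - v 0) * x ^+ n.+1 = \sum_(i < n.+1) v (n.+1 - i)%N * x ^+ i.
  rewrite -{1}v1 big_ord_recl expr0 mulr1 addrC addKr mulr_suml.
  rewrite [RHS](reindex_inj rev_ord_inj) /=; apply: eq_bigr => i _.
  rewrite /bump add1n subKn // -mulrA; congr (_ * _).
  by rewrite exprVn -{2}(subnK (ltn_ord i)) exprD mulrCA mulVf ?expf_neq0 // mulr1.
exists (fun i => (1 - v 0) * u i + u n.+1 * v (n.+1 - i)%N + (if i == 0 then v 0 else 0)); split.
  move=> i; apply: (ID (ID _ _)); [|exact: IM|by case: ifP].
  by rewrite mulrBl mul1r; apply: ID => //; apply: IN; apply: IM.
under eq_bigr => i _ do rewrite mulrDl mulrDl -!mulrA.
rewrite !big_split /= -!mulr_sumr -vx.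
have -> : \sum_(i < n.+1) (if i == 0 :> nat then v 0 else 0) * x ^+ i = v 0.
  by rewrite big_ord_recl /= mulr1 big1 ?addr0 // => i _; rewrite mul0r.
move: u1; rewrite big_ord_recr /= => u1.
by rewrite -[RHS](subrK (v 0)) -{3}[1 - v 0]mulr1 -u1; congr (_ + _); ring.
Qed.

Lemma no_inverse_pair n x : x != 0 -> one_at n x -> one_at n x^-1 -> False.
Proof.
move=> x0; elim: n => [|n IH] h h'.
  by case: h => u [Iu]; rewrite big_ord1 mulr1 => u1; apply: I1; rewrite -u1.
apply: IH; first exact: one_at_step.
by apply: one_at_step; rewrite ?invr_eq0 ?invrK.
Qed.

Lemma no_inverse_polys x (U V : {poly L}) : x != 0 ->
  (forall i, I U`_i) -> (forall i, I V`_i) -> U.[x] = 1 -> V.[x^-1] = 1 -> False.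
Proof.
move=> x0 IU IV hU hV; apply: (@no_inverse_pair (maxn (size U) (size V)) x) => //.
  exists (fun i => U`_i); split=> //; rewrite -horner_coef_wide //.
  by rewrite (leq_trans (leq_maxl _ (size V))).
exists (fun i => V`_i); split=> //; rewrite -horner_coef_wide //.
by rewrite (leq_trans (leq_maxr (size U) _)).
Qed.
End Chevalley.

(** Zorn's lemma gives a subring M containing the ring of v and maximal among those in which the
    maximal ideal of v does not generate 1. If neither x nor its inverse lay in M, both M[x] and
    M[1/x] would violate the condition, against [no_inverse_polys]. *)
Lemma place_extend (K L : fieldType) (e : {rmorphism K -> L}) (v : place K) :
  exists w : place L, forall x, (e x \in w) = (x \in v).
Proof.
pose ideal (S : set L) (y : L) := exists n (a : 'I_n -> K) (s : 'I_n -> L),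
  [/\ forall j, a j \in vmax v, forall j, S (s j) & y = \sum_j e (a j) * s j].
pose good (S : set L) := [/\ forall x, x \in v -> S (e x), forall x y, S x -> S y -> S (x - y),
   forall x y, S x -> S y -> S (x * y) & ~ ideal S 1].
pose W : set L := [set y | exists2 x, x \in v & y = e x]%classic.
have [] := @zorn_above L good W 1.
- by exists 1; rewrite ?place1 ?rmorph1.
- split=> [x vx|_ _ [x vx ->] [y vy ->]|_ _ [x vx ->] [y vy ->]|[n [a [s [ma Ss e1]]]]].
  + by exists x.
  + by exists (x - y); rewrite ?placeB ?rmorphB.
  + by exists (x * y); rewrite ?placeM ?rmorphM.
  + have /choice[t tE] : forall j, exists x, x \in v /\ s j = e x.
      by move=> j; have [x vx xE] := Ss j; exists x.
    have : 1 \in vmax v.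
      have -> : 1 = \sum_j t j * a j.
        apply: (fmorph_inj e); rewrite rmorph1 e1 rmorph_sum; apply: eq_bigr => j _.
        by rewrite rmorphM (tE j).2 mulrC.
      by apply: vmax_sum => j _; rewrite vmaxM // (tE j).1.
    by rewrite (negPf (vmax1 v)).
- move=> C [X0 CX0] gC tot.
  have two u u' : (\bigcup_(X in C) X)%classic u -> (\bigcup_(X in C) X)%classic u' ->
    exists X, [/\ C X, X u & X u'].
    move=> [X CX Xu] [Y CY Yv]; case: (tot _ _ CX CY) => sub.
      by exists Y; split=> //; exact: sub.
    by exists X; split=> //; exact: sub.
  split.
  + by move=> x vx; exists X0 => //; case: (gC _ CX0) => + _ _ _; apply.
  + move=> x y h h'; have [X [CX hx hy]] := two _ _ h h'; exists X => //.
    by case: (gC _ CX) => _ + _ _; apply.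
  + move=> x y h h'; have [X [CX hx hy]] := two _ _ h h'; exists X => //.
    by case: (gC _ CX) => _ _ + _; apply.
  + move=> [n [a [s [ma Ss e1]]]].
    have [X [CX Xs]] : exists X, C X /\ forall j, X (s j).
      clear e1 ma a; elim: n s Ss => [|n IH] s Ss; first by exists X0; split=> // -[].
      have [X [CX Xs]] := IH (fun j => s (lift ord0 j)) (fun j => Ss _).
      have [Y CY Y0] := Ss ord0.
      case: (tot _ _ CX CY) => sub.
        by exists Y; split=> // j; case: (unliftP ord0 j) => [i|] -> //; exact: sub.
      by exists X; split=> // j; case: (unliftP ord0 j) => [i|] -> //; exact: sub.
    by case: (gC _ CX) => _ _ _; apply; exists n, a, s.
move=> M [[Mv MB MM M1] _ maxM].
have Me1 : M 1 by have := Mv 1 (place1 v); rewrite rmorph1.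
have M0 : M 0 by have := MB _ _ Me1 Me1; rewrite subrr.
have MN x : M x -> M (- x) by move=> h; rewrite -sub0r; apply: MB.
have MD x y : M x -> M y -> M (x + y) by move=> h h'; rewrite -[y]opprK; apply: MB => //; apply: MN.
pose I y := ideal M y.
have I0 : I 0 by exists 0, (fun=> 0), (fun=> 0); split=> [[]|[]|] //; rewrite big_ord0.
have ID x y : I x -> I y -> I (x + y).
  move=> [n [a [s [ma Ms ->]]]] [m [b [t [mb Mt ->]]]].
  exists (n + m)%N, (fun j => match fintype.split j with inl i => a i | inr i => b i end),
    (fun j => match fintype.split j with inl i => s i | inr i => t i end); split.
  - by move=> j; case: (fintype.split j).
  - by move=> j; case: (fintype.split j).
  rewrite big_split_ord /=; congr (_ + _); apply: eq_bigr => i _.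
    by rewrite (unsplitK (inl i)).
  by rewrite (unsplitK (inr i)).
have IMl x y : M x -> I y -> I (x * y).
  move=> Mx [n [a [s [ma Ms ->]]]]; exists n, a, (fun j => x * s j); split=> // [j|].
    exact: MM.
  by rewrite mulr_sumr; apply: eq_bigr => j _; rewrite mulrCA.
have IN x : I x -> I (- x) by move=> h; rewrite -mulN1r; apply: IMl => //; apply: MN.
have IinM x : I x -> M x.
  move=> [n [a [s [ma Ms ->]]]]; apply: (big_ind M) => // j _.
  by apply: MM => //; apply: Mv; exact: vmax_place.
have ISum (J : Type) (r : seq J) (f : J -> L) : (forall j, I (f j)) -> I (\sum_(j <- r) f j).
  by move=> h; apply: (big_ind I).
have IM x y : I x -> I y -> I (x * y) by move=> h h'; apply: IMl => //; exact: IinM.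
have adj x : ~ M x -> exists U : {poly L}, (forall i, I U`_i) /\ U.[x] = 1.
  move=> nx; apply: contrapT => noU; apply: nx.
  pose X : set L := [set y | exists r : {poly L}, (forall i, M r`_i) /\ y = r.[x]]%classic.
  apply: (maxM X) => [|y My|]; last by exists 'X; split=> [i|]; rewrite ?hornerX // coefX; case: eqP.
    split=> [y vy|_ _ [r [Mr ->]] [r' [Mr' ->]]|_ _ [r [Mr ->]] [r' [Mr' ->]]|].
    - exists (e y)%:P; split=> [i|]; last by rewrite hornerC.
      by rewrite coefC; case: eqP => // _; exact: Mv.
    - by exists (r - r'); split=> [i|]; [rewrite coefB; apply: MB|rewrite hornerD hornerN].
    - exists (r * r'); split=> [i|]; last by rewrite hornerM.
      by rewrite coefM; apply: (big_ind M) => // j _; apply: MM.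
    - move=> [n [a [s [ma Xs e1]]]]; apply: noU.
      have /choice[r rE] := Xs.
      exists (\sum_j (e (a j))%:P * r j); split; last first.
        rewrite horner_sum e1; apply: eq_bigr => j _.
        by rewrite hornerM hornerC (rE j).2.
      move=> i; rewrite coef_sum; apply: ISum => j; rewrite coefCM mulrC.
      apply: IMl; first exact: (rE j).1.
      by exists 1%N, (fun=> a j), (fun=> 1); split=> //; rewrite big_ord1 mulr1.
  by exists y%:P; split=> [i|]; rewrite ?hornerC // coefC; case: eqP.
pose R : {pred L} := [pred x | `[< M x >]].
have RP x : reflect (M x) (x \in R) by exact: asboolP.
have cR : subring_closed R.
  by split=> [|x y /RP h /RP h'|x y /RP h /RP h']; apply/RP => //; [exact: MB|exact: MM].
have tR x : x \in R \/ x^-1 \in R.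
  have [->|x0] := eqVneq x 0; first by left; apply/RP.
  have [h|/adj[U [IU U1]]] := pselect (M x); first by left; apply/RP.
  have [h|/adj[V [IV V1]]] := pselect (M x^-1); first by right; apply/RP.
  by case: (no_inverse_polys I0 ID IM IN M1 x0 IU IV U1 V1).
have Re x : (e x \in R) = (x \in v).
  apply/RP/idP => [h|]; last exact: Mv.
  apply: contraT => vx; have mx := place_inv vx.
  have x0 : x != 0 by apply: contraNneq vx => ->; exact: place0.
  case: M1; exists 1%N, (fun=> x^-1), (fun=> e x); split=> //.
  by rewrite big_ord1 -rmorphM mulVf // rmorph1.
have pR : exists x, x \notin R.
  by have [x vx] := vring_proper v; exists (e x); rewrite Re.
by exists (Place cR tR pR) => x; exact: Re.
Qed.

(** * Completions *)

Section CauchySequences.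
Variables (L : fieldType) (v : place L).
Implicit Types u t : nat -> L.

Lemma cauchy_bounded u : v_cauchy v u ->
  exists d N, [/\ d != 0, d \in v & forall n, (N <= n)%N -> u n * d \in v].
Proof.
move=> cu; have [N hN] := cu 1 (oner_neq0 L).
have [d [d0 hd]] := place_list v [:: u N; 1].
have vd : d \in v by have := hd 1; rewrite mul1r; apply; rewrite !inE eqxx orbT.
exists d, N; split=> // n Nn; rewrite -(subrK (u N) (u n)) mulrDl placeD //.
  by rewrite placeM //; have := hN n N Nn (leqnn N); rewrite divr1.
by apply: hd; exact: mem_head.
Qed.

Lemma cauchyB u t : v_cauchy v u -> v_cauchy v t -> v_cauchy v (u - t).
Proof.
move=> cu ct c c0; have [N hN] := cu c c0; have [M hM] := ct c c0.
exists (maxn N M) => m n; rewrite !geq_max => /andP[Nm Mm] /andP[Nn Mn].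
have -> : (u - t) m - (u - t) n = (u m - u n) - (t m - t n).
  by rewrite -[(u - t) m]/(u m - t m) -[(u - t) n]/(u n - t n); ring.
by rewrite mulrBl placeB ?hN ?hM.
Qed.

Lemma cauchyM u t : v_cauchy v u -> v_cauchy v t -> v_cauchy v (u * t).
Proof.
move=> cu ct c c0.
have [d [N [d0 _ hd]]] := cauchy_bounded cu; have [e [M [e0 _ he]]] := cauchy_bounded ct.
have ce0 : c * e != 0 by rewrite mulf_neq0.
have cd0 : c * d != 0 by rewrite mulf_neq0.
have [N' hN'] := cu _ ce0; have [M' hM'] := ct _ cd0.
exists (maxn (maxn N M) (maxn N' M')) => m n; rewrite !geq_max.
move=> /andP[/andP[Nm Mm] /andP[Nm' Mm']] /andP[/andP[Nn Mn] /andP[Nn' Mn']].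
have -> : ((u * t) m - (u * t) n) / c =
    (u m * d) * ((t m - t n) / (c * d)) + (t n * e) * ((u m - u n) / (c * e)).
  rewrite -[(u * t) m]/(u m * t m) -[(u * t) n]/(u n * t n).
  by field; rewrite c0 e0 d0.
by apply: placeD; apply: placeM; [exact: hd|exact: hM'|exact: he|exact: hN'].
Qed.

Lemma cauchy_cst x : v_cauchy v (fun=> x).
Proof. by move=> c c0; exists 0 => m n _ _; rewrite subrr mul0r place0. Qed.

Lemma nullP u : v_cvg v u 0 <-> forall c, c != 0 -> exists N, forall n, (N <= n)%N -> u n / c \in v.
Proof.
split=> h c c0; have [N hN] := h c c0; exists N => n Nn.
  by rewrite -[u n]subr0 hN.
by rewrite subr0 hN.
Qed.

Lemma nullB u t : v_cvg v u 0 -> v_cvg v t 0 -> v_cvg v (u - t) 0.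
Proof.
move=> /nullP cu /nullP ct; apply/nullP => c c0; have [N hN] := cu c c0; have [M hM] := ct c c0.
exists (maxn N M) => n; rewrite !geq_max => /andP[Nn Mn].
by rewrite -[(u - t) n]/(u n - t n) mulrBl placeB ?hN ?hM.
Qed.

Lemma nullM u t : v_cauchy v u -> v_cvg v t 0 -> v_cvg v (u * t) 0.
Proof.
move=> cu /nullP ct; apply/nullP => c c0; have [d [N [d0 _ hd]]] := cauchy_bounded cu.
have cd0 : c * d != 0 by rewrite mulf_neq0.
have [M hM] := ct _ cd0; exists (maxn N M) => n; rewrite geq_max => /andP[Nn Mn].
have -> : (u * t) n / c = (u n * d) * (t n / (c * d)).
  by rewrite -[(u * t) n]/(u n * t n); field; rewrite d0 c0.
by rewrite placeM ?hd ?hM.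
Qed.

(** By the ultrametric inequality, a Cauchy sequence with one late term outside a ball around 0
    stays outside that ball. *)
Lemma nonnull u : v_cauchy v u -> ~ v_cvg v u 0 ->
  exists b N, b != 0 /\ forall n, (N <= n)%N -> u n != 0 /\ b / u n \in v.
Proof.
move=> cu nn; apply: contrapT => no; apply: nn; apply/nullP => c c0.
have [N hN] := cu c c0; exists N; apply: contrapT => /existsNP[n1 /not_implyP[Nn1 /negP un1]].
apply: no; exists c, N; split=> // n Nn.
have h : u n / c \notin v.
  apply: contra un1 => h; rewrite -(subrK (u n) (u n1)) mulrDl placeD ?hN //.
split; first by apply: contraNneq h => ->; rewrite mul0r place0.
by rewrite -invf_div vmax_place // place_inv.
Qed.

Lemma cauchyV u : v_cauchy v u -> ~ v_cvg v u 0 -> v_cauchy v (fun n => (u n)^-1).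
Proof.
move=> cu nn c c0; have [b [N [b0 hb]]] := nonnull cu nn.
have cb0 : c * b ^+ 2 != 0 by rewrite mulf_neq0 ?expf_neq0.
have [M hM] := cu _ cb0; exists (maxn N M) => m n.
rewrite !geq_max => /andP[Nm Mm] /andP[Nn Mn].
have [um0 hm] := hb m Nm; have [un0 hn] := hb n Nn.
have -> : ((u m)^-1 - (u n)^-1) / c = - ((u m - u n) / (c * b ^+ 2)) * ((b / u m) * (b / u n)).
  by field; rewrite c0 b0 um0 un0.
by rewrite placeM ?placeN ?hM // placeM.
Qed.
End CauchySequences.

(** Cauchy sequences modulo null sequences, the place being given by the classes of eventually
    integral sequences. Rank one enters in the proof of completeness, where the powers of t form a
    countable basis of neighbourhoods of 0. *)
Lemma completion_exists (F : fieldType) (L : fieldAlgType F) (v : place L) : archimedean v ->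
  exists (K : fieldAlgType F) (i : {lrmorphism L -> K}) (w : place K), is_completion v i w.
Proof.
move=> arch.
pose P : {pred nat -> L} := [pred u | `[< v_cauchy v u >]].
have PP u : reflect (v_cauchy v u) (u \in P) by exact: asboolP.
have cP : subring_closed P.
  split=> [|u t /PP cu /PP ct|u t /PP cu /PP ct]; apply/PP.
  - exact: (cauchy_cst v 1).
  - exact: cauchyB.
  - exact: cauchyM.
have [A [io [injio ioP]]] := subring_type cP.
have cio a : v_cauchy v (io a) by apply/PP/ioP; exists a.
pose I : {pred A} := [pred a | `[< v_cvg v (io a) 0 >]].
have IP a : reflect (v_cvg v (io a) 0) (a \in I) by exact: asboolP.
have inv a : ~ v_cvg v (io a) 0 -> exists a', io a' = (fun n => (io a n)^-1).
  by move=> na; apply/ioP/PP; exact: cauchyV.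
have [|a b /IP ha /IP hb|a b /IP hb||a /IP na|K0 [pi [pis piI]]] := @quotient_field A I.
- by apply/IP/nullP => c c0; exists 0 => n _; rewrite rmorph0 -[(0 : nat -> L) n]/(0 : L) mul0r place0.
- by apply/IP; rewrite rmorphB; exact: nullB.
- by apply/IP; rewrite rmorphM; exact: nullM.
- apply/IP => /nullP h; have [y [my y0]] := uniformizer v; have [N /(_ N (leqnn _))] := h y y0.
  rewrite rmorph1 -[(1 : nat -> L) N]/(1 : L) mul1r; apply/negP; exact: vmax_inv.
- have [a' a'E] := inv a na; exists a'; apply/IP/nullP => c c0.
  have [b [N [_ hN]]] := nonnull (cio a) na.
  exists N => n Nn; have [an0 _] := hN n Nn.
  rewrite rmorphB rmorphM rmorph1 a'E -[(_ - _) n]/((io a n)^-1 * io a n - 1).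
  by rewrite mulVf // subrr mul0r place0.
have piN a : reflect (v_cvg v (io a) 0) (pi a == 0) by rewrite piI; exact: IP.
have /choice[cs0 cs0E] : forall x : L, exists a, io a = fun=> x.
  by move=> x; apply/ioP/PP; exact: cauchy_cst.
have [cs csE] : exists cs : {rmorphism L -> A}, cs =1 cs0.
  apply: build_rmorph => [|x y|x y]; apply: (injio).
  - by rewrite cs0E rmorph1.
  - by rewrite rmorphD !cs0E.
  - by rewrite rmorphM !cs0E.
have {csE cs0E}csE x : io (cs x) = fun=> x by rewrite csE.
have pcs0 b : b != 0 -> pi (cs b) != 0.
  by move=> b0; rewrite (fmorph_eq0 (pi \o cs : {rmorphism L -> K0})).
have pcsV b : (pi (cs b))^-1 = pi (cs b^-1).
  by rewrite [RHS](fmorphV (pi \o cs : {rmorphism L -> K0})).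
pose ev (u : nat -> L) := exists N, forall n, (N <= n)%N -> u n \in v.
pose W0 : {pred K0} := [pred x | `[< exists a, pi a = x /\ ev (io a) >]].
have W0P a : reflect (ev (io a)) (pi a \in W0).
  apply: (iffP (asboolP _)) => [[b [ba [N hN]]]|h]; last by exists a.
  have /piN/nullP/(_ 1 (oner_neq0 L))[M hM] : pi (a - b) == 0 by rewrite rmorphB ba subrr.
  exists (maxn N M) => n; rewrite geq_max => /andP[Nn Mn].
  have := hM n Mn; rewrite divr1 rmorphB -[(_ - _) n]/(io a n - io b n) => h.
  by rewrite -(subrK (io b n) (io a n)) placeD ?hN.
have invK a : pi a != 0 -> exists a' b, [/\ b != 0, pi a' = (pi a)^-1, io a' = (fun n => (io a n)^-1) &
    exists N, forall n, (N <= n)%N -> b / io a n \in v].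
  move=> a0; have na : ~ v_cvg v (io a) 0 by move/piN; apply/negP.
  have [a' a'E] := inv a na; have [b [N [b0 hN]]] := nonnull (cio a) na.
  exists a', b; split=> //; last by exists N => n /hN[].
  apply: (mulIf a0); rewrite mulVf // -rmorphM; apply/eqP; rewrite -subr_eq0 -(rmorph1 pi) -rmorphB.
  apply/piN/nullP => c c0; exists N => n /hN[an0 _].
  rewrite rmorphB rmorphM rmorph1 a'E -[(_ - _) n]/((io a n)^-1 * io a n - 1).
  by rewrite mulVf // subrr mul0r place0.
have cW0 : subring_closed W0.
  split=> [|x y|x y].
  - by rewrite -(rmorph1 pi); apply/W0P; exists 0 => n _; rewrite rmorph1; exact: place1.
  - have [a <-] := pis x; have [b <-] := pis y => /W0P[N hN] /W0P[M hM].
    rewrite -rmorphB; apply/W0P; exists (maxn N M) => n; rewrite geq_max => /andP[Nn Mn].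
    by rewrite rmorphB -[(_ - _) n]/(io a n - io b n) placeB ?hN ?hM.
  - have [a <-] := pis x; have [b <-] := pis y => /W0P[N hN] /W0P[M hM].
    rewrite -rmorphM; apply/W0P; exists (maxn N M) => n; rewrite geq_max => /andP[Nn Mn].
    by rewrite rmorphM -[(_ * _) n]/(io a n * io b n) placeM ?hN ?hM.
have tW0 x : x \in W0 \/ x^-1 \in W0.
  have [a <-] := pis x; have [/eqP->|a0] := boolP (pi a == 0).
    by left; rewrite -(rmorph0 pi); apply/W0P; exists 0 => n _; rewrite rmorph0; exact: place0.
  have [a' [b [_ <- a'E _]]] := invK a a0.
  have [N hN] := cio a 1 (oner_neq0 L).
  have [aN|aN] := boolP (io a N \in v).
    left; apply/W0P; exists N => n Nn; rewrite -(subrK (io a N) (io a n)) placeD //.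
    by have := hN n N Nn (leqnn N); rewrite divr1.
  right; apply/W0P; exists N => n Nn; rewrite a'E vmax_place // place_inv //.
  apply: contra aN => h; rewrite -(subrK (io a n) (io a N)) placeD //.
  by have := hN N n (leqnn N) Nn; rewrite divr1.
have W0cs x : (pi (cs x) \in W0) = (x \in v).
  apply/W0P/idP => [[N]|vx]; rewrite csE; last by exists 0.
  by move=> /(_ N (leqnn N)).
have pW0 : exists x, x \notin W0.
  by have [x vx] := vring_proper v; exists (pi (cs x)); rewrite W0cs.
pose w0 := Place cW0 tW0 pW0.
have w0P a : reflect (ev (io a)) (pi a \in w0) by exact: W0P.
have cof c : c != 0 -> exists b, b != 0 /\ pi (cs b) / c \in w0.
  have [a <-] := pis c => /invK[a' [b [b0 <- a'E [N hN]]]]; exists b; split=> //.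
  by rewrite -rmorphM; apply/w0P; exists N => n Nn; rewrite rmorphM csE a'E; exact: hN.
have dens x c : c != 0 -> exists y, (x - pi (cs y)) / c \in w0.
  move=> c0; have [b [b0 hb]] := cof c c0.
  have [a aE] := pis x; have [N hN] := cio a b b0; exists (io a N).
  apply: (place_trans (c := pi (cs b))) hb => //; first exact: pcs0.
  rewrite -aE -rmorphB /= pcsV -rmorphM; apply/w0P; exists N => n Nn.
  rewrite rmorphM rmorphB !csE; exact: hN.
have [K [f [g [fg gf fA]]]] := @field_algebra F K0 (pi \o cs \o in_alg L : {rmorphism F -> K0}).
have [i iE] : exists i : {lrmorphism L -> K}, i =1 (f \o pi \o cs).
  apply: (@rmorph_lr F L K (f \o pi \o cs : {rmorphism L -> K})) => c.
  by rewrite -fA.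
have [|w wE] := @place_restrict K K0 g w0.
  by have [x wx] := vring_proper w0; exists (f x); rewrite fg.
have gi x : g (i x) = pi (cs x) by rewrite iE fg.
exists K, i, w; split.
- by move=> x; rewrite -wE gi; exact: W0cs.
- move=> x c c0; have [|y hy] := dens (g x) (g c); first by rewrite fmorph_eq0.
  by exists y; rewrite -wE rmorphM rmorphB fmorphV gi.
(* Each [U n] is replaced by an element [y n] of L within t^n of it; the class of the sequence y is
   the limit. *)
- move=> U cU; have [t [mt t0]] := uniformizer v.
  have /choice[y yE] : forall n, exists y, (g (U n) - pi (cs y)) / pi (cs t) ^+ n \in w0.
    by move=> n; apply: dens; rewrite expf_neq0 // pcs0.
  have cofn c : c != 0 -> exists N, forall n, (N <= n)%N -> (g (U n) - pi (cs (y n))) / pi (cs c) \in w0.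
    move=> c0; have [N hN] := arch t c mt c0; exists N => n Nn.
    apply: (place_trans _ (yE n)); first by rewrite expf_neq0 // pcs0.
    by rewrite -!rmorphXn pcsV -!rmorphM W0cs hN.
  have cy : v_cauchy v y.
    move=> c c0; have [N hN] := cofn c c0; have ic0 : i c != 0 by rewrite fmorph_eq0.
    have [M hM] := cU (i c) ic0; exists (maxn N M) => m n.
    rewrite !geq_max => /andP[Nm Mm] /andP[Nn Mn].
    rewrite -W0cs !rmorphM /= -pcsV !rmorphB.
    have := hM m n Mm Mn; rewrite -wE rmorphM rmorphB !fmorphV gi => h.
    have -> : (pi (cs (y m)) - pi (cs (y n))) / pi (cs c) = ((g (U m) - g (U n)) / pi (cs c) +
       (g (U n) - pi (cs (y n))) / pi (cs c)) - (g (U m) - pi (cs (y m))) / pi (cs c).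
      by ring.
    apply: (@placeB _ w0); last exact: hN.
    by apply: placeD => //; exact: hN.
  have [a aE] : exists a, io a = y by apply/ioP/PP.
  exists (f (pi a)) => c c0.
  have [|b [b0 hb]] := cof (g c); first by rewrite fmorph_eq0.
  have [N hN] := cofn b b0; have [M hM] := cy b b0.
  have pb0 : pi (cs b) != 0 by exact: pcs0.
  exists (maxn N M) => n; rewrite geq_max => /andP[Nn Mn].
  rewrite -wE rmorphM rmorphB fmorphV fg; apply: (place_trans (c := pi (cs b))) hb => //.
  have -> : g (U n) - pi a = (g (U n) - pi (cs (y n))) + (pi (cs (y n)) - pi a) by ring.
  rewrite mulrDl placeD ?hN // -rmorphB /= pcsV -rmorphM.
  apply/w0P; exists M => m Mm; rewrite rmorphM rmorphB !csE aE.
  exact: hM.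
Qed.

Section Cofinal.
Variables (K L : fieldType) (i : {rmorphism K -> L}) (w : place L).

Definition cofinal := forall c : L, c != 0 -> exists a : K, a != 0 /\ i a / c \in w.

Lemma near_unit (x y : L) : x != 0 -> (x - y) / x \in vmax w ->
  [/\ y != 0, y / x \in w & x / y \in w].
Proof.
move=> x0 h; have e : y / x = 1 - (x - y) / x by field.
have u : y / x \notin vmax w by rewrite e unitD ?vmax1 // vmaxN.
have y0 : y != 0 by apply: contraNneq (unit_neq0 u) => ->; rewrite mul0r.
split=> //; last by rewrite -invf_div unit_inv.
by rewrite e placeB ?place1 ?vmax_place.
Qed.

Lemma dense_cofinal :
  (forall (x c : L), c != 0 -> exists y, (x - i y) / c \in w) -> cofinal.
Proof.
move=> dens c c0; have [t [mt t0]] := uniformizer w.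
have [|a ha] := dens c (c * t); first by rewrite mulf_neq0.
have [|a0 h _] := @near_unit c (i a) c0.
  have -> : (c - i a) / c = ((c - i a) / (c * t)) * t by field; rewrite c0 t0.
  by rewrite vmaxM.
by exists a; split=> //; apply: contraNneq a0 => ->; rewrite rmorph0.
Qed.

Lemma cofinal_list (s : seq L) : cofinal -> exists a : K, a != 0 /\ forall x, x \in s -> x * i a \in w.
Proof.
move=> cof; have [c [c0 hc]] := place_list w s.
have [a [a0 ha]] := cof c c0; exists a; split=> // x xs.
have -> : x * i a = (x * c) * (i a / c) by field.
by rewrite placeM ?hc.
Qed.

Lemma cofinal_separated x : cofinal -> (forall a : K, a != 0 -> x / i a \in w) -> x = 0.
Proof.
move=> cof h; apply: (@place_separated _ w) => c c0; have [a [a0 ha]] := cof c c0.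
by apply: (place_trans _ (h a a0)) => //; rewrite fmorph_eq0.
Qed.

Lemma cofinal_cauchy u : cofinal ->
  (forall a : K, a != 0 -> exists N, forall m n, (N <= m)%N -> (N <= n)%N -> (u m - u n) / i a \in w) ->
  v_cauchy w u.
Proof.
move=> cof h c c0; have [a [a0 ha]] := cof c c0; have [N hN] := h a a0.
by exists N => m n Nm Nn; apply: (place_trans _ (hN m n Nm Nn)) => //; rewrite fmorph_eq0.
Qed.

End Cofinal.

Lemma place_mul_near (L : fieldType) (w : place L) (x x' a a' c d : L) :
  c != 0 -> d != 0 -> d \in w -> x * d \in w -> x' * d \in w -> c * d \in w ->
  (x - a) / (c * d) \in w -> (x' - a') / (c * d) \in w -> (x * x' - a * a') / c \in w.
Proof.
move=> c0 d0 wd xd xd' cd h h'.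
have ad : a' * d \in w.
  have -> : a' * d = x' * d - (x' - a') / (c * d) * (c * d) * d by field; rewrite d0 c0.
  by apply: placeB => //; apply: placeM => //; apply: placeM.
have -> : (x * x' - a * a') / c = (x * d) * ((x' - a') / (c * d)) + (a' * d) * ((x - a) / (c * d)).
  by field; rewrite d0 c0.
by apply: placeD; apply: placeM.
Qed.

Section CompletionMap.
Variables (F : fieldType) (K H L : fieldAlgType F) (v : place K) (i : {lrmorphism K -> H})
  (w : place H) (f : {lrmorphism K -> L}) (u : place L).
Hypotheses (comp : is_completion v i w) (arch : archimedean v).
Hypotheses (fv : forall x, (f x \in u) = (x \in v)) (cof : cofinal f u).
Hypothesis complete : forall s, v_cauchy u s -> exists x, v_cvg u s x.

Let iv x : (i x \in w) = (x \in v). Proof. by case: comp. Qed.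
Let dens (x c : H) : c != 0 -> exists y, (x - i y) / c \in w.
Proof. by case: comp => _ + _; apply. Qed.
Let cofi : cofinal i w. Proof. exact: dense_cofinal. Qed.

(** The graph of the extension of f by continuity: x and y have common approximants from K.
    Compatibility with the operations is proved on the graph, before any limit is chosen. *)
Let lim (x : H) (y : L) := forall c : K, c != 0 -> exists a, (x - i a) / i c \in w /\ (y - f a) / f c \in u.

Let limD x y x' y' : lim x y -> lim x' y' -> lim (x + x') (y + y').
Proof.
move=> h h' c c0; have [a [ha ha']] := h c c0; have [b [hb hb']] := h' c c0.
by exists (a + b); split; rewrite rmorphD opprD addrACA mulrDl placeD.
Qed.

Let limM x y x' y' : lim x y -> lim x' y' -> lim (x * x') (y * y').
Proof.
move=> h h' c c0.
have [d [d0 hd]] := cofinal_list [:: x; x'; i c; 1] cofi.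
have [e [e0 he]] := cofinal_list [:: y; y'; f c; 1] cof.
have vd : d \in v by rewrite -iv -[i d]mul1r hd // !inE eqxx ?orbT.
have ve : e \in v by rewrite -fv -[f e]mul1r he // !inE eqxx ?orbT.
have de0 : d * e != 0 by rewrite mulf_neq0.
have cde0 : c * (d * e) != 0 by rewrite mulf_neq0.
have [a [ha ha']] := h _ cde0; have [b [hb hb']] := h' _ cde0.
have wd z : z \in [:: x; x'; i c; 1] -> z * i (d * e) \in w.
  by move=> zs; rewrite rmorphM mulrA; apply: placeM; [exact: hd|rewrite iv].
have ud z : z \in [:: y; y'; f c; 1] -> z * f (d * e) \in u.
  by move=> zs; rewrite rmorphM mulrCA; apply: placeM; [rewrite fv|exact: he].
have ide : i (d * e) \in w by rewrite iv placeM.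
have fde : f (d * e) \in u by rewrite fv placeM.
exists (a * b); rewrite !(rmorphM _ a); split.
- apply: (@place_mul_near _ w _ _ _ _ _ (i (d * e))) => //; rewrite ?fmorph_eq0 -?(rmorphM _ c) //;
    by [apply: wd; rewrite !inE eqxx ?orbT|rewrite rmorphM; apply: wd; rewrite !inE eqxx ?orbT].
- apply: (@place_mul_near _ u _ _ _ _ _ (f (d * e))) => //; rewrite ?fmorph_eq0 -?(rmorphM _ c) //;
    by [apply: ud; rewrite !inE eqxx ?orbT|rewrite rmorphM; apply: ud; rewrite !inE eqxx ?orbT].
Qed.

Let limB a : lim (i a) (f a).
Proof. by move=> c c0; exists a; rewrite !subrr !mul0r !place0. Qed.

Let lim0 y : lim 0 y -> y = 0.
Proof.
move=> h; apply: (cofinal_separated cof) => c c0; have [a [ha ha']] := h c c0.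
rewrite -(subrK (f a) y) mulrDl placeD // -fmorph_div fv.
by move: ha; rewrite sub0r mulNr placeN -fmorph_div iv.
Qed.

Let lim_place x y : lim x y -> (x \in w) = (y \in u).
Proof.
move=> h; have [a [ha ha']] := h 1 (oner_neq0 K).
move: ha ha'; rewrite !rmorph1 !divr1 => ha ha'.
transitivity (a \in v).
  rewrite -iv; apply/idP/idP => h'; first by rewrite -[i a](subKr x) placeB.
  by rewrite -(subrK (i a) x) placeD.
rewrite -fv; apply/idP/idP => h'; first by rewrite -(subrK (f a) y) placeD.
by rewrite -[f a](subKr y) placeB.
Qed.

Let lim_total x : exists y, lim x y.
Proof.
have [t [mt t0]] := uniformizer v.
have it0 n : i t ^+ n != 0 by rewrite expf_neq0 // fmorph_eq0.
have /choice[a aE] := fun n => dens x (it0 n).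
have ha c : c != 0 -> exists N, forall n, (N <= n)%N -> (x - i (a n)) / i c \in w.
  move=> c0; have [N hN] := arch mt c0; exists N => n Nn.
  by apply: (place_trans (it0 n) (aE n)); rewrite -rmorphXn -fmorph_div iv hN.
have cc : v_cauchy u (fun n => f (a n)).
  apply: (cofinal_cauchy cof) => c c0; have [N hN] := ha c c0; exists N => m n Nm Nn.
  rewrite -rmorphB -fmorph_div fv -iv fmorph_div rmorphB.
  have -> : i (a m) - i (a n) = (x - i (a n)) - (x - i (a m)) by ring.
  by rewrite mulrBl placeB ?hN.
have [y hy] := complete cc; exists y => c c0.
have [N hN] := ha c c0; have [|M hM] := hy (f c); first by rewrite fmorph_eq0.
exists (a (maxn N M)); split; first by apply: hN; exact: leq_maxl.
by rewrite -opprB mulNr placeN hM // leq_maxr.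
Qed.

Lemma completion_map : exists g : {lrmorphism H -> L}, (forall x, g (i x) = f x) /\
  forall x, (g x \in u) = (x \in w).
Proof.
have /choice[g gE] := lim_total.
have limN x y : lim x y -> lim (- x) (- y).
  move=> h; have := limM (limB (-1)) h; by rewrite !rmorphN !rmorph1 !mulN1r.
have uniq x y y' : lim x y -> lim x y' -> y = y'.
  move=> h h'; apply/eqP; rewrite -subr_eq0; apply/eqP/lim0.
  by have := limD h (limN _ _ h'); rewrite subrr.
have [c|x y|x y|h hE] := @build_lrmorph F H L g.
- by apply: (uniq c%:A) => //; rewrite -{1}(lrmorph_cA i) -(lrmorph_cA f).
- by apply: (uniq (x + y)) => //; exact: limD.
- by apply: (uniq (x * y)) => //; exact: limM.
exists h; split=> x; rewrite hE; first exact: (uniq (i x)).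
by rewrite (lim_place (gE x)).
Qed.

(** Approximants of y from K form a Cauchy sequence already in H, and the limit there maps to y. *)
Lemma completion_image (g : {lrmorphism H -> L}) y :
  (forall x, g (i x) = f x) -> (forall x, (g x \in u) = (x \in w)) ->
  (forall c : K, c != 0 -> exists a, (y - f a) / f c \in u) -> exists x, g x = y.
Proof.
move=> gi gw hy; have [t [mt t0]] := uniformizer v.
have /choice[a aE] : forall n, exists a, (y - f a) / f (t ^+ n) \in u.
  by move=> n; apply: hy; rewrite expf_neq0.
have ha c : c != 0 -> exists N, forall n, (N <= n)%N -> (y - f (a n)) / f c \in u.
  move=> c0; have [N hN] := arch mt c0; exists N => n Nn.
  by apply: (place_trans _ (aE n)); rewrite ?fmorph_eq0 ?expf_neq0 // -fmorph_div fv hN.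
have ca : v_cauchy w (fun n => i (a n)).
  apply: (cofinal_cauchy cofi) => c c0; have [N hN] := ha c c0; exists N => m n Nm Nn.
  rewrite -rmorphB -fmorph_div iv -fv fmorph_div rmorphB.
  have -> : f (a m) - f (a n) = (y - f (a n)) - (y - f (a m)) by ring.
  by rewrite mulrBl placeB ?hN.
have [_ _ cw] := comp; have [x hx] := cw _ ca; exists x; apply/eqP; rewrite -subr_eq0; apply/eqP.
apply: (cofinal_separated cof) => c c0; have [N hN] := ha c c0.
have [|M hM] := hx (i c); first by rewrite fmorph_eq0.
have h1 := hN (maxn N M) (leq_maxl _ _); have h2 := hM (maxn N M) (leq_maxr _ _).
have -> : g x - y = - (f (a (maxn N M)) - g x) - (y - f (a (maxn N M))) by ring.
rewrite mulrBl placeB // mulNr placeN.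
have -> z : (f z - g x) / f c = g ((i z - x) / i c) by rewrite fmorph_div rmorphB /= !gi.
by rewrite gw.
Qed.
End CompletionMap.

Lemma completion_map_unique (F : fieldType) (K H L : fieldAlgType F) (v : place K)
    (i : {lrmorphism K -> H}) (w : place H) (f : {lrmorphism K -> L}) (u : place L)
    (g g' : {lrmorphism H -> L}) :
  is_completion v i w -> cofinal f u ->
  (forall x, g (i x) = f x) -> (forall x, g' (i x) = f x) ->
  (forall x, (g x \in u) = (x \in w)) -> (forall x, (g' x \in u) = (x \in w)) -> g =1 g'.
Proof.
move=> [_ dens _] cof gi gi' gw gw' x; apply/eqP; rewrite -subr_eq0; apply/eqP.
apply: (cofinal_separated cof) => c c0.
have [|a ha] := dens x (i c); first by rewrite fmorph_eq0.
have -> : g x - g' x = (g x - f a) - (g' x - f a) by ring.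
rewrite mulrBl placeB //.
  have -> : (g x - f a) / f c = g ((x - i a) / i c) by rewrite fmorph_div rmorphB /= !gi.
  by rewrite gw.
have -> : (g' x - f a) / f c = g' ((x - i a) / i c) by rewrite fmorph_div rmorphB /= !gi'.
by rewrite gw'.
Qed.

Lemma cofinal_comp (K N M : fieldType) (e : {rmorphism K -> N}) (i : {rmorphism N -> M})
    (w : place N) (wM : place M) :
  (forall x, (i x \in wM) = (x \in w)) -> cofinal e w -> cofinal i wM -> cofinal (i \o e) wM.
Proof.
move=> iw ce ci c c0; have [b [b0 hb]] := ci c c0; have [a [a0 ha]] := ce b b0.
exists a; split=> //; apply: (place_trans _ _ hb); first by rewrite fmorph_eq0.
by rewrite /= -fmorph_div iw.
Qed.

(** * Weak approximation and decomposition groups *)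

Lemma arch_vmax (N : fieldType) (v : place N) z y : archimedean v -> z \in vmax v ->
  exists R, forall r, (R <= r)%N -> z ^+ r * y \in vmax v.
Proof.
move=> arch mz; have [->|y0] := eqVneq y 0; first by exists 0 => r _; rewrite mulr0 vmax0.
have [t [mt t0]] := uniformizer v.
have [|R hR] := arch z (t / y) mz; first by rewrite mulf_neq0 // invr_eq0.
exists R => r Rr; have -> : z ^+ r * y = (z ^+ r / (t / y)) * t by field; rewrite t0 y0.
by rewrite vmaxM ?hR.
Qed.

Lemma unit_1D (N : fieldType) (v : place N) z : z \in vmax v -> 1 + z \in v /\ 1 + z \notin vmax v.
Proof. by move=> mz; rewrite placeD ?place1 ?vmax_place // unitD ?vmax1. Qed.

(** Prepares the quotient z^r / (1 + z^r), which tends to 1 where z is not integral and to 0 where z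
    is in the maximal ideal: the function behind weak approximation. *)
Lemma infinite_1D (N : fieldType) (v : place N) z r : z \notin v -> (0 < r)%N ->
  [/\ z != 0, 1 + z ^+ r != 0 & z ^+ r / (1 + z ^+ r) = (1 + z^-1 ^+ r)^-1] /\
  (1 + z^-1 ^+ r \in v /\ 1 + z^-1 ^+ r \notin vmax v).
Proof.
move=> nz r0.
have z0 : z != 0 by apply: contraNneq nz => ->; exact: place0.
have m : z^-1 ^+ r \in vmax v by case: r r0 => // r _; rewrite vmaxX // place_inv.
have [u nu] := unit_1D m; split=> //.
have zr0 := expf_neq0 r z0; have e : 1 + z ^+ r = (1 + z^-1 ^+ r) * z ^+ r.
  by rewrite mulrDl mul1r exprVn mulVf // addrC.
split=> //; first by rewrite e mulf_neq0 // (unit_neq0 nu).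
by rewrite e invfM mulrCA divff // mulr1.
Qed.

Section WeakApproximation.
Variables (N : fieldType) (v : place N) (T : eqType) (u : T -> place N).
Hypothesis arch : forall v : place N, archimedean v.

(** The argument of Artin and Whaples: if z serves for the list s and y for h, then z^r y works for
    large r when z is integral at h, and y z^r / (1 + z^r) works otherwise. *)
Lemma separating_element (s : seq T) :
  (forall g, g \in s -> exists z, z \notin v /\ z \in vmax (u g)) ->
  exists z, z \notin v /\ forall g, g \in s -> z \in vmax (u g).
Proof.
elim: s => [|h s IH] hs.
  by have [x vx] := vring_proper v; exists x.
have [z [vz hz]] := IH (fun g gs => hs g (mem_behead (s := h :: s) gs)).
have [y [vy hy]] := hs h (mem_head _ _).
have [R hR] : exists R, forall r, (R <= r)%N -> forall g, g \in s -> z ^+ r * y \in vmax (u g).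
  elim: s {IH hs} hz => [|g s IH] hz; first by exists 0.
  have [R hR] := IH (fun g gs => hz g (mem_behead (s := _ :: s) gs)).
  have [R' hR'] := arch_vmax y (@arch (u g)) (hz g (mem_head _ _)).
  exists (maxn R R') => r; rewrite geq_max => /andP[h1 h2] g'; rewrite inE => /orP[/eqP->|gs].
    exact: hR'.
  exact: hR.
have vzV : z^-1 \in vmax v by exact: place_inv.
have vyV : y^-1 \in vmax v by exact: place_inv.
have v0 x : x \notin v -> x != 0 by apply: contraNneq => ->; exact: place0.
have [hz'|hz'] := boolP (z \in u h).
  exists (z ^+ R * y); split.
    rewrite -[_ * _]invrK; apply: vmax_inv; last by rewrite invr_eq0 mulf_neq0 ?expf_neq0 ?v0.
    by rewrite invfM -exprVn vmaxM // placeX // vmax_place.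
  move=> g; rewrite inE => /orP[/eqP->|gs]; last exact: hR.
  by rewrite vmaxM ?placeX.
have [[z0 zR0 e] [w1 w2]] := infinite_1D vz (ltn0Sn R).
have [[_ _ e'] [w1' w2']] := infinite_1D hz' (ltn0Sn R).
exists (z ^+ R.+1 / (1 + z ^+ R.+1) * y); split.
  rewrite e; apply: contra vy => vy; have -> : y = (1 + z^-1 ^+ R.+1) * ((1 + z^-1 ^+ R.+1)^-1 * y).
    by rewrite mulVKf // (unit_neq0 w2).
  by rewrite placeM.
move=> g; rewrite inE => /orP[/eqP->|gs]; first by rewrite e' vmaxM // unit_inv.
rewrite mulrAC mulrC vmaxM ?hR //.
by have [_ n1] := unit_1D (vmaxX R (hz g gs)); rewrite unit_inv.
Qed.

Lemma weak_approximation (s : seq T) c : c != 0 ->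
  (forall g, g \in s -> exists z, z \notin v /\ z \in vmax (u g)) ->
  exists a, (a - 1) / c \in v /\ forall g, g \in s -> a / c \in u g.
Proof.
move=> c0 /separating_element[z [vz hz]].
have [R1 hR1] := arch (place_inv vz) c0.
have [R2 hR2] : exists R, forall r, (R <= r)%N -> forall g, g \in s -> z ^+ r / c \in u g.
  elim: s hz => [|g s IH] hz; first by exists 0.
  have [R hR] := IH (fun g gs => hz g (mem_behead (s := _ :: s) gs)).
  have [R' hR'] := arch (hz g (mem_head _ _)) c0.
  exists (maxn R R') => r; rewrite geq_max => /andP[h1 h2] g'; rewrite inE => /orP[/eqP->|gs].
    exact: hR'.
  exact: hR.
pose r := (maxn R1 R2).+1.
have r1 : (R1 <= r)%N by rewrite leqW // leq_maxl.
have r2 : (R2 <= r)%N by rewrite leqW // leq_maxr.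
have [[z0 zR0 e] [w1 w2]] := infinite_1D vz (ltn0Sn _ : (0 < r)%N).
exists (z ^+ r / (1 + z ^+ r)); split.
  have n0 := unit_neq0 w2; rewrite e; move: n0 w2 (hR1 r r1); move: (z^-1 ^+ r) => q n0 w2 hq.
  have -> : ((1 + q)^-1 - 1) / c = - (1 + q)^-1 * (q / c) by field; rewrite c0 n0.
  by rewrite placeM // placeN unit_inv.
move=> g gs; rewrite mulrAC placeM ?hR2 //.
by have [_ n1] := unit_1D (vmaxX (maxn R1 R2) (hz g gs)); rewrite unit_inv.
Qed.
End WeakApproximation.

Lemma nat_inverse (p : nat) (N : fieldType) n : p \in [pchar N] -> coprime p n ->
  exists m, (n%:R : N) * m%:R = 1.
Proof.
move=> pN cpn; have /coprimeP : coprime n p by rewrite coprime_sym.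
case: n cpn => [|n] cpn; first by rewrite /coprime gcdn0 in cpn; have := pcharf_prime pN; rewrite (eqP cpn).
move=> /(_ isT)[[a b] /= h]; exists a; rewrite -natrM mulnC.
have -> : (a * n.+1 = 1 + b * p)%N by rewrite -h subnK // ltnW // -subn_gt0 h.
by rewrite natrD natrM (pcharf0 pN) mulr0 addr0.
Qed.

Section Decomposition.
Variables (F : fieldType) (K N : fieldAlgType F) (e : {lrmorphism K -> N}).
Variables (gT : finGroupType) (act : gT -> {lrmorphism N -> N}) (w : place N).
Hypothesis gal : galois_datum e act.
Variable p : nat.
Hypotheses (pN : p \in [pchar N]) (cop : coprime p #|gT|).
Hypothesis arch : forall v : place N, archimedean v.
Hypothesis alg : forall x, algebraic e x.

Definition decomposition : {set gT} := [set g | `[< forall x, (act g x \in w) = (x \in w) >]].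

Let DP g : reflect (forall x, (act g x \in w) = (x \in w)) (g \in decomposition).
Proof. by rewrite inE; exact: asboolP. Qed.

Let actM g h x : act (g * h)%g x = act g (act h x).
Proof. by case: gal => _ + _ _ => ->. Qed.

Let actV g x : act g (act g^-1%g x) = x.
Proof. by rewrite -actM mulgV (act1 gal). Qed.

Lemma decomposition_group : group_set decomposition.
Proof.
apply/group_setP; split; first by apply/DP => x; rewrite (act1 gal).
by move=> g h /DP hg /DP hh; apply/DP => x; rewrite actM hg hh.
Qed.

Let copD : coprime p #|Group decomposition_group|.
Proof.
apply: coprime_dvdr cop; rewrite -cardsT.
exact: (@cardSg gT [set: gT]%G (Group decomposition_group) (finset.subsetT _)).
Qed.

(** An inclusion between w and its conjugate by g, iterated up to the finite order of g, returns to
    w and is therefore an equality. *)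
Let sub_decomposition g : (forall x, x \in w -> act g x \in w) -> g \in decomposition.
Proof.
move=> h; have hn n x : x \in w -> act (g ^+ n)%g x \in w.
  move=> wx; elim: n => [|n IH]; first by rewrite expg0 (act1 gal).
  by rewrite expgS actM h.
apply/DP => x; apply/idP/idP => [wx|]; last exact: h.
by have := hn #[g]%g.-1 _ wx; rewrite -actM -expgSr prednK ?order_gt0 // expg_order (act1 gal).
Qed.

(** x and y witness the failure of the two inclusions between w and its conjugate, and x / y then
    separates the two places. *)
Let incomparable g : g \notin decomposition -> exists z, z \notin w /\
  act g z \in vmax w.
Proof.
move=> gD; have [x xw gx] : exists2 x, x \notin w & act g x \in w.
  apply: contrapT => no; case/negP: gD; rewrite -[g]invgK (@groupV _ (Group decomposition_group)).
  apply: sub_decomposition => x wx; apply: contraT => h.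
  by case: no; exists (act g^-1%g x) => //; rewrite actV.
have [y yw gy] : exists2 y, y \in w & act g y \notin w.
  apply: contrapT => no; case/negP: gD; apply: sub_decomposition => y yw.
  by apply: contraT => h; case: no; exists y.
have y0 : y != 0 by apply: contraNneq gy => ->; rewrite rmorph0 place0.
exists (x / y); split; last by rewrite rmorphM fmorphV vmaxM // place_inv.
by apply: contra xw => h; rewrite -(divfK y0 x) placeM.
Qed.

(** Weak approximation gives a close to 1 at w and close to 0 at the conjugates of w outside the
    decomposition group D. The trace of a x is then close to #|D| x, and #|D| is invertible, being
    prime to p. *)
Lemma decomposition_dense x c : c != 0 ->
  (forall g, g \in decomposition -> act g x = x) -> exists a, (x - e a) / e c \in w.
Proof.
move=> c0 fx; have /choice[u uE] : forall g, exists u : place N, forall x, (act g x \in w) = (x \in u).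
  move=> g; apply: place_restrict; have [y wy] := vring_proper w; exists (act g^-1%g y).
  by rewrite -(actV g y) in wy.
have ec0 : e c != 0 by rewrite fmorph_eq0.
have fe g y : act g (e y) = e y by case: gal.
have cof : cofinal e w by exact: place_cofinal.
(* b bounds all conjugates of x relative to c, and so fixes the precision required of a. *)
have [b [b0 hb]] := cofinal_list [seq act g x / e c | g : gT] cof.
have {}hb g : act g x / e c * e b \in w by apply: hb; apply/mapP; exists g; rewrite ?mem_enum.
have eb0 : e b != 0 by rewrite fmorph_eq0.
have [|a [ha1 ha2]] := @weak_approximation N w gT u (@arch) (enum [predC decomposition]) (e b) eb0.
  move=> g; rewrite mem_enum => /incomparable[z [wz hz]]; exists z; split=> //.
  apply: vmaxI; first by rewrite -uE vmax_place.
  rewrite -uE fmorphV; apply: vmax_inv => //; rewrite fmorph_eq0.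
  by apply: contraNneq wz => ->; rewrite place0.
have [y yE] := tr_base gal (a * x).
pose D := Group decomposition_group.
have [m hm] := nat_inverse pN copD.
exists (m%:R * y); rewrite rmorphM rmorph_nat /= yE.
have -> : (x - m%:R * tr act (a * x)) / e c = m%:R * ((#|D|%:R * x - tr act (a * x)) / e c).
  by rewrite [RHS]mulrA mulrBr (mulrA m%:R) [m%:R * #|D|%:R]mulrC hm mul1r.
rewrite placeM ?place_nat //.
rewrite /tr (bigID (mem decomposition)) /= opprD addrA mulrBl placeB //.
  have -> : #|D|%:R * x = \sum_(g in decomposition) x by rewrite sumr_const mulr_natl.
  rewrite -sumrB mulr_suml.
  apply: place_sum => g gD; rewrite rmorphM /= fx //.
  rewrite -opprB mulNr placeN -[X in _ * _ - X]mul1r -mulrBl.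
  have -> : (act g a - 1) * x / e c = (act g a - 1) / e b * (x / e c * e b) by field; rewrite ec0 eb0.
  apply: placeM; last by have := hb 1%g; rewrite (act1 gal).
  rewrite -(rmorph1 (act g)) -(fe g b) -rmorphB -fmorph_div.
  by move/DP: gD => ->.
rewrite mulr_suml; apply: place_sum => g gD; rewrite rmorphM /=.
have -> : act g a * act g x / e c = (act g a / e b) * (act g x / e c * e b) by field; rewrite ec0 eb0.
apply: placeM => //; rewrite -(fe g b) -fmorph_div uE; apply: ha2.
by rewrite mem_enum.
Qed.

Variables (v : place K) (Kh M : fieldAlgType F) (i : {lrmorphism K -> Kh}) (wK : place Kh)
  (iN : {lrmorphism N -> M}) (wM : place M).
Hypotheses (ev : forall x, (e x \in w) = (x \in v)) (archK : archimedean v).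
Hypotheses (cK : is_completion v i wK) (cM : is_completion w iN wM).

Let iw x : (iN x \in wM) = (x \in w). Proof. by case: cM. Qed.
Let cofN : cofinal iN wM. Proof. by apply: dense_cofinal; case: cM. Qed.
Let cofK : cofinal (iN \o e : {lrmorphism K -> M}) wM.
Proof. by apply: (cofinal_comp iw) => //; exact: place_cofinal. Qed.

(** The decomposition group acts on M by continuity. A fixed element x is approximated by some y of
    N; averaging y over the group keeps the approximation, and [decomposition_dense] replaces the
    average by an element of K. *)
Lemma local_galois : exists (c : {lrmorphism Kh -> M}) (D : finGroupType) (actM : D -> {lrmorphism M -> M}),
  [/\ galois_datum c actM, forall x, c (i x) = iN (e x), coprime p #|D| &
      forall x, (c x \in wM) = (x \in wK)].
Proof.
have [c [ci cw]] : exists c : {lrmorphism Kh -> M}, (forall x, c (i x) = (iN \o e) x) /\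
    forall x, (c x \in wM) = (x \in wK).
  apply: (completion_map cK archK) => //; last by case: cM.
  by move=> x; rewrite /= iw ev.
pose D := Group decomposition_group.
pose dT : finGroupType := subg_of D.
have /(_ _)/cid-/all_sig[ac acE] : forall g : dT, exists a : {lrmorphism M -> M},
    (forall x, a (iN x) = iN (act (sgval g) x)) /\ forall x, (a x \in wM) = (x \in wM).
  move=> g; apply: (completion_map (f := (iN \o act (sgval g) : {lrmorphism N -> M})) cM) => //.
  - by move=> x; rewrite /= iw; have /DP -> := subgP g.
  - move=> y y0; have [b [b0 hb]] := cofN y0; exists (act (sgval g)^-1%g b).
    by rewrite fmorph_eq0 /= actV.
  - by case: cM.
have acc g x : ac g (c x) = c x.
  apply: (@completion_map_unique F K Kh M v i wK (iN \o e : {lrmorphism K -> M}) wM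
    (ac g \o c : {lrmorphism Kh -> M}) c) => // y /=.
  - by rewrite ci /= (acE g).1; case: gal => ->.
  - by rewrite (acE g).2.
exists c, dT, ac; split=> //.
- split=> // [g h x|g g1|x fx].
  + apply: (@completion_map_unique F N M M w iN wM (iN \o act (sgval (g * h)%g) : {lrmorphism N -> M}) wM
      (ac (g * h)%g) (ac g \o ac h : {lrmorphism M -> M})) => // [|y|y|y|y] /=.
    * move=> y y0; have [b [b0 hb]] := cofN y0; exists (act (sgval (g * h)%g)^-1%g b).
      by rewrite fmorph_eq0 /= actV.
    * exact: (acE _).1.
    * by rewrite (acE h).1 (acE g).1 -actM.
    * exact: (acE _).2.
    * by rewrite (acE g).2 (acE h).2.
  + have [_ _ faith _] := gal; have [|x hx] := faith (sgval g).
      by apply: contra_neq g1 => h; apply: val_inj.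
    by exists (iN x); rewrite (acE g).1 (inj_eq (fmorph_inj iN)).
  + apply: (completion_image cK archK (f := (iN \o e : {lrmorphism K -> M})) _ cofK ci cw).
      by move=> y; rewrite /= iw ev.
    move=> b b0; have ib0 : iN (e b) != 0 by rewrite !fmorph_eq0.
    have [_ dens _] := cM; have [y hy] := dens x (iN (e b)) ib0.
    have [m hm] := nat_inverse pN copD.
    pose y' := m%:R * \sum_(g in D) act g y.
    have fy' g : g \in decomposition -> act g y' = y'.
      move=> gD; rewrite rmorphM rmorph_nat rmorph_sum; congr (_ * _).
      rewrite [RHS](reindex_inj (mulgI g)) /=; apply: eq_big => [h|h _]; last by rewrite actM.
      exact: esym (groupMl (G := D) h gD).
    have [a ha] := decomposition_dense b0 fy'; exists a.
    rewrite /= -(subrK (iN y') x) -addrA mulrDl placeD //; last first.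
      by rewrite -rmorphB -fmorph_div iw.
    have -> : (x - iN y') = m%:R * \sum_(g in D) (x - iN (act g y)).
      rewrite sumrB sumr_const mulrBr -[x *+ _]mulr_natl mulrA [m%:R * #|D|%:R]mulrC.
      have -> : (#|D|%:R * m%:R : M) = 1 by rewrite -!(rmorph_nat iN) -rmorphM hm rmorph1.
      by rewrite mul1r /y' rmorphM rmorph_nat rmorph_sum.
    rewrite -mulrA placeM ?place_nat // mulr_suml; apply: place_sum => g gD.
    have -> : (x - iN (act g y)) / iN (e b) = ac (subg D g) ((x - iN y) / iN (e b)).
      rewrite fmorph_div rmorphB /= fx (acE (subg D g)).1 subgK //.
      by congr (_ / _); rewrite -[iN (e b)]ci acc.
    by rewrite (acE _).2.
- have -> : #|dT| = #|D| by rewrite card_sub; exact: eq_card.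
  exact: copD.
Qed.
End Decomposition.

(** * Separability of the completion *)

Lemma vmax_root (N : fieldType) (w : place N) x n : x ^+ n \in vmax w -> x \in vmax w.
Proof.
move=> h; apply: contraT => mx; have x0 := unit_neq0 mx.
have : x ^+ n \notin vmax w; last by rewrite h.
elim: n {h} => [|n IH]; first by rewrite expr0 vmax1.
by rewrite exprS unitM.
Qed.

Section FrobeniusIndependence.
Variables (p : nat) (H : fieldType) (t : H).
Hypotheses (pH : p \in [pchar H]) (nt : forall y, y ^+ p != t).

Lemma frobenius_sum (I : Type) (r : seq I) (P : pred I) (f : I -> H) :
  (\sum_(i <- r | P i) f i) ^+ p = \sum_(i <- r | P i) f i ^+ p.
Proof. by rewrite -[LHS](pFrobenius_autE pH) rmorph_sum; apply: eq_bigr => i _; exact: pFrobenius_autE. Qed.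

(** With Frobenius as the embedding, the minimal polynomial of t over the p-th powers divides (X -
    t)^p, so it is (X - t)^d up to a scalar. A nontrivial relation forces d < p; then d is
    invertible, and the coefficient of degree d - 1 shows that t is a p-th power. *)
Lemma powers_indep (y : 'I_p -> H) : \sum_(j < p) t ^+ j * y j ^+ p = 0 -> forall j, y j = 0.
Proof.
pose phi : {rmorphism H -> H} := pFrobenius_aut pH.
have phiE z : phi z = z ^+ p by exact: pFrobenius_autE.
have p1 := prime_gt1 (pcharf_prime pH).
have rX : root (map_poly phi ('X^p - t%:P)) t.
  rewrite rmorphB /= map_polyXn map_polyC /= rootE !hornerE /=.
  by rewrite -/(phi t) phiE subrr.
have X0 : 'X^p - t%:P != 0.
  by rewrite -size_poly_eq0 size_XnsubC // ltnW.
have [|m [m0 mt mP]] := @min_poly_exists H H phi t; first by exists ('X^p - t%:P).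
move=> rel; pose q : {poly H} := \poly_(j < p) (if insub j is Some i then y i else 0).
have qE (j : 'I_p) : q`_j = y j by rewrite coef_poly ltn_ord insubT //= => h; congr y; exact: val_inj.
have qt : root (map_poly phi q) t.
  apply/rootP; rewrite (horner_coef_wide (n := p)) ?size_map_poly ?size_poly // -[RHS]rel.
  by apply: eq_bigr => j _; rewrite coef_map /= qE -/(phi _) phiE mulrC.
have [q0|nq] := eqVneq q 0; first by move=> j; rewrite -qE q0 coef0.
have sm : (size m <= p)%N.
  by apply: (@leq_trans (size q)); [apply: dvdp_leq => //; rewrite -mP|exact: size_poly].
have : map_poly phi m %| ('X - t%:P) ^+ p.
  have -> : ('X - t%:P) ^+ p = map_poly phi ('X^p - t%:P).
    have pP : p \in [pchar {poly H}] by rewrite inE (pcharf_prime pH) /= -polyC_natr (pcharf0 pH) polyC0 eqxx.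
    have := pFrobenius_autB_comm pP (mulrC 'X t%:P); rewrite !pFrobenius_autE => ->.
    by rewrite rmorphB /= map_polyXn map_polyC /= -/(phi t) phiE polyC_exp.
  by rewrite dvdp_map -mP.
case/dvdp_exp_XsubCP => d dp meq.
have sd : size m = d.+1 by have := eqp_size meq; rewrite size_map_poly size_exp_XsubC.
have d0 : (0 < d)%N.
  have : (1 < size m)%N by rewrite -(size_map_poly phi) (root_size_gt1 _ mt) // map_poly_eq0.
  by rewrite sd.
have [[c1 c2] /= /andP[c10 c20] ceq] := eqpP _ _ meq.
have cd : (('X - t%:P) ^+ d)`_d.-1 = - (t *+ d).
  have := @coefPn_prod_XsubC _ (nseq d t); rewrite size_nseq !big_nseq iter_mulr_1 iter_addr_0.
  by apply; rewrite -lt0n.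
have cd' : (('X - t%:P) ^+ d)`_d = 1.
  have /monicP : ('X - t%:P) ^+ d \is monic by rewrite monic_exp ?monicXsubC.
  by rewrite /lead_coef size_exp_XsubC.
have e1 : c1 * phi m`_d = c2.
  by have := congr1 (fun q : {poly H} => q`_d) ceq; rewrite !coefZ coef_map cd' mulr1.
have e2 : c1 * phi m`_d.-1 = c2 * - (t *+ d).
  by have := congr1 (fun q : {poly H} => q`_d.-1) ceq; rewrite !coefZ coef_map cd.
have md0 : m`_d != 0 by rewrite -[d]/(d.+1.-1) -sd -/(lead_coef m) lead_coef_eq0.
have [n hn] : exists n, (d%:R : H) * n%:R = 1.
  apply: (nat_inverse pH); rewrite prime_coprime ?(pcharf_prime pH) //.
  by rewrite gtnNdvd // -sd.
have := nt (- n%:R * (m`_d.-1 / m`_d)).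
have pd0 : phi m`_d != 0 by rewrite fmorph_eq0.
rewrite -phiE rmorphM rmorphN rmorph_nat fmorph_div.
have -> : phi m`_d.-1 = - (phi m`_d * t * d%:R).
  apply: (mulfI c10); rewrite e2 -e1 -mulr_natr; ring.
have -> : - (n%:R : H) * (- (phi m`_d * t * d%:R) / phi m`_d) = t * (d%:R * n%:R) by field.
by rewrite hn mulr1 eqxx.
Qed.
End FrobeniusIndependence.

(** * A finite extension of a function field over its p-th powers *)

Section FrobeniusBasis.
Variables (p : nat) (k F A : fieldType) (ka : {rmorphism k -> F}) (io : {rmorphism F -> A}).
Hypothesis cka : constants p ka.
Hypothesis finA : finite_over io.
Let kA : {rmorphism k -> A} := io \o ka.
Variable t : A.
Hypotheses (tt : ~ algebraic kA t) (nt : forall y, y ^+ p != t).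

Let pA : p \in [pchar A]. Proof. by rewrite (fmorph_pchar io) (const_char cka). Qed.

Lemma constant_root (a : k) : exists b, b ^+ p = a.
Proof.
have [->|a0] := eqVneq a 0.
  by exists 0; rewrite expr0n; case: (p) (pcharf_prime pA) => // -[].
have [n [n0 an]] := const_root cka a0.
have [|b hb] := root_of_unity_pth (x := a) (p := p) _ n0 an; last by exists b.
by rewrite -(fmorph_pchar ka) (const_char cka).
Qed.

(** On k(t) the claim holds because constants are p-th powers. The p-th powers of a basis of A over
    k(t) are independent over k(t) by [powers_indep], so by counting they are again a basis; the
    coefficients from k(t) are then split along the powers of t. *)
Lemma frobenius_basis x : exists c : 'I_p -> A, x = \sum_(j < p) t ^+ j * c j ^+ p.
Proof.
have p1 := prime_gt1 (pcharf_prime pA).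
have [k2 [i2 [iota [ik [t2 t2E] i2q]]]] := simple_subfield kA t.
have ev (q : {poly k}) : exists z, i2 z = (map_poly kA q).[t].
  exists (map_poly iota q).[t2]; rewrite -horner_map /= t2E -map_poly_comp.
  by congr _.[_]; apply: eq_map_poly => z; rewrite -[LHS]/((i2 \o iota) z) ik.
pose V (y : A) := exists c : 'I_p -> k2, y = \sum_(j < p) t ^+ j * i2 (c j) ^+ p.
have VD y z : V y -> V z -> V (y + z).
  move=> [c ->] [d ->]; exists (fun j => c j + d j); rewrite -big_split; apply: eq_bigr => j _.
  by rewrite rmorphD -!(pFrobenius_autE pA) rmorphD mulrDr.
have V0 : V 0.
  exists (fun=> 0); rewrite big1 // => j _; rewrite rmorph0 expr0n.
  by rewrite gtn_eqF ?mulr0 // ltnW.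
have VM y z : V y -> V (y * i2 z ^+ p).
  move=> [c ->]; exists (fun j => c j * z); rewrite mulr_suml; apply: eq_bigr => j _.
  by rewrite rmorphM exprMn mulrA.
have Vt n z : V (t ^+ n * i2 z ^+ p).
  apply: (VM); have -> : t ^+ n = t ^+ (n %% p)%N * i2 (t2 ^+ (n %/ p)%N) ^+ p.
    by rewrite rmorphXn t2E -exprM -exprD addnC -divn_eq.
  apply: (VM).
  exists (fun j => ((j : nat) == (n %% p)%N)%:R).
  rewrite (bigD1 (Ordinal (ltn_pmod n (ltnW p1)))) //= eqxx rmorph1 expr1n mulr1 big1 ?addr0 ?t2E //.
  move=> j /negPf nj; rewrite -[(_ == (n %% p)%N)]/(j == Ordinal (ltn_pmod n (ltnW p1))) nj rmorph0 expr0n.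
  by rewrite gtn_eqF ?mulr0 // ltnW.
have Vq (q : {poly k}) : V (map_poly kA q).[t].
  rewrite horner_coef; apply: (big_ind V) => // j _.
  have [b bE] := constant_root q`_j.
  have -> : (map_poly kA q)`_j = kA b ^+ p by rewrite coef_map -bE; exact: (rmorphXn kA).
  rewrite mulrC.
  by have [z zE] := ev b%:P; move: zE; rewrite map_polyC hornerC => <-; exact: Vt.
have Vk z : V (i2 z).
  have [q [q' [q'0 ->]]] := i2q z; have [y yE] := ev q'.
  have -> : (map_poly kA q).[t] / (map_poly kA q').[t] = (map_poly kA (q * q' ^+ p.-1)).[t] * i2 y^-1 ^+ p.
    rewrite rmorphM hornerM rmorphXn horner_exp fmorphV yE exprVn -mulrA; congr (_ * _).
    by rewrite -{2}(prednK (ltnW p1)) exprSr invfM mulrCA mulrA mulVf ?mul1r // expf_neq0.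
  exact: VM.
have /choice[r rE] := Vk.
have h := @transc_finite p k F A ka io cka k2 i2 t finA.
have {h}[n [b hb]] : finite_over i2 by exact: (h tt ev).
have [m [be [hbe _ ibe]]] := span_basis (V := fun=> True) (fun x _ => hb x) (fun=> I).
have split_sum (c : 'I_m -> k2) : \sum_l i2 (c l) * be l ^+ p =
    \sum_(j < p) t ^+ j * (\sum_l i2 (r (c l) j) * be l) ^+ p.
  under [RHS]eq_bigr => j _ do rewrite (frobenius_sum pA) mulr_sumr.
  rewrite exchange_big; apply: eq_bigr => l _; rewrite {1}rE mulr_suml; apply: eq_bigr => j _.
  by rewrite exprMn mulrA.
have ind : indep i2 (fun l => be l ^+ p).
  move=> c c0 l; apply: (fmorph_inj i2); rewrite rE rmorph0 big1 // => j _.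
  have := powers_indep pA nt (etrans (esym (split_sum c)) c0) j => h.
  by rewrite (ibe _ h) rmorph0 expr0n gtn_eqF ?mulr0 // ltnW.
suff [c ->] : in_span i2 (fun l => be l ^+ p) x by rewrite split_sum; eexists.
have [|c [[l0 cl0] c0]] := @span_dependent _ _ i2 m m.+1 be
    (fun l : 'I_m.+1 => if unlift ord_max l is Some l' then be l' ^+ p else x) (ltnSn m).
  by move=> l; apply: hbe.
move: c0; rewrite big_ord_recr /= unlift_none.
have lE (l : 'I_m) : unlift ord_max (widen_ord (leqnSn m) l) = Some l.
  have -> : widen_ord (leqnSn m) l = lift ord_max l by apply: val_inj; rewrite /= /bump leqNgt ltn_ord.
  by rewrite liftK.
under eq_bigr => l _ do rewrite lE.
move=> c0; have [cm|cm] := eqVneq (c ord_max) 0.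
  move: c0; rewrite cm rmorph0 mul0r addr0 => /ind h.
  have [l0m|l0m] := ltnP l0 m; last first.
    have e0 : l0 = ord_max by apply: val_inj; apply/eqP; rewrite eqn_leq l0m -ltnS ltn_ord.
    by move: cl0; rewrite e0 cm eqxx.
  have e0 : l0 = widen_ord (leqnSn m) (Ordinal l0m) by apply: val_inj.
  by move: cl0; rewrite e0 h eqxx.
exists (fun l => - (c (widen_ord (leqnSn m) l) / c ord_max)).
have icm : i2 (c ord_max) != 0 by rewrite fmorph_eq0.
apply: (mulfI icm); move/eqP: c0; rewrite addrC addr_eq0 => /eqP ->.
rewrite -sumrN mulr_sumr; apply: eq_bigr => l _.
by rewrite rmorphN fmorph_div; field.
Qed.
End FrobeniusBasis.

Section Associate.
Variables (N : fieldType) (w : place N).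
Definition associate x y := x / y \in w /\ y / x \in w.

Lemma associate_trans x y z : y != 0 -> associate x y -> associate y z -> associate x z.
Proof.
by move=> y0 [h1 h2] [h3 h4]; split; [apply: place_trans h1 h3|apply: place_trans h4 h2].
Qed.
Lemma associateX x y n : associate x y -> associate (x ^+ n) (y ^+ n).
Proof. by move=> [h1 h2]; split; rewrite -exprVn -exprMn placeX. Qed.
Lemma associate_near x y : x != 0 -> (x - y) / x \in vmax w -> y != 0 /\ associate x y.
Proof. by move=> x0 h; have [y0 h1 h2] := near_unit x0 h. Qed.
End Associate.

Section NotPower.
Variables (p : nat) (k F A : fieldType) (ka : {rmorphism k -> F}) (io : {rmorphism F -> A}).
Hypothesis cka : constants p ka.
Hypothesis finA : finite_over io.
Let kA : {rmorphism k -> A} := io \o ka.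
Variable v : place A.

(** Otherwise the value of some y could be divided by p any number of times. Let n elements span A
    over k(y), let q = p^n > n, and let z^q have the value of y. All values of k(y) are multiples of
    that of z^q, so 1, z, ..., z^(q-1) have distinct values modulo them and are independent over
    k(y), which is too many. *)
Lemma not_power_value : exists t, [/\ t \in vmax v, t != 0 &
  forall z, z != 0 -> ~ associate v t (z ^+ p)].
Proof.
have algA x : algebraic io x by exact: finite_algebraic.
have p1 := prime_gt1 (pcharf_prime (const_char cka)).
apply: contrapT => no.
have pw t : t \in vmax v -> t != 0 -> exists z, [/\ z \in vmax v, z != 0 & associate v t (z ^+ p)].
  move=> mt t0; apply: contrapT => nz; apply: no; exists t; split=> // z z0 h; apply: nz.
  exists z; split=> //; apply: (@vmax_root _ _ _ p).
  by case: h => _ h; rewrite -(divfK t0 (z ^+ p)) vmaxM.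
have [y [my y0]] := uniformizer v.
have pwn r : exists z, [/\ z \in vmax v, z != 0 & associate v y (z ^+ (p ^ r))].
  elim: r => [|r [z [mz z0 h]]].
    by exists y; split=> //; rewrite expr1; split; rewrite divff ?place1.
  have [z' [mz' z0' h']] := pw z mz z0; exists z'; split=> //.
  apply: (associate_trans (expf_neq0 _ z0) h).
  by rewrite expnS exprM; exact: associateX.
have [k1 [i1 [iota [ik [t1 t1E] i1q]]]] := simple_subfield kA y.
have ev (q : {poly k}) : exists z, i1 z = (map_poly kA q).[y].
  exists (map_poly iota q).[t1]; rewrite -horner_map /= t1E -map_poly_comp.
  by congr _.[_]; apply: eq_map_poly => z; rewrite -[LHS]/((i1 \o iota) z) ik.
have [n [b hb]] : finite_over i1.
  have h := @transc_finite p k F A ka io cka k1 i1 y finA.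
  exact: (h (vmax_transc cka my y0) ev).
have [q qE] : exists q, q = (p ^ n)%N by exists (p ^ n)%N.
have nq : (n < q)%N by rewrite qE; exact: ltn_expl.
have [z [mz z0 [h1 h2]]] := pwn n; rewrite -qE in h1 h2.
have zq0 : z ^+ q != 0 by rewrite expf_neq0.
have val c : c != 0 -> exists a b u, [/\ u \in v, u \notin vmax v & i1 c * z ^+ (q * b) = z ^+ (q * a) * u].
  move=> c0; have [r [r' [r'0 cE]]] := i1q c.
  have nr' : r' != 0 by apply: contraNneq r'0 => ->; rewrite rmorph0 horner0.
  have nr : r != 0.
    by apply: contraNneq c0 => r0; rewrite -(fmorph_eq0 i1) cE r0 rmorph0 horner0 mul0r.
  have [a [u [vu mu uE]]] := poly_value io cka nr my y0.
  have [a' [u' [vu' mu' uE']]] := poly_value io cka nr' my y0.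
  have [s [sE vs ms]] : exists s, [/\ y = s * z ^+ q, s \in v & s \notin vmax v].
    exists (y / z ^+ q); split; rewrite ?divfK // -[_ / _]invrK; apply: unitV; first by rewrite invf_div.
    rewrite invf_div; apply: contraL h1 => h.
    by rewrite -invf_div; apply: vmax_inv => //; rewrite mulf_neq0 ?invr_eq0.
  have unX x j : x \notin vmax v -> x ^+ j \notin vmax v.
    by move=> mx; apply: contra mx; exact: vmax_root.
  exists a, a', (u * s ^+ a / (u' * s ^+ a')); split.
  - by rewrite placeM ?placeM ?placeX ?unit_inv ?unitM ?unX.
  - by rewrite unitM ?unitV ?unitM ?unX ?placeM ?placeX.
  - rewrite cE uE uE' sE !exprMn -!exprM.
    have := unX _ a' ms => /unit_neq0 sa0; have u0 := unit_neq0 mu'; have za0 := expf_neq0 (q * a') z0.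
    move: (s ^+ a) (s ^+ a') (z ^+ (q * a')) (z ^+ (q * a)) sa0 za0 => x1 x2 x3 x4 n1 n2.
    by field; rewrite u0 n1 n2.
have [c [[j0 cj0] c0]] := span_dependent nq (fun j : 'I_q => hb (z ^+ j)).
have valf j : exists ab : nat * nat, c j != 0 ->
    exists u, [/\ u \in v, u \notin vmax v & i1 (c j) * z ^+ (q * ab.2) = z ^+ (q * ab.1) * u].
  have [->|/val[a [a' [u h]]]] := eqVneq (c j) 0; first by exists (0, 0).
  by exists (a, a') => _; exists u.
have {valf}/choice[ab abE] := valf.
pose B := \sum_j (ab j).2.
have bB j : ((ab j).2 <= B)%N by rewrite /B (bigD1 j) //= leq_addr.
(* The exponent of z in the j-th term after multiplication by z^(q B), which clears negative
   exponents. Distinct j give distinct residues modulo q, so a single term has the least value. *)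
pose ex (j : 'I_q) := (q * ((ab j).1 + (B - (ab j).2)) + j)%N.
have valE j : c j != 0 -> exists u, [/\ u \in v, u \notin vmax v & i1 (c j) * z ^+ j * z ^+ (q * B) = z ^+ ex j * u].
  move=> /abE[u [vu mu uE]]; exists u; split=> //.
  have -> : z ^+ ex j = z ^+ (q * (ab j).1) * z ^+ (q * (B - (ab j).2)) * z ^+ j.
    by rewrite -!exprD -mulnDr.
  have -> : z ^+ (q * B) = z ^+ (q * (ab j).2) * z ^+ (q * (B - (ab j).2)).
    by rewrite -exprD -mulnDr subnKC.
  move: uE; move: (z ^+ (q * (ab j).2)) (z ^+ (q * (B - (ab j).2))) (z ^+ (q * (ab j).1)) (z ^+ j) => x1 x2 x3 x4 uE.
  transitivity (i1 (c j) * x1 * (x2 * x4)); first by ring.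
  by rewrite uE; ring.
case: (@arg_minnP _ j0 (fun j => c j != 0) ex cj0) => j1 cj1 minj.
have exinj j : ex j = ex j1 -> j = j1.
  move=> e; apply: val_inj; have := congr1 (fun x => x %% q)%N e.
  by rewrite /ex ![(q * _)%N]mulnC !modnMDl !modn_small.
have [u1 [vu1 mu1 e1]] := valE j1 cj1.
have : u1 \in vmax v.
  have -> : u1 = - \sum_(j | j != j1) i1 (c j) * z ^+ j * z ^+ (q * B) / z ^+ ex j1.
    move/eqP: c0; rewrite (bigD1 j1) //= addr_eq0 => /eqP c0.
    rewrite -!mulr_suml -!mulNr -c0 e1 mulrAC divff ?mul1r // expf_neq0 //.
  rewrite vmaxN; apply: vmax_sum => j jj1.
  have [->|cj] := eqVneq (c j) 0; first by rewrite rmorph0 !mul0r vmax0.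
  have [u [vu mu ->]] := valE j cj.
  have lt : (ex j1 < ex j)%N.
    rewrite ltn_neqAle minj // andbT; apply: contra jj1 => /eqP e.
    by apply/eqP/exinj.
  have -> : z ^+ ex j * u / z ^+ ex j1 = u * z ^+ (ex j - ex j1).-1.+1.
    rewrite prednK ?subn_gt0 // -{1}(subnK (ltnW lt)) exprD mulrAC mulfK ?expf_neq0 //.
    by rewrite mulrC.
  by rewrite vmaxM ?vmaxX.
by rewrite (negPf mu1).
Qed.
End NotPower.

Section DecompositionRoot.
Variables (F : fieldType) (K N : fieldAlgType F) (e : {lrmorphism K -> N}).
Variables (gT : finGroupType) (act : gT -> {lrmorphism N -> N}) (w : place N).
Hypothesis gal : galois_datum e act.
Variable p : nat.
Hypotheses (pN : p \in [pchar N]) (cop : coprime p #|gT|).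
Hypothesis arch : forall v : place N, archimedean v.
Hypothesis alg : forall x, algebraic e x.

(** For g in the decomposition group, the p-th power of y - act g y is small relative to y^p because
    t is fixed by g. Hence y is close to its conjugates and to their average, which is fixed by the
    group and so is approximated from K. *)
Lemma decomposition_root (y : N) (t : K) : t != 0 -> (e t - y ^+ p) / e t \in vmax w ->
  exists a, a != 0 /\ associate w (e t) (e a ^+ p).
Proof.
move=> t0 h; have et0 : e t != 0 by rewrite fmorph_eq0.
have [yp0 asy] := associate_near et0 h.
have p1 := prime_gt1 (pcharf_prime pN).
have y0 : y != 0 by apply: contraNneq yp0 => ->; rewrite expr0n gtn_eqF // ltnW.
have frobB (a b : N) : (a - b) ^+ p = a ^+ p - b ^+ p.
  by have := pFrobenius_autB_comm pN (mulrC a b); rewrite !pFrobenius_autE.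
pose D := Group (decomposition_group w gal).
have DP g : g \in D -> forall x, (act g x \in w) = (x \in w).
  by rewrite /D /= inE => /asboolP.
have DPm g : g \in D -> forall x, (act g x \in vmax w) = (x \in vmax w).
  by move=> gD x; rewrite !inE DP // fmorph_eq0 -fmorphV DP.
have near g : g \in D -> (y - act g y) / y \in vmax w.
  move=> gD; apply: (@vmax_root _ _ _ p); rewrite exprMn exprVn frobB.
  have -> : (y ^+ p - act g y ^+ p) / y ^+ p =
    (e t / y ^+ p) * (act g ((e t - y ^+ p) / e t) - (e t - y ^+ p) / e t).
    rewrite fmorph_div rmorphB rmorphXn /=; have [-> _ _ _] := gal.
    by field; rewrite et0 yp0.
  by case: asy => h1 _; rewrite vmaxM // vmaxB // DPm.
have copD : coprime p #|D|.
  apply: coprime_dvdr cop; rewrite -cardsT.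
  exact: (@cardSg gT [set: gT]%G D (finset.subsetT _)).
have [m hm] := nat_inverse pN copD.
pose y' := m%:R * \sum_(g in D) act g y.
have fy' g : g \in D -> act g y' = y'.
  move=> gD; rewrite rmorphM rmorph_nat rmorph_sum; congr (_ * _).
  rewrite [RHS](reindex_inj (mulgI g)) /=; apply: eq_big => [h'|h' _].
    exact: esym (groupMl (G := D) h' gD).
  by have [_ -> _ _] := gal.
have [y'0 asy'] : y' != 0 /\ associate w y y'.
  apply: associate_near => //.
  have -> : (y - y') / y = m%:R * \sum_(g in D) ((y - act g y) / y).
    rewrite -mulr_suml sumrB sumr_const mulrA mulrBr -[y *+ _]mulr_natl mulrA [m%:R * #|D|%:R]mulrC.
    by rewrite hm mul1r.
  by rewrite vmaxM ?place_nat //; apply: vmax_sum => g; exact: near.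
have [s [ms s0]] := uniformizer w.
have ys0 : y' * s != 0 by rewrite mulf_neq0.
have [c [c0 hc]] := place_cofinal alg w ys0.
have [a ha] := decomposition_dense gal pN cop (@arch) alg c0 fy'.
have [ea0 asa] : e a != 0 /\ associate w y' (e a).
  apply: associate_near => //.
  have -> : (y' - e a) / y' = ((y' - e a) / e c) * (e c / (y' * s)) * s.
    by field; rewrite s0 y'0 fmorph_eq0 c0.
  by apply: vmaxM => //; exact: placeM.
exists a; split; first by apply: contraNneq ea0 => ->; rewrite rmorph0.
apply: (associate_trans yp0 asy); apply: associateX.
exact: associate_trans asy' asa.
Qed.
End DecompositionRoot.

Section NoRoot.
Variables (F : fieldType) (p : nat) (K L H : fieldAlgType F) (e : {lrmorphism K -> L}) (j : {lrmorphism L -> H}).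
Variables (v : place K) (w : place L) (wH : place H).
Hypotheses (pF : p \in [pchar F]) (tow : galois_tower p e) (cH : is_completion w j wH).
Hypothesis ew : forall x, (e x \in w) = (x \in v).
Hypothesis algL : forall x, algebraic e x.
Hypothesis arch : forall (N : fieldAlgType F) (f : {lrmorphism N -> L}) (u : place N), archimedean u.

(** A p-th root of t in the completion is close to an element of L, which lies in some finite N;
    there [decomposition_root] contradicts the choice of t. *)
Lemma no_root t : t != 0 -> (forall z, z != 0 -> ~ associate v t (z ^+ p)) ->
  forall y : H, y ^+ p != j (e t).
Proof.
move=> t0 nt y; apply/negP => /eqP yt.
have p1 := prime_gt1 (pcharf_prime pF).
have pH : p \in [pchar H] by rewrite (fmorph_pchar (in_alg H)).
have jt0 : j (e t) != 0 by rewrite !fmorph_eq0.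
have y0 : y != 0 by apply: contraNneq jt0 => y0; rewrite -yt y0 expr0n gtn_eqF // ltnW.
have [s [ms s0]] := uniformizer wH.
have [_ dens _] := cH; have [|y0' hy] := dens y (y * s); first by rewrite mulf_neq0.
have {}hy : (y - j y0') / y \in vmax wH.
  have -> : (y - j y0') / y = (y - j y0') / (y * s) * s by field; rewrite s0 y0.
  by rewrite vmaxM.
have [N [jN [e' [gT [act [gal jNe inN cop _]]]]]] := tow [:: y0'].
have [y1 y1E] := inN _ (mem_head _ _).
have [|u uE] := @place_restrict_alg N L jN w.
  by move=> x; apply: (@algebraic_up _ _ _ e jN) (algL x) => z; exists (e' z); exact: jNe.
have jNE x : jN (e' x) = e x by exact: jNe.
have [||||a [a0 asa]] := @decomposition_root F K N e' gT act u gal p _ cop _ _ y1 t t0.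
- by rewrite (fmorph_pchar (in_alg N)).
- by move=> x; exact: (arch jN).
- move=> x; have [h1 _] := @algebraic_map K N L e' jN x; apply: h1; apply: (algebraic_eq _ (algL _)) => z; symmetry; exact: jNE.
- have [jw _ _] := cH.
  have mj z : (z \in vmax u) = (j (jN z) \in vmax wH).
    by rewrite !inE jw uE !fmorph_eq0 -!fmorphV jw uE.
  rewrite mj fmorph_div rmorphB rmorphXn /= fmorph_div rmorphB rmorphXn /= jNE y1E -yt.
  have := pFrobenius_autB_comm pH (mulrC y (j y0')); rewrite !pFrobenius_autE => <-.
  rewrite -exprVn -exprMn; case: (p) p1 => // p' _; exact: vmaxX.
apply: (nt a a0); case: asa => h1 h2.
by split; rewrite -ew fmorph_div rmorphXn /= -!jNE -rmorphXn -fmorph_div uE.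
Qed.
End NoRoot.

(** * MacLane's separability criterion *)

Lemma msize_bound (K : nzRingType) n (h : {mpoly K[n]}) N :
  (forall m, h@_m != 0 -> (mdeg m < N)%N) -> (msize h <= N)%N.
Proof.
move=> hm; rewrite msizeE big_seq; apply: (big_ind (fun x => (x <= N)%N)) => // [x y hx hy|m].
  by rewrite geq_max hx.
by rewrite mcoeff_msupp => /hm.
Qed.

Lemma msize_deriv (K : nzRingType) n (h : {mpoly K[n]}) i : h != 0 -> (msize (mderiv i h) < msize h)%N.
Proof.
move=> h0; have hp : (0 < msize h)%N by rewrite lt0n msize_poly_eq0.
rewrite -(prednK hp) ltnS; apply: msize_bound => m; rewrite mcoeff_deriv => hm.
have : (m + U_(i))%MM \in msupp h by rewrite mcoeff_msupp; apply: contraNneq hm => ->; rewrite mul0rn.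
by move/msize_mdeg_lt; rewrite mdegD mdeg1 addn1 -{1}(prednK hp) ltnS.
Qed.

Section MacLane.
Variables (p : nat) (K H : fieldType) (i : {rmorphism K -> H}) (t : K).
Hypothesis pK : p \in [pchar K].
Hypothesis basis : forall x, exists c : 'I_p -> K, x = \sum_(j < p) t ^+ j * c j ^+ p.
Hypothesis nt : forall y, y ^+ p != i t.

Let p1 : (1 < p)%N. Proof. exact: prime_gt1 (pcharf_prime pK). Qed.

(** In a nonzero relation h of least degree, if all derivatives vanish at s they are zero, so the
    exponents are divisible by p. Writing the coefficients through powers of t and p-th powers gives
    h(s) as the sum of the t^j g_j(s)^p; independence makes each g_j a relation of smaller degree,
    so all g_j are zero, and h with them. *)
Lemma maclane_relation n (s : 'I_n -> H) (h : {mpoly K[n]}) : h != 0 -> mmap i s h = 0 ->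
  exists (g : {mpoly K[n]}) i0, mmap i s g = 0 /\ mmap i s (mderiv i0 g) != 0.
Proof.
move=> h0 hs; pose P N := `[< exists h : {mpoly K[n]}, [/\ h != 0, mmap i s h = 0 & msize h = N] >].
have exP : exists N, P N by exists (msize h); apply/asboolP; exists h.
case: (ex_minnP exP) => N /asboolP[{hs h0}{}h [h0 hs sh]] minN.
have small g : mmap i s g = 0 -> (msize g < N)%N -> g = 0.
  move=> gs lt; apply/eqP; apply: contraLR lt => g0; rewrite -leqNgt minN //.
  by apply/asboolP; exists g.
apply: contrapT => no.
have dh i0 : mderiv i0 h = 0.
  apply: small; last by rewrite -sh msize_deriv.
  by apply/eqP; apply: contrapT => /negP h1; apply: no; exists h, i0.
have dvd m j : m \in msupp h -> (p %| m j)%N.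
  move=> mh; case E : (m j) => [|l]; first exact: dvdn0.
  have mU : (m - U_(j) + U_(j))%MM = m.
    by rewrite submK //; apply/mnm_lepP => a; rewrite mnm1E; case: eqP => // <-; rewrite E.
  have := mcoeff_deriv j (m - U_(j)) h; rewrite dh mcoeff0 mU mnmBE mnm1E eqxx E subn1 /=.
  move/esym/eqP; rewrite -mulr_natr mulf_eq0 -(dvdn_pcharf pK) => /orP[|//].
  by move: mh; rewrite mcoeff_msupp => /negPf->.
have sh2 : (1 < N)%N.
  rewrite ltnNge -sh; apply/negP => /msize1_polyC hc; move: hs h0; rewrite hc mmapC.
  by move/eqP; rewrite fmorph_eq0 => /eqP ->; rewrite mpolyC0 eqxx.
have /choice[c cE] := basis.
pose hp (m : 'X_{1..n}) : 'X_{1..n} := [multinom (m k %/ p)%N | k < n].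
have hpinj m m' : m \in msupp h -> m' \in msupp h -> hp m = hp m' -> m = m'.
  move=> mh mh' /mnmP e; apply/mnmP => k; have := e k; rewrite !mnmE => ek.
  by rewrite -(divnK (dvd m k mh)) ek divnK // dvd.
pose g j : {mpoly K[n]} := \sum_(m <- msupp h) c h@_m j *: 'X_[hp m].
have pH : p \in [pchar H] by rewrite (fmorph_pchar i).
have rel : \sum_(j < p) i t ^+ j * mmap i s (g j) ^+ p = 0.
  rewrite -[RHS]hs [in RHS](mpolyE h) rmorph_sum /=.
  transitivity (\sum_(j < p) \sum_(m <- msupp h) i t ^+ j * i (c h@_m j) ^+ p * mmap1 s m).
    apply: eq_bigr => j _; rewrite rmorph_sum /= (frobenius_sum pH) mulr_sumr big_seq [RHS]big_seq.
    apply: eq_bigr => m mh; rewrite mmapZ mmapX exprMn -mulrA; congr (_ * (_ * _)).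
    rewrite /mmap1 -prodrXl; apply: eq_bigr => k _.
    by rewrite mnmE -exprM divnK // dvd.
  rewrite exchange_big; apply: eq_bigr => m _; rewrite mmapZ mmapX -mulr_suml; congr (_ * _).
  rewrite [in RHS](cE h@_m) rmorph_sum; apply: eq_bigr => j _.
  by rewrite rmorphM !rmorphXn.
have gs j := powers_indep pH nt rel j.
have g0 j : g j = 0.
  apply: small (gs j) _; apply: leq_ltn_trans (_ : N.-1 < N)%N; last by rewrite prednK // ltnW.
  apply: msize_bound => m; rewrite raddf_sum /= => hm.
  have [m' mh ->] : exists2 m', m' \in msupp h & m = hp m'.
    apply: contrapT => nm; case/eqP: hm; rewrite big_seq big1 // => m' mh.
    rewrite mcoeffZ mcoeffX; case: eqP => [e|_]; last by rewrite mulr0.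
    by case: nm; exists m'.
  have le : (mdeg (hp m') * 2 <= mdeg m')%N.
    rewrite !mdegE big_distrl /=; apply: leq_sum => k _; rewrite mnmE.
    by apply: leq_trans (leq_trunc_div (m' k) p); rewrite leq_mul2l p1 orbT.
  have lt := msize_mdeg_lt mh; rewrite sh in lt.
  have [e|e] := posnP (mdeg (hp m')); first by rewrite e -subn1 subn_gt0.
  rewrite -ltnS prednK ?(ltnW sh2) //; apply: leq_trans lt; rewrite ltnS; apply: leq_trans le.
  by rewrite muln2 -addnn -[X in (X < _)%N]addn0 ltn_add2l.
have [m0 mh0] : exists m0, m0 \in msupp h.
  case E : (msupp h) => [|m0 r]; last by exists m0; rewrite mem_head.
  by move/eqP: E; rewrite msupp_eq0 (negPf h0).
move: (mh0); rewrite mcoeff_msupp => /eqP[].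
rewrite (cE h@_m0) big1 // => j _.
have := congr1 (fun q : {mpoly K[n]} => q@_(hp m0)) (g0 j); rewrite mcoeff0 raddf_sum /=.
rewrite (bigD1_seq m0) ?msupp_uniq //= big_seq_cond big1 => [|m /andP[mh mm0]].
  rewrite mcoeffZ mcoeffX eqxx mulr1 addr0 => ->.
  by rewrite expr0n gtn_eqF ?mulr0 // ltnW.
rewrite mcoeffZ mcoeffX; case: eqP => [/hpinj e|_]; last by rewrite mulr0.
by rewrite e ?eqxx // in mm0.
Qed.
End MacLane.

Section GeneratedRing.
Variables (K H : fieldType) (i : {rmorphism K -> H}).

Definition gen n (s : 'I_n -> H) : {pred H} := [pred x | `[< exists h : {mpoly K[n]}, x = mmap i s h >]].

Lemma genP n (s : 'I_n -> H) x : reflect (exists h : {mpoly K[n]}, x = mmap i s h) (x \in gen s).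
Proof. exact: asboolP. Qed.

Lemma gen_closed n (s : 'I_n -> H) : subring_closed (gen s).
Proof.
split=> [|_ _ /genP[h ->] /genP[g ->]|_ _ /genP[h ->] /genP[g ->]]; apply/genP.
- by exists 1; rewrite rmorph1.
- by exists (h - g); rewrite rmorphB.
- by exists (h * g); rewrite rmorphM.
Qed.

Lemma gen_base n (s : 'I_n -> H) a : i a \in gen s.
Proof. by apply/genP; exists a%:MP; rewrite mmapC. Qed.

Lemma gen_var n (s : 'I_n -> H) j : s j \in gen s.
Proof. by apply/genP; exists 'X_j; rewrite mmapX mmap1U. Qed.

Lemma gen_min n (s : 'I_n -> H) (P : {pred H}) : subring_closed P -> (forall a, i a \in P) ->
  (forall j, s j \in P) -> {subset gen s <= P}.
Proof.
move=> cP iP sP _ /genP[h ->]; have [[P0 P1 PN] [PD PM]] := subring_closedD cP.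
rewrite /mmap; apply: (big_ind (fun x => x \in P)) => // m _; apply: (PM) => //.
apply: (big_ind (fun x => x \in P)) => // j _.
by elim: (m j) => [|l IH]; rewrite ?expr0 // exprS PM.
Qed.

(* h as a polynomial in the variable i0, the other variables being evaluated *)
Definition one_var n (s : 'I_n -> H) (i0 : 'I_n) : {mpoly K[n]} -> {poly H} :=
  mmap (polyC \o i) (fun j => if j == i0 then 'X else (s j)%:P).

Let one_var1 n (s : 'I_n -> H) i0 m :
  mmap1 (fun j => if j == i0 then 'X else (s j)%:P) m = (\prod_(j | j != i0) s j ^+ m j)%:P * 'X^(m i0).
Proof.
rewrite /mmap1 (bigD1 i0) //= eqxx mulrC rmorph_prod; congr (_ * _).
by apply: eq_bigr => j /negPf ->; rewrite rmorphXn.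
Qed.

Lemma one_var_eval n (s : 'I_n -> H) i0 h : (one_var s i0 h).[s i0] = mmap i s h.
Proof.
rewrite /one_var /mmap horner_sum; apply: eq_bigr => m _; rewrite one_var1 /= mulrA -polyCM hornerM hornerC hornerXn -mulrA; congr (_ * _).
by rewrite /mmap1 [RHS](bigD1 i0) //= mulrC.
Qed.

Lemma one_var_deriv n (s : 'I_n -> H) i0 h : (one_var s i0 h)^`() = one_var s i0 (mderiv i0 h).
Proof.
rewrite [h]mpolyE [mderiv _ _]raddf_sum /one_var !rmorph_sum /= [LHS]raddf_sum; apply: eq_bigr => m _.
rewrite mderivZ mderivX !mmapZ !mmapX !one_var1 /= [X in X^`()]mulrA -[X in (X * _)^`()]polyCM.
rewrite [X in X^`()]mul_polyC derivZ derivXn -[LHS]mul_polyC.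
have [->|n0] := posnP (m i0); first by rewrite mulr0n !rmorph0 mulr0 mul0r mulr0.
rewrite mnmBE mnm1E eqxx subn1 -[_ *+ m i0]mulr_natl rmorph_nat polyC_natr polyCM.
have -> : \prod_(j | j != i0) s j ^+ (m - U_(i0))%MM j = \prod_(j | j != i0) s j ^+ m j.
  by apply: eq_bigr => j ji; rewrite mnmBE mnm1E eq_sym (negPf ji) subn0.
by ring.
Qed.

Lemma one_var_coef n (s : 'I_n.+1 -> H) i0 h j : (one_var s i0 h)`_j \in gen (fun l => s (lift i0 l)).
Proof.
set P := gen _; have [[P0 P1 PN] [PD PM]] := subring_closedD (gen_closed (fun l => s (lift i0 l))).
rewrite /one_var /mmap coef_sum; apply: (big_ind (fun x => x \in P)) => // m _.
rewrite one_var1 /= mulrA -polyCM coefCM coefXn; apply: (PM); last by case: eqP.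
apply: (PM); first exact: gen_base.
apply: (big_ind (fun x => x \in P)) => // l li; have [l' ->|e] := unliftP i0 l; last by rewrite e eqxx in li.
elim: (m _) => [|a IH]; rewrite ?expr0 // exprS PM //; exact: (gen_var (fun l => s (lift i0 l))).
Qed.

Lemma gen_adjoin n (s : 'I_n.+1 -> H) i0 x : x \in gen s ->
  exists r : {poly H}, (forall j, r`_j \in gen (fun l => s (lift i0 l))) /\ x = r.[s i0].
Proof. by move=> /genP[h ->]; exists (one_var s i0 h); rewrite one_var_eval; split=> // j; exact: one_var_coef. Qed.

Let muni_mwiden n (g : {mpoly K[n]}) : muni (mwiden g) = g%:P.
Proof.
rewrite [g]mpolyE [mwiden _]raddf_sum !raddf_sum /=; apply: eq_bigr => m _.
rewrite mwidenZ mwidenX muniZ -mul_polyC -mul_mpolyC polyCM; congr (_ * _).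
rewrite muniE msuppX big_seq1 mcoeffX eqxx scale1r mnmwiden_ordmax -mul_polyC mulr1; congr (_%:P).
by congr 'X_[_]; apply/mnmP => j; rewrite mnmE mnmwiden_widen.
Qed.

(** The coefficients of r are lifted to polynomials in the other variables; [muni] recovers them,
    which shows that the relation obtained is nonzero. *)
Lemma dependent_relation n (s : 'I_n.+1 -> H) (r : {poly H}) : r != 0 ->
  (forall j, r`_j \in gen (fun l => s (lift ord_max l))) -> r.[s ord_max] = 0 ->
  exists h : {mpoly K[n.+1]}, h != 0 /\ mmap i s h = 0.
Proof.
move=> r0 rg rs; have /choice[g gE] : forall j, exists h : {mpoly K[n]}, r`_j = mmap i (fun l => s (lift ord_max l)) h.
  by move=> j; exact/genP/rg.
pose h : {mpoly K[n.+1]} := \sum_(j < size r) mwiden (g j) * 'X_ord_max ^+ j.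
have wE (q : {mpoly K[n]}) : mmap i s (mwiden q) = mmap i (fun l => s (lift ord_max l)) q.
  rewrite [q]mpolyE [mwiden _]raddf_sum !rmorph_sum /=; apply: eq_bigr => m _.
  rewrite mwidenZ mwidenX !mmapZ !mmapX; congr (_ * _).
  rewrite /mmap1 big_ord_recr /= mnmwiden_ordmax expr0 mulr1; apply: eq_bigr => j _.
  rewrite mnmwiden_widen; congr (s _ ^+ _); apply: val_inj.
  by rewrite /= /bump leqNgt ltn_ord.
exists h; split; last first.
  rewrite -rs horner_coef rmorph_sum; apply: eq_bigr => j _.
  by rewrite rmorphM rmorphXn /= wE -gE mmapX mmap1U.
apply: contraNneq r0 => h0; apply/eqP/polyP => j; rewrite coef0.
have [sj|sj] := ltnP j (size r); last by rewrite nth_default.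
have muni_max : muni ('X_ord_max : {mpoly K[n.+1]}) = 'X.
  rewrite muniE msuppX big_seq1 mcoeffX eqxx scale1r mnm1E eqxx expr1.
  have -> : [multinom (U_(ord_max))%MM (widen_ord (leqnSn n) l) | l < n] = 0%MM.
    by apply/mnmP => l; rewrite mnmE mnm0E mnm1E -val_eqE /= gtn_eqF.
  by rewrite mpolyX0 scale1r.
have mh : muni h = \poly_(l < size r) g l.
  rewrite poly_def /h raddf_sum; apply: eq_bigr => l _.
  by rewrite /= rmorphM rmorphXn /= muni_mwiden muni_max mul_polyC.
have := congr1 (fun q : {poly {mpoly K[n]}} => q`_j) mh.
by rewrite h0 raddf0 coef0 coef_poly sj gE => <-; rewrite rmorph0.
Qed.
End GeneratedRing.

(** * Approximation of finitely generated subrings *)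

Section Contraction.
Variables (K M : fieldType) (i : {rmorphism K -> M}) (v : place K) (w : place M).
Hypotheses (iv : forall x, (i x \in w) = (x \in v)) (cof : cofinal i w) (arch : archimedean v).
Hypothesis complete : forall u, v_cauchy w u -> exists x, v_cvg w u x.

Lemma horner_lipschitz (P : {poly M}) x y : (forall l, P`_l \in w) -> x \in w -> y \in w ->
  exists q, q \in w /\ P.[x] - P.[y] = (x - y) * q.
Proof.
move=> wP wx wy; exists (\sum_(l < size P) P`_l * \sum_(a < l) x ^+ (l.-1 - a) * y ^+ a); split.
  by apply: place_sum => l _; apply: placeM => //; apply: place_sum => a _; apply: placeM; exact: placeX.
rewrite !horner_coef -sumrB mulr_sumr; apply: eq_bigr => l _.
by rewrite -mulrBr subrXX mulrCA.
Qed.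

(** The map u -> al + i pi P(u) preserves the ring of w and contracts by pi, so its iterates from 0
    converge to a fixed point. *)
Lemma contraction pi al (P : {poly M}) : pi \in vmax v -> pi != 0 -> al \in w -> (forall l, P`_l \in w) ->
  exists u, u \in w /\ u = al + i pi * P.[u].
Proof.
move=> mpi pi0 wal wP; pose g u := al + i pi * P.[u].
have wpi : i pi \in w by rewrite iv vmax_place.
have wPu u : u \in w -> P.[u] \in w.
  by move=> wu; rewrite horner_coef; apply: place_sum => l _; apply: placeM => //; exact: placeX.
pose un n := iter n g 0.
have wun n : un n \in w.
  elim: n => [|n IH]; first exact: place0.
  by rewrite /un iterS; apply: placeD => //; apply: placeM => //; exact: wPu.
have gE x y : g x - g y = i pi * (P.[x] - P.[y]) by rewrite /g; ring.
have pn0 n : i pi ^+ n != 0 by rewrite expf_neq0 // fmorph_eq0.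
have step n : (un n.+1 - un n) / i pi ^+ n \in w.
  elim: n => [|n IH]; first by rewrite expr0 divr1 placeB.
  have [q [wq qE]] := horner_lipschitz wP (wun n.+1) (wun n).
  have -> : (un n.+2 - un n.+1) / i pi ^+ n.+1 = ((un n.+1 - un n) / i pi ^+ n) * q.
    rewrite -[un n.+2]/(g (un n.+1)) -[X in g _ - X]/(g (un n)) gE qE exprS.
    by move: (pn0 n) (pn0 1%N); rewrite expr1; move: (i pi ^+ n) (i pi) => a1 a2 h1 h2; field; rewrite h1 h2.
  exact: placeM.
have far n m : (un (n + m)%N - un n) / i pi ^+ n \in w.
  elim: m => [|m IH]; first by rewrite addn0 subrr mul0r place0.
  rewrite -(subrK (un (n + m)%N) (un _)) -addrA mulrDl placeD // addnS.
  have -> : (un (n + m).+1%N - un (n + m)%N) / i pi ^+ n = (un (n + m).+1%N - un (n + m)%N) / i pi ^+ (n + m)%N * i pi ^+ m.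
    by rewrite exprD; move: (pn0 n) (pn0 m) => h1 h2; field; rewrite h1 h2.
  by apply: placeM => //; exact: placeX.
have far2 N m n : (N <= m)%N -> (N <= n)%N -> (un m - un n) / i pi ^+ N \in w.
  move=> /subnKC <- /subnKC <-.
  have -> : un (N + (m - N))%N - un (N + (n - N))%N = (un (N + (m - N))%N - un N) - (un (N + (n - N))%N - un N) by ring.
  by rewrite mulrBl placeB.
have [u hu] : exists u, v_cvg w un u.
  apply: complete; apply: (cofinal_cauchy cof) => a a0; have [N hN] := arch mpi a0.
  exists N => m n Nm Nn; apply: (place_trans (pn0 N) (far2 N m n Nm Nn)).
  by rewrite -rmorphXn -fmorph_div iv hN.
have near a : a != 0 -> exists n, (u - un n) / i a \in w /\ (u - un n.+1) / i a \in w.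
  move=> a0; have [|N hN] := hu (i a); first by rewrite fmorph_eq0.
  by exists N; split; rewrite -opprB mulNr placeN hN.
have wu : u \in w.
  have [n [h _]] := near 1 (oner_neq0 K); move: h; rewrite rmorph1 divr1 => h.
  by rewrite -(subrK (un n) u) placeD.
exists u; split=> //; apply/eqP; rewrite -subr_eq0; apply/eqP.
apply: (cofinal_separated cof) => a a0; have [n [h1 h2]] := near a a0.
have [q [wq qE]] := horner_lipschitz wP wu (wun n).
have -> : u - (al + i pi * P.[u]) = (u - un n.+1) - i pi * ((u - un n) * q).
  by rewrite -qE -[un n.+1]/(al + i pi * P.[un n]); ring.
rewrite mulrBl placeB // -mulrA; apply: placeM => //.
by rewrite mulrAC; apply: placeM.
Qed.
End Contraction.

Section Near.
Variables (K H : fieldType) (i : {rmorphism K -> H}) (w : place H).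
Hypothesis cof : cofinal i w.

Definition near (a : K) (x y : H) := (x - y) / i a \in w.

Lemma near_refl a x : near a x x. Proof. by rewrite /near subrr mul0r place0. Qed.

Lemma nearD a x y x' y' : near a x y -> near a x' y' -> near a (x + x') (y + y').
Proof. by move=> h h'; rewrite /near opprD addrACA mulrDl placeD. Qed.

Lemma near_muln a x y n : near a x y -> near a (x *+ n) (y *+ n).
Proof. by move=> h; rewrite /near -mulrnBl -mulr_natl -mulrA placeM ?place_nat. Qed.

Lemma near_le a d x y : d != 0 -> i d / i a \in w -> near d x y -> near a x y.
Proof. by move=> d0 h h'; apply: place_trans h' h; rewrite fmorph_eq0. Qed.

Lemma tolerance (s : seq H) : (forall c, c \in s -> c != 0) ->
  exists d : K, d != 0 /\ forall c, c \in s -> i d / c \in w.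
Proof.
move=> s0; have [d [d0 hd]] := cofinal_list (map GRing.inv s) cof.
exists d; split=> // c cs; rewrite mulrC hd //; exact: map_f.
Qed.

Lemma near_mul x x' a : a != 0 -> exists d, d != 0 /\
  forall y y', near d x y -> near d x' y' -> near a (x * x') (y * y').
Proof.
move=> a0; have [d [d0 hd]] := cofinal_list [:: x; x'; i a; 1] cof.
exists (a * d); split; first exact: mulf_neq0.
move=> y y'; rewrite /near rmorphM => h h'.
apply: (place_mul_near _ _ _ _ _ _ h h'); rewrite ?fmorph_eq0 //;
  by [rewrite -[i d]mul1r hd // !inE eqxx ?orbT|rewrite hd // !inE eqxx ?orbT].
Qed.

Lemma near_sum n (u : nat -> H) b a : a != 0 -> exists d, d != 0 /\ forall u' b',
  (forall l, (l < n)%N -> near d (u l) (u' l)) -> near d b b' ->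
  near a (\sum_(l < n) u l * b ^+ l) (\sum_(l < n) u' l * b' ^+ l).
Proof.
elim: n u a => [|n IH] u a a0.
  by exists 1; rewrite oner_neq0; split=> // u' b' _ _; rewrite !big_ord0; exact: near_refl.
have [d [d0 hd]] := near_mul b (\sum_(l < n) u l.+1 * b ^+ l) a0.
have [d' [d'0 hd']] := IH (fun l => u l.+1) d d0.
have [|m [m0 hm]] := tolerance (s := [:: i a; i d; i d']).
  by move=> c; rewrite !inE => /or3P[] /eqP ->; rewrite fmorph_eq0.
exists m; split=> // u' b' hu hb.
have eS (t : nat -> H) z : \sum_(l < n.+1) t l * z ^+ l = t 0 + z * \sum_(l < n) t l.+1 * z ^+ l.
  rewrite big_ord_recl expr0 mulr1 mulr_sumr; congr (_ + _); apply: eq_bigr => l _.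
  by rewrite /= /bump add1n exprS mulrCA.
have ma : i m / i a \in w by apply: hm; rewrite !inE eqxx ?orbT.
have md : i m / i d \in w by apply: hm; rewrite !inE eqxx ?orbT.
have md' : i m / i d' \in w by apply: hm; rewrite !inE eqxx ?orbT.
rewrite !eS; apply: nearD; first by apply: (near_le m0 ma); exact: hu.
apply: hd; first exact: near_le m0 md hb.
by apply: (hd' (fun l => u' l.+1)) => [l ln|]; apply: (near_le m0 md') => //; exact: hu.
Qed.

Lemma near_horner (q : {poly H}) b a : a != 0 -> exists d, d != 0 /\ forall (q' : {poly H}) b',
  (size q' <= size q)%N -> (forall l, near d q`_l q'`_l) -> near d b b' -> near a q.[b] q'.[b'].
Proof.
move=> a0; have [d [d0 hd]] := near_sum (size q) (fun l => q`_l) b a0.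
exists d; split=> // q' b' sq hq hb.
by rewrite horner_coef (horner_coef_wide _ sq); apply: hd.
Qed.

(** Divided derivatives appear because the Taylor expansion is used in characteristic p; one
    tolerance d is chosen for all orders. *)
Lemma near_nderiv (q : {poly H}) b a : a != 0 -> exists d, d != 0 /\ forall (q' : {poly H}) b' n,
  (size q' <= size q)%N -> (forall l, near d q`_l q'`_l) -> near d b b' ->
  (n < size q)%N -> near a q^`N(n).[b] q'^`N(n).[b'].
Proof.
move=> a0; have /choice[D DP] : forall n, exists d, d != 0 /\ forall (q' : {poly H}) b',
  (size q' <= size q)%N -> (forall l, near d q`_l q'`_l) -> near d b b' ->
  near a q^`N(n).[b] q'^`N(n).[b'].
  move=> n; have [d [d0 hd]] := near_sum (size q) (fun l => q^`N(n)`_l) b a0.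
  exists d; split=> // q' b' sq hq hb.
  have sz (r : {poly H}) : (size r <= size q)%N -> (size r^`N(n) <= size q)%N.
    move=> sr; apply: leq_trans sr; apply/leq_sizeP => l sl.
    by rewrite coef_nderivn nth_default ?mul0rn // (leq_trans sl) // leq_addl.
  rewrite !(horner_coef_wide (n := size q)) ?sz //; apply: hd => // l _.
  by rewrite !coef_nderivn; exact: near_muln.
have [|m [m0 hm]] := tolerance (s := [seq i (D l) | l <- iota 0 (size q)]).
  by move=> _ /mapP[l _ ->]; rewrite fmorph_eq0; case: (DP l).
exists m; split=> // q' b' n sq hq hb nq; have [D0 hD] := DP n.
have mD : i m / i (D n) \in w by apply: hm; apply: map_f; rewrite mem_iota.
by apply: hD => // [l|]; apply: (near_le m0 mD).
Qed.
End Near.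

Section Approximation.
Variables (F : fieldType) (K L H : fieldAlgType F) (i : {lrmorphism K -> H}) (j : {lrmorphism L -> H}).
Variables (v : place K) (w : place H).
Hypotheses (arch : archimedean v) (iv : forall x, (i x \in w) = (x \in v)) (cof : cofinal i w).
Hypothesis dens : forall x c : H, c != 0 -> exists y, (x - j y) / c \in w.
Variable good : forall M : fieldAlgType F, {lrmorphism M -> H} -> Prop.
Hypothesis good_ex : forall G : seq L, exists (M : fieldAlgType F) (psi : {lrmorphism M -> H}),
  good psi /\ forall x, x \in G -> exists y, psi y = j x.
Hypothesis good_spec : forall (M : fieldAlgType F) (psi : {lrmorphism M -> H}), good psi ->
  exists (wM : place M) (kM : {lrmorphism K -> M}),
  [/\ forall x, (psi x \in w) = (x \in wM), forall x, psi (kM x) = i x &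
      forall u, v_cauchy wM u -> exists x, v_cvg wM u x].

(** The ring S, mapped to H, can be moved into a good field M by morphisms over K that displace the
    elements of T by less than a. The list G is carried along because M has to contain the
    approximants from L chosen for further generators. *)
Definition approximable (S : comNzRingType) (io : {rmorphism S -> H}) :=
  forall (T : seq S) (a : K) (G : seq L), a != 0 ->
  exists (M : fieldAlgType F) (psi : {lrmorphism M -> H}) (phi : {rmorphism S -> M}),
  [/\ good psi, forall x, x \in G -> exists y, psi y = j x,
      forall x b, io x = i b -> psi (phi x) = i b &
      forall x, x \in T -> near i w a (io x) (psi (phi x))].

Lemma approximable_base (S : comNzRingType) (io : {rmorphism S -> H}) :
  (forall x, exists b, io x = i b) -> approximable io.
Proof.
move=> h T a G a0; have [M [psi [gpsi inG]]] := good_ex G.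
have [wM [kM [_ kE _]]] := good_spec gpsi.
have /choice[f fE] := h.
have [|x y|x y|phi phiE] := @build_rmorph S M (fun x => kM (f x)).
- by apply: (fmorph_inj psi); rewrite /= kE -fE !rmorph1.
- by apply: (fmorph_inj psi); rewrite rmorphD /= !kE -!fE rmorphD.
- by apply: (fmorph_inj psi); rewrite rmorphM /= !kE -!fE rmorphM.
have pE x : psi (phi x) = io x by rewrite phiE kE -fE.
exists M, psi, phi; split=> // [x b|x _]; rewrite pE //; exact: near_refl.
Qed.

Section Step.
Variables (S S' : comNzRingType) (io : {rmorphism S -> H}) (io' : {rmorphism S' -> H}) (b : H).
Hypotheses (inj : injective io) (inj' : injective io') (ap : approximable io).
Hypothesis gen' : forall x, exists r : {poly S}, io' x = (map_poly io r).[b].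

(** A morphism on S[b] is given by phi and an image b' that satisfies all relations of b; its values
    stay close to the original ones because evaluation of polynomials is continuous. *)
Lemma approximable_adjoin :
  (forall (a : K) (T : seq S) (G : seq L), a != 0 ->
    exists (M : fieldAlgType F) (psi : {lrmorphism M -> H}) (phi : {rmorphism S -> M}) (b' : M),
    [/\ good psi, forall x, x \in G -> exists y, psi y = j x,
      forall x c, io x = i c -> psi (phi x) = i c,
      forall x, x \in T -> near i w a (io x) (psi (phi x)) &
      near i w a b (psi b') /\
      forall r : {poly S}, (map_poly io r).[b] = 0 -> (map_poly phi r).[b'] = 0]) ->
  (forall c, exists x, io x = i c) ->
  approximable io'.
Proof.
move=> h base T a G a0; have /choice[r rE] := gen'.
have [d [d0 hd]] : exists d, d != 0 /\ forall x, x \in T -> forall (q' : {poly H}) b',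
    (size q' <= size (map_poly io (r x)))%N -> (forall l, near i w d (map_poly io (r x))`_l q'`_l) ->
    near i w d b b' -> near i w a (map_poly io (r x)).[b] q'.[b'].
  elim: T => [|x T [d [d0 hd]]]; first by exists 1; rewrite oner_neq0.
  have [d' [d'0 hd']] := near_horner cof (map_poly io (r x)) b a0.
  have [|m [m0 hm]] := tolerance cof (s := [:: i d; i d']).
    by move=> c; rewrite !inE => /orP[] /eqP ->; rewrite fmorph_eq0.
  have md : i m / i d \in w by apply: hm; rewrite !inE eqxx ?orbT.
  have md' : i m / i d' \in w by apply: hm; rewrite !inE eqxx ?orbT.
  exists m; split=> // y; rewrite inE => /orP[/eqP->|yT] q' b' sq hq hb.
    by apply: hd' => // [l|]; exact: (near_le m0 md').
  by apply: hd => // [l|]; exact: (near_le m0 md).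
have [M [psi [phi [b' [gpsi inG kE nT [nb ker]]]]]] := h d (flatten [seq polyseq (r x) | x <- T]) G d0.
pose ev (q : {poly S}) := (map_poly phi q).[b'].
have evE x (q : {poly S}) : io' x = (map_poly io q).[b] -> ev (r x) = ev q.
  move=> e; apply/eqP; rewrite -subr_eq0; apply/eqP.
  rewrite /ev -hornerN -hornerD -rmorphB; apply: ker.
  by rewrite rmorphB hornerD hornerN -rE -e subrr.
have [|x y|x y|f fE] := @build_rmorph S' M (fun x => ev (r x)).
- rewrite (evE 1 1); first by rewrite /ev rmorph1 hornerC.
  by rewrite !rmorph1 hornerC.
- rewrite (evE (x + y) (r x + r y)); first by rewrite /ev rmorphD hornerD.
  by rewrite !rmorphD hornerD -!rE.
- rewrite (evE (x * y) (r x * r y)); first by rewrite /ev rmorphM hornerM.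
  by rewrite !rmorphM hornerM -!rE.
exists M, psi, f; split=> // [x c xc|x xT].
  have [y yE] := base c.
  rewrite fE (evE x y%:P); last by rewrite map_polyC hornerC /= yE.
  by rewrite /ev map_polyC hornerC /=; exact: kE.
rewrite fE rE -horner_map /= -map_poly_comp; apply: hd => //.
  by rewrite (size_map_inj_poly inj (rmorph0 _)); exact: size_poly.
move=> l; rewrite !coef_map /=; have [sl|sl] := ltnP l (size (r x)).
  by apply: nT; apply/flattenP; exists (r x : seq S); [exact: (map_f (fun x => polyseq (r x)))|exact: mem_nth].
by rewrite nth_default // !rmorph0; exact: near_refl.
Qed.

Lemma approximable_transcendental : (forall c, exists x, io x = i c) ->
  (forall r : {poly S}, (map_poly io r).[b] = 0 -> r = 0) -> approximable io'.
Proof.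
move=> base tr; apply: approximable_adjoin => // a T G a0.
have [|b0 hb0] := dens b (c := i a); first by rewrite fmorph_eq0.
have [M [psi [phi [gpsi inG kE nT]]]] := ap T (b0 :: G) a0.
have [b' b'E] := inG b0 (mem_head _ _).
exists M, psi, phi, b'; split=> // [x xG|].
  by apply: inG; rewrite inE xG orbT.
split=> [|r /tr ->]; last by rewrite rmorph0 horner0.
by rewrite b'E.
Qed.

(** S is not a field, so a relation of least degree divides the others only up to powers of its
    leading coefficient, whose image will have to be kept nonzero. *)
Lemma pseudo_division (m r : {poly S}) : m != 0 ->
  (forall q : {poly S}, (map_poly io q).[b] = 0 -> q != 0 -> (size m <= size q)%N) ->
  (map_poly io m).[b] = 0 -> (map_poly io r).[b] = 0 ->
  exists n q, lead_coef m ^+ n *: r = q * m.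
Proof.
move=> m0 minm mb rb; exists (Pdiv.Ring.rscalp r m), (Pdiv.Ring.rdivp r m).
have e := Pdiv.ComRing.rdivp_eq m r.
have rmb : (map_poly io (Pdiv.Ring.rmodp r m)).[b] = 0.
  have := congr1 (fun q : {poly S} => (map_poly io q).[b]) e.
  rewrite rmorphD rmorphM hornerD hornerM mb mulr0 add0r => <-.
  by rewrite -mul_polyC rmorphM hornerM rb mulr0.
rewrite e -[RHS]addr0; congr (_ + _); apply/eqP; apply: contraT => r0.
by have := minm _ rmb r0; rewrite leqNgt Pdiv.Ring.ltn_rmodp m0.
Qed.

(** Newton's method at an approximate root. Under phi the least relation m of b becomes g, and an
    element of L near b is almost a root of g, with a derivative of the same value as that of m at
    b; a true root b' near it is found in the complete field M. *)
Lemma approximable_separable (f : {poly S}) : (forall c, exists x, io x = i c) ->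
  (map_poly io f).[b] = 0 -> (map_poly io f^`()).[b] != 0 -> approximable io'.
Proof.
move=> base fb f'b.
have f0 : f != 0 by apply: contraNneq f'b => ->; rewrite deriv0 rmorph0 horner0.
pose P N := `[< exists q : {poly S}, [/\ q != 0, (map_poly io q).[b] = 0 & size q = N] >].
have exP : exists N, P N by exists (size f); apply/asboolP; exists f.
case: (ex_minnP exP) => N /asboolP[m [m0 mb sm]] minN.
have minm (q : {poly S}) : (map_poly io q).[b] = 0 -> q != 0 -> (size m <= size q)%N.
  by move=> qb q0; rewrite sm; apply: minN; apply/asboolP; exists q.
have pd r := pseudo_division m0 minm mb (r := r).
(* b is a simple root of m, since m divides f up to a power of its leading coefficient and the
   derivative of f does not vanish at b. *)
have m'b : (map_poly io m^`()).[b] != 0.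
  apply: contraNneq f'b => m'b; have [n [q qE]] := pd f fb.
  have lm0 : io (lead_coef m) ^+ n != 0.
    by rewrite expf_neq0 // -(rmorph0 io) (inj_eq inj) lead_coef_eq0.
  have := congr1 (fun q : {poly S} => (map_poly io q^`()).[b]) qE.
  rewrite derivZ derivM -mul_polyC !(rmorphM, rmorphD) !(hornerM, hornerD) /= mb m'b !mulr0 addr0.
  rewrite map_polyC hornerC /= (rmorphXn io) => /eqP; by rewrite mulf_eq0 (negPf lm0).
apply: approximable_adjoin => // a T G a0.
pose q := map_poly io m; have sq : size q = size m by exact: (size_map_inj_poly inj (rmorph0 _)).
pose D0 := q^`N(1).[b].
have D0n : D0 != 0 by rewrite /D0 poly.nderivn1 /q deriv_map.
have [pi [mpi pi0]] := uniformizer v.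
have ipi0 : i pi != 0 by rewrite fmorph_eq0.
have wpi : i pi \in w by rewrite iv vmax_place.
have mipi : i pi \in vmax w by rewrite !inE iv fmorph_eq0 -fmorphV iv.
have s2 : (1 < size q)%N.
  rewrite ltnNge; apply/negP => /size1_polyC qc; case/eqP: D0n.
  by rewrite /D0 poly.nderivn1 qc derivC horner0.
have [d [d0 hd]] := cofinal_list (1 :: [seq q^`N(l).[b] | l <- iota 0 (size q)]) cof.
have wd : i d \in w by rewrite -[i d]mul1r hd ?mem_head.
have wdq l : (l < size q)%N -> q^`N(l).[b] * i d \in w.
  by move=> lq; apply: hd; rewrite inE; apply/orP; right; apply: map_f; rewrite mem_iota.
have id0 : i d != 0 by rewrite fmorph_eq0.
have ia0 : i a != 0 by rewrite fmorph_eq0.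
(* The radius in which the root is sought: integral, below a, and small enough for the terms of
   degree at least 2 to be divisible by pi relative to the linear one; d bounds the Taylor
   coefficients. *)
have [|ep [ep0 hep]] := tolerance cof (s := [:: 1; i a; i d * i pi * D0 * i pi]).
  by move=> c; rewrite !inE => /or3P[] /eqP -> //; rewrite ?oner_neq0 ?mulf_neq0.
have wep : i ep \in w by rewrite -[i ep]divr1 hep ?mem_head.
have epa : i ep / i a \in w by apply: hep; rewrite !inE eqxx ?orbT.
have epD : i ep / (i d * i pi * D0 * i pi) \in w by apply: hep; rewrite !inE eqxx ?orbT.
have iep0 : i ep != 0 by rewrite fmorph_eq0.
have lm0 : io (lead_coef m) != 0 by rewrite -(rmorph0 io) (inj_eq inj) lead_coef_eq0.
(* The error allowed on the Taylor coefficients. Its bounds yield in turn closeness within a, a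
   small constant term, a linear coefficient of the value of D0, the bound d on the other
   coefficients, and a nonzero leading coefficient. *)
have [|ta [ta0 hta]] := tolerance cof (s := [:: i a; D0 * i ep; D0 * i pi; (i d)^-1; io (lead_coef m) * i pi]).
  move=> c; rewrite !inE => /or4P[/eqP->|/eqP->|/eqP->|/orP[]/eqP->] //; rewrite ?invr_eq0 ?mulf_neq0 //.
have ta1 : i ta / i a \in w by apply: hta; rewrite !inE eqxx ?orbT.
have ta2 : i ta / (D0 * i ep) \in w by apply: hta; rewrite !inE eqxx ?orbT.
have ta3 : i ta / (D0 * i pi) \in w by apply: hta; rewrite !inE eqxx ?orbT.
have ta4 : i ta * i d \in w by rewrite -[i d]invrK hta // !inE eqxx ?orbT.
have ta5 : i ta / (io (lead_coef m) * i pi) \in w by apply: hta; rewrite !inE eqxx ?orbT.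
have [de [de0 hde]] := near_nderiv cof q b ta0.
have ita0 : i ta != 0 by rewrite fmorph_eq0.
have [|de' [de'0 hde']] := tolerance cof (s := [:: i de; i ta]).
  by move=> c; rewrite !inE => /orP[] /eqP ->; rewrite fmorph_eq0.
have dde : i de' / i de \in w by apply: hde'; rewrite !inE eqxx ?orbT.
have dta : i de' / i ta \in w by apply: hde'; rewrite !inE eqxx ?orbT.
have [|b0 hb0] := dens b (c := i de'); first by rewrite fmorph_eq0.
have [M [psi [phi [gpsi inG kE nT]]]] := ap (T ++ m) (b0 :: G) de'0.
have [b0' b0'E] := inG b0 (mem_head _ _).
have [wM [kM [psiw psik completeM]]] := good_spec gpsi.
have kv x : (kM x \in wM) = (x \in v) by rewrite -psiw psik iv.
have cofM : cofinal kM wM.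
  move=> c c0; have [|x [x0 hx]] := cof (c := psi c); first by rewrite fmorph_eq0.
  by exists x; split=> //; rewrite -psiw fmorph_div /= psik.
pose g := map_poly phi m.
have nearg l : (l < size q)%N -> near i w ta q^`N(l).[b] (psi g^`N(l).[b0']).
  move=> lq; rewrite -horner_map /= b0'E -poly.nderivn_map; apply: hde => //.
  - by rewrite -map_poly_comp (leq_trans (size_poly _ _)) // sq.
  - move=> l'; rewrite -map_poly_comp !coef_map /=; have [sl|sl] := ltnP l' (size m).
      by apply: (near_le de'0 dde); apply: nT; rewrite mem_cat mem_nth ?orbT.
    by rewrite nth_default // !rmorph0; exact: near_refl.
  - exact: (near_le de'0 dde).
pose c l := g^`N(l).[b0'].
have c0w : psi (c 0) / (D0 * i ep) \in w.
  have := nearg 0 (ltnW s2); rewrite poly.nderivn0 -/q mb.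
  rewrite /near sub0r mulNr placeN => h; exact: (place_trans ita0 h ta2).
have [c1n asc1] : psi (c 1%N) != 0 /\ associate w D0 (psi (c 1%N)).
  apply: associate_near => //; have h := place_trans ita0 (nearg 1%N s2) ta3.
  have -> : (D0 - psi (c 1%N)) / D0 = (D0 - psi (c 1%N)) / (D0 * i pi) * i pi by field; rewrite D0n ipi0.
  by rewrite vmaxM.
have cw l : (l < size q)%N -> psi (c l) * i d \in w.
  move=> lq; have h := placeM (nearg l lq) ta4.
  have -> : psi (c l) * i d = q^`N(l).[b] * i d - ((q^`N(l).[b] - psi (c l)) / i ta) * (i ta * i d).
    by field.
  by rewrite placeB ?wdq.
have c1n' : c 1%N != 0 by apply: contraNneq c1n => ->; rewrite rmorph0.
have kep0 : kM ep != 0 by rewrite fmorph_eq0.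
have kpi0 : kM pi != 0 by rewrite fmorph_eq0.
(* With b' = b0' + ep u, Taylor's formula divided by the linear coefficient times ep turns g(b') = 0
   into the fixed point equation u = al + pi Q(u). *)
pose al := - (c 0 / (c 1%N * kM ep)).
pose Q : {poly M} := \poly_(l < size q) (if (1 < l)%N then - (c l * kM ep ^+ l.-1 / (c 1%N * kM pi)) else 0).
have wal : al \in wM.
  rewrite /al placeN -psiw fmorph_div rmorphM /= psik.
  have -> : psi (c 0) / (psi (c 1%N) * i ep) = (psi (c 0) / (D0 * i ep)) * (D0 / psi (c 1%N)).
    by field; rewrite c1n D0n iep0.
  by case: asc1 => h _; apply: placeM.
have wQ l : Q`_l \in wM.
  rewrite coef_poly; case: ifP => lq; last exact: place0.
  case: ifP => l1; last exact: place0.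
  rewrite placeN -psiw fmorph_div !rmorphM rmorphXn /= !psik.
  have -> : psi (c l) * i ep ^+ l.-1 / (psi (c 1%N) * i pi) =
     (psi (c l) * i d) * (i ep / (i d * i pi * D0 * i pi) * i pi) * (D0 / psi (c 1%N)) * i ep ^+ l.-2.
    have -> : i ep ^+ l.-1 = i ep * i ep ^+ l.-2 by rewrite -exprS prednK // -subn1 subn_gt0.
    by field; rewrite c1n D0n ipi0 id0.
  by case: asc1 => h _; apply: placeM; [apply: placeM => //; apply: placeM; [exact: cw|exact: placeM]|exact: placeX].
have [u [wu uE]] := contraction kv cofM arch completeM mpi pi0 wal wQ.
pose b' := b0' + kM ep * u.
have gb' : g.[b'] = 0.
  rewrite /b' (nderiv_taylor_wide (n := size q)); last 2 first.
  - exact: mulrC.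
  - by rewrite sq; exact: size_poly.
  have [N' NE] : exists N', size q = N'.+2 by case: (size q) s2 => [|[|N']] // _; exists N'.
  move: uE; rewrite (horner_coef_wide (n := size q)) ?size_poly // NE !big_ord_recl /=.
  have c1k : c 1%N * kM ep != 0 by rewrite mulf_neq0.
  rewrite /= !coef_poly !NE /= !mul0r !add0r => uE.
  rewrite expr0 mulr1 expr1 -/(c 0) -/(c 1%N).
  have -> : c 1%N * (kM ep * u) = - c 0 - \sum_(l < N') c l.+2 * (kM ep * u) ^+ l.+2.
    rewrite [in LHS]uE !mulrDr; congr (_ + _).
      by rewrite /al; field; rewrite c1n' kep0.
    rewrite !mulr_sumr -sumrN; apply: eq_bigr => l _.
    rewrite coef_poly NE /= /bump !add1n !ltnS ltn_ord /= exprMn add0n.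
    have -> : kM ep ^+ l.+2 = kM ep * kM ep ^+ l.+1 by rewrite exprS.
    by field; rewrite c1n' kpi0.
  rewrite [X in _ + (_ + X)](eq_bigr (fun l : 'I_N' => c l.+2 * (kM ep * u) ^+ l.+2)); first by rewrite subrK subrr.
  by move=> l _; rewrite /= /bump !add1n.
have dea : i de' / i a \in w by exact: (place_trans ita0 dta ta1).
have philead : phi (lead_coef m) != 0.
  have h : near i w de' (io (lead_coef m)) (psi (phi (lead_coef m))).
    apply: nT; rewrite mem_cat; apply/orP; right; apply: mem_nth.
    by rewrite prednK // lt0n size_poly_eq0.
  have ide'0 : i de' != 0 by rewrite fmorph_eq0.
  have h' := place_trans ita0 (place_trans ide'0 h dta) ta5.
  have [|n0 _ _] := @near_unit _ w (io (lead_coef m)) (psi (phi (lead_coef m))) lm0; last first.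
    by apply: contraNneq n0 => ->; rewrite rmorph0.
  set x := _ - _; have -> : x / io (lead_coef m) = x / (io (lead_coef m) * i pi) * i pi.
    by field; rewrite ipi0 lm0.
  by rewrite vmaxM.
exists M, psi, phi, b'; split=> //.
- by move=> x xG; apply: inG; rewrite inE xG orbT.
- by move=> x xT; apply: (near_le de'0 dea); apply: nT; rewrite mem_cat xT.
split.
- rewrite /near /b' rmorphD rmorphM /= psik b0'E opprD addrA mulrBl placeB //.
    exact: (near_le de'0 dea hb0).
  by rewrite mulrAC; apply: placeM => //; rewrite psiw.
- move=> r rb; have [n [q' q'E]] := pd r rb.
  have := congr1 (fun q : {poly S} => (map_poly phi q).[b']) q'E.
  rewrite rmorphM hornerM gb' mulr0 -mul_polyC rmorphM hornerM /= map_polyC hornerC /= (rmorphXn phi).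
  by move/eqP; rewrite mulf_eq0 expf_eq0 (negPf philead) andbF /= => /eqP.
Qed.
End Step.
End Approximation.

Section GeneratedApproximation.
Variables (F : fieldType) (K L H : fieldAlgType F) (i : {lrmorphism K -> H}) (j : {lrmorphism L -> H}).
Variables (v : place K) (w : place H).
Hypotheses (arch : archimedean v) (iv : forall x, (i x \in w) = (x \in v)) (cof : cofinal i w).
Hypothesis dens : forall x c : H, c != 0 -> exists y, (x - j y) / c \in w.
Variable good : forall M : fieldAlgType F, {lrmorphism M -> H} -> Prop.
Hypothesis good_ex : forall G : seq L, exists (M : fieldAlgType F) (psi : {lrmorphism M -> H}),
  good psi /\ forall x, x \in G -> exists y, psi y = j x.
Hypothesis good_spec : forall (M : fieldAlgType F) (psi : {lrmorphism M -> H}), good psi ->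
  exists (wM : place M) (kM : {lrmorphism K -> M}),
  [/\ forall x, (psi x \in w) = (x \in wM), forall x, psi (kM x) = i x &
      forall u, v_cauchy wM u -> exists x, v_cvg wM u x].
Variables (p : nat) (t : K).
Hypotheses (pK : p \in [pchar K]) (basis : forall x, exists c : 'I_p -> K, x = \sum_(j < p) t ^+ j * c j ^+ p).
Hypothesis nt : forall y, y ^+ p != i t.

(** If some variable satisfies a relation with nonzero derivative, it is adjoined last, as a simple
    root. Otherwise MacLane's criterion excludes every relation, and the last variable is
    transcendental over the others. *)
Lemma gen_approximable n (s : 'I_n -> H) (S : comNzRingType) (io : {rmorphism S -> H}) :
  injective io -> (forall x, x \in gen i s <-> exists y, io y = x) -> approximable i j w good io.
Proof.
elim: n s S io => [|n IH] s S io injio ioP.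
  apply: (approximable_base good_ex good_spec) => x.
  pose P : {pred H} := [pred x | `[< exists b, x = i b >]].
  have /asboolP // : io x \in P.
    apply: (gen_min (i := i) (s := s)) => [|a|[//]|]; last by apply/ioP; exists x.
      split=> [|_ _ /asboolP[a ->] /asboolP[b ->]|_ _ /asboolP[a ->] /asboolP[b ->]]; apply/asboolP.
      - by exists 1; rewrite rmorph1.
      - by exists (a - b); rewrite rmorphB.
      - by exists (a * b); rewrite rmorphM.
    by apply/asboolP; exists a.
have step i0 : exists (S0 : comNzRingType) (io0 : {rmorphism S0 -> H}),
    [/\ injective io0, approximable i j w good io0,
      forall r : {poly H}, (forall a, r`_a \in gen i (fun l => s (lift i0 l))) -> exists q, map_poly io0 q = r,
      forall (q : {poly S0}) a, (map_poly io0 q)`_a \in gen i (fun l => s (lift i0 l)) &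
      forall c, exists x, io0 x = i c].
  have [S0 [io0 [inj0 io0P]]] := subring_type (gen_closed i (fun l => s (lift i0 l))).
  exists S0, io0; split=> //.
  - exact: IH io0P.
  - by move=> r rg; apply: lift_poly => a; exact/io0P.
  - by move=> q a; rewrite coef_map; apply/io0P; exists q`_a.
  - by move=> c; apply/io0P; exact: gen_base.
have gen' i0 (S0 : comNzRingType) (io0 : {rmorphism S0 -> H}) :
    (forall r : {poly H}, (forall a, r`_a \in gen i (fun l => s (lift i0 l))) -> exists q, map_poly io0 q = r) ->
    forall x, exists r : {poly S0}, io x = (map_poly io0 r).[s i0].
  move=> lft x; have [|r [rg ->]] := @gen_adjoin _ _ i n s i0 (io x); first by apply/ioP; exists x.
  by have [q <-] := lft r rg; exists q.
have [[g [i0 [gs dgs]]]|no] := pselect (exists (g : {mpoly K[n.+1]}) i0, mmap i s g = 0 /\ mmap i s (mderiv i0 g) != 0).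
  have [S0 [io0 [inj0 ap0 lft inG base]]] := step i0.
  have [f fE] := lft (one_var i s i0 g) (one_var_coef i s i0 g).
  apply: (approximable_separable arch iv cof dens good_spec inj0 ap0 (gen' i0 _ _ lft) (f := f) base).
    by rewrite fE one_var_eval.
  by rewrite -deriv_map fE one_var_deriv one_var_eval.
have [S0 [io0 [inj0 ap0 lft inG base]]] := step ord_max.
apply: (approximable_transcendental cof dens inj0 ap0 (gen' ord_max _ _ lft) base) => r rs.
apply/eqP; apply: contraT => r0; case: no.
have r0' : map_poly io0 r != 0.
  by rewrite -size_poly_eq0 (size_map_inj_poly inj0 (rmorph0 _)) size_poly_eq0.
have [h [h0 hs]] := dependent_relation r0' (inG r) rs.
have h1 := @maclane_relation p K H i t pK basis nt _ s h h0 hs; exact: h1.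
Qed.
End GeneratedApproximation.

(** * Selmer groups *)

Lemma finite_extension_over (F : fieldType) (K : fieldAlgType F) :
  finite_extension K -> finite_over (in_alg K).
Proof.
move=> [s hs]; exists (size s), (fun l => s`_l) => x; have [c ->] := hs x.
by exists (fun l => c l); apply: eq_bigr => l _; rewrite /= mulr_algl.
Qed.

Lemma galois_algebraic (F : fieldType) (L : fieldAlgType F) :
  galois_extension L -> forall x : L, algebraic (in_alg L) x.
Proof.
move=> gal x; have [q [s [_ qs _ xs]]] := gal x; exists q; last by rewrite qs root_prod_XsubC.
by rewrite -(map_poly_eq0 (in_alg L)) qs monic_neq0 // monic_prod_XsubC.
Qed.

Lemma algebraic_sub (F : fieldType) (N L : fieldAlgType F) (f : {lrmorphism N -> L}) :
  (forall x : L, algebraic (in_alg L) x) -> forall x : N, algebraic (in_alg N) x.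
Proof.
move=> alg x; have [h _] := @algebraic_map F N L (in_alg N) f x; apply: h.
by apply: algebraic_eq (alg (f x)) => c /=; rewrite lrmorph_cA.
Qed.

Lemma algebraic_tower (F : fieldType) (K L : fieldAlgType F) (e : {lrmorphism K -> L}) :
  (forall x : L, algebraic (in_alg L) x) -> forall x : L, algebraic e x.
Proof.
by move=> alg x; apply: algebraic_up (alg x) => c; exists c%:A; rewrite /= lrmorph_cA.
Qed.

(** * Local conditions at the places of K and L *)

Section Local.
Variables (p : nat) (k F : fieldType) (ka : {rmorphism k -> F}) (E : ellipticCurve F).
Hypothesis cka : constants p ka.
Variables (K L : fieldAlgType F) (e : {lrmorphism K -> L}).
Hypotheses (tow : galois_tower p e) (finK : finite_over (in_alg K)).
Hypothesis algL : forall x : L, algebraic (in_alg L) x.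

Let pF : p \in [pchar F]. Proof. exact: const_char cka. Qed.

Let archN (N : fieldAlgType F) (f : {lrmorphism N -> L}) (u : place N) : archimedean u.
Proof. exact: place_archimedean cka (algebraic_sub f algL) u. Qed.

Let algE x : algebraic e x. Proof. exact: algebraic_tower. Qed.

Lemma selmer_up (X : cochains E p K) : selmer X -> selmer (res e X).
Proof.
move=> [cX sX]; split; first exact: res_is_class.
move=> w H j wH cH; have [v vE] := place_restrict_alg w algE.
have archv : archimedean v by exact: (archN e).
have [Kh [i [wK cK]]] := completion_exists archv.
have [jw dj completeH] := cH.
have cofH : cofinal (j \o e : {lrmorphism K -> H}) wH.
  by apply: (cofinal_comp jw); [exact: place_cofinal|exact: dense_cofinal].
have [c [ci _]] : exists g : {lrmorphism Kh -> H}, (forall x, g (i x) = (j \o e) x) /\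
    forall x, (g x \in wH) = (x \in wK).
  apply: (completion_map cK archv) => //.
  by move=> x; rewrite /= jw vE.
have [P [n PE]] := sX v Kh i wK cK; exists (ecmap c P), n.
rewrite (res_comp (f := (j \o e : {lrmorphism K -> H})) cX) //.
rewrite -(res_comp (e := i) (e' := c) (f := (j \o e : {lrmorphism K -> H})) cX); last by move=> x; rewrite /= ci.
have [y yE] := res_is_class i cX.
rewrite PE; apply: (@kummer_res _ _ _ _ _ _ _ _ y).
by rewrite -PE yE; exact: rt_id.
Qed.

Section Descent.
Variables (v : place K) (Kh : fieldAlgType F) (iK : {lrmorphism K -> Kh}) (wK : place Kh).
Hypothesis cK : is_completion v iK wK.
Variables (w : place L) (H : fieldAlgType F) (j : {lrmorphism L -> H}) (wH : place H).
Hypotheses (ew : forall x, (e x \in w) = (x \in v)) (cH : is_completion w j wH).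

Let i : {lrmorphism K -> H} := j \o e.

Let archv : archimedean v. Proof. exact: (archN e). Qed.
Let jw x : (j x \in wH) = (x \in w). Proof. by case: cH. Qed.
Let iv x : (i x \in wH) = (x \in v). Proof. by rewrite /= jw ew. Qed.
Let dens x c : c != 0 -> exists y, (x - j y) / c \in wH. Proof. by case: cH => _ + _; apply. Qed.
Let cofH : cofinal i wH.
Proof. by apply: (cofinal_comp jw); [exact: place_cofinal|exact: dense_cofinal]. Qed.

(** The completions of the finite levels, reduced to the properties used: completeness, for Newton's
    method, and Galois descent to Kh by a group of order prime to p. *)
Definition good (M : fieldAlgType F) (psi : {lrmorphism M -> H}) := exists (wM : place M)
  (c : {lrmorphism Kh -> M}) (D : finGroupType) (act : D -> {lrmorphism M -> M}),
  [/\ forall x, (psi x \in wH) = (x \in wM), forall x, psi (c (iK x)) = i x,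
      forall u, v_cauchy wM u -> exists x, v_cvg wM u x,
      galois_datum c act & coprime p #|D|].

Let good_ex (G : seq L) : exists (M : fieldAlgType F) (psi : {lrmorphism M -> H}),
  good psi /\ forall x, x \in G -> exists y, psi y = j x.
Proof.
have [N [jN [e' [gT [act [gal jNe inN cop _]]]]]] := tow G.
have jNE x : jN (e' x) = e x by exact: jNe.
have algN x : algebraic e' x by exact: algebraic_tower (algebraic_sub jN algL) x.
have [|u uE] := @place_restrict_alg N L jN w.
  by move=> x; apply: (@algebraic_up _ _ _ e jN) (algE x) => z; exists (e' z); exact: jNe.
have archu : archimedean u by exact: (archN jN).
have [M [iN [wM cM]]] := completion_exists archu.
have [psi [psii psiw]] : exists g : {lrmorphism M -> H}, (forall x, g (iN x) = (j \o jN) x) /\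
    forall x, (g x \in wH) = (x \in wM).
  apply: (completion_map cM archu) => //; last by case: cH.
  - by move=> x; rewrite /= jw uE.
  - by move=> c c0; have [a [a0 ha]] := cofH c0; exists (e' a); rewrite fmorph_eq0 /= jNE.
have [|||c [D [actM [galM cE copD _]]]] := @local_galois F K N e' gT act u gal p _ cop _ algN v Kh M iK wK iN wM _ archv cK cM.
- by rewrite (fmorph_pchar (in_alg N)).
- by move=> u'; exact: (archN jN).
- by move=> x; rewrite -uE /= jNE ew.
exists M, psi; split; last by move=> x xG; have [y <-] := inN x xG; exists (iN y); rewrite psii.
exists wM, c, D, actM; split=> //; last by case: cM.
by move=> x; rewrite cE psii /= jNE.
Qed.

Let good_spec (M : fieldAlgType F) (psi : {lrmorphism M -> H}) : good psi ->
  exists (wM : place M) (kM : {lrmorphism K -> M}),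
  [/\ forall x, (psi x \in wH) = (x \in wM), forall x, psi (kM x) = i x &
      forall u, v_cauchy wM u -> exists x, v_cvg wM u x].
Proof. by move=> [wM [c [D [act [h1 h2 h3 _ _]]]]]; exists wM, (c \o iK : {lrmorphism K -> M}). Qed.

Lemma finitely_generated_specialization (s : seq H) : exists (B : comAlgType F)
    (tB : {lrmorphism K -> B}) (io : {lrmorphism B -> H}) (M : fieldAlgType F)
    (psi : {lrmorphism M -> H}) (phi : {lrmorphism B -> M}),
  [/\ injective io, io \o tB =1 i, forall x, x \in s -> exists y, io y = x, good psi &
      psi \o phi \o tB =1 i].
Proof.
have algK x : algebraic (in_alg K) x by exact: (algebraic_sub e algL).
(* One t serves twice: its powers generate K over the p-th powers, and it has no p-th root in H, as
   MacLane's criterion requires. *)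
have [t [mt t0 tp]] := not_power_value cka finK v.
have nt := no_root pF tow cH ew algE archN t0 tp.
have tt : ~ algebraic (in_alg K \o ka : {rmorphism k -> K}) t by exact: (vmax_transc cka mt).
have ntK (y : K) : y ^+ p != t.
  by apply: contraNneq (nt (i y)) => <-; rewrite -rmorphXn.
have basis x := frobenius_basis cka finK tt ntK x.
have pK : p \in [pchar K] by rewrite (fmorph_pchar (in_alg K)).
pose sf (l : 'I_(size s)) := s`_l.
have [B [io [injio ioP]]] : exists (B : comAlgType F) (io : {lrmorphism B -> H}), injective io /\
    forall x, x \in gen i sf <-> exists y, io y = x.
  apply: subalgebra; first exact: gen_closed.
  by move=> c; rewrite -(lrmorph_cA i); exact: gen_base.
have [tB tBE] : exists tB : {lrmorphism K -> B}, io \o tB =1 i.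
  by apply: factor_inj injio _ => a; apply/ioP; exact: gen_base.
have ap := gen_approximable archv iv cofH dens good_ex good_spec pK basis nt injio ioP.
(* A morphism over K is all that is asked here, hence the empty lists; closeness to the inclusion
   matters inside the induction. *)
have [M [psi [phi0 [gpsi _ phiE _]]]] := ap [::] 1 [::] (oner_neq0 K).
have [phi phi0E] : exists phi : {lrmorphism B -> M}, phi =1 phi0.
  apply: rmorph_lr => c; apply: (fmorph_inj psi).
  have ic : i c%:A = c%:A by exact: (lrmorph_cA i).
  by rewrite /= (phiE c%:A c%:A) ic ?(lrmorph_cA psi) //; exact: (lrmorph_cA io).
exists B, tB, io, M, psi, phi; split=> // [x xs|x].
  apply/ioP; have -> : x = sf (Ordinal (etrans (index_mem x s) xs)) by rewrite /sf nth_index.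
  exact: gen_var.
by rewrite /= phi0E; apply: phiE; exact: tBE.
Qed.

Lemma selmer_down (x : cocycle E p K) (P : ecpoint E H) n :
  res i (cohomologous x) = kummer (p := p) P n ->
  exists (P' : ecpoint E Kh) n', res iK (cohomologous x) = kummer (p := p) P' n'.
Proof.
move=> /kummer_trivializes[C [h [Q [hC hQ]]]].
have cw := cval_cocycle x; have tw := cval_torsion x.
have [U [iU [jU tU]]] := tensor_exists (cov_str (coc_cov x)) i.
have [Q0 [hQ0 _]] := trivialization_descent cw tw hC tU hQ.
have [s hs] := trivialization_specialize p cw tU hQ0.
have [B [tB [io [M [psi [phi [injio ioB ins gpsi phiB]]]]]]] := finitely_generated_specialization s.
have [wM [c [D [act [_ ci _ gal cop]]]]] := gpsi.
pose t' : {lrmorphism K -> M} := c \o iK.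
have [U' [i' [j' tU']]] := tensor_exists (cov_str (coc_cov x)) t'.
have phit : phi \o tB =1 t'.
  by move=> a; apply: (fmorph_inj psi); rewrite -[LHS]/((psi \o phi \o tB) a) phiB /= ci.
have [Q1 [hQ1 _]] := hs B tB io M phi t' U' i' j' injio ioB ins phit tU'.
have [Q2 [hQ2 _]] := galois_trivial gal cop cw tw tU' hQ1.
have ft : finite_type (j' \o c : {lrmorphism Kh -> U'}).
  by apply: (finite_type_comp (t := j') (galois_finite_type gal)) => //; apply: (finite_type_tensor tU'); exact: cov_ft.
pose C' : cover Kh := Cover ft.
apply: (@trivial_kummer _ _ _ _ _ iK x C' i' Q2) => [y|]; last exact: hQ2.
by case: tU' => + _ _; apply.
Qed.
End Descent.
End Local.

Lemma selmer_transfer (p : nat) (k F : fieldType) (ka : {rmorphism k -> F}) (E : ellipticCurve F)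
    (K L : fieldAlgType F) (e : {lrmorphism K -> L}) :
  constants p ka -> galois_tower p e -> finite_over (in_alg K) ->
  (forall x : L, algebraic (in_alg L) x) -> selmer_res_iso E p e.
Proof.
move=> cka tow finK algL; split.
- move=> X sX; split; first exact: (@selmer_up p _ F ka E cka K L e algL X sX).
  move=> s [bs es]; have [cX _] := sX.
  by apply: res_comp cX _ => x /=; rewrite es.
- by move=> X Y [cX _] [cY _]; exact: res_add.
- move=> X Y [[x ->] _] [[y ->] _] XY; apply/class_eqP.
  have [[z zE] _] : is_class (res e (cohomologous x)) /\ True.
    by split=> //; apply: res_is_class; exists x.
  apply: (tower_injective tow (z := z)); apply: res_classP; first exact: zE.
  by rewrite -XY.
- move=> Z [[[z ->] sZ] invZ].
  have [A [q [n [beta fb]]]] := cover_free (coc_cov z).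
  have [|x xz] := tower_surjective (z := z) tow fb.
    by move=> s gs; apply: res_classP; exact: invZ.
  exists (cohomologous x); last exact: res_class.
  split; first by exists x.
  (* The Selmer condition of z is known at places of L, so v is extended to one of them. *)
  move=> v Kh iK wK cK; have [w we] := place_extend e v.
  have archw : archimedean w by exact: place_archimedean cka algL w.
  have [H [j [wH cH]]] := completion_exists archw.
  have [P [m PE]] := sZ w H j wH cH.
  apply: (selmer_down cka tow finK algL cK we cH (P := P) (n := m)).
  rewrite -PE -(res_class xz); symmetry; apply: res_comp => //.
  by exists x.
Qed.

Theorem theorem5p1
  (p : nat) (F : fieldType) (k : {pred F}) (E : ellipticCurve F)
  (l d : nat) (L : fieldAlgType F) (Fs : nat -> fieldAlgType F)
  (e : forall n, {lrmorphism Fs n -> L}) :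
  function_field p k ->
  wj E \notin k ->
  (forall v : place F, good_reduction v E \/ split_multiplicative_reduction v E) ->
  prime l -> l <> p ->
  Zl_extension l d L ->
  (forall n, finite_extension (Fs n)) ->
  (forall n x, exists y, e n.+1 y = e n x) ->
  (forall z, exists n x, e n x = z) ->
  forall n, selmer_res_iso E p (e n).
Proof.
move=> ff _ _ pl lp Zl fin _ _ n.
have [k0 [ka cka]] := function_field_constants ff.
have [galL _] := Zl.
apply: (selmer_transfer E cka); first 1 last.
- exact: finite_extension_over.
- exact: galois_algebraic.
apply: (@gal_tower F L galL p l (Fs n) (e n)) => //; last exact: Zl_torsion Zl.
- exact: pcharf_prime (const_char cka).
- by apply/eqP.
Qed.
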